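(* Let $X\subset K^m$ be a definable set and let $\varphi$ be in $\mathcal{C}(X\times\mathbf{N})$. Suppose that $\varphi$ is $X$-bounded. Then there exists $\varphi'$ in $\mathcal{C}(X\times\mathbf{N})$ with $\lim_{n\to\infty}\varphi'(x,n)=0$ for all $x\in X$ and such that, for each $x\in X$, the function $$g_x:\mathbf{N}\to\mathbf{Q}:\ n\mapsto\varphi(x,n)-\varphi'(x,n)$$ has finite image. The function $g:X\times\mathbf{N}\to\mathbf{Q}:(x,n)\mapsto g_x(n)$ lies in $\mathcal{C}(X\times\mathbf{N})$. Hence, writing $\varphi_x:n\mapsto\varphi(x,n)$, $\mathrm{MV}_\infty(g_x)$ and $\mathrm{MV}_\infty(\varphi_x)$ exist and are equal for every $x\in X$, and the function $x\mapsto\mathrm{MV}_\infty(\varphi_x)$ lies in $\mathcal{C}(X)$. Also, if $\varphi\ge 0$ then $\mathrm{MV}_\infty(\varphi_x)\ge 0$ for all $x\in X$.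
   Context: $K$ is a finite extension of $\mathbf{Q}_p$ with valuation ring $R$, normalized valuation $\mathrm{ord}$, residue field $k_K$ with $q$ elements. $\mathcal{L}$ is one of two languages (the result holds for each): $\mathcal{L}_{\rm Mac}=\{0,1,+,-,\cdot,\{P_n\}_{n>0}\}$ with $P_n$ the set of $n$th powers in $K^\times$, or $\mathcal{L}_{\rm an}=\mathcal{L}_{\rm Mac}\cup\{{}^{-1}\}\cup\bigcup_{m>0}K\{x_1,\dots,x_m\}$, where $0^{-1}=0$ and each power series $f\in K\{x_1,\dots,x_m\}$ converging on $R^m$ is interpreted as the function equal to $f$ on $R^m$ and $0$ elsewhere on $K^m$. Subsets of $K^m$ are definable if $\mathcal{L}$-definable with coefficients from $K$. For sets in $K^m\times\mathbf{Z}^r$, definable means definable (with coefficients from $K$) in the three-sorted language $\mathcal{L}'$ consisting of $\mathcal{L}$ on $K$, the ring language on $k_K$, the Presburger language on $\mathbf{Z}$, and the maps $\mathrm{ord}:K^\times\to\mathbf{Z}$ and $\overline{\rm ac}:K\to k_K$ (the residue of $\pi_K^{-\mathrm{ord}(x)}x$ for a fixed uniformizer $\pi_K$, and $\overline{\rm ac}(0)=0$). For definable $X\subset K^m\times\mathbf{Z}^r$, $\mathcal{C}(X)$ is the $\mathbf{Q}$-algebra of functions on $X$ generated by the functions $\alpha$ and $q^{-\alpha}$ for all definable $\alpha:X\to\mathbf{Z}$. A real-valued function $g$ on $X\times\mathbf{N}$ is $X$-bounded if for every $x\in X$ the set $g(\{x\}\times\mathbf{N})$ is contained in a compact subset of $\mathbf{R}$.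 A function $h:\mathbf{N}\to\mathbf{R}$ has a mean value at infinity if there exists an integer $e>0$ such that $\lim_{n\to\infty,\,n\equiv c\bmod e}h(n)$ exists in $\mathbf{R}$ for each $c=0,\dots,e-1$; then $\mathrm{MV}_\infty(h)=\frac1e\sum_{c=0}^{e-1}\lim_{n\to\infty,\,n\equiv c\bmod e}h(n)$ (independent of the choice of $e$). *)

(* Defs.v *)
(* Library: MathComp and MathComp-Analysis. *)
From HB Require Import structures.
From mathcomp Require Import all_boot all_order all_algebra all_field.
From mathcomp Require Import finmap.
From mathcomp Require Import all_classical all_reals all_analysis.

Set Implicit Arguments.
Unset Strict Implicit.
Unset Printing Implicit Defensive.

Import Order.TTheory GRing.Theory Num.Theory.
Import numFieldNormedType.Exports.

Local Open Scope classical_set_scope.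
Local Open Scope ring_scope.

(* Discrete valuations are total maps v : F -> int whose value at 0 carries no
   meaning; [vge v N x] reads "v x >= N" with the convention v 0 = +oo. *)
Definition vge (F : fieldType) (v : F -> int) (N : int) (x : F) : bool :=
  (x == 0) || (N <= v x).

Record valuation (F : fieldType) (v : F -> int) : Prop := Valuation {
  valuationM : forall x y, x != 0 -> y != 0 -> v (x * y) = v x + v y;
  valuationD : forall x y, x != 0 -> y != 0 -> x + y != 0 ->
    Num.min (v x) (v y) <= v (x + y)
}.

Definition padic_val_rat (p : nat) (r : rat) : int :=
  (logn p `|numq r|%N)%:Z - (logn p `|denq r|%N)%:Z.

(* (F, v) is the field Q_p with its p-adic valuation: the completion of the
   rationals for the p-adic valuation (unique up to unique isomorphism). *)
Record padic_numbers (p : nat) (F : fieldType) (v : F -> int) : Prop :=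
  PadicNumbers {
  Qp_valuation : valuation v;
  Qp_char0 : [pchar F] =i pred0;
  Qp_extends : forall r : rat, r != 0 -> v (ratr r) = padic_val_rat p r;
  Qp_dense : forall (x : F) (N : int), exists r : rat, vge v N (x - ratr r);
  Qp_complete : forall u : nat -> F,
    (forall N : int, exists n0 : nat, forall i j : nat,
       (n0 <= i)%N -> (n0 <= j)%N -> vge v N (u i - u j)) ->
    exists l : F, forall N : int, exists n0 : nat, forall i : nat,
      (n0 <= i)%N -> vge v N (u i - l)
}.

(* [k] with [res] is the quotient of the valuation ring by its maximal ideal;
   the values of [res] outside the valuation ring are irrelevant. *)
Record residue_map (F : fieldType) (v : F -> int) (k : fieldType)
    (res : F -> k) : Prop := ResidueMap {
  res1 : res 1 = 1;
  resD : forall x y, vge v 0 x -> vge v 0 y -> res (x + y) = res x + res y;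
  resM : forall x y, vge v 0 x -> vge v 0 y -> res (x * y) = res x * res y;
  res_ker : forall x, vge v 0 x -> (res x = 0 <-> vge v 1 x);
  res_surj : forall a : k, exists2 x, vge v 0 x & res x = a
}.

(* A finite extension K of Q_p, with its normalized valuation, its residue
   field and a fixed uniformizer. *)
Record padic_field := PadicField {
  pf_p : nat;
  pf_Qp : fieldType;
  pf_vp : pf_Qp -> int;
  pf_K :> fieldExtType pf_Qp;
  ord : pf_K -> int;
  resfield : finFieldType;
  res : pf_K -> resfield;
  unif : pf_K;
  pf_prime : prime pf_p;
  pf_padic : padic_numbers pf_p pf_vp;
  ord_valuation : valuation ord;
  ord_extends : exists2 e : nat, (0 < e)%N &
    forall a : pf_Qp, a != 0 -> ord (a%:A) = e%:Z * pf_vp a;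
  res_residue : residue_map ord res;
  unif_neq0 : unif != 0;
  (* also expresses that [ord] is normalized *)
  ord_unif : ord unif = 1
}.

Arguments ord {p} x : rename.
Arguments res {p} x : rename.

Section Language.
Variable K : padic_field.

Definition qK : nat := #|resfield K|.

Definition inR (x : K) : bool := vge ord 0 x.

Definition ac (x : K) : resfield K :=
  if x == 0 then 0 else res (unif K ^ (- ord x) * x).

Section Series.
Variable m : nat.

(* [s] is the sum of the (unordered) family a_i x^i, i a multi-index. *)
Definition has_sum (a : {ffun 'I_m -> nat} -> K) (x : 'I_m -> K) (s : K) :
    Prop :=
  forall N : int, exists B : {fset {ffun 'I_m -> nat}},
    forall A : {fset {ffun 'I_m -> nat}}, (B `<=` A)%fset ->
      vge ord N (\sum_(i <- A) a i * (\prod_(j < m) x j ^+ i j) - s).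

(* K{x_1, ..., x_m} *)
Record conv_series := ConvSeries {
  coefs : {ffun 'I_m -> nat} -> K;
  coefs_conv : forall x : 'I_m -> K, (forall j, inR (x j)) ->
    exists s, has_sum coefs x s
}.

Definition series_fun (f : conv_series) (x : 'I_m -> K) : K :=
  if [forall j, inR (x j)] then xget 0 [set s | has_sum (coefs f) x s] else 0.

End Series.

Inductive language := L_Mac | L_an.

(* Terms of the valued-field sort with coefficients from K; the symbols 0 and 1
   are subsumed by the coefficients. *)
Inductive kterm (L : language) : Type :=
| KVar of nat
| KCst of K
| KAdd of kterm L & kterm L
| KSub of kterm L & kterm L
| KMul of kterm L & kterm L
| KInv of L = L_an & kterm L
| KSeries (m : nat) of L = L_an & (0 < m)%N & conv_series m
    & ('I_m -> kterm L).
Arguments KVar {L} i : rename.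
Arguments KCst {L} c : rename.

Inductive rterm (L : language) : Type :=
| RVar of nat
| RZero
| ROne
| RAdd of rterm L & rterm L
| RSub of rterm L & rterm L
| RMul of rterm L & rterm L
| RAc of kterm L.

Inductive zterm (L : language) : Type :=
| ZVar of nat
| ZZero
| ZOne
| ZAdd of zterm L & zterm L
| ZSub of zterm L & zterm L
| ZOrd of kterm L.

(* Formulas of the three-sorted language L'.  Each sort has its own variables,
   named by natural numbers. *)
Inductive formula (L : language) : Type :=
| FKEq of kterm L & kterm L
| FKPow (n : nat) of (0 < n)%N & kterm L
| FREq of rterm L & rterm L
| FZEq of zterm L & zterm L
| FZLe of zterm L & zterm L
| FZMod (n : nat) of (0 < n)%N & zterm L & zterm L
| FNot of formula L
| FAnd of formula L & formula L
| FExK of nat & formula L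
| FExR of nat & formula L
| FExZ of nat & formula L.

(* The formulas of L' that are formulas of the one-sorted language L. *)
Fixpoint one_sorted (L : language) (F : formula L) : bool :=
  match F with
  | FKEq _ _ => true
  | FKPow _ _ _ => true
  | FNot G => one_sorted G
  | FAnd G H => one_sorted G && one_sorted H
  | FExK _ G => one_sorted G
  | _ => false
  end.

Record assignment := Assignment {
  asK : nat -> K;
  asR : nat -> resfield K;
  asZ : nat -> int
}.

Definition upd (T : Type) (e : nat -> T) (i : nat) (a : T) : nat -> T :=
  fun j => if j == i then a else e j.

Definition updK e i a := Assignment (upd (asK e) i a) (asR e) (asZ e).
Definition updR e i a := Assignment (asK e) (upd (asR e) i a) (asZ e).
Definition updZ e i a := Assignment (asK e) (asR e) (upd (asZ e) i a).

Fixpoint keval (L : language) (e : assignment) (t : kterm L) : K :=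
  match t with
  | KVar i => asK e i
  | KCst c => c
  | KAdd t1 t2 => keval e t1 + keval e t2
  | KSub t1 t2 => keval e t1 - keval e t2
  | KMul t1 t2 => keval e t1 * keval e t2
  | KInv _ t1 => (keval e t1)^-1
  | KSeries _ _ _ f ts => series_fun f (fun j => keval e (ts j))
  end.

Fixpoint reval (L : language) (e : assignment) (t : rterm L) : resfield K :=
  match t with
  | RVar i => asR e i
  | RZero => 0
  | ROne => 1
  | RAdd t1 t2 => reval e t1 + reval e t2
  | RSub t1 t2 => reval e t1 - reval e t2
  | RMul t1 t2 => reval e t1 * reval e t2
  | RAc t1 => ac (keval e t1)
  end.

(* [ZOrd t] takes an arbitrary fixed value when t = 0; since {0} is definable,
   this does not affect definability. *)
Fixpoint zeval (L : language) (e : assignment) (t : zterm L) : int :=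
  match t with
  | ZVar i => asZ e i
  | ZZero => 0
  | ZOne => 1
  | ZAdd t1 t2 => zeval e t1 + zeval e t2
  | ZSub t1 t2 => zeval e t1 - zeval e t2
  | ZOrd t1 => ord (keval e t1)
  end.

Fixpoint holds (L : language) (e : assignment) (F : formula L) : Prop :=
  match F with
  | FKEq t1 t2 => keval e t1 = keval e t2
  | FKPow n _ t => exists2 y : K, y != 0 & keval e t = y ^+ n
  | FREq t1 t2 => reval e t1 = reval e t2
  | FZEq t1 t2 => zeval e t1 = zeval e t2
  | FZLe t1 t2 => zeval e t1 <= zeval e t2
  | FZMod n _ t1 t2 => (zeval e t1 = zeval e t2 %[mod n%:Z])%Z
  | FNot G => ~ holds e G
  | FAnd G H => holds e G /\ holds e H
  | FExK i G => exists a : K, holds (updK e i a) G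
  | FExR i G => exists a : resfield K, holds (updR e i a) G
  | FExZ i G => exists a : int, holds (updZ e i a) G
  end.

(* K^m x Z^r *)
Definition space (m r : nat) : Type := (m.-tuple K * r.-tuple int)%type.

(* Variables that do not name a coordinate are assigned 0. *)
Definition env_of (m r : nat) (x : space m r) : assignment :=
  Assignment (fun i => nth 0 x.1 i) (fun _ => 0) (fun i => nth 0 x.2 i).

(* L-definable subsets of K^m, with coefficients from K *)
Definition definableK (L : language) (m : nat) (X : set (m.-tuple K)) : Prop :=
  exists2 F : formula L, one_sorted F &
    forall x : m.-tuple K, X x <-> holds (env_of (x, [tuple])) F.

(* L'-definable subsets of K^m x Z^r, with coefficients from K *)
Definition definable (L : language) (m r : nat) (X : set (space m r)) : Prop :=
  exists F : formula L, forall x, X x <-> holds (env_of x) F.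

(* A function on a set X is represented by a total function considered up to
   equality on X. *)
Definition graph_on (m r : nat) (X : set (space m r)) (alpha : space m r -> int) :
    set (space m r.+1) :=
  [set (x.1, [tuple of rcons x.2 (alpha x)]) | x in X].

Definition definable_fun (L : language) (m r : nat) (X : set (space m r))
    (alpha : space m r -> int) : Prop :=
  definable L (graph_on X alpha).

(* C(X), as the closure under the Q-algebra operations of the generators *)
Inductive constructible (L : language) (m r : nat) (X : set (space m r)) :
    (space m r -> rat) -> Prop :=
| cst_fun alpha of definable_fun L X alpha :
    constructible L X (fun x => (alpha x)%:~R)
| cst_qpow alpha of definable_fun L X alpha :
    constructible L X (fun x => (qK%:R : rat) ^ (- alpha x))
| cst_scalar (c : rat) : constructible L X (fun=> c)
| cst_add f g of constructible L X f & constructible L X g :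
    constructible L X (fun x => f x + g x)
| cst_mul f g of constructible L X f & constructible L X g :
    constructible L X (fun x => f x * g x)
| cst_eq_on f g of constructible L X f & (forall x, X x -> f x = g x) :
    constructible L X g.

(* C(X) for X a subset of K^m = K^m x Z^0 *)
Definition constructibleK (L : language) (m : nat) (X : set (m.-tuple K))
    (f : m.-tuple K -> rat) : Prop :=
  constructible L [set y : space m 0 | X y.1] (fun y => f y.1).

(* C(X x N), with X x N viewed inside K^m x Z^1 *)
Definition constructibleN (L : language) (m : nat) (X : set (m.-tuple K))
    (phi : m.-tuple K -> nat -> rat) : Prop :=
  constructible L [set y : space m 1 | X y.1 /\ 0 <= thead y.2]
    (fun y => phi y.1 `|thead y.2|%N).

End Language.

Section MeanValue.
Variable R : realType.

Definition bounded_over (T : Type) (X : set T) (g : T -> nat -> R) : Prop :=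
  forall x, X x -> exists2 A : set R, compact A & range (g x) `<=` A.

(* n --> oo along the residue class of c modulo e *)
Definition oo_mod (e c : nat) : set_system nat :=
  within [set n | n = c %[mod e]] \oo.

Definition has_mean_value_mod (h : nat -> R) (e : nat) : Prop :=
  (0 < e)%N /\ forall c : 'I_e, cvg (h @ oo_mod e c).

Definition has_mean_value (h : nat -> R) : Prop :=
  exists e : nat, has_mean_value_mod h e.

(* The value does not depend on the modulus e chosen by [xget]. *)
Definition mean_value (h : nat -> R) : R :=
  let e := xget 1%N [set e | has_mean_value_mod h e] in
  e%:R^-1 * \sum_(c < e) lim (h @ oo_mod e c).

End MeanValue.

(* Main.v *)
(* A function definable in the valued field K is, after quantifier elimination,
   governed by Presburger conditions whose coefficients and moduli are fixed and
   in which the points of K enter only through integer constants.  Elimination of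
   a field variable goes in two steps.  For polynomial dependence, the ring of
   coefficient functions is enlarged, without new tame sets, to one that is
   p-adically closed at every ultrafilter; there a polynomial in y is controlled
   by its Taylor monomials around a suitable centre.  For analytic dependence,
   Weierstrass division makes restricted series polynomial in one variable up to
   a unit.

   Hence n |-> alpha (x, n) is eventually affine on the classes modulo some E that
   is independent of x, with finitely many slopes in all and a definable threshold
   l0 (x), so that phi (x, E (l0 + l) + c) is a finite sum of terms
   k (x) l^i q^(s l) with k in C(X).  Boundedness kills the terms with s > 0 and
   those with s = 0 < i, the terms with s < 0 make up phi', and the mean value is
   the average over c of the coefficients of l^0 q^0. *)

(* Formulas are replaced by [tame] sets: subsets of an arbitrary set times the integer assignments,
   cut out by Presburger conditions on the orders, zeros and approximate angular components of a set
   of functions. The parameters carry no structure, so one elimination also serves when they are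
   themselves points of an analytic family. Choosing centres and roots uniformly in the parameters
   is the first obstacle. It is avoided by following an existential witness along one ultrafilter at
   a time, where every alternative is decided; [tame_compact] then glues finitely many local
   answers. A centre must lie in the coefficient ring, which is why that ring has to contain the
   roots isolated by Hensel's lemma. In the analytic case a series has infinitely many coefficient
   functions, and finitely many conditions cannot select a dominant one; strong noetherianity leaves
   finitely many, up to multiples of the uniformizer. Dividing by the dominant one forces restricted
   division into the class of functions, and its quotients are later turned into new R-valued
   variables determined by equations. *)
Require Import Defs.
From HB Require Import structures.
From mathcomp Require Import all_boot all_order all_algebra all_field.
From mathcomp Require Import finmap.
From mathcomp Require Import all_classical all_reals all_analysis.
From mathcomp Require Import zify ring.
From mathcomp.multinomials Require mpoly.
Import -(notations) mpoly.
Import Order.TTheory GRing.Theory Num.Theory.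
Import numFieldNormedType.Exports.
Local Open Scope classical_set_scope.
Local Open Scope ring_scope.
Set Implicit Arguments.
Unset Strict Implicit.
Unset Printing Implicit Defensive.
(* [lia] treats syntactically different but convertible instances of [ord] as
   distinct atoms; this identifies them. *)
Ltac ordnorm := repeat (match goal with
  | H : context [@ord ?L ?x], H2 : context [@ord ?L2 ?y] |- _ =>
      tryif constr_eq x y then fail else (unify x y; change (@ord L2 y) with (@ord L x) in H2)
  | H : context [@ord ?L ?x] |- context [@ord ?L2 ?y] =>
      tryif constr_eq x y then fail else (unify x y; change (@ord L2 y) with (@ord L x))
  | |- context [@ord ?L ?x] => match goal with |- context [@ord ?L2 ?y] =>
      tryif constr_eq x y then fail else (unify x y; change (@ord L2 y) with (@ord L x)) end
  end).
Ltac olia := first [lia | intros; ordnorm; lia].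

(** * Valuation, completeness and Hensel lemmas *)

Definition V (K : padic_field) (N : int) (x : K) : bool := vge (@ord K) N x.

Section Valuation.
Variable K : padic_field.
Implicit Types (x y z : K) (M N : int).

Lemma ordM x y : x != 0 -> y != 0 -> ord (x * y) = ord x + ord y.
Proof. exact: (valuationM (ord_valuation K)). Qed.

Lemma ord1 : ord (1 : K) = 0.
Proof.
have := @ordM 1 1 (oner_neq0 _) (oner_neq0 _); rewrite mulr1 => h.
by apply: (@addrI _ (ord (1:K))); rewrite addr0 -h.
Qed.

Lemma ordV x : ord x^-1 = - ord x \/ x = 0.
Proof.
case: (eqVneq x 0) => [->|x0]; [by right|left].
have := @ordM x x^-1 x0; rewrite invr_neq0 // divff // ord1 => /(_ isT); lia.
Qed.

Lemma ordVn x : x != 0 -> ord x^-1 = - ord x.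
Proof. by move=> x0; case: (ordV x) => // /eqP; rewrite (negbTE x0). Qed.

Lemma ordN x : ord (- x) = ord x.
Proof.
have oN1 : ord (-1 : K) = 0.
  have h1 : (-1 : K) != 0 by rewrite oppr_eq0 oner_eq0.
  by have := ordM h1 h1; rewrite mulrNN mulr1 ord1; lia.
case: (eqVneq x 0) => [->|x0]; first by rewrite oppr0.
by rewrite -mulN1r ordM ?oN1 ?add0r // oppr_eq0 oner_eq0.
Qed.

Lemma ordX x n : x != 0 -> ord (x ^+ n) = n%:Z * ord x.
Proof.
move=> x0; elim: n => [|n IH]; first by rewrite expr0 ord1 mul0r.
by rewrite exprS ordM ?expf_neq0 // IH; lia.
Qed.

Lemma ordXz x (n : int) : x != 0 -> ord (x ^ n) = n * ord x.
Proof.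
move=> x0; case: n => n; first by rewrite -exprnP ordX.
by rewrite NegzE -exprnN ordVn ?expf_neq0 // ordX //; lia.
Qed.

Lemma unifn0 : unif K != 0. Proof. exact: unif_neq0. Qed.

Lemma ord_pi (n : int) : ord (unif K ^ n) = n.
Proof. by rewrite ordXz ?unifn0 // ord_unif mulr1. Qed.

Lemma pin0 (n : int) : unif K ^ n != 0.
Proof. by rewrite expfz_neq0 ?unifn0. Qed.

Lemma V0 N : V N (0 : K). Proof. by rewrite /V /vge eqxx. Qed.

Lemma VE N x : x != 0 -> V N x = (N <= ord x).
Proof. by rewrite /V /vge => /negbTE ->. Qed.

Lemma V_ord N x : N <= ord x -> V N x.
Proof. by rewrite /V /vge => ->; rewrite orbT. Qed.

Lemma Vle M N x : M <= N -> V N x -> V M x.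
Proof. by rewrite /V /vge => le /orP[->//|h]; rewrite (le_trans le h) orbT. Qed.

Lemma VD N x y : V N x -> V N y -> V N (x + y).
Proof.
case: (eqVneq x 0) => [->|x0]; first by rewrite add0r.
case: (eqVneq y 0) => [->|y0]; first by rewrite addr0.
case: (eqVneq (x + y) 0) => [->|xy0]; first by rewrite V0.
rewrite !VE // => hx hy.
by apply: le_trans (valuationD (ord_valuation K) x0 y0 xy0); rewrite le_min hx hy.
Qed.

Lemma VN N x : V N (- x) = V N x.
Proof. by rewrite /V /vge oppr_eq0 ordN. Qed.

Lemma VB N x y : V N x -> V N y -> V N (x - y).
Proof. by move=> hx hy; apply: VD; rewrite ?VN. Qed.

Lemma VBC N x y : V N (x - y) = V N (y - x).
Proof. by rewrite -VN opprB. Qed.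

Lemma Vtrans N y x z : V N (x - y) -> V N (y - z) -> V N (x - z).
Proof. by move=> h1 h2; rewrite -(subrK y x) -addrA VD. Qed.

Lemma VM M N x y : V M x -> V N y -> V (M + N) (x * y).
Proof.
case: (eqVneq x 0) => [->|x0]; first by rewrite mul0r !V0.
case: (eqVneq y 0) => [->|y0]; first by rewrite mulr0 !V0.
by rewrite !VE ?mulf_neq0 // ordM //; lia.
Qed.

Lemma VMl N x y : V N x -> V 0 y -> V N (x * y).
Proof. by move=> hx hy; rewrite -[N]addr0 VM. Qed.

Lemma VMr N x y : V 0 x -> V N y -> V N (x * y).
Proof. by move=> hx hy; rewrite -[N]add0r VM. Qed.

Lemma V_sum N (T : Type) (s : seq T) (P : pred T) (f : T -> K) :
  (forall i, P i -> V N (f i)) -> V N (\sum_(i <- s | P i) f i).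
Proof. by move=> h; elim/big_ind: _ => //; [exact: V0 | exact: VD]. Qed.

Lemma V_sum_in N (T : eqType) (s : seq T) (f : T -> K) :
  (forall i, i \in s -> V N (f i)) -> V N (\sum_(i <- s) f i).
Proof. by move=> h; rewrite big_seq; apply: V_sum. Qed.

Lemma V1 : V 0 (1 : K). Proof. by rewrite VE ?oner_eq0 ?ord1. Qed.

Lemma V_nat n : V 0 (n%:R : K).
Proof. by elim: n => [|n IH]; rewrite ?V0 // mulrSr VD ?V1. Qed.

Lemma VX x n : V 0 x -> V 0 (x ^+ n).
Proof. by move=> hx; elim: n => [|n IH]; rewrite ?expr0 ?V1 // exprS VMr. Qed.

Lemma V_all x : (forall N : nat, V N%:Z x) -> x = 0.
Proof.
move=> h; apply/eqP/negP => /negP x0.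
by have := h (`|ord x|%N).+1; rewrite VE //; lia.
Qed.

Lemma V_self x : V (ord x) x. Proof. exact: V_ord. Qed.

Lemma V_mulc N x y : x != 0 -> V (ord x + N) (x * y) = V N y.
Proof.
move=> x0; case: (eqVneq y 0) => [->|y0]; first by rewrite mulr0 !V0.
by rewrite !VE ?mulf_neq0 // ordM // lerD2l.
Qed.

Lemma V_divc N x y : x != 0 -> V N (y / x) = V (N + ord x) y.
Proof. by move=> x0; rewrite -(V_mulc N _ x0) mulrC divfK // addrC. Qed.

Lemma neq0_V N x : ~~ V N x -> x != 0.
Proof. by apply: contraNneq => ->; rewrite V0. Qed.

Lemma ord_nV N x : ~~ V N x -> ord x < N.
Proof. by move=> h; move: (h); rewrite VE ?(neq0_V h) // -ltNge. Qed.

Lemma nV_ord N x : x != 0 -> ord x < N -> ~~ V N x.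
Proof. by move=> h; rewrite VE // -ltNge. Qed.

Lemma ord_dom x y : x != 0 -> V (ord x + 1) (y - x) -> y != 0 /\ ord y = ord x.
Proof.
move=> x0 h; have y0 : y != 0.
  by apply: contraTneq h => ->; rewrite sub0r VN VE // -ltNge ltzD1.
split=> //; apply/eqP; rewrite eq_le; apply/andP; split.
  case: leP => // lt; have : V (ord x + 1) x.
    by rewrite -[X in V _ X](subKr y x); apply: VB => //; apply: V_ord; lia.
  by rewrite VE //; lia.
have : V (ord x) y.
  by rewrite -[X in V _ X](subrK x y) VD ?V_self //; apply: Vle h; lia.
by rewrite VE.
Qed.

Lemma pchar0 n : (n%:R : K) = 0 -> n = 0%N.
Proof.
move=> h.
have hn : (n%:R : pf_Qp K) = 0.
  apply: (fmorph_inj (in_alg K)); rewrite rmorph_nat h rmorph0 //.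
by move/pcharf0P: (Qp_char0 (pf_padic K)) => /(_ n); rewrite hn eqxx => /esym/eqP.
Qed.

Lemma natn0 n : (0 < n)%N -> (n%:R : K) != 0.
Proof. by move=> h; apply/eqP => /pchar0; case: n h. Qed.

Lemma ord_nat n : (0 < n)%N -> 0 <= ord (n%:R : K).
Proof. by move=> h; rewrite -VE ?natn0 ?V_nat. Qed.

End Valuation.

(** * Completeness of a finite extension of the p-adic numbers *)

Section Complete.
Variable K : padic_field.
Let F := pf_Qp K.
Let v := @pf_vp K.

Definition cauchy (u : nat -> K) := forall N : int, exists n0 : nat,
  forall i j, (n0 <= i)%N -> (n0 <= j)%N -> V N (u i - u j).
Definition conv (u : nat -> K) l := forall N : int, exists n0 : nat,
  forall i, (n0 <= i)%N -> V N (u i - l).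

Lemma cauchy_of (u : nat -> K) : (forall n : nat, V n%:Z (u n.+1 - u n)) -> cauchy u.
Proof.
move=> h N; exists `|N|%N.
have aux i k : V i%:Z (u (i + k)%N - u i).
  elim: k => [|k IH]; first by rewrite addn0 subrr V0.
  by apply: Vtrans IH; rewrite addnS; apply: Vle (h _); lia.
have aux2 i : (`|N| <= i)%N -> V N (u i - u `|N|%N).
  by move=> le; have := aux `|N|%N (i - `|N|)%N; rewrite subnKC //; apply: Vle; lia.
by move=> i j hi hj; apply: (Vtrans (aux2 _ hi)); rewrite VBC aux2.
Qed.

Lemma conv_unique u l l' : conv u l -> conv u l' -> l = l'.
Proof.
move=> h h'; apply/subr0_eq/V_all => N.
have [n hn] := h N; have [m hm] := h' N.
apply: (Vtrans (y := u (maxn n m))); last by apply: hm; rewrite leq_maxr.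
by rewrite VBC hn ?leq_maxl.
Qed.

(** One vector [b] is added at a time. The smaller span is complete, hence closed, so a vector
    outside it stays at positive distance; this distance makes the coefficients of [b] in a Cauchy
    sequence Cauchy again. *)
Lemma span_complete (X : seq K) (u : nat -> K) : cauchy u ->
  (forall i, u i \in <<X>>%VS) -> exists2 l, l \in <<X>>%VS & conv u l.
Proof.
elim: X u => [|b X IH] u cu hu.
  exists 0; rewrite ?mem0v // => N; exists 0%N => i _.
  by move: (hu i); rewrite span_nil memv0 => /eqP ->; rewrite subr0 V0.
have [bX|bX] := boolP (b \in <<X>>%VS).
  have e : <<b :: X>>%VS = <<X>>%VS by rewrite span_cons; apply/addv_idPr; rewrite -memvE.
  by rewrite e in hu *; apply: IH.
(* Otherwise ever better approximations of [b] from the span would converge inside it, and their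
   limit is [b]. *)
have [N hN] : exists N : int, forall s, s \in <<X>>%VS -> ~~ V N (b - s).
  apply: contrapT => /forallNP hn.
  have {}hn : forall n : nat, exists s, s \in <<X>>%VS /\ V n%:Z (b - s).
    move=> n; have := hn n%:Z; apply: contra_notP => /forallNP h s sX.
    by apply/negP => hV; apply: (h s).
  have [s hs] := choice hn.
  have cs : cauchy s.
    apply: cauchy_of => n; apply: (Vtrans (y := b)); last by case: (hs n).
    by rewrite VBC; case: (hs n.+1) => _; apply: Vle; lia.
  have [l lX hl] := IH s cs (fun n => (hs n).1).
  case/negP: bX; suff -> : b = l by [].
  apply: (@conv_unique s) => // M; exists `|M|%N => i hi.
  by rewrite VBC; case: (hs i) => _; apply: Vle; lia.
have /choice[sa hsa] : forall i, exists sa : K * F, sa.1 \in <<X>>%VS /\ u i = sa.1 + sa.2 *: b.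
  move=> i; have := hu i; rewrite span_cons addvC => /memv_addP[s sX [w /vlineP[a ->] ->]].
  by exists (s, a).
pose s i := (sa i).1; pose a i := (sa i).2.
(* [e] is the ramification index; it converts between [ord] and the valuation of the base field,
   where completeness is given. *)
have [e e0 he] := ord_extends K.
have Va (M : int) (x : F) : V (e%:Z * M) (x%:A : K) -> vge v M x.
  rewrite /V /vge; case: (eqVneq x 0) => //= x0.
  rewrite he // scaler_eq0 (negbTE x0) oner_eq0 /= ler_pM2l ?ltz_nat //.
have Va' (M : int) (x : F) : vge v M x -> V (e%:Z * M) (x%:A : K).
  rewrite /V /vge; case: (eqVneq x 0) => [->|x0]; first by rewrite scale0r eqxx.
  by rewrite he // /= => h; apply/orP; right; rewrite ler_pM2l ?ltz_nat.
have key (x : F) (t : K) (M : int) : t \in <<X>>%VS -> V (M + N) (t + x *: b) -> V M (x%:A : K).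
  move=> tX; case: (eqVneq x 0) => [->|x0]; first by rewrite !scale0r V0.
  have xA0 : (x%:A : K) != 0 by rewrite scaler_eq0 negb_or x0 oner_neq0.
  have -> : t + x *: b = x%:A * (b - (- x^-1) *: t).
    by rewrite mulrBr -!scalerAl !mul1r scalerA mulrN scaleNr opprK divff // scale1r addrC.
  have h1 := hN _ (memvZ (- x^-1) tX).
  have n0 := neq0_V h1; have h2 := ord_nV h1.
  rewrite !VE ?mulf_neq0 // ordM //. move=> h4.
  by rewrite -(lerD2r N); apply: le_trans h4 _; rewrite lerD2l ltW.
have ca : forall M : int, exists n0 : nat, forall i j : nat,
       (n0 <= i)%N -> (n0 <= j)%N -> vge v M (a i - a j).
  move=> M; have [n0 h] := cu (e%:Z * M + N); exists n0 => i j hi hj.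
  apply: Va; apply: (@key _ (s i - s j)); first by rewrite memvB; case: (hsa i); case: (hsa j).
  have := h i j hi hj; rewrite (hsa i).2 (hsa j).2 -/(s i) -/(s j) -/(a i) -/(a j).
  by rewrite scalerBl opprD addrACA.
have [al hal] := Qp_complete (pf_padic K) ca.
have hab : conv (fun i => a i *: b) (al *: b).
  move=> M; have [n0 h] := hal (`|M - ord b|%N)%:Z; exists n0 => i hi.
  have := Va' _ _ (h i hi) => {}h.
  case: (eqVneq b 0) => [->|b0]; first by rewrite !scaler0 subrr V0.
  rewrite -scalerBl -[(_ - _) *: b]mulr_algl mulrC.
  have -> : M = ord b + (M - ord b) by lia.
  rewrite V_mulc //; apply: Vle h; nia.
have [sl slX hsl] : exists2 l, l \in <<X>>%VS & conv s l.
  apply: IH; last by move=> i; case: (hsa i).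
  have es i : s i = u i - a i *: b by rewrite (hsa i).2 addrK.
  move=> M; have [n0 h] := cu M; have [n1 h1] := hab M; exists (maxn n0 n1) => i j hi hj.
  rewrite !es opprD addrACA VD //; first by apply: h; lia.
  by rewrite -opprD VN; apply: (Vtrans (y := al *: b)); rewrite ?h1 // 1?VBC ?h1; lia.
exists (sl + al *: b).
  by rewrite span_cons addvC memv_add // memvZ ?memv_line.
move=> M; have [n0 h] := hsl M; have [n1 h1] := hab M; exists (maxn n0 n1) => i hi.
by rewrite (hsa i).2 opprD addrACA VD ?h ?h1 //; lia.
Qed.

Lemma K_complete (u : nat -> K) : cauchy u -> exists l, conv u l.
Proof.
move=> cu; have hu i : u i \in <<vbasis (fullv : {vspace K})>>%VS.
  by rewrite (span_basis (vbasisP _)) memvf.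
by have [l _ hl] := span_complete cu hu; exists l.
Qed.

(** The rate matters: the n-th term is already correct to precision n, so later limits can be read
    off at a chosen index. *)
Lemma conv_limit (u : nat -> K) : (forall n : nat, V n%:Z (u n.+1 - u n)) ->
  exists l, forall n : nat, V n%:Z (u n - l).
Proof.
move=> h; have [l hl] := K_complete (cauchy_of h); exists l => n.
have [m hm] := hl n%:Z.
have aux k : V n%:Z (u (n + k)%N - u n).
  elim: k => [|k IH]; first by rewrite addn0 subrr V0.
  by apply: Vtrans IH; rewrite addnS; apply: Vle (h _); lia.
have := hm (n + m)%N (leq_addl _ _); apply: Vtrans.
by rewrite VBC aux.
Qed.

End Complete.

(** * Finite sets of representatives *)

Section Residues.
Variable K : padic_field.
Implicit Types (x y z : K) (N : nat).

Lemma res_reps1 : exists s : seq K, (forall r, r \in s -> V 0 r) /\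
  forall x, V 0 x -> exists2 r, r \in s & V 1 (x - r).
Proof.
have /choice[f hf] : forall a : resfield K, exists x : K, V 0 x /\ res x = a.
  by move=> a; have [x h1 h2] := res_surj (res_residue K) a; exists x.
exists [seq f a | a <- enum (resfield K)]; split.
  by move=> r /mapP[a _ ->]; case: (hf a).
move=> x hx; exists (f (res x)); first by apply: map_f; rewrite mem_enum.
have [h1 h2] := hf (res x).
have R := res_residue K.
have hN1 : vge (@ord K) 0 (-1 : K) by rewrite -/(V 0 _) VN V1.
have h0 : res (0 : K) = 0 by apply/(res_ker R); [exact: V0 | exact: V0].
have hm : res (-1 : K) = -1.
  apply/eqP; rewrite -addr_eq0; apply/eqP.
  by rewrite -(res1 R) -(resD R) ?addNr //; apply: V1.
apply/(res_ker R); first exact: VB.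
rewrite -mulN1r (resD R) ?(resM R) //; first by rewrite h2 hm mulN1r subrr.
by apply: VMr.
Qed.

Lemma V_pi N : V N%:Z (unif K ^+ N).
Proof. by rewrite exprnP V_ord // ord_pi. Qed.

(** Representatives are built digit by digit. Their finite number makes every case split on an
    angular component at bounded precision a finite one. *)
Lemma res_reps N : exists s : seq K, (forall r, r \in s -> V 0 r) /\
  forall x, V 0 x -> exists2 r, r \in s & V N%:Z (x - r).
Proof.
elim: N => [|N [s [hs1 hs2]]].
  by exists [:: 0]; split=> [r|x hx]; [rewrite inE => /eqP ->; rewrite V0|exists 0; rewrite ?inE ?subr0].
have [t [ht1 ht2]] := res_reps1.
exists [seq r + unif K ^+ N * r' | r <- s, r' <- t]; split.
  move=> r /allpairsP[[a b] /= [ha hb ->]]; apply: VD; first exact: hs1.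
  by apply: VMr; [apply: Vle (V_pi N)|exact: ht1].
move=> x hx; have [r hr hv] := hs2 x hx.
have hq : V 0 ((x - r) / unif K ^+ N).
  by rewrite V_divc ?expf_neq0 ?unifn0 // exprnP ord_pi add0r.
have [r' hr' hv'] := ht2 _ hq.
exists (r + unif K ^+ N * r').
  by apply/allpairsP; exists (r, r').
have -> : x - (r + unif K ^+ N * r') = unif K ^+ N * ((x - r) / unif K ^+ N - r').
  by rewrite mulrBr [_ * ((x - r) / _)]mulrC divfK ?expf_neq0 ?unifn0 // opprD addrA.
have -> : N.+1%:Z = N%:Z + 1 by lia.
by apply: VM; rewrite ?V_pi.
Qed.

End Residues.

(** * Hensel's lemma and polynomials with two dominant terms *)

Section Hensel.
Variable K : padic_field.
Implicit Types (x y z t s : K) (M N : int) (P : {poly K}).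

Definition Vpoly N P := forall i, V N P`_i.

Lemma V_horner P t : Vpoly 0 P -> V 0 t -> V 0 P.[t].
Proof.
move=> hP ht; rewrite horner_coef; apply: V_sum => i _.
by apply: VMr; rewrite ?VX.
Qed.

(** Difference quotients in a ball around [t0] are congruent to the derivative at [t0]. This gives
    both the contraction in [hensel] and the uniqueness in [hensel_unique]. *)
Lemma horner_diff P M t0 t s : 0 <= M -> Vpoly 0 P -> V 0 t0 -> V M (t - t0) -> V M (s - t0) ->
  exists2 c, V M (c - P^`().[t0]) & P.[t] - P.[s] = (t - s) * c.
Proof.
move=> M0 + h0 ht hs.
have hs0 : V 0 s by rewrite -(subrK t0 s) VD //; apply: Vle hs.
have ht0 : V 0 t by rewrite -(subrK t0 t) VD //; apply: Vle ht.
elim/poly_ind: P => [|P c IH] hP.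
  by exists 0; rewrite ?deriv0 !horner0 ?subrr ?V0 // mulr0.
have hP' : Vpoly 0 P by move=> i; have := hP i.+1; rewrite coefD coefMX coefC /= addr0.
have [c1 hc1 e1] := IH hP'.
have hd : Vpoly 0 P^`() by move=> i; rewrite coef_deriv -mulr_natl VMr ?V_nat.
have [c2 hc2 e2] : exists2 c2, V 0 c2 & P.[s] - P.[t0] = (s - t0) * c2.
  elim/poly_ind: {IH hP e1 hc1 c1 hd} P hP' => [|Q d IHQ] hQ.
    by exists 0; rewrite ?V0 // !horner0 subrr mulr0.
  have hQ' : Vpoly 0 Q by move=> i; have := hQ i.+1; rewrite coefD coefMX coefC /= addr0.
  have [c2 hc2 e2] := IHQ hQ'; exists (c2 * s + Q.[t0]).
    by apply: VD; [apply: VMr|apply: V_horner].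
  rewrite !hornerMXaddC; have -> : Q.[s] = Q.[t0] + (s - t0) * c2 by rewrite -e2; ring.
  by ring.
exists (c1 * t + P.[s]).
  rewrite derivMXaddC hornerD hornerMX.
  have -> : c1 * t + P.[s] - (P.[t0] + P^`().[t0] * t0) =
    (c1 - P^`().[t0]) * t + P^`().[t0] * (t - t0) + (P.[s] - P.[t0]) by ring.
  apply: VD; [apply: VD|]; [exact: VMl|apply: VMr => //; exact: V_horner|].
  by rewrite e2; apply: VMl.
rewrite !hornerMXaddC; have -> : P.[t] = P.[s] + (t - s) * c1 by rewrite -e1; ring.
by ring.
Qed.

Lemma hensel P t0 N (k := ord (P^`().[t0])) : Vpoly 0 P -> V 0 t0 -> P^`().[t0] != 0 ->
  2 * k + 1 <= N -> V N P.[t0] -> exists2 t, P.[t] = 0 & V (N - k) (t - t0).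
Proof.
move=> hP h0 d0 hN hv; set d := P^`().[t0] in d0 k hN *.
have k0 : 0 <= k.
  rewrite -VE //; apply: V_horner => // i; rewrite coef_deriv -mulr_natl VMr ?V_nat //.
(* Newton's iteration with the slope frozen at [t0]; each step gains one digit, which is enough for
   convergence. *)
pose f t := t - P.[t] / d; pose u n := iter n f t0.
have hf t s : V (N - k) (t - t0) -> V (N - k) (s - t0) ->
   forall M, V M (t - s) -> V (M + 1) (f t - f s).
  move=> ht hs M hM.
  have [|c hc e] := @horner_diff P (N - k) t0 t s _ hP h0 ht hs; first by lia.
  have -> : f t - f s = (t - s) * ((d - c) / d).
    have -> : f t - f s = (t - s) - (P.[t] - P.[s]) / d by rewrite /f; ring.
    by rewrite e; field.
  apply: VM => //; rewrite V_divc // -/k VBC; apply: Vle hc; lia.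
have h1 : V (N - k) (f t0 - t0).
  by rewrite /f addrAC subrr add0r VN V_divc // -/k subrK.
have hb n : V (N - k) (u n - t0) /\ V (N - k + n%:Z) (u n.+1 - u n).
  elim: n => [|n [IH1 IH2]]; first by rewrite subrr V0 addr0.
  have hs : V (N - k) (u n.+1 - t0).
    by apply: (Vtrans (y := u n)) => //; apply: Vle IH2; lia.
  split=> //; have := hf _ _ hs IH1 _ IH2; apply: Vle; lia.
have [l hl] : exists l, forall n : nat, V n%:Z (u n - l).
  by apply: conv_limit => n; have [_] := hb n; apply: Vle; lia.
have hl0 : V (N - k) (l - t0).
  apply: (Vtrans (y := u `|N|%N)); last by case: (hb `|N|%N).
  by rewrite VBC; apply: Vle (hl _); lia.
exists l => //; apply: contrapT => /eqP Pl0.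
have : l - f l = 0.
  apply: V_all => n; apply: (Vtrans (y := u n.+1)); first by rewrite VBC; apply: Vle (hl _); lia.
  have := hf _ _ (hb n).1 hl0 _ (hl n); apply: Vle; lia.
rewrite /f opprB addrCA subrr addr0 => /eqP.
by rewrite mulf_eq0 invr_eq0 (negbTE d0) orbF (negbTE Pl0).
Qed.

Lemma hensel_unique P t0 t s (k := ord (P^`().[t0])) : Vpoly 0 P -> V 0 t0 ->
  P^`().[t0] != 0 -> V (k + 1) (t - t0) -> V (k + 1) (s - t0) ->
  P.[t] = 0 -> P.[s] = 0 -> t = s.
Proof.
move=> hP h0 d0 ht hs Pt Ps.
have k0 : 0 <= k.
  rewrite -VE //; apply: V_horner => // i; rewrite coef_deriv -mulr_natl VMr ?V_nat //.
have [|c hc e] := @horner_diff P (k + 1) t0 t s _ hP h0 ht hs; first by lia.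
have [c0 _] := ord_dom d0 hc.
move/eqP: e; rewrite Pt Ps subrr eq_sym mulf_eq0 (negbTE c0) orbF subr_eq0.
by move/eqP.
Qed.

(* [s] is an approximate root of the two dominant terms [p`_0 + p`_n * z ^+ n]. *)
Definition two_term (p : {poly K}) n N s :=
  [/\ s != 0, p`_n != 0,
    V (ord (p`_n * s ^+ n) + N) (p`_0 + p`_n * s ^+ n) &
    forall j, (j != 0)%N -> j != n -> V (ord (p`_n * s ^+ n) + N) (p`_j * s ^+ j)].

(** Rescaling the argument by [s] and dividing by the dominant monomial brings a two-term polynomial
    close to ['X^n - 1]: 1 is an approximate root, with derivative close to n. *)
Let nrm (p : {poly K}) n s := \poly_(j < size p) (p`_j * s ^+ j / (p`_n * s ^+ n)).

Lemma nrmP (p : {poly K}) n s t : s != 0 -> p`_n != 0 ->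
  (nrm p n s).[t] = p.[s * t] / (p`_n * s ^+ n).
Proof.
move=> s0 pn0; rewrite horner_poly horner_coef mulr_suml; apply: eq_bigr => i _.
by rewrite exprMn; ring.
Qed.

Lemma two_term_aux p n N s : (0 < n)%N -> ord (n%:R : K) < N -> two_term p n N s ->
  let P := nrm p n s in
  [/\ Vpoly 0 P, P^`().[1] != 0, ord P^`().[1] = ord (n%:R : K) & V N P.[1]].
Proof.
move=> n0 hN [s0 pn0 h0 hj] P.
have q0 : p`_n * s ^+ n != 0 by rewrite mulf_neq0 ?expf_neq0.
have hP j : P`_j = p`_j * s ^+ j / (p`_n * s ^+ n).
  rewrite coef_poly; case: ltnP => // h; by rewrite (nth_default 0 h) !mul0r.
have vn0 := @ord_nat K n n0.
have hPj j : (j != 0)%N -> j != n -> V N P`_j.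
  by move=> j0 jn; rewrite hP V_divc // addrC hj.
have Pn : P`_n = 1 by rewrite hP divff.
have P0 : V N (P`_0 + 1).
  by rewrite hP expr0 mulr1 -(divff q0) -mulrDl V_divc // addrC.
have hPz : Vpoly 0 P.
  move=> j; case: (eqVneq j n) => [->|jn]; first by rewrite Pn V1.
  case: (eqVneq j 0%N) => [->|j0]; last by apply: Vle (hPj _ j0 jn); lia.
  by rewrite -(addrK 1 P`_0) VB ?V1 //; apply: Vle P0; lia.
have hsz : (n < size P)%N.
  by rewrite ltnNge; apply/negP => h; move: Pn; rewrite nth_default // => /eqP; rewrite eq_sym oner_eq0.
have hd : V N (P^`().[1] - n%:R).
  rewrite (horner_coef_wide _ (n := size P)); last first.
    by apply: leq_trans (leq_pred _); rewrite /deriv size_poly.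
  have hn1 : (n.-1 < size P)%N by lia.
  rewrite (bigD1 (Ordinal hn1)) //= coef_deriv prednK // Pn expr1n mulr1 addrAC subrr add0r.
  apply: V_sum => i hi; rewrite expr1n mulr1 coef_deriv -mulr_natl VMr ?V_nat //.
  apply: hPj => //; apply: contraNneq hi => e; apply/eqP/val_inj => /=; lia.
have [d0 dn] : P^`().[1] != 0 /\ ord P^`().[1] = ord (n%:R : K).
  by apply: ord_dom; rewrite ?natn0 //; apply: Vle hd; lia.
split=> //.
rewrite horner_coef; have h0s : (0 < size P)%N by lia.
rewrite (bigD1 (Ordinal h0s)) //= (bigD1 (Ordinal hsz)) /=; last by rewrite -val_eqE /=; lia.
rewrite !expr1n !mulr1 Pn addrA VD //; apply: V_sum => i /andP[h1 h2].
by rewrite expr1n mulr1 hPj.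
Qed.

(** The bound on N is Hensel's condition at 1, where the normalized polynomial has a derivative of
    order [ord n]; undoing the rescaling shifts distances by [ord s]. *)
Lemma two_term_root p n N s : (0 < n)%N -> 2 * ord (n%:R : K) + 1 <= N -> two_term p n N s ->
  exists2 z, p.[z] = 0 & V (ord s + N - ord (n%:R : K)) (z - s).
Proof.
move=> n0 hN h; have vn0 := @ord_nat K n n0.
have [|hz d0 dn h1] := two_term_aux n0 _ h; first by lia.
have [s0 pn0 _ _] := h.
have [|t Pt ht] := hensel hz (V1 K) d0 _ h1; first by rewrite dn.
exists (s * t).
  move: Pt; rewrite nrmP // => /eqP; rewrite mulf_eq0 invr_eq0 mulf_eq0 expf_eq0.
  by rewrite (negbTE s0) (negbTE pn0) andbF !orbF => /eqP.
rewrite -[X in V _ (_ - X)]mulr1 -mulrBr -addrA V_mulc //.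
by move: ht; rewrite dn.
Qed.

Lemma two_term_unique p n N s z1 z2 : (0 < n)%N -> ord (n%:R : K) < N -> two_term p n N s ->
  V (ord s + ord (n%:R : K) + 1) (z1 - s) -> V (ord s + ord (n%:R : K) + 1) (z2 - s) ->
  p.[z1] = 0 -> p.[z2] = 0 -> z1 = z2.
Proof.
move=> n0 hN h h1 h2 r1 r2.
have [hz d0 dn _] := two_term_aux n0 hN h.
have [s0 pn0 _ _] := h.
have aux z : V (ord s + ord (n%:R : K) + 1) (z - s) -> V (ord (n%:R : K) + 1) (z / s - 1).
  by rewrite -[X in _ -> V _ (_ - X)](divff s0) -mulrBl V_divc // => hh; apply: Vle hh; lia.
have : z1 / s = z2 / s; last by move/(mulIf (invr_neq0 s0)).
apply: (hensel_unique hz (V1 K) d0); rewrite ?dn ?aux // nrmP // [s * _]mulrC divfK // ?r1 ?r2 mul0r //.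
Qed.

End Hensel.

(** * Tame sets *)

(** Integer variables are de Bruijn indices: [scons] enters a quantifier and [tl] drops the
    innermost variable. *)
Definition env := nat -> int.
Definition scons (z : int) (e : env) : env := fun i => if i is i'.+1 then e i' else z.
Definition tl (e : env) : env := fun i => e i.+1.

Section Tame.
Variable K : padic_field.

(** A lift of the angular component to the units of R, so that it can be considered modulo any power
    of the uniformizer and not only in the residue field. *)
Definition up (x : K) : K := x * unif K ^ (- ord x).

Section Def.
Variable I : Type.
Implicit Types F : set (I -> K).

Inductive lin F : (I -> env -> int) -> Prop :=
| lin_var i : lin F (fun _ e => e i)
| lin_cst k : lin F (fun _ _ => k)
| lin_ord t of F t : lin F (fun x _ => ord (t x))
| lin_add l l' of lin F l & lin F l' : lin F (fun x e => l x e + l' x e)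
| lin_opp l of lin F l : lin F (fun x e => - l x e).

(** Atoms see a function of F only through its order, its vanishing and its angular component, and
    only integers are quantified. [B] bounds the precision of the angular atoms, so that a
    substitution has to be controlled at one fixed precision only. *)
Inductive tb F (B : nat) : (I -> env -> Prop) -> Prop :=
| tb_ge l of lin F l : tb F B (fun x e => 0 <= l x e)
| tb_mod (m : nat) l of (0 < m)%N & lin F l : tb F B (fun x e => (m%:Z %| l x e)%Z)
| tb_zero t of F t : tb F B (fun x _ => t x = 0)
| tb_unit t (N : nat) z of F t & (N <= B)%N : tb F B (fun x _ => V N%:Z (up (t x) - z))
| tb_not P of tb F B P : tb F B (fun x e => ~ P x e)
| tb_and P Q of tb F B P & tb F B Q : tb F B (fun x e => P x e /\ Q x e)
| tb_ex P of tb F B P : tb F B (fun x e => exists z, P x (scons z e)).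

Definition tame F P := exists B, tb F B P.

Lemma lin_mono F F' l : F `<=` F' -> lin F l -> lin F' l.
Proof. by move=> s; elim=> *; constructor => //; apply: s. Qed.

Lemma tb_mono F F' B B' P : F `<=` F' -> (B <= B')%N -> tb F B P -> tb F' B' P.
Proof.
move=> s le; elim=> *; try by constructor => //; apply: lin_mono; eauto.
  by apply: tb_zero; apply: s.
by apply: tb_unit; [apply: s|apply: leq_trans le].
Qed.

Lemma tame_mono F F' P : F `<=` F' -> tame F P -> tame F' P.
Proof. by move=> s [B h]; exists B; apply: tb_mono h. Qed.

Lemma tame_ext F P Q : (forall x e, P x e <-> Q x e) -> tame F P -> tame F Q.
Proof. by move=> h; suff -> : P = Q by []; apply/funext => x; apply/funext => e; apply/propext. Qed.

Variable F : set (I -> K).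

Lemma tame_ge l : lin F l -> tame F (fun x e => 0 <= l x e).
Proof. by exists 0%N; constructor. Qed.
Lemma tame_mod (m : nat) l : (0 < m)%N -> lin F l -> tame F (fun x e => (m%:Z %| l x e)%Z).
Proof. by exists 0%N; constructor. Qed.
Lemma tame_zero t : F t -> tame F (fun x _ => t x = 0).
Proof. by exists 0%N; constructor. Qed.
Lemma tame_unit t N z : F t -> tame F (fun x _ => V N%:Z (up (t x) - z)).
Proof. by exists N; constructor. Qed.
Lemma tame_not P : tame F P -> tame F (fun x e => ~ P x e).
Proof. by case=> B h; exists B; constructor. Qed.
Lemma tame_and P Q : tame F P -> tame F Q -> tame F (fun x e => P x e /\ Q x e).
Proof.
case=> B h [B' h']; exists (maxn B B'); constructor.
  by apply: tb_mono h; rewrite ?leq_maxl.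
by apply: tb_mono h'; rewrite ?leq_maxr.
Qed.
Lemma tame_ex P : tame F P -> tame F (fun x e => exists z, P x (scons z e)).
Proof. by case=> B h; exists B; constructor. Qed.

Lemma tame_or P Q : tame F P -> tame F Q -> tame F (fun x e => P x e \/ Q x e).
Proof.
move=> hP hQ; apply: tame_ext (tame_not (tame_and (tame_not hP) (tame_not hQ))) => x e.
split=> [h|h [h1 h2]]; last by case: h.
by case: (pselect (P x e)) => hp; [left|right; apply: contrapT => hq; apply: h].
Qed.

Lemma tame_imp P Q : tame F P -> tame F Q -> tame F (fun x e => P x e -> Q x e).
Proof.
move=> hP hQ; apply: tame_ext (tame_or (tame_not hP) hQ) => x e.
split=> [[h|h]|h] //; case: (pselect (P x e)) => hp; [right|left] => //; exact: h.
Qed.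

Lemma tame_true : tame F (fun _ _ => True).
Proof. by apply: tame_ext (tame_ge (lin_cst F 0)) => x e; split. Qed.

Lemma tame_const (P : Prop) : tame F (fun _ _ => P).
Proof.
case: (pselect P) => h; first by apply: tame_ext tame_true => x e; split.
by apply: tame_ext (tame_not tame_true) => x e; split.
Qed.

Lemma tame_has (T : eqType) (s : seq T) (P : T -> I -> env -> Prop) :
  (forall r, r \in s -> tame F (P r)) -> tame F (fun x e => exists2 r, r \in s & P r x e).
Proof.
elim: s => [|a s IH] h.
  by apply: tame_ext (tame_const False) => x e; split=> // [[r]]; rewrite in_nil.
have h1 : tame F (P a) by apply: h; rewrite mem_head.
have h2 := IH (fun r hr => h r (@mem_behead _ (a :: s) r hr)).
apply: tame_ext (tame_or h1 h2) => x e; split=> [[ha|[r hr hp]]|[r]].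
- by exists a; rewrite ?mem_head.
- by exists r; rewrite // inE hr orbT.
by rewrite inE => /orP[/eqP-> |hr] hp; [left|right; exists r].
Qed.

Lemma tame_allin (T : eqType) (s : seq T) (P : T -> I -> env -> Prop) :
  (forall r, r \in s -> tame F (P r)) -> tame F (fun x e => forall r, r \in s -> P r x e).
Proof.
move=> h; have := tame_not (@tame_has T s (fun r x e => ~ P r x e) (fun r hr => tame_not (h r hr))).
apply: tame_ext => x e; split=> [hh r hr|hh [r hr]]; last by apply; apply: hh.
by apply: contrapT => hn; apply: hh; exists r.
Qed.

Lemma lin_sub l l' : lin F l -> lin F l' -> lin F (fun x e => l x e - l' x e).
Proof. by move=> h h'; apply: lin_add => //; apply: lin_opp. Qed.

Lemma tame_le l l' : lin F l -> lin F l' -> tame F (fun x e => l x e <= l' x e).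
Proof.
by move=> h h'; apply: tame_ext (tame_ge (lin_sub h' h)) => x e; rewrite subr_ge0.
Qed.

Lemma tame_eq l l' : lin F l -> lin F l' -> tame F (fun x e => l x e = l' x e).
Proof.
move=> h h'; apply: tame_ext (tame_and (tame_le h h') (tame_le h' h)) => x e.
by split=> [[h1 h2]|->] //; apply/eqP; rewrite eq_le h1 h2.
Qed.

End Def.

Definition lift (s : nat -> nat) (i : nat) := if i is i'.+1 then (s i').+1 else 0%N.

Lemma scons_lift z e s : (fun i => scons z e (lift s i)) = scons z (fun i => e (s i)).
Proof. by apply/funext; case. Qed.

Lemma tame_ren I (F : set (I -> K)) P (s : nat -> nat) :
  tame F P -> tame F (fun x e => P x (fun i => e (s i))).
Proof.
have hl l : lin F l -> forall s, lin F (fun x e => l x (fun i => e (s i))).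
  elim=> [i|k|t Ft|l1 l2 _ IH1 _ IH2|l1 _ IH] s'.
  - exact: (lin_var F (s' i)).
  - exact: (lin_cst F k).
  - exact: (lin_ord Ft).
  - exact: (lin_add (IH1 s') (IH2 s')).
  exact: (lin_opp (IH s')).
case=> B h; exists B; elim: h s => {P} [l /hl h|m l m0 /hl h|t Ft|t N z Ft hN|P hP IH|P Q hP IHP hQ IHQ|P hP IH] s.
- exact: (tb_ge B (h s)).
- exact: (tb_mod B m0 (h s)).
- exact: (tb_zero B Ft).
- exact: (tb_unit z Ft hN).
- exact: (tb_not (IH s)).
- exact: (tb_and (IHP s) (IHQ s)).
suff -> : (fun x (e : env) => exists z, P x (scons z (fun i => e (s i)))) =
   (fun x e => exists z, (fun x e => P x (fun i => e (lift s i))) x (scons z e)).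
  exact: (tb_ex (IH (lift s))).
apply/funext => x; apply/funext => e; apply/propext; split=> [] [z h]; exists z.
  by rewrite scons_lift.
by rewrite scons_lift in h.
Qed.

Lemma tame_tl I (F : set (I -> K)) P : tame F P -> tame F (fun x e => P x (tl e)).
Proof. exact: (@tame_ren _ _ _ S). Qed.

Lemma lin_ren I (F : set (I -> K)) l (s : nat -> nat) :
  lin F l -> lin F (fun x e => l x (fun i => e (s i))).
Proof.
elim=> [i|k|t Ft|l1 l2 _ IH1 _ IH2|l1 _ IH].
- exact: (lin_var F (s i)).
- exact: (lin_cst F k).
- exact: (lin_ord Ft).
- exact: (lin_add IH1 IH2).
exact: (lin_opp IH).
Qed.

Lemma lin_tl I (F : set (I -> K)) l : lin F l -> lin F (fun x e => l x (tl e)).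
Proof. exact: (@lin_ren _ _ _ S). Qed.

Lemma tame_sub I (F : set (I -> K)) P l : tame F P -> lin F l ->
  tame F (fun x e => P x (scons (l x e) e)).
Proof.
move=> hP hl.
have := tame_ex (tame_and (tame_eq (lin_var F 0) (lin_tl hl)) hP).
by apply: tame_ext => x e; split=> [[z [/= -> ]]|h] //; exists (l x e).
Qed.

Lemma upM (x y : K) : up (x * y) = up x * up y.
Proof.
case: (eqVneq x 0) => [->|x0]; first by rewrite /up !(mul0r, mulr0).
case: (eqVneq y 0) => [->|y0]; first by rewrite /up !(mul0r, mulr0).
by rewrite /up ordM // opprD expfzDr ?unifn0 //; ring.
Qed.

Lemma up0 : up 0 = 0. Proof. by rewrite /up mul0r. Qed.

Lemma up_neq0 (x : K) : x != 0 -> up x != 0.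
Proof. by move=> x0; rewrite mulf_neq0 ?pin0. Qed.

Lemma ord_up (x : K) : x != 0 -> ord (up x) = 0.
Proof. by move=> x0; rewrite ordM ?pin0 // ord_pi subrr. Qed.

Lemma V_up (x : K) : V 0 (up x).
Proof.
by case: (eqVneq x 0) => [->|x0]; rewrite ?up0 ?V0 // V_ord // ord_up.
Qed.

Lemma upK (x : K) : x = up x * unif K ^ ord x.
Proof. by rewrite /up -mulrA -expfzDr ?unifn0 // addNr expr0z mulr1. Qed.

Lemma up_unit (z : K) : z != 0 -> ord z = 0 -> up z = z.
Proof. by move=> z0 oz; rewrite /up oz oppr0 expr0z mulr1. Qed.

Lemma up_pi n : up (unif K ^ n) = 1.
Proof. by rewrite /up ord_pi -expfzDr ?unifn0 // subrr expr0z. Qed.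

(** Two descriptions of the same class in K^* / (1 + pi^N R): relative closeness of elements of
    equal order, and congruence of angular components. *)
Lemma rv_up (N : int) (x y : K) : ord x = ord y -> V (ord y + N) (x - y) = V N (up x - up y).
Proof.
move=> e; rewrite [in x - y](upK x) [in X in _ - X](upK y) e -mulrBl.
by rewrite mulrC -{1}(ord_pi K (ord y)) V_mulc ?pin0.
Qed.

(** * Functions with tame classes *)

Section Measurable.
Variables (I : Type) (F : set (I -> K)).
Implicit Types (C P Q : I -> env -> Prop) (g h : I -> env -> K).

(* [mr C N g]: on [C], the class of [g] in K^* / (1 + pi^N R) is tame *)
Definition mr C (N : nat) g := forall z, tame F (fun x e =>
  [/\ C x (tl e), g x (tl e) != 0, ord (g x (tl e)) = e 0%N & V N%:Z (up (g x (tl e)) - z)]).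

Lemma tame_and4 P Q P' Q' : tame F P -> tame F Q -> tame F P' -> tame F Q' ->
  tame F (fun x e => [/\ P x e, Q x e, P' x e & Q' x e]).
Proof.
move=> h1 h2 h3 h4; apply: tame_ext (tame_and h1 (tame_and h2 (tame_and h3 h4))) => x e.
by split=> [[? [? []]]|[]].
Qed.

Lemma mr_F C N t : tame F C -> F t -> mr C N (fun x _ => t x).
Proof.
move=> hC ht z; apply: tame_and4; first exact: tame_tl.
- by apply: tame_ext (tame_not (tame_zero ht)) => x e; split=> /eqP.
- by apply: tame_eq; constructor.
exact: tame_unit.
Qed.

Lemma mr_ren C N g s : mr C N g -> mr (fun x e => C x (fun i => e (s i))) N (fun x e => g x (fun i => e (s i))).
Proof. by move=> h z; exact: (@tame_ren _ _ _ (lift s) (h z)). Qed.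

Lemma mr_sub C C' N g : tame F C' -> (forall x e, C' x e -> C x e) -> mr C N g -> mr C' N g.
Proof.
move=> hC' s h z; apply: tame_ext (tame_and (tame_tl hC') (h z)) => x e.
by split=> [[? []]|[? ? ? ?]] //; split=> //; split=> //; apply: s.
Qed.

Lemma mr_ext C N g h : (forall x e, C x e -> g x e = h x e) -> mr C N g -> mr C N h.
Proof.
move=> gh hg z; apply: tame_ext (hg z) => x e.
by split=> [[hC]|[hC]]; rewrite ?gh //; split.
Qed.

Lemma mr_pi C N l (u : K) : tame F C -> lin F l -> u != 0 -> ord u = 0 ->
  mr C N (fun x e => unif K ^ l x e * u).
Proof.
move=> hC hl u0 ou z; have h := tame_and (tame_eq (lin_tl hl) (lin_var F 0)) (tame_const F (V N%:Z (u - z))).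
apply: tame_ext (tame_and (tame_tl hC) h) => x e.
rewrite mulf_neq0 ?pin0 // ordM ?pin0 // ou addr0 ord_pi upM up_pi mul1r up_unit //.
by split=> [[? []]|[]].
Qed.

(** A coarse class is a finite union of finer ones, indexed by representatives. *)
Lemma mr_ge C N N' g : (N' <= N)%N -> mr C N g -> mr C N' g.
Proof.
move=> le h z; have [s [_ hs]] := res_reps K N.
have := @tame_has _ F _ s (fun r x e => (V N'%:Z (r - z)) /\
  [/\ C x (tl e), g x (tl e) != 0, ord (g x (tl e)) = e 0%N & V N%:Z (up (g x (tl e)) - r)])
  (fun r _ => tame_and (tame_const F _) (h r)).
apply: tame_ext => x e; split=> [[r rs [h1 [h2 h3 h4 h5]]]|[h2 h3 h4 h5]].
  by split=> //; apply: Vtrans h1; apply: Vle h5; rewrite lez_nat.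
have [r rs hr] := hs _ (V_up (g x (tl e))).
exists r => //; split=> //; apply: Vtrans h5; rewrite VBC; apply: Vle hr; rewrite lez_nat //.
Qed.

Lemma mr_nz C g : mr C 0 g -> tame F (fun x e => C x e /\ g x e != 0).
Proof.
move=> h; apply: tame_ext (tame_ex (h 0)) => x e.
rewrite /tl /=; split=> [[z []]|[hC h0]] //.
by exists (ord (g x e)); split=> //; rewrite subr0 V_up.
Qed.

Lemma mr_zero C g : tame F C -> mr C 0 g -> tame F (fun x e => C x e /\ g x e = 0).
Proof.
move=> hC h; apply: tame_ext (tame_and hC (tame_not (mr_nz h))) => x e.
split=> [[h1 h2]|[h1 h2]]; split=> //; last by rewrite h2 eqxx; case.
by apply: contrapT => /eqP h3; apply: h2.
Qed.

Lemma mr_ord C g l : lin F l -> mr C 0 g -> tame F (fun x e => [/\ C x e, g x e != 0 & ord (g x e) = l x e]).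
Proof.
move=> hl h.
have h' := h 0.
have := tame_sub h' hl; apply: tame_ext => x e; rewrite /tl /=.
by split=> [[]|[]] // *; split=> //; rewrite subr0 V_up.
Qed.

Lemma mr_le C g l : lin F l -> mr C 0 g ->
  tame F (fun x e => [/\ C x e, g x e != 0 & l x e <= ord (g x e)]).
Proof.
move=> hl h; have := tame_ex (tame_and (tame_le (lin_tl hl) (lin_var F 0)) (h 0)).
apply: tame_ext => x e; split=> [[z [/= h1 [h2 h3 h4 _]]]|[h1 h2 h3]].
  by split=> //; rewrite [X in _ <= X]h4.
by exists (ord (g x e)); split=> //; split; rewrite // subr0 V_up.
Qed.

Lemma mr_V C g l : tame F C -> lin F l -> mr C 0 g -> tame F (fun x e => C x e /\ V (l x e) (g x e)).
Proof.
move=> hC hl h; apply: tame_ext (tame_or (mr_zero hC h) (mr_le hl h)) => x e; split.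
  by case=> [[h1 ->]|[h1 h2 h3]]; split=> //; rewrite ?V0 ?VE.
case: (eqVneq (g x e) 0) => [h0 [h1 _]|h0 [h1]]; first by left.
by rewrite VE //; right.
Qed.

(** The class of a product depends only on the classes of the factors: a finite union over pairs of
    representatives, with the orders of the factors quantified as integers. *)
Lemma mr_mul C N g h : mr C N g -> mr C N h -> mr C N (fun x e => g x e * h x e).
Proof.
move=> hg hh z; have [s [s0 hs]] := res_reps K N.
pose ss := [seq (a, b) | a <- s, b <- s].
pose P (r : K * K) x (e : env) := V N%:Z (r.1 * r.2 - z) /\
   exists a, exists b, [/\ e 0%N = a + b,
      [/\ C x (tl e), g x (tl e) != 0, ord (g x (tl e)) = a & V N%:Z (up (g x (tl e)) - r.1)] &
      [/\ C x (tl e), h x (tl e) != 0, ord (h x (tl e)) = b & V N%:Z (up (h x (tl e)) - r.2)]].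
have hP r : tame F (P r).
  apply: tame_and; first exact: tame_const.
  (* Under the two quantifiers, variables 1 and 0 are the orders of the factors and variable 2 is
     the order of the product. *)
  have h1 := @tame_ren _ _ _ (fun i => if i is i'.+1 then i'.+3 else 1%N) (hg r.1).
  have h2 := @tame_ren _ _ _ (fun i => if i is i'.+1 then i'.+3 else 0%N) (hh r.2).
  have h3 := tame_eq (lin_var F 2) (lin_add (lin_var F 1) (lin_var F 0)).
  apply: tame_ext (tame_ex (tame_ex (tame_and h3 (tame_and h1 h2)))) => x e.
  split=> [[a [b [/= e0 [ha hb]]]]|[a [b [e0 ha hb]]]]; exists a; exists b; split=> //.
have := @tame_has _ F _ ss P (fun r _ => hP r); apply: tame_ext => x e; split.
  case=> -[a b] /allpairsP[[a' b'] /= [as_ bs [-> ->]]] [hz [k [l [e0 [h1 h2 h3 h4] [_ h2' h3' h4']]]]].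
  move: hz h4 h4' => /= hz h4 h4'; split=> //; rewrite ?mulf_neq0 // ?ordM // ?h3 ?h3' ?e0 //.
  apply: Vtrans hz; rewrite upM.
  have -> : up (g x (tl e)) * up (h x (tl e)) - a' * b' = (up (g x (tl e)) - a') * up (h x (tl e)) + a' * (up (h x (tl e)) - b') by ring.
  by apply: VD; [apply: VMl; rewrite ?V_up|apply: VMr; rewrite ?s0].
case=> hC; rewrite mulf_eq0 negb_or => /andP[g0 h0]; rewrite ordM // => e0; rewrite upM => hz.
have [a as_ ha] := hs _ (V_up (g x (tl e))); have [b bs hb] := hs _ (V_up (h x (tl e))).
exists (a, b); first by apply/allpairsP; exists (a, b).
split=> /=; last first.
  by exists (ord (g x (tl e))), (ord (h x (tl e))); split=> //; split.
apply: Vtrans hz.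
have -> : a * b - up (g x (tl e)) * up (h x (tl e)) = - ((up (g x (tl e)) - a) * up (h x (tl e)) + a * (up (h x (tl e)) - b)) by ring.
rewrite VN; by apply: VD; [apply: VMl; rewrite ?V_up|apply: VMr; rewrite ?s0].
Qed.

Lemma mr_cst C N (c : K) : tame F C -> mr C N (fun _ _ => c).
Proof.
move=> hC; case: (eqVneq c 0) => [->|c0].
  move=> z; apply: tame_ext (tame_const F False) => x e; rewrite eqxx; split=> // -[]//.
apply: (@mr_ext _ _ (fun x e => unif K ^ (ord c) * up c)).
  by move=> x e _; rewrite mulrC -upK.
by apply: mr_pi; rewrite ?up_neq0 ?ord_up //; constructor.
Qed.

Lemma mr_exp C N g n : tame F C -> mr C N g -> mr C N (fun x e => g x e ^+ n).
Proof.
move=> hC hg; elim: n => [|n IH].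
  by apply: mr_ext (mr_cst N 1 hC) => x e _; rewrite expr0.
by apply: mr_ext (mr_mul hg IH) => x e _; rewrite exprS.
Qed.

Lemma mr_rv C N g h : tame F C -> mr C N g -> mr C N h ->
  tame F (fun x e => [/\ C x e, g x e != 0, h x e != 0, ord (h x e) = ord (g x e) & V (ord (g x e) + N%:Z) (h x e - g x e)]).
Proof.
move=> hC hg hh; have [s [s0 hs]] := res_reps K N.
have := @tame_has _ F _ s _ (fun r _ => tame_ex (tame_and (hg r) (hh r))).
apply: tame_ext => x e; split.
  case=> r rs [z [/= [h1 h2 h3 h4] [_ h2' h3' h4']]].
  have e1 : ord (h x e) = ord (g x e) by rewrite [LHS]h3' [RHS]h3.
  by split=> //; rewrite rv_up //; apply: Vtrans h4' _; rewrite VBC.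
case=> h1 h2 h3 h4; rewrite rv_up // => h5.
have [r rs hr] := hs _ (V_up (g x e)); exists r => //; exists (ord (g x e)); split; split=> //.
by apply: Vtrans h5 _.
Qed.

(** This is how a dominant monomial stands in for a whole polynomial, or a polynomial approximation
    for a series. *)
Lemma mr_close C N g h : tame F C -> mr C N g ->
  (forall x e, C x e -> (g x e = 0 /\ h x e = 0) \/
      [/\ g x e != 0, h x e != 0, ord (h x e) = ord (g x e) & V (ord (g x e) + N%:Z) (h x e - g x e)]) ->
  mr C N h.
Proof.
move=> hC hg hc z; apply: tame_ext (hg z) => x e; split=> [] [h1 h2 h3 h4].
  case: (hc _ _ h1) => [[g0]|[]]; first by rewrite g0 eqxx in h2.
  move=> g0 h0 o; rewrite rv_up // => hv; split; rewrite ?o //.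
  exact: Vtrans hv h4.
case: (hc _ _ h1) => [[_ g0]|[]]; first by rewrite g0 eqxx in h2.
move=> g0 h0 o; rewrite rv_up // => hv; split; rewrite -?o //.
by apply: Vtrans h4; rewrite VBC.
Qed.

Lemma mr_cover C N g (T : eqType) (s : seq T) (D : T -> I -> env -> Prop) :
  (forall x e, C x e <-> exists2 r, r \in s & D r x e) ->
  (forall r, r \in s -> mr (D r) N g) -> mr C N g.
Proof.
move=> h hr z; have := @tame_has _ F _ s _ (fun r rs => hr r rs z).
apply: tame_ext => x e; split=> [[r rs [h1 h2 h3 h4]]|[/h [r rs h1] h2 h3 h4]].
  by split=> //; apply/h; exists r.
by exists r.
Qed.

End Measurable.

(** Substitution of a point that may depend on the parameters and on integers. The composites need
    not belong to F: atoms see only classes of precision B, so measurability at that precision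
    suffices. *)
Lemma tame_pull I J (F : set (I -> K)) (G : set (J -> K)) B P :
  tb G B P -> forall (C : I -> env -> Prop) (th : I -> env -> J) (s : nat -> nat),
  tame F C -> (forall g, G g -> mr F C B (fun x e => g (th x e))) ->
  tame F (fun x e => C x e /\ P (th x e) (fun i => e (s i))).
Proof.
have hlin l : lin G l -> forall (C : I -> env -> Prop) (th : I -> env -> J) (s : nat -> nat),
  tame F C -> (forall g, G g -> mr F C B (fun x e => g (th x e))) ->
  tame F (fun x e => C x (tl e) /\ e 0%N = l (th x (tl e)) (fun i => tl e (s i))).
  elim=> [i|k|t Gt|l1 l2 _ IH1 _ IH2|l1 _ IH1] C th s hC hG.
  - apply: tame_and; first exact: tame_tl.
    by apply: tame_eq; [constructor|exact: (lin_var F (s i).+1)].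
  - apply: tame_and; first exact: tame_tl.
    by apply: tame_eq; constructor.
  (* [mr] speaks of nonzero values only, so the conventional value of [ord] at 0 is a separate
     case. *)
  - have h0 := mr_ge (leq0n B) (hG _ Gt).
    have h1 := tame_and (tame_tl (mr_zero hC h0)) (tame_eq (lin_var F 0) (lin_cst F (ord (0:K)))).
    have h2 : mr F (fun x e => C x (tl e)) 0 (fun x e => t (th x (tl e))) := mr_ren S h0.
    have h3 := mr_ord (lin_var F 0) h2.
    apply: tame_ext (tame_or h1 h3) => x e; split.
      by case=> [[[h ->] ->]|[h h' h'']]; split.
    case=> h he; case: (eqVneq (t (th x (tl e))) 0) => [e0|e0]; last by right.
    by left; split; rewrite // he e0.
  - have h1 := @tame_ren _ _ _ (fun i => if i is i'.+1 then i'.+3 else 1%N) (IH1 _ _ s hC hG).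
    have h2 := @tame_ren _ _ _ (fun i => if i is i'.+1 then i'.+3 else 0%N) (IH2 _ _ s hC hG).
    have h3 := tame_eq (lin_var F 2) (lin_add (lin_var F 1) (lin_var F 0)).
    apply: tame_ext (tame_ex (tame_ex (tame_and h3 (tame_and h1 h2)))) => x e.
    split=> [[a [b [/= e0 [[hc ha] [_ hb]]]]]|[hc e0]].
      by split=> //; rewrite e0 ha hb.
    by exists (l1 (th x (tl e)) (fun i => tl e (s i))), (l2 (th x (tl e)) (fun i => tl e (s i))).
  have h1 := @tame_ren _ _ _ (fun i => if i is i'.+1 then i'.+2 else 0%N) (IH1 _ _ s hC hG).
  have h3 := tame_eq (lin_var F 1) (lin_opp (lin_var F 0)).
  apply: tame_ext (tame_ex (tame_and h3 h1)) => x e.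
  split=> [[a [/= e0 [hc ha]]]|[hc e0]].
    by split=> //; rewrite e0 ha.
  by exists (l1 (th x (tl e)) (fun i => tl e (s i))).
elim=> {P} [l hl|m l m0 hl|t Gt|t N z Gt hN|P hP IH|P Q hP IHP hQ IHQ|P hP IH] C th s hC hG.
- have := tame_ex (tame_and (tame_ge (lin_var F 0)) (hlin l hl C th s hC hG)).
  apply: tame_ext => x e; split=> [[z [/= h0 [h1 h2]]]|[h1 h2]].
    by split=> //; move: h2 h0 => /= ->.
  by exists (l (th x e) (fun i => e (s i))).
- have := tame_ex (tame_and (tame_mod m0 (lin_var F 0)) (hlin l hl C th s hC hG)).
  apply: tame_ext => x e; split=> [[z [/= h0 [h1 h2]]]|[h1 h2]].
    by split=> //; move: h2 h0 => /= ->.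
  by exists (l (th x e) (fun i => e (s i))).
- exact: (mr_zero hC (mr_ge (leq0n B) (hG _ Gt))).
- have h1 := tame_and (mr_zero hC (mr_ge (leq0n B) (hG _ Gt))) (tame_const F (V N%:Z (0 - z))).
  have h2 := tame_ex (mr_ge hN (hG _ Gt) z).
  apply: tame_ext (tame_or h1 h2) => x e; split.
    by case=> [[[h ->]]|[k [h h' h'' h3]]]; rewrite ?up0.
  case=> h hz; case: (eqVneq (t (th x e)) 0) => [e0|e0]; last by right; exists (ord (t (th x e))).
  by left; split; [split|rewrite -up0 -e0].
- apply: tame_ext (tame_and hC (tame_not (IH C th s hC hG))) => x e.
  by split=> [[h1 h2]|[h1 h2]]; split=> // h3; apply: h2 => //; case: h3.
- by apply: tame_ext (tame_and (IHP C th s hC hG) (IHQ C th s hC hG)) => x e; split=> [[[? ?] []]|[? []]].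
have hC' : tame F (fun x e => C x (tl e)) by exact: tame_tl.
have hG' g : G g -> mr F (fun x e => C x (tl e)) B (fun x e => g (th x (tl e))).
  by move=> Gg; exact: (@mr_ren _ F C B (fun x e => g (th x e)) S (hG g Gg)).
have := tame_ex (IH _ (fun x e => th x (tl e)) (lift s) hC' hG').
apply: tame_ext => x e; split=> [[z [h1]]|[h1 [z h2]]].
  by rewrite scons_lift; split=> //; exists z.
by exists z; split=> //; rewrite scons_lift.
Qed.

Lemma tame_trans I (F F' : set (I -> K)) P :
  (forall g, F' g -> forall N, mr F (fun _ _ => True) N (fun x _ => g x)) -> tame F' P -> tame F P.
Proof.
move=> h [B hP]; have := @tame_pull _ _ F _ _ _ hP (fun _ _ => True) (fun x _ => x) id (tame_true F) (fun g Gg => h g Gg B).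
by apply: tame_ext => x e; split=> [[]|].
Qed.

Definition rveq (N : nat) (a b : K) := (a = 0 /\ b = 0) \/
  [/\ a != 0, b != 0, ord b = ord a & V (ord a + N%:Z) (b - a)].

(** A formula mentions finitely many functions, which is what allows one centre to be chosen for all
    of them. *)
Lemma tb_fin I (F : set (I -> K)) B P : tb F B P -> exists fs : seq (I -> K),
  (forall f, List.In f fs -> F f) /\ tb (fun f => List.In f fs) B P.
Proof.
have hlin l : lin F l -> exists fs : seq (I -> K), (forall f, List.In f fs -> F f) /\ lin (fun f => List.In f fs) l.
  elim=> [i|k|t Gt|l1 l2 _ [fs [h1 h2]] _ [fs' [h1' h2']]|l1 _ [fs [h1 h2]]].
  - by exists [::]; split=> //; constructor.
  - by exists [::]; split=> //; constructor.
  - by exists [:: t]; split=> [f /= [<-|//]|] //; constructor; left.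
  - exists (fs ++ fs')%list; split=> [f /List.in_app_iff[/h1|/h1']//|].
    by apply: lin_add; [apply: lin_mono h2|apply: lin_mono h2'] => f hf; apply/List.in_app_iff; [left|right].
  by exists fs; split=> //; apply: lin_opp.
elim=> {P} [l /hlin[fs [h1 h2]]|m l m0 /hlin[fs [h1 h2]]|t Gt|t N z Gt hN|P hP [fs [h1 h2]]|P Q hP [fs [h1 h2]] hQ [fs' [h1' h2']]|P hP [fs [h1 h2]]].
- by exists fs; split=> //; constructor.
- by exists fs; split=> //; constructor.
- by exists [:: t]; split=> [f /= [<-|//]|] //; constructor; left.
- by exists [:: t]; split=> [f /= [<-|//]|] //; constructor => //; left.
- by exists fs; split=> //; constructor.
- exists (fs ++ fs')%list; split=> [f /List.in_app_iff[/h1|/h1']//|].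
  by apply: tb_and; [apply: tb_mono h2|apply: tb_mono h2'] => // f hf; apply/List.in_app_iff; [left|right].
by exists fs; split=> //; constructor.
Qed.

(** A witness may be exchanged for a simpler one as long as the functions of the formula keep their
    classes at precision B. *)
Lemma tb_rveq I (F : set (I -> K)) B P (x y : I) : tb F B P ->
  (forall f, F f -> rveq B (f x) (f y)) -> forall e, P x e <-> P y e.
Proof.
move=> hP h.
have hl l : lin F l -> forall e, l x e = l y e.
  elim=> //= [t Ft e|l1 l2 _ IH1 _ IH2 e|l1 _ IH e].
  - by case: (h t Ft) => [[-> ->]|[]].
  - by rewrite IH1 IH2.
  by rewrite IH.
elim: hP => {P} [l /hl H e|m l m0 /hl H e|t Ft e|t N z Ft hN e|P hP IH e|P Q hP IHP hQ IHQ e|P hP IH e].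
- by rewrite H.
- by rewrite H.
- by case: (h t Ft) => [[-> ->]|[/eqP h1 /eqP h2 _ _]].
- case: (h t Ft) => [[-> ->]//|[h1 h2 o]]; rewrite rv_up // => hv.
  have hv' : V N%:Z (up (t y) - up (t x)) by apply: Vle hv; rewrite lez_nat.
  by split; apply: Vtrans; rewrite // VBC.
- by rewrite IH.
- by rewrite IHP IHQ.
by split=> -[z /IH hz]; exists z.
Qed.

(** If P were not tame, the sets containing P minus some tame subset of P would form a proper
    filter, as finite unions of tame sets are tame. An ultrafilter above it contains P but no tame
    subset of P. *)
Lemma tame_compact I (F : set (I -> K)) (P : I -> env -> Prop) :
  (forall U : set_system (I * env), UltraFilter U -> U [set w | P w.1 w.2] ->
     exists D, [/\ tame F D, U [set w | D w.1 w.2] & forall x e, D x e -> P x e]) ->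
  tame F P.
Proof.
move=> h; apply: contrapT => hn.
pose FF : set_system (I * env) := fun A => exists D, [/\ tame F D, forall x e, D x e -> P x e &
  forall x e, P x e -> ~ D x e -> A (x, e)].
have hF : ProperFilter FF.
  apply: Build_ProperFilter.
    move=> [D [hD hDP hA]]; apply: hn; apply: tame_ext hD => x e; split; first exact: hDP.
    by move=> hp; apply: contrapT => hd; apply: (hA x e).
  constructor.
  - by exists (fun _ _ => False); split=> //; exact: tame_const.
  - move=> A A' [D [hD hDP hA]] [D' [hD' hDP' hA']].
    exists (fun x e => D x e \/ D' x e); split; first exact: tame_or.
      by move=> x e [/hDP|/hDP'].
    by move=> x e hp hd; split; [apply: hA|apply: hA'] => // hh; apply: hd; [left|right].
  move=> A A' s [D [hD hDP hA]]; exists D; split=> // x e h1 h2; apply: s; exact: hA.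
have [U [UU sU]] := ultraFilterLemma hF.
have hUP : U [set w | P w.1 w.2].
  by apply: sU; exists (fun _ _ => False); split=> //; exact: tame_const.
have [D [hD UD hDP]] := h U UU hUP.
have UnD : U [set w | ~ D w.1 w.2] by apply: sU; exists D.
have := @filterI _ _ (@ultra_proper _ _ UU) _ _ UD UnD.
rewrite (_ : _ `&` _ = set0); last by apply/seteqP; split=> w // [].
exact: (@filter_not_empty _ _ (@ultra_proper _ _ UU)).
Qed.

End Tame.

(** * Rings of coefficient functions *)

Section Rings.
Variable K : padic_field.
Variable I : Type.
Implicit Types (F E : set (I -> K)) (p q : I -> {poly K}) (b c t : I -> K).

Record ring_set F : Prop := RingSet {
  rs_cst : forall c : K, F (fun _ => c);
  rs_add : forall s t, F s -> F t -> F (fun x => s x + t x);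
  rs_mul : forall s t, F s -> F t -> F (fun x => s x * t x)
}.

Lemma rs_ext F s t : (forall x, s x = t x) -> F s -> F t.
Proof. by move=> h; suff -> : s = t by []; apply/funext. Qed.

Lemma rs_opp F t : ring_set F -> F t -> F (fun x => - t x).
Proof.
move=> R h; apply: rs_ext (rs_mul R (rs_cst R (-1)) h) => x; exact: mulN1r.
Qed.

Lemma rs_sub F s t : ring_set F -> F s -> F t -> F (fun x => s x - t x).
Proof. by move=> R h h'; apply: (rs_add R) => //; apply: rs_opp. Qed.

Lemma rs_exp F t n : ring_set F -> F t -> F (fun x => t x ^+ n).
Proof.
move=> R h; elim: n => [|n IH].
  by apply: rs_ext (rs_cst R 1) => x; rewrite expr0.
by apply: rs_ext (rs_mul R h IH) => x; rewrite exprS.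
Qed.

Lemma rs_sum F (T : Type) (s : seq T) (f : T -> I -> K) : ring_set F ->
  (forall i, F (f i)) -> F (fun x => \sum_(i <- s) f i x).
Proof.
move=> R h; elim: s => [|a s IH].
  by apply: rs_ext (rs_cst R 0) => x; rewrite big_nil.
by apply: rs_ext (rs_add R (h a) IH) => x; rewrite big_cons.
Qed.

Definition coefF F p := forall j, F (fun x => (p x)`_j).
Definition polyF F (d : nat) p := (forall x, (size (p x) <= d)%N) /\ coefF F p.

Lemma coefF_add F p q : ring_set F -> coefF F p -> coefF F q -> coefF F (fun x => p x + q x).
Proof.
by move=> R hp hq j; apply: rs_ext (rs_add R (hp j) (hq j)) => x; rewrite coefD.
Qed.

Lemma coefF_mul F p q : ring_set F -> coefF F p -> coefF F q -> coefF F (fun x => p x * q x).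
Proof.
move=> R hp hq j.
apply: rs_ext (rs_sum (index_enum 'I_j.+1) R (fun i => rs_mul R (hp i) (hq (j - i)%N))) => x.
by rewrite coefM.
Qed.

Lemma coefF_C F t : ring_set F -> F t -> coefF F (fun x => (t x)%:P).
Proof.
move=> R ht [|j]; first by apply: rs_ext ht => x; rewrite coefC.
by apply: rs_ext (rs_cst R 0) => x; rewrite coefC.
Qed.

Lemma coefF_cst F (p : {poly K}) : ring_set F -> coefF F (fun _ => p).
Proof. by move=> R j; exact: rs_cst. Qed.

Lemma coefF_sum F (T : Type) (s : seq T) (f : T -> I -> {poly K}) : ring_set F ->
  (forall i, coefF F (f i)) -> coefF F (fun x => \sum_(i <- s) f i x).
Proof.
move=> R h j; apply: rs_ext (rs_sum s R (fun i => h i j)) => x.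
by rewrite coef_sum.
Qed.

Lemma coefF_exp F p n : ring_set F -> coefF F p -> coefF F (fun x => p x ^+ n).
Proof.
move=> R h; elim: n => [|n IH] j.
  by apply: rs_ext (coefF_cst 1 R j) => x; rewrite expr0.
by apply: rs_ext (coefF_mul R h IH j) => x; rewrite exprS.
Qed.

Lemma polyF_horner F d p t : ring_set F -> polyF F d p -> F t -> F (fun x => (p x).[t x]).
Proof.
move=> R [sp hp] ht.
apply: rs_ext (rs_sum (index_enum 'I_d) R (fun i : 'I_d => rs_mul R (hp i) (rs_exp i R ht))) => x.
by rewrite (horner_coef_wide _ (sp x)).
Qed.

(** The coefficients are the Taylor coefficients of [p x] at the centre [c x]. *)
Definition shp c p x := p x \Po ('X + (c x)%:P).

Lemma shpE c p x z : (shp c p x).[z] = (p x).[z + c x].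
Proof. by rewrite /shp horner_comp hornerD hornerX hornerC. Qed.

Lemma size_shp c p x : size (shp c p x) = size (p x).
Proof. by rewrite size_comp_poly2 // size_XaddC. Qed.

Lemma shp_deriv c p x : (shp c p x)^`() = shp c (fun x => (p x)^`()) x.
Proof. by rewrite deriv_comp derivD derivX derivC addr0 mulr1. Qed.

Lemma polyF_shp F d c p : ring_set F -> F c -> polyF F d p -> polyF F d (shp c p).
Proof.
move=> R hc [sp hp]; split; first by move=> x; rewrite size_shp.
have hX : coefF F (fun x => 'X + (c x)%:P).
  by apply: coefF_add => //; [exact: coefF_cst|exact: coefF_C].
have := coefF_sum (index_enum 'I_d) R (fun i : 'I_d => coefF_mul R (coefF_C R (hp i)) (coefF_exp i R hX)).
suff -> : (fun x => \sum_(i : 'I_d) ((p x)`_i)%:P * ('X + (c x)%:P) ^+ i) = shp c p by [].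
apply/funext => x; rewrite /shp /comp_poly (horner_coef_wide _ (n := d)).
  by apply: eq_bigr => i _; rewrite coef_map.
by rewrite size_map_polyC.
Qed.

Lemma polyF_deriv F d p : ring_set F -> polyF F d.+1 p -> polyF F d (fun x => (p x)^`()).
Proof.
move=> R [sp hp]; split=> [x|j].
  by rewrite /deriv; apply: leq_trans (size_poly _ _) _; move: (sp x); lia.
apply: rs_ext (rs_mul R (rs_cst R j.+1%:R) (hp j.+1)) => x.
by rewrite coef_deriv mulr_natl.
Qed.

Lemma polyF_mono F F' d p : F `<=` F' -> polyF F d p -> polyF F' d p.
Proof. by move=> s [h1 h2]; split=> // j; apply: s. Qed.

Definition adjoin F b : set (I -> K) :=
  [set g | exists d p, polyF F d p /\ g = fun x => (p x).[b x]].

Lemma adjoin_ring F b : ring_set F -> ring_set (adjoin F b).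
Proof.
move=> R; split.
- move=> c; exists 1%N, (fun _ => c%:P); split; last by apply/funext => x; rewrite hornerC.
  by split=> [x|]; [exact: size_polyC_leq1|exact: coefF_cst].
- move=> _ _ [d [p [[sp hp] ->]]] [d' [q [[sq hq] ->]]].
  exists (maxn d d'), (fun x => p x + q x); split; last by apply/funext => x; rewrite hornerD.
  split; last exact: coefF_add.
  by move=> x; apply: leq_trans (size_polyD _ _) _; move: (sp x) (sq x); lia.
move=> _ _ [d [p [[sp hp] ->]]] [d' [q [[sq hq] ->]]].
exists (d + d')%N, (fun x => p x * q x); split; last by apply/funext => x; rewrite hornerM.
split; last exact: coefF_mul.
by move=> x; apply: leq_trans (size_polyMleq _ _) _; move: (sp x) (sq x); lia.
Qed.

Lemma adjoin_sub F b : ring_set F -> F `<=` adjoin F b.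
Proof.
move=> R t ht; exists 1%N, (fun x => (t x)%:P); split; last by apply/funext => x; rewrite hornerC.
by split=> [x|]; [exact: size_polyC_leq1|exact: coefF_C].
Qed.

Lemma adjoin_mem F b : ring_set F -> adjoin F b b.
Proof.
move=> R; exists 2%N, (fun x => 'X); split; last by apply/funext => x; rewrite hornerX.
by split=> [x|]; [rewrite size_polyX|exact: coefF_cst].
Qed.

Definition T0 : I -> env -> Prop := fun _ _ => True.

(** The condition concerns all polynomials in [b], not [b] alone: the whole ring generated by [b]
    must bring no new tame set. *)
Definition simple F b := forall g, adjoin F b g -> forall N, mr F T0 N (fun x _ => g x).

Definition closedE E := ring_set E /\ forall b, simple E b -> E b.

(* Adjoining to [F] functions that do not enlarge the class of tame sets,
   as long as possible, yields a ring all of whose germs are p-adically closed. *)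
Lemma closure F : ring_set F -> exists E, [/\ F `<=` E, closedE E & forall P, tame E P -> tame F P].
Proof.
move=> R.
pose good E := ring_set E /\ forall g, E g -> forall N, mr F T0 N (fun x _ => g x).
have goodF : good F by split=> // g Fg N; apply: mr_F => //; exact: tame_true.
have [|A [hA hmax]] := @Zorn_bigcup (I -> K) (fun A => good (F `|` A)).
  move=> C hC tot; split; last first.
    move=> g [Fg|[X CX Xg]] N; first by have [_] := goodF; apply.
    by have [_] := hC X CX; apply; right.
  have key s t : (F `|` \bigcup_(X in C) X) s -> (F `|` \bigcup_(X in C) X) t ->
    exists E, [/\ ring_set E, E s, E t & E `<=` F `|` \bigcup_(X in C) X].
    have sX X : C X -> F `|` X `<=` F `|` \bigcup_(X in C) X.
      by move=> CX g [Fg|Xg]; [left|right; exists X].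
    move=> [Fs|[X CX Xs]] [Ft|[Y CY Yt]].
    - by exists F; split=> // g; left.
    - by exists (F `|` Y); split; [by case: (hC Y CY)|left|right|exact: sX].
    - by exists (F `|` X); split; [by case: (hC X CX)|right|left|exact: sX].
    case: (tot X Y CX CY) => s'.
      by exists (F `|` Y); split; [by case: (hC Y CY)|right; apply: s'|right|exact: sX].
    by exists (F `|` X); split; [by case: (hC X CX)|right|right; apply: s'|exact: sX].
  split=> [c|s t hs ht|s t hs ht]; first by left; apply: rs_cst.
    by have [E [RE Es Et]] := key s t hs ht; apply; apply: rs_add.
  by have [E [RE Es Et]] := key s t hs ht; apply; apply: rs_mul.
set E := F `|` A in hA; have [RE hE] := hA.
have htr P : tame E P -> tame F P by apply: tame_trans.
exists E; split=> //; first by move=> g; left.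
split=> // b sb.
have gB : good (adjoin E b).
  split; first exact: adjoin_ring.
  by move=> g /sb h N z; apply: htr; apply: h.
apply: contrapT => nb; apply: (hmax (adjoin E b)); last first.
  suff -> : F `|` adjoin E b = adjoin E b by [].
  apply/seteqP; split=> g; last by right.
  by case=> // Fg; apply: adjoin_sub => //; left.
split=> [|s]; first by move=> g Ag; apply: adjoin_sub => //; right.
by apply: nb; right; apply: s; apply: adjoin_mem.
Qed.

End Rings.

Section Units.
Variable K : padic_field.

Lemma unit_reps (N : nat) : exists s : seq K, (forall r, r \in s -> r != 0 /\ ord r = 0) /\
  forall x : K, x != 0 -> ord x = 0 -> exists2 r, r \in s & V N%:Z (x - r).
Proof.
case: N => [|N].
  exists [:: 1]; split=> [r|x x0 ox]; first by rewrite inE => /eqP ->; rewrite oner_neq0 ord1.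
  by exists 1; rewrite ?inE //; apply: VB; rewrite ?V1 // V_ord // ox.
have [s [_ hs]] := res_reps K N.+1.
exists [seq r <- s | (r != 0) && (ord r == 0)]; split.
  by move=> r; rewrite mem_filter => /andP[/andP[? /eqP ?] _].
move=> x x0 ox; have [|r rs hr] := hs x; first by rewrite V_ord // ox.
exists r => //; rewrite mem_filter rs andbT.
have [|r0 ->] := @ord_dom K x r x0; first by rewrite VBC ox add0r; apply: Vle hr; lia.
by rewrite r0 ox eqxx.
Qed.

Lemma upV (x : K) : up x^-1 = (up x)^-1.
Proof.
case: (eqVneq x 0) => [->|x0]; first by rewrite invr0 !up0 invr0.
by rewrite /up ordVn // invfM invr_expz !opprK.
Qed.

Variables (I : Type) (F : set (I -> K)).

Lemma mr_inv C N (g : I -> env -> K) : mr F C N g -> mr F C N (fun x e => (g x e)^-1).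
Proof.
move=> hg z; have [s [s0 hs]] := unit_reps N.
have h r := tame_and (tame_const F (V N%:Z (r^-1 - z)))
  (tame_ex (tame_and (tame_eq (lin_var F 1) (lin_opp (lin_var F 0)))
     (@tame_ren _ _ _ _ (fun i => if i is i'.+1 then i'.+2 else 0%N) (hg r)))).
have := @tame_has _ _ F _ s _ (fun r _ => h r).
have vinv (a r : K) : a != 0 -> ord a = 0 -> r != 0 -> ord r = 0 ->
    V N%:Z (a - r) -> V N%:Z (a^-1 - r^-1).
  move=> a0 oa r0 or_ hv.
  have -> : a^-1 - r^-1 = (r - a) / (a * r) by field; rewrite a0 r0.
  by rewrite V_divc ?mulf_neq0 // ordM // oa or_ !addr0 VBC.
apply: tame_ext => x e; split.
  case=> r rs [hz [a [/= e0 [h1 h2 h3 h4]]]].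
  have [r0 or_] := s0 r rs.
  split=> //; rewrite ?invr_eq0 ?ordVn ?h3 ?e0 //.
  by apply: Vtrans hz; rewrite upV; apply: vinv; rewrite ?up_neq0 ?ord_up.
case=> h1; rewrite invr_eq0 => h2; rewrite ordVn // upV => h3 h4.
have [r rs hr] := hs _ (up_neq0 h2) (ord_up h2); have [r0 or_] := s0 r rs.
exists r => //; split.
  by apply: Vtrans h4; rewrite VBC; apply: vinv; rewrite ?up_neq0 ?ord_up.
by exists (ord (g x (tl e))); split; first by rewrite /= h3.
Qed.

End Units.

Section ClosedRing.
Variable K : padic_field.
Variable I : Type.
Variable E : set (I -> K).
Hypothesis cE : closedE E.
Let RE : ring_set E := cE.1.

(** A polynomial in the inverse of [t], multiplied by a power of [t], is an element of E, so its
    classes are tame where [t] is nonzero; where [t] vanishes only the constant coefficient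
    remains. *)
Lemma closed_inv t : E t -> E (fun x => (t x)^-1).
Proof.
move=> Et; apply: cE.2 => _ [d [p [[sp hp] ->]]] N.
pose C0 : I -> env -> Prop := fun x _ => t x = 0.
pose C1 : I -> env -> Prop := fun x _ => t x != 0.
have tC0 : tame E C0 by exact: tame_zero.
have tC1 : tame E C1 by apply: tame_ext (tame_not tC0) => x e; split=> /eqP.
apply: (@mr_cover _ _ _ _ N _ bool [:: true; false] (fun b => if b then C0 else C1)).
  move=> x e; split=> // _; case: (eqVneq (t x) 0) => h; first by exists true.
  by exists false.
case=> _; rewrite /=.
  apply: (@mr_ext _ _ _ _ _ (fun x _ => (p x)`_0)); last exact: mr_F.
  by move=> x e /= ->; rewrite invr0 horner_coef0.
have h1 : E (fun x => \sum_(i : 'I_d) (p x)`_i * t x ^+ (d - i)%N).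
  apply: rs_sum => // i; apply: (rs_mul RE) => //; exact: rs_exp.
apply: (@mr_ext _ _ _ _ _ (fun x (e : env) => (\sum_(i : 'I_d) (p x)`_i * t x ^+ (d - i)%N) * ((t x)^-1) ^+ d)).
  move=> x e /= tx; rewrite (horner_coef_wide _ (sp x)) mulr_suml; apply: eq_bigr => i _.
  rewrite -mulrA; congr (_ * _); rewrite exprVn exprB ?(ltnW (ltn_ord i)) ?unitfE // exprVn.
  by rewrite mulrC mulrA mulVf ?mul1r ?expf_neq0.
apply: mr_mul; first exact: mr_F.
by apply: mr_exp => //; apply: mr_inv; apply: mr_F.
Qed.

End ClosedRing.

(** * Statements holding along an ultrafilter *)

Section Ultra.
Variables (W : Type) (U : set_system W).
Context {UU : UltraFilter U}.
Implicit Types P Q : W -> Prop.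

Definition ae P := U [set w | P w].

Lemma ae_imp P Q : (forall w, P w -> Q w) -> ae P -> ae Q.
Proof. by move=> h; apply: filterS. Qed.

Lemma ae_and P Q : ae P -> ae Q -> ae (fun w => P w /\ Q w).
Proof. by move=> h h'; apply: filterI. Qed.

Lemma ae_all P : (forall w, P w) -> ae P.
Proof. by move=> h; apply: (ae_imp (P := fun _ => True)) => //; apply: filterT. Qed.

Lemma ae_false : ~ ae (fun _ => False).
Proof.
move=> h; apply: (@filter_not_empty _ U); by rewrite (_ : set0 = [set w | False]).
Qed.

Lemma ae_not P : ~ ae P <-> ae (fun w => ~ P w).
Proof.
split=> [h|h h'].
  by have [|] := in_ultra_setVsetC [set w | P w] UU.
by apply: ae_false; apply: ae_imp (ae_and h h') => w [].
Qed.

Lemma nae P : ~ ae P -> ae (fun w => ~ P w).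
Proof. by move/ae_not. Qed.

Lemma ae_or P Q : ae (fun w => P w \/ Q w) -> ae P \/ ae Q.
Proof.
move=> h; case: (pselect (ae P)) => hp; [by left|right].
by move/ae_not: hp => hp; apply: ae_imp (ae_and h hp) => w [[]].
Qed.

(** Along an ultrafilter, integers of bounded size and residue classes become constants. *)
Lemma ae_const (T : eqType) (s : seq T) (P : T -> W -> Prop) :
  ae (fun w => exists2 r, r \in s & P r w) -> exists2 r, r \in s & ae (P r).
Proof.
elim: s => [|a s IH] h.
  by case: ae_false; apply: ae_imp h => w [r]; rewrite in_nil.
have [ha|hs] : ae (P a) \/ ae (fun w => exists2 r, r \in s & P r w).
  apply: ae_or; apply: ae_imp h => w [r]; rewrite inE => /orP[/eqP ->|rs] hp; first by left.
  by right; exists r.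
  by exists a; rewrite ?mem_head.
by have [r rs hr] := IH hs; exists r; rewrite // inE rs orbT.
Qed.

Lemma ae_allin (T : eqType) (s : seq T) (P : T -> W -> Prop) :
  (forall r, r \in s -> ae (P r)) -> ae (fun w => forall r, r \in s -> P r w).
Proof.
elim: s => [|a s IH] h; first exact: ae_all.
have h1 : ae (P a) by apply: h; rewrite mem_head.
have h2 := IH (fun r hr => h r (@mem_behead _ (a :: s) r hr)).
apply: ae_imp (ae_and h1 h2) => w [ha hs] r; rewrite inE => /orP[/eqP ->|] //; exact: hs.
Qed.

Lemma ae_ex P : ae P -> exists w, P w.
Proof.
by move=> h; apply: contrapT => hn; apply: ae_false; apply: ae_imp h => w hw; apply: hn; exists w.
Qed.

End Ultra.

(** * Polynomials dominated by a Taylor monomial *)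

Section Dominance.
Variable K : padic_field.
Implicit Types (q : {poly K}) (z : K).

Definition dom q (N k : nat) z := [/\ q`_k != 0, z != 0 &
  forall j, j != k -> V (ord (q`_k * z ^+ k) + N%:Z) (q`_j * z ^+ j)].

Lemma dom_value q N k z : dom q N k z ->
  V (ord (q`_k * z ^+ k) + N%:Z) (q.[z] - q`_k * z ^+ k).
Proof.
move=> [h1 h2 h3].
have hk : (k < size q)%N.
  by rewrite ltnNge; apply: contra h1 => h; rewrite nth_default.
rewrite horner_coef (bigD1 (Ordinal hk)) //= [X in V _ X]addrAC subrr add0r.
by apply: V_sum => i ik; apply: h3; rewrite -val_eqE in ik.
Qed.

Lemma dom_ord q N k z : (0 < N)%N -> dom q N k z ->
  q.[z] != 0 /\ ord q.[z] = ord (q`_k * z ^+ k).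
Proof.
move=> N0 h; have [h1 h2 _] := h; apply: ord_dom; first by rewrite mulf_neq0 ?expf_neq0.
by apply: Vle (dom_value h); lia.
Qed.

Lemma deriv_neq0 q : (1 < size q)%N -> q^`() != 0.
Proof.
move=> sq; apply/eqP => h; have := congr1 (fun p : {poly K} => p`_(size q).-2) h.
rewrite coef_deriv coef0 -mulr_natr => /eqP; rewrite mulf_eq0 => /orP[].
  have -> : (size q).-2.+1 = (size q).-1 by lia.
  by rewrite -lead_coefE lead_coef_eq0 => /eqP e; rewrite e size_poly0 in sq.
by rewrite (negbTE (natn0 K _)).
Qed.

Lemma seq_min (s : seq nat) (P : nat -> Prop) (f : nat -> int) :
  (exists2 j, j \in s & P j) ->
  exists2 k, k \in s & P k /\ forall j, j \in s -> P j -> f k <= f j.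
Proof.
elim: s => [[j]//|a s IH] hj.
case: (pselect (exists2 j, j \in s & P j)) => [/IH[k ks [Pk hk]]|hn]; last first.
  have Pa : P a.
    by case: hj => j; rewrite inE => /orP[/eqP->//|js Pj]; case: hn; exists j.
  exists a; rewrite ?mem_head //; split=> // j; rewrite inE => /orP[/eqP->//|js Pj].
  by case: hn; exists j.
case: (pselect (P a /\ f a <= f k)) => [[Pa le]|na].
  exists a; rewrite ?mem_head //; split=> // j; rewrite inE => /orP[/eqP->//|js Pj].
  exact: le_trans le (hk j js Pj).
exists k; first by rewrite inE ks orbT.
split=> // j; rewrite inE => /orP[/eqP->|] Pj; last exact: hk.
by case: (leP (f k) (f a)) => // lt; case: na; split=> //; apply: ltW.
Qed.

End Dominance.

Section Prep.
Variable K : padic_field.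
Variable I : Type.
Variable E : set (I -> K).
Hypothesis cE : closedE E.
Let RE : ring_set E := cE.1.
Local Notation W := (I * env)%type.

(** The germs of E along U form a field; it is required to contain its roots of polynomials of
    degree below d. The given root may depend on the integer variables, the germ found in E does
    not. *)
Definition ClosedD (d : nat) := forall (U : set_system W), UltraFilter U ->
  forall (b : W -> K) p, polyF E d p -> ae U (fun w => p w.1 != 0) ->
  ae U (fun w => (p w.1).[b w] = 0) -> exists2 c, E c & ae U (fun w => b w = c w.1).

Variable d : nat.
Hypothesis Cl : ClosedD d.
Variable U : set_system W.
Context {UU : UltraFilter U}.
Variable b : W -> K.
Hypothesis nb : forall c, E c -> ae U (fun w => b w != c w.1).

Local Notation "b %- c" := (fun w => b w - c w.1) (at level 50).

Lemma nb0 c : E c -> ae U (fun w => b w - c w.1 != 0).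
Proof. by move=> /nb; apply: ae_imp => w; rewrite subr_eq0. Qed.

Lemma polyF_le n p : (n <= d)%N -> polyF E n p -> polyF E d p.
Proof. by move=> le [h1 h2]; split=> // x; apply: leq_trans le. Qed.

(** If [c] is a best approximation of [b] from E, then l times the order of [b - c] is not an order
    from E up to a constant, for 0 < l < d. Otherwise Hensel's lemma extracts an l-th root of a
    constant multiple of [t] close to [b - c]. Having degree below d, it lies in E, and adding it to
    [c] improves the approximation. *)
Lemma purity c t (l : nat) (s : int) : E c ->
  (forall c', E c' -> ae U (fun w => ord (b w - c' w.1) <= ord (b w - c w.1))) ->
  E t -> ae U (fun w => t w.1 != 0) -> (0 < l < d)%N ->
  ~ ae U (fun w => l%:Z * ord (b w - c w.1) = ord (t w.1) + s).
Proof.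
move=> Ec hmax Et t0 /andP[l0 ld] H.
pose z w := b w - c w.1; pose N := `|(2 * ord (l%:R : K) + 1)%R|%N.
have vl := @ord_nat K l l0.
have [rs [hrs1 hrs2]] := @unit_reps K N.
have hz := nb0 Ec; rewrite -/z in hz.
pose eta w := z w ^+ l / (t w.1 * unif K ^ s).
have heta w : z w != 0 -> t w.1 != 0 -> l%:Z * ord (z w) = ord (t w.1) + s ->
    eta w != 0 /\ ord (eta w) = 0.
  move=> z0 tw e; rewrite /eta; split.
    by rewrite mulf_neq0 ?invr_eq0 ?expf_neq0 ?mulf_neq0 ?pin0.
  by rewrite ordM ?ordVn ?ordM ?ordX ?ord_pi ?invr_eq0 ?expf_neq0 ?mulf_neq0 ?pin0 // e; lia.
have [r rrs hr] : exists2 r, r \in rs & ae U (fun w => V N%:Z (eta w - r)).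
  apply: ae_const; apply: ae_imp (ae_and hz (ae_and t0 H)) => w [z0 [tw e]].
  by have [h1 h2] := heta w z0 tw e; apply: hrs2.
have [r0 or_] := hrs1 r rrs.
pose p (x : I) : {poly K} := 'X^l - (t x * (unif K ^ s * r))%:P.
have pc x j : (p x)`_j = (j == l)%:R - (if j == 0%N then t x * (unif K ^ s * r) else 0).
  by rewrite coefB coefXn coefC.
have pl x : (p x)`_l = 1 by rewrite pc eqxx; case: (l) l0 => // m _; rewrite subr0.
have hp : polyF E d p.
  split=> [x|j].
    apply: leq_trans (size_polyD _ _) _; rewrite size_polyN size_polyXn geq_max ld /=.
    by apply: leq_trans (size_polyC_leq1 _) _; lia.
  apply: rs_ext (rs_sub RE (rs_cst RE ((j == l)%:R)) (_ : E (fun x => if j == 0%N then t x * (unif K ^ s * r) else 0))) => [x|].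
    by rewrite pc.
  by case: (j == 0%N); [apply: (rs_mul RE) => //|]; exact: (rs_cst RE).
have h2t : ae U (fun w => z w != 0 /\ two_term (p w.1) l N%:Z (z w)).
  apply: ae_imp (ae_and hr (ae_and hz (ae_and t0 H))) => w [hv [z0 [tw e]]]; split=> //.
  have [e0 oe] := heta w z0 tw e.
  split=> //; first by rewrite pl oner_neq0.
    rewrite pl mul1r pc eq_sym (negbTE (lt0n_neq0 l0)) sub0r /=.
    have -> : - (t w.1 * (unif K ^ s * r)) + z w ^+ l = (t w.1 * unif K ^ s) * (eta w - r).
      by rewrite mulrBr mulrC -mulrA /eta [_ * (_ / _)]mulrC divfK ?mulf_neq0 ?pin0 //; ring.
    have -> : ord (z w ^+ l) = ord (t w.1 * unif K ^ s) by rewrite ordX // ordM ?pin0 // ord_pi e.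
    by rewrite V_mulc // mulf_neq0 ?pin0.
  by move=> j /negbTE j0 /negbTE jl; rewrite (pc w.1 j) j0 jl subrr mul0r V0.
have /choice[y hy] : forall w, exists y, two_term (p w.1) l N%:Z (z w) ->
   (p w.1).[y] = 0 /\ V (ord (z w) + 1) (y - z w).
  move=> w; case: (pselect (two_term (p w.1) l N%:Z (z w))) => h; last by exists 0.
  have [|y h1 h2] := two_term_root l0 _ h; first by lia.
  by exists y => _; split=> //; apply: Vle h2; lia.
have [||c1 Ec1 hc1] := @Cl U UU y p hp.
- apply: ae_all => w; apply/eqP => h; have := pl w.1; rewrite h coef0 => /eqP.
  by rewrite eq_sym oner_eq0.
- by apply: ae_imp h2t => w [_ /hy[]].
have Ecc : E (fun x => c x + c1 x) by apply: (rs_add RE).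
apply: (@ae_false _ U UU); apply: ae_imp (ae_and (nb0 Ecc) (ae_and (hmax _ Ecc) (ae_and hc1 h2t))) => w /=.
rewrite opprD addrA -/(z w) => -[h1 [h2 [h3 [h4 /hy[_ h5]]]]].
by move: h5; rewrite h3 VBC VE //; olia.
Qed.

(** By [purity], two Taylor monomials with nonzero coefficients cannot differ in order by a bounded
    amount, so a smallest order wins by any prescribed margin. *)
Lemma prep_max c p N : E c ->
  (forall c', E c' -> ae U (fun w => ord (b w - c' w.1) <= ord (b w - c w.1))) ->
  polyF E d p -> ae U (fun w => p w.1 != 0) ->
  exists k, ae U (fun w => dom (shp c p w.1) N k (b w - c w.1)).
Proof.
move=> Ec hmax hp p0.
pose z w := b w - c w.1; pose q := shp c p.
have hq : polyF E d q by apply: polyF_shp.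
have hz := nb0 Ec; rewrite -/z in hz.
pose f w j := ord ((q w.1)`_j * z w ^+ j).
have [k kd hk] : exists2 k, k \in iota 0 d & ae U (fun w => (q w.1)`_k != 0 /\
   forall j, j \in iota 0 d -> (q w.1)`_j != 0 -> f w k <= f w j).
  apply: ae_const; apply: ae_imp p0 => w pw.
  apply: (@seq_min _ (fun j => (q w.1)`_j != 0)).
  exists (size (q w.1)).-1; last by rewrite -lead_coefE lead_coef_eq0 -size_poly_eq0 size_shp size_poly_eq0.
  have h1 : (0 < size (q w.1))%N by rewrite size_shp size_poly_gt0.
  by rewrite mem_iota add0n leq0n /= prednK //; apply: hq.1.
exists k.
have hE j : E (fun x => (q x)`_j) by apply: hq.2.
have key j : j \in iota 0 d -> ae U (fun w => j != k -> V (f w k + N%:Z) ((q w.1)`_j * z w ^+ j)).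
  move=> jd; case: (eqVneq j k) => [->|jk]; first exact: ae_all.
  case: (pselect (ae U (fun w => V (f w k + N%:Z) ((q w.1)`_j * z w ^+ j)))) => [|/nae hn].
    exact: ae_imp.
  (* Where dominance fails, the difference of the two orders lies between 0 and N, hence is constant
     along U. *)
  have [s sN hs] : exists2 s, s \in iota 0 N & ae U (fun w => [/\ (q w.1)`_j != 0, (q w.1)`_k != 0 & f w j = f w k + s%:Z]).
    apply: ae_const; apply: ae_imp (ae_and hn (ae_and hk hz)) => w [/negP h1 [[h2 h3] h4]].
    have h5 := ord_nV h1; have h6 := neq0_V h1.
    have h7 : (q w.1)`_j != 0 by apply: contraNneq h6 => ->; rewrite mul0r.
    have h8 := h3 j jd h7; exists `|(f w j - f w k)%R|%N; last by split=> //; lia.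
    by rewrite mem_iota; rewrite -/(f w j) in h5; lia.
  have hf w i : (q w.1)`_i != 0 -> z w != 0 -> f w i = ord (q w.1)`_i + i%:Z * ord (z w).
    by move=> h1 h2; rewrite /f ordM ?expf_neq0 // ordX.
  rewrite !mem_iota /= !add0n in kd jd.
  have [lt|lt] : (k < j)%N \/ (j < k)%N by lia.
    have Et := rs_mul RE (hE k) (closed_inv cE (hE j)).
    case: (@purity c _ (j - k) s%:Z Ec hmax Et).
    - by apply: ae_imp hs => w [h1 h2 _]; rewrite mulf_neq0 ?invr_eq0.
    - by lia.
    apply: ae_imp (ae_and hz hs) => w [z0 [h1 h2]].
    rewrite ordM ?ordVn ?invr_eq0 // !hf // -/(z w).
    have -> : (j - k)%N%:Z = j%:Z - k%:Z by lia.
    by rewrite mulrBl; lia.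
  have Et := rs_mul RE (hE j) (closed_inv cE (hE k)).
  case: (@purity c _ (k - j) (- s%:Z) Ec hmax Et).
  - by apply: ae_imp hs => w [h1 h2 _]; rewrite mulf_neq0 ?invr_eq0.
  - by lia.
  apply: ae_imp (ae_and hz hs) => w [z0 [h1 h2]].
  rewrite ordM ?ordVn ?invr_eq0 // !hf // -/(z w).
  have -> : (k - j)%N%:Z = k%:Z - j%:Z by lia.
  by rewrite mulrBl; lia.
apply: ae_imp (ae_and hz (ae_and hk (ae_allin key))) => w [z0 [[h1 _] h2]].
split=> // j jk; case: (ltnP j d) => jd; first by apply: h2; rewrite // mem_iota.
have -> : (shp c p w.1)`_j = 0 by apply: nth_default; apply: leq_trans (hq.1 w.1) jd.
by rewrite mul0r V0.
Qed.

Lemma improve : (forall c, E c -> exists2 c', E c' & ae U (fun w => ord (b w - c w.1) < ord (b w - c' w.1))) ->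
  forall (m : nat) c, E c -> exists2 c', E c' & ae U (fun w => ord (b w - c w.1) + m%:Z <= ord (b w - c' w.1)).
Proof.
move=> nm; elim=> [|m IH] c Ec; first by exists c => //; apply: ae_all => w; rewrite addr0.
have [c1 Ec1 h1] := IH c Ec; have [c2 Ec2 h2] := nm c1 Ec1.
exists c2 => //; apply: ae_imp (ae_and h1 h2) => w [h h']; lia.
Qed.

(** Without a best approximation [b] is a pseudo-limit of elements of E, and at close enough centres
    the constant Taylor coefficient should dominate. The induction goes through the derivative: once
    its size at [b] is known, [p] is nearly affine around [b]. *)
Lemma prep_nomax :
  (forall c, E c -> exists2 c', E c' & ae U (fun w => ord (b w - c w.1) < ord (b w - c' w.1))) ->
  forall n p, (n <= d)%N -> polyF E n p -> ae U (fun w => p w.1 != 0) -> forall N,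
  exists2 c0, E c0 & forall c, E c -> ae U (fun w => ord (b w - c0 w.1) <= ord (b w - c w.1)) ->
    ae U (fun w => dom (shp c p w.1) N 0 (b w - c w.1)).
Proof.
move=> nm; have himp := improve nm.
elim=> [|n IH] p nd hp p0 N0.
  have [w] := ae_ex p0; have := hp.1 w.1.
  by rewrite leqn0 size_poly_eq0 => ->.
have [h|h] : ae U (fun w => (size (p w.1) <= 1)%N) \/ ae U (fun w => (1 < size (p w.1))%N).
  by apply: ae_or; apply: ae_all => w; case: (leqP (size (p w.1)) 1); [left|right].
  exists (fun _ => 0); first exact: (rs_cst RE).
  move=> c Ec _; apply: ae_imp (ae_and (nb0 Ec) (ae_and h p0)) => w [z0 [sp pw]].
  have sq : size (shp c p w.1) = 1%N.
    by rewrite size_shp; apply/eqP; rewrite eqn_leq sp size_poly_gt0.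
  split=> //.
    have -> : 0%N = (size (shp c p w.1)).-1 by rewrite sq.
    by rewrite -lead_coefE lead_coef_eq0 -size_poly_eq0 sq.
  move=> j j0; have -> : (shp c p w.1)`_j = 0 by apply: nth_default; rewrite sq; lia.
  by rewrite mul0r V0.
pose N := N0.+1.
(* [M] covers the precision lost when Taylor coefficients of the derivative are divided by their
   integer factors. *)
pose M := (\sum_(j < n.+2) `|ord (j%:R : K)|)%N.
have hM j : (j < n.+2)%N -> (`|ord (j%:R : K)| <= M)%N.
  by move=> jn; rewrite /M (bigD1 (Ordinal jn)) //= leq_addr.
pose dp x := (p x)^`().
have hdp : polyF E n dp by apply: polyF_deriv.
have dp0 : ae U (fun w => dp w.1 != 0) by apply: ae_imp h => w; apply: deriv_neq0.
have [c1 Ec1 hc1] := IH dp (ltnW nd) hdp dp0 (N + M)%N.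
pose lam w := ord (dp w.1).[b w]; pose beta w := (p w.1).[b w].
(* At every centre at least as close as [c1], the linear term outweighs all higher ones and its
   slope has the order of the derivative at [b]. *)
have Fc c : E c -> ae U (fun w => ord (b w - c1 w.1) <= ord (b w - c w.1)) ->
  ae U (fun w => let z := b w - c w.1 in let q := shp c p w.1 in
    [/\ z != 0, q`_1 != 0, ord q`_1 = lam w,
        forall j, (1 < j)%N -> V (lam w + ord z + N%:Z) (q`_j * z ^+ j) &
        V (lam w + ord z + N%:Z) (beta w - (q`_0 + q`_1 * z))]).
  move=> Ec hc; apply: ae_imp (ae_and (nb0 Ec) (hc1 c Ec hc)) => w [z0 hd].
  have [h1 _ h3] := hd; have [h4 h5] := dom_ord (N := (N + M)%N) isT hd.
  set z := b w - c w.1 in z0 h3 h4 h5 *; set q := shp c p w.1.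
  have e1 : (shp c dp w.1) = q^`() by rewrite shp_deriv.
  rewrite e1 expr0 mulr1 in h1 h3 h4 h5 *.
  have qq j : q^`()`_j = j.+1%:R * q`_j.+1 by rewrite coef_deriv mulr_natl.
  rewrite qq mul1r in h1 h3 h5.
  have hl : ord q`_1 = lam w.
    by rewrite -h5 -e1 shpE /lam subrK.
  have hj j : (1 < j)%N -> V (lam w + ord z + N%:Z) (q`_j * z ^+ j).
    case: j => // j; rewrite ltnS => j0.
    case: (ltnP j.+1 n.+2) => jn; last first.
      by rewrite nth_default ?mul0r ?V0 // size_shp; apply: leq_trans (hp.1 w.1) _; lia.
    have := h3 j (lt0n_neq0 j0); rewrite qq hl -mulrA.
    have jn0 := natn0 K (ltn0Sn j).
    have -> : lam w + (N + M)%N%:Z = ord (j.+1%:R : K) + (lam w + N%:Z + (M%:Z - ord (j.+1%:R : K))) by lia.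
    rewrite V_mulc // => hv; rewrite exprSr mulrA.
    have := VM hv (V_self z); apply: Vle.
    have := hM _ jn; lia.
  split=> //.
  have -> : beta w = q.[z] by rewrite shpE subrK.
  have sq : (size q <= n.+2)%N by rewrite size_shp; apply: leq_trans (hp.1 w.1) _; lia.
  rewrite (horner_coef_wide _ sq) big_ord_recl big_ord_recl /= expr0 mulr1 expr1 addrA [X in V _ X]addrAC subrr add0r.
  by apply: V_sum => i _; apply: hj.
have b0 : ae U (fun w => beta w != 0).
  apply: contrapT => /nae hb.
  have [|c Ec hc] := @Cl U UU b p (polyF_le nd hp) p0.
    by apply: ae_imp hb => w /negP; rewrite negbK => /eqP.
  by apply: (@ae_false _ U UU); apply: ae_imp (ae_and hc (nb Ec)) => w [->]; rewrite eqxx.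
have clt c c' c'' : ae U (fun w => ord (b w - c w.1) <= ord (b w - c' w.1)) ->
  ae U (fun w => ord (b w - c' w.1) <= ord (b w - c'' w.1)) -> ae U (fun w => ord (b w - c w.1) <= ord (b w - c'' w.1)).
  by move=> h1 h2; apply: ae_imp (ae_and h1 h2) => w [? ?]; lia.
(* Either some centre makes the linear term negligible against the value at [b], and the constant
   term dominates; or the linear term always exceeds that value, which will produce a root in E. *)
case: (pselect (exists c2, [/\ E c2, ae U (fun w => ord (b w - c1 w.1) <= ord (b w - c2 w.1)) &
   ae U (fun w => ord (beta w) + N%:Z <= ord (b w - c2 w.1) + lam w)])) => [[c2 [Ec2 h12 h2]]|hn].
  exists c2 => // c Ec hc; apply: ae_imp (ae_and (Fc c Ec (clt _ _ _ h12 hc)) (ae_and h2 (ae_and hc b0))) => w.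
  move=> [[z0 q1 oq hj hb] [h3 [h4 h5]]].
  set z := b w - c w.1 in z0 hj hb h4 *; set q := shp c p w.1 in q1 oq hj hb *.
  have o1 : ord (q`_1 * z) = lam w + ord z by rewrite ordM // oq.
  have hq0 : V (ord (beta w) + N%:Z) (q`_0 - beta w).
    have -> : q`_0 - beta w = - (beta w - (q`_0 + q`_1 * z)) - q`_1 * z by ring.
    apply: VB; last by apply: V_ord; rewrite o1; lia.
    by rewrite VN; apply: Vle hb; lia.
  have [q00 oq0] : q`_0 != 0 /\ ord q`_0 = ord (beta w).
    by apply: ord_dom => //; apply: Vle hq0; lia.
  split=> // j j0; rewrite expr0 mulr1 oq0.
  case: (ltnP 1 j) => j1; first by apply: Vle (hj j j1); rewrite /N; lia.
  have -> : j = 1%N by lia.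
  by rewrite expr1; apply: V_ord; rewrite o1 /N in h3 *; lia.
have {}hn c : E c -> ae U (fun w => ord (b w - c1 w.1) <= ord (b w - c w.1)) ->
   ae U (fun w => ord (b w - c w.1) + lam w + N%:Z < ord (beta w)).
  move=> Ec hc; have [c' Ec' hc'] := himp (2 * N)%N c Ec.
  have h1c' : ae U (fun w => ord (b w - c1 w.1) <= ord (b w - c' w.1)).
    by apply: ae_imp (ae_and hc hc') => w [? ?]; lia.
  have : ~ ae U (fun w => ord (beta w) + N%:Z <= ord (b w - c' w.1) + lam w).
    by move=> hh; apply: hn; exists c'.
  move/nae => hh; apply: ae_imp (ae_and hh hc') => w [/negP]; rewrite -ltNge => ? ?; lia.
have hc11 : ae U (fun w => ord (b w - c1 w.1) <= ord (b w - c1 w.1)) by apply: ae_all.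
pose z w := b w - c1 w.1.
have h2t : ae U (fun w => two_term (shp c1 p w.1) 1 N%:Z (z w)).
  apply: ae_imp (ae_and (Fc c1 Ec1 hc11) (hn c1 Ec1 hc11)) => w [[z0 q1 oq hj hb] h2].
  have o1 : ord ((shp c1 p w.1)`_1 * z w) = lam w + ord (z w) by rewrite ordM // oq.
  split=> //.
    rewrite expr1 o1 -[X in V _ X](subKr (beta w)); apply: VB => //.
    by apply: V_ord; rewrite -/(z w) in h2; lia.
  by move=> j j0 j1; rewrite expr1 o1; apply: hj; lia.
have /choice[y hy] : forall w, exists y, two_term (shp c1 p w.1) 1 N%:Z (z w) ->
   (p w.1).[y] = 0 /\ V (ord (z w) + N%:Z) (y - b w).
  move=> w; case: (pselect (two_term (shp c1 p w.1) 1 N%:Z (z w))) => hh; last by exists 0.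
  have [|y h1 h2] := two_term_root (ltn0Sn 0) _ hh; first by rewrite ord1 /N; lia.
  exists (y + c1 w.1) => _; split; first by rewrite -shpE.
  have -> : y + c1 w.1 - b w = y - z w by rewrite /z; ring.
  by move: h2; rewrite ord1 subr0.
(* The root isolated next to [b] is a germ [cs] of E. At this centre the constant term vanishes, so
   the value at [b] has the order of the linear term, against the inequality [hn]. *)
have [|cs Ecs hcs] := @Cl U UU y p (polyF_le nd hp) p0.
  by apply: ae_imp h2t => w /hy[].
have hcl : ae U (fun w => ord (b w - c1 w.1) <= ord (b w - cs w.1)).
  apply: ae_imp (ae_and (nb0 Ecs) (ae_and hcs h2t)) => w [h1 [h2 /hy[_ h3]]].
  by move: h3; rewrite h2 VBC VE // -/(z w); lia.
case: (@ae_false _ U UU).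
apply: ae_imp (ae_and (Fc cs Ecs hcl) (ae_and (hn cs Ecs hcl) (ae_and hcs (ae_and h2t b0)))) => w.
move=> [[z0 q1 oq hj hb] [h2 [h3 [/hy[h4 _] bw]]]].
have q0 : (shp cs p w.1)`_0 = 0 by rewrite -horner_coef0 shpE add0r -h3.
have o1 : ord ((shp cs p w.1)`_1 * (b w - cs w.1)) = lam w + ord (b w - cs w.1) by rewrite ordM // oq.
rewrite q0 add0r in hb.
have [||_ e] := @ord_dom K ((shp cs p w.1)`_1 * (b w - cs w.1)) (beta w); first by rewrite mulf_neq0.
  by rewrite o1; apply: Vle hb; rewrite /N; lia.
by rewrite e o1 in h2; lia.
Qed.

Lemma max_or : (exists c, E c /\ forall c', E c' -> ae U (fun w => ord (b w - c' w.1) <= ord (b w - c w.1))) \/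
  (forall c, E c -> exists2 c', E c' & ae U (fun w => ord (b w - c w.1) < ord (b w - c' w.1))).
Proof.
case: (pselect (exists c, E c /\ forall c', E c' -> ae U (fun w => ord (b w - c' w.1) <= ord (b w - c w.1)))) => h; [by left|right].
move=> c Ec; apply: contrapT => hn; apply: h; exists c; split=> // c' Ec'.
apply: contrapT => /nae h; apply: hn; exists c' => //.
by apply: ae_imp h => w /negP; rewrite -ltNge.
Qed.

(** One centre serves all polynomials: a best approximation if there is one, otherwise the closest
    of the finitely many centres found. *)
Lemma prep (ps : seq (I -> {poly K})) N :
  (forall p, List.In p ps -> polyF E d p /\ ae U (fun w => p w.1 != 0)) ->
  exists2 c, E c & forall p, List.In p ps -> exists k, ae U (fun w => dom (shp c p w.1) N k (b w - c w.1)).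
Proof.
move=> hps; case: max_or => [[c [Ec hc]]|nm].
  by exists c => // p /hps[h1 h2]; apply: prep_max.
suff [c0 Ec0 h0] : exists2 c0, E c0 & forall c, E c -> ae U (fun w => ord (b w - c0 w.1) <= ord (b w - c w.1)) ->
    forall p, List.In p ps -> ae U (fun w => dom (shp c p w.1) N 0 (b w - c w.1)).
  by exists c0 => // p hp; exists 0%N; apply: h0 => //; apply: ae_all.
elim: ps hps => [|p ps IH] hps; first by exists (fun _ => 0) => //; apply: (rs_cst RE).
have [|c1 Ec1 h1] := IH; first by move=> q hq; apply: hps; right.
have [hp p0] := hps p (or_introl erefl).
have [c2 Ec2 h2] := prep_nomax nm (leqnn d) hp p0 N.
have [le|le] : ae U (fun w => ord (b w - c1 w.1) <= ord (b w - c2 w.1)) \/ ae U (fun w => ord (b w - c2 w.1) <= ord (b w - c1 w.1)).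
  by apply: ae_or; apply: ae_all => w; case: (lerP (ord (b w - c1 w.1)) (ord (b w - c2 w.1))) => h; [left|right; apply: ltW].
  exists c2 => // c Ec hc q /= [<-|hq]; first exact: h2.
  by apply: h1 => //; apply: ae_imp (ae_and le hc) => w [? ?]; lia.
exists c1 => // c Ec hc q /= [<-|hq]; last exact: h1.
by apply: h2 => //; apply: ae_imp (ae_and le hc) => w [? ?]; lia.
Qed.

End Prep.

(** * Pointwise estimates on Taylor monomials *)

Section Pointwise.
Variable K : padic_field.
Implicit Types (q : {poly K}) (z s : K) (N : int).

Lemma rv_exp z s N k : s != 0 -> ord z = ord s -> V (ord s + N) (z - s) ->
  V (ord (s ^+ k) + N) (z ^+ k - s ^+ k).
Proof.
move=> s0 o h; case: k => [|k]; first by rewrite !expr0 subrr V0.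
have z0 : z != 0 \/ z = 0 by case: (eqVneq z 0); [right|left].
case: z0 => [z0|z0]; last first.
  rewrite z0 sub0r VN VE // in h.
  by rewrite z0 expr0n /= sub0r VN V_ord //; olia.
rewrite subrXX ordX //.
have -> : k.+1%:Z * ord s + N = (ord s + N) + k%:Z * ord s by lia.
apply: VM => //; apply: V_sum => i _.
rewrite V_ord // ordM ?expf_neq0 // !ordX // o -mulrDl.
by have := ltn_ord i; rewrite ltnS => hi; rewrite /= -PoszD subnK.
Qed.

(** At a root the constant term must cancel the n-th one up to the negligible terms, so no estimate
    on it has to be assumed. *)
Lemma two_term_of_root q n N z : (0 < n)%N -> q.[z] = 0 -> z != 0 -> q`_n != 0 ->
  (forall j, (j != 0)%N -> j != n -> V (ord (q`_n * z ^+ n) + N) (q`_j * z ^+ j)) ->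
  two_term q n N z.
Proof.
move=> n0 r z0 qn h; split=> //.
have sn : (n < size q)%N by rewrite ltnNge; apply: contra qn => hh; rewrite nth_default.
have s0 : (0 < size q)%N by lia.
move: r; rewrite horner_coef (bigD1 (Ordinal s0)) //= (bigD1 (Ordinal sn)) /=; last by rewrite -val_eqE /=; lia.
rewrite expr0 mulr1 addrA => /eqP; rewrite addr_eq0 => /eqP ->; rewrite VN.
apply: V_sum => i /andP[h1 h2]; apply: h; first by rewrite -val_eqE in h1.
by rewrite -val_eqE in h2.
Qed.

Lemma two_term_rv q n N z s : 0 <= N -> s != 0 -> ord z = ord s -> V (ord s + N) (z - s) ->
  two_term q n N z -> two_term q n N s.
Proof.
move=> N0 s0 o h [z0 qn h0 hj].
have e k : q`_k != 0 -> ord (q`_k * z ^+ k) = ord (q`_k * s ^+ k).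
  by move=> qk; rewrite !ordM ?expf_neq0 // !ordX // o.
split=> //; last first.
  move=> j j0 jn; have := hj j j0 jn; rewrite e //.
  case: (eqVneq q`_j 0) => [->|qj]; first by rewrite !mul0r !V0.
  by rewrite !VE ?mulf_neq0 ?expf_neq0 // e.
have -> : q`_0 + q`_n * s ^+ n = (q`_0 + q`_n * z ^+ n) - q`_n * (z ^+ n - s ^+ n) by ring.
rewrite -e // in h0 *; apply: VB => //.
by rewrite e // ordM ?expf_neq0 // -addrA V_mulc // rv_exp.
Qed.

Lemma two_term_ord q n N s : 1 <= N -> two_term q n N s -> q`_0 != 0 /\ ord q`_0 = ord (q`_n * s ^+ n).
Proof.
move=> N1 [s0 qn h0 _].
have t0 : q`_n * s ^+ n != 0 by rewrite mulf_neq0 ?expf_neq0.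
have [||h1 h2] := @ord_dom K (- (q`_n * s ^+ n)) q`_0; rewrite ?oppr_eq0 // ?ordN ?opprK.
  by apply: Vle h0; lia.
by split=> //; rewrite h2 ordN.
Qed.

Lemma coef_comp_scale q (a : K) j : (q \Po (a *: 'X))`_j = q`_j * a ^+ j.
Proof.
elim/poly_ind: q j => [|q c IH] j; first by rewrite comp_poly0 !coef0 mul0r.
rewrite comp_polyD comp_polyM comp_polyX comp_polyC -scalerAr coefD coefZ coefMX coefC coefD coefMX coefC.
case: j => [|j] /=; first by rewrite mulr0 !add0r expr0 mulr1.
by rewrite !addr0 IH exprS; ring.
Qed.

Lemma Vpoly_XaddC q : Vpoly 0 q -> Vpoly 0 (q \Po ('X + 1%:P)).
Proof.
elim/poly_ind: q => [|q c IH] h; first by rewrite comp_poly0 => i; rewrite coef0 V0.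
have h' : Vpoly 0 q by move=> i; have := h i.+1; rewrite coefD coefMX coefC /= addr0.
have hc : V 0 c by have := h 0%N; rewrite coefD coefMX coefC /= add0r.
rewrite comp_polyD comp_polyM comp_polyX comp_polyC mulrDr mulr1 => i.
rewrite !coefD coefMX coefC; apply: VD; [apply: VD|].
- by case: i => [|i] /=; [rewrite V0|apply: IH].
- exact: IH.
by case: (i == 0%N); rewrite ?V0.
Qed.

(** In normalized form the new linear coefficient is the derivative at 1, of order [ord n], while
    all coefficients stay integral. Close to an approximate root the linear term therefore takes
    over. *)
Lemma recenter q n N w : (0 < n)%N -> ord (n%:R : K) < N -> two_term q n N w ->
  let q2 := q \Po ('X + w%:P) in
  [/\ q2`_1 != 0, ord (q2`_1 * w) = ord (q`_n * w ^+ n) + ord (n%:R : K) &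
     forall j, V (ord (q`_n * w ^+ n)) (q2`_j * w ^+ j)].
Proof.
move=> n0 hN h q2; have [hP d0 dn _] := two_term_aux n0 hN h.
have [w0 qn _ _] := h.
set P := \poly_(j < _) _ in hP d0 dn.
have t0 : q`_n * w ^+ n != 0 by rewrite mulf_neq0 ?expf_neq0.
have eP : q \Po (w *: 'X) = (q`_n * w ^+ n) *: P.
  apply/polyP => j; rewrite coef_comp_scale coefZ coef_poly.
  case: ltnP => [_|sj]; first by rewrite [RHS]mulrC divfK.
  by rewrite nth_default // mul0r mulr0.
have e2 : q2 \Po (w *: 'X) = (q`_n * w ^+ n) *: (P \Po ('X + 1%:P)).
  rewrite -comp_polyZ -eP /q2 -!comp_polyA; congr (_ \Po _).
  by rewrite !comp_polyD !comp_polyC comp_polyX comp_polyZ comp_polyX scalerDr -mul_polyC -[w *: 1%:P]mul_polyC mulr1.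
have e3 j : q2`_j * w ^+ j = (q`_n * w ^+ n) * (P \Po ('X + 1%:P))`_j.
  by rewrite -coef_comp_scale e2 coefZ.
have e1 : (P \Po ('X + 1%:P))`_1 = P^`().[1].
  have : (P \Po ('X + 1%:P))^`()`_0 = (P \Po ('X + 1%:P))`_1 by rewrite coef_deriv.
  move=> <-; rewrite deriv_comp derivD derivX derivC addr0 mulr1.
  by rewrite -horner_coef0 horner_comp hornerD hornerX hornerC add0r.
have e4 : q2`_1 * w = (q`_n * w ^+ n) * P^`().[1] by rewrite -e1 -e3 expr1.
split.
- have : q2`_1 * w != 0 by rewrite e4 mulf_neq0.
  by rewrite mulf_eq0 negb_or => /andP[].
- by rewrite e4 ordM // dn.
move=> j; rewrite e3 -[X in V X _]addr0 V_mulc //; exact: Vpoly_XaddC.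
Qed.

Lemma dom_tr q (N k : nat) z s : s != 0 -> ord z = ord s -> dom q N k s -> z != 0 -> dom q N k z.
Proof.
move=> s0 o [h1 _ h3] z0.
have e j : q`_j != 0 -> ord (q`_j * z ^+ j) = ord (q`_j * s ^+ j).
  by move=> qk; rewrite !ordM ?expf_neq0 // !ordX // o.
split=> // j jk; have := h3 j jk; rewrite e //.
case: (eqVneq q`_j 0) => [->|qj]; first by rewrite !mul0r !V0.
by rewrite !VE ?mulf_neq0 ?expf_neq0 // e.
Qed.

End Pointwise.

(** * Tameness of dominance conditions at sample points *)

Section TameHelp.
Variable K : padic_field.
Variable I : Type.
Variable E : set (I -> K).
Hypothesis RE : ring_set E.
Implicit Types (C : I -> env -> Prop) (g h : I -> env -> K) (q : I -> {poly K}).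

Lemma mr_dom C g h (N : int) : tame E C -> mr E C 0 g -> mr E C 0 h ->
  tame E (fun x e => [/\ C x e, g x e != 0 & V (ord (g x e) + N) (h x e)]).
Proof.
move=> hC hg hh.
have h1 := mr_ord (lin_var E 0) (mr_ren S hg).
have h2 := mr_V (tame_tl hC) (lin_add (lin_var E 0) (lin_cst E N)) (mr_ren S hh).
apply: tame_ext (tame_ex (tame_and h1 h2)) => x e; split.
  by case=> z [/= [hc g0 og] [_ hv]]; split=> //; rewrite -og in hv.
by case=> hc g0 hv; exists (ord (g x e)).
Qed.

Lemma tame_T0 : tame E (@T0 I). Proof. exact: tame_true. Qed.

Variables (zeta : K).
Hypotheses (z0 : zeta != 0) (oz : ord zeta = 0).
(** A sample point of order [dl] with a fixed unit: through it an integer variable stands in for a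
    field variable. *)
Definition spi (dl : int) : K := unif K ^ dl * zeta.

Lemma spi_neq0 dl : spi dl != 0. Proof. by rewrite mulf_neq0 ?pin0. Qed.
Lemma ord_spi dl : ord (spi dl) = dl.
Proof. by rewrite ordM ?pin0 // oz addr0 ord_pi. Qed.

Lemma mr_spi N : mr E (@T0 I) N (fun _ e => spi (e 0%N)).
Proof. by apply: mr_pi => //; [exact: tame_T0|constructor]. Qed.

Lemma mr_mono q j N : coefF E q -> mr E (@T0 I) N (fun x e => (q x)`_j * spi (e 0%N) ^+ j).
Proof.
move=> hq; apply: mr_mul; first by apply: (@mr_F _ _ _ _ _ (fun x => (q x)`_j)); [exact: tame_T0|].
by apply: mr_exp; [exact: tame_T0|exact: mr_spi].
Qed.

Lemma tame_neq0 t : E t -> tame E (fun x _ => t x != 0).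
Proof. by move=> h; apply: tame_ext (tame_not (tame_zero h)) => x e; split=> /eqP. Qed.

Lemma tame_dom q d (N k : nat) : polyF E d q -> tame E (fun x e => dom (q x) N k (spi (e 0%N))).
Proof.
move=> [sq hq].
have h := tame_allin (s := [seq j <- iota 0 d | j != k])
  (fun j _ => mr_dom N%:Z tame_T0 (mr_mono k 0 hq) (mr_mono j 0 hq)).
apply: tame_ext (tame_and (tame_neq0 (hq k)) h) => x e; split.
  case=> h1 h2; split=> //; first exact: spi_neq0.
  move=> j jk; case: (ltnP j d) => jd.
    by have [|_ _] := h2 j; first by rewrite mem_filter jk mem_iota.
  have -> : (q x)`_j = 0 by apply: nth_default; apply: leq_trans (sq x) jd.
  by rewrite mul0r V0.
case=> h1 _ h2; split=> // j; rewrite mem_filter => /andP[jk _]; split=> //.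
  by rewrite mulf_neq0 ?expf_neq0 ?spi_neq0.
exact: h2.
Qed.

Lemma tame_two_term q d n (N : nat) : (0 < N)%N -> polyF E d q ->
  tame E (fun x e => two_term (q x) n N%:Z (spi (e 0%N))).
Proof.
move=> N0 [sq hq].
have h := tame_allin (s := [seq j <- iota 1 d | j != n])
  (fun j _ => mr_dom N%:Z tame_T0 (mr_mono n 0 hq) (mr_mono j 0 hq)).
have hm : mr E (@T0 I) N (fun x e => -1 * ((q x)`_n * spi (e 0%N) ^+ n)).
  by apply: mr_mul; [apply: mr_cst; exact: tame_T0|exact: mr_mono].
have h' := mr_rv tame_T0 hm (mr_mono 0 N hq).
apply: tame_ext (tame_and (tame_neq0 (hq n)) (tame_and h h')) => x e.
rewrite mulN1r opprK expr0 mulr1 ordN; split.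
  case=> h1 [h2 [_ _ _ _ h3]]; split=> //; first exact: spi_neq0.
  move=> j j0 jn; case: (ltnP j d) => jd.
    by have [|_ _] := h2 j; first by rewrite mem_filter jn mem_iota; lia.
  have -> : (q x)`_j = 0 by apply: nth_default; apply: leq_trans (sq x) jd.
  by rewrite mul0r V0.
have N1 : 1 <= N%:Z by lia.
move=> ht; have [q0 oq] := two_term_ord N1 ht; case: ht => _ h1 h2 h3.
have t0 : (q x)`_n * spi (e 0%N) ^+ n != 0 by rewrite mulf_neq0 ?expf_neq0 ?spi_neq0.
split=> //; split; last by split=> //; rewrite oppr_eq0.
move=> j; rewrite mem_filter mem_iota => /andP[jn /andP[j0 _]]; split=> //.
by apply: h3; lia.
Qed.

Lemma tame_near t (m : nat) : (0 < m)%N -> E t ->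
  tame E (fun x e => V (ord (spi (e 0%N)) + m%:Z) (t x - spi (e 0%N))).
Proof.
move=> m0 Et.
have h := mr_rv tame_T0 (mr_spi m) (@mr_F _ _ _ _ m _ tame_T0 Et).
apply: tame_ext h => x e; split=> [[]|h] //.
have [||t0 ot] := @ord_dom K (spi (e 0%N)) (t x); rewrite ?spi_neq0 //.
by apply: Vle h; lia.
Qed.

End TameHelp.

Section Units2.
Variable K : padic_field.

(** At given precision the angular component takes finitely many values, so it is constant along U
    and [z] can be compared with the sample point of its order. *)
Lemma ae_unit (W : Type) (U : set_system W) (UU : UltraFilter U) (N : nat) (z : W -> K) :
  ae U (fun w => z w != 0) ->
  exists r : K, [/\ r != 0, ord r = 0 & ae U (fun w => V (ord (z w) + N%:Z) (z w - spi r (ord (z w))))].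
Proof.
move=> h; have [rs [hrs1 hrs2]] := @unit_reps K N.
have [r rrs hr] : exists2 r, r \in rs & ae U (fun w => z w != 0 /\ V N%:Z (up (z w) - r)).
  apply: ae_const; apply: ae_imp h => w z0.
  by have [r h1 h2] := hrs2 _ (up_neq0 z0) (ord_up z0); exists r.
have [r0 or_] := hrs1 r rrs; exists r; split=> //.
apply: ae_imp hr => w [z0 hv].
have o : ord (spi r (ord (z w))) = ord (z w) by rewrite ord_spi.
rewrite -[X in V (X + _)]o rv_up; last by rewrite o.
by rewrite /spi upM up_pi mul1r (up_unit r0 or_).
Qed.

End Units2.

(** * Roots of polynomials over a p-adically closed ring *)

Section ModPoly.
Variable K : padic_field.
Variable I : Type.
Variable E : set (I -> K).
Hypothesis cE : closedE E.
Let RE : ring_set E := cE.1.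

(** Euclidean division over E, possible since E contains inverses. At a root of [p] it lowers the
    degree below d, into the range where [ClosedD] is available. *)
Lemma modF d D (p r : I -> {poly K}) : polyF E d.+1 p -> polyF E (d + D) r ->
  exists2 r', polyF E d r' & forall x y, (p x)`_d != 0 -> (p x).[y] = 0 -> (r x).[y] = (r' x).[y].
Proof.
move=> [sp hp]; elim: D r => [|D IH] r hr; first by exists r => //; rewrite addn0 in hr.
have [sr cr] := hr.
pose r1 x := r x - ((r x)`_(d + D) * ((p x)`_d)^-1)%:P * ('X^D * p x).
have cr1 : coefF E r1.
  have h1 := coefF_C RE (rs_mul RE (cr (d + D)%N) (closed_inv cE (hp d))).
  have h2 := coefF_mul RE h1 (coefF_mul RE (coefF_cst 'X^D RE) hp).
  have h3 := coefF_mul RE (coefF_cst (-1) RE) h2.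
  move=> j; apply: rs_ext (coefF_add RE cr h3 j) => x.
  by rewrite /r1 mulN1r.
pose r2 x := \poly_(j < d + D) (r1 x)`_j.
have hr2 : polyF E (d + D) r2.
  split=> [x|j]; first exact: size_poly.
  case: (ltnP j (d + D)) => h.
    by apply: rs_ext (cr1 j) => x; rewrite coef_poly h.
  by apply: rs_ext (rs_cst RE 0) => x; rewrite coef_poly ltnNge h.
have [r' hr' e] := IH r2 hr2; exists r' => // x y lc0 py.
rewrite -e //.
have -> : r2 x = r1 x.
  apply/polyP => j; rewrite coef_poly; case: ltnP => // h.
  rewrite /r1 coefB coefCM coefXnM.
  have -> : (j < D)%N = false by lia.
  case: (eqVneq j (d + D)%N) => [->|jn].
    by rewrite addnK divfK // subrr.
  have -> : (r x)`_j = 0 by apply: nth_default; apply: leq_trans (sr x) _; lia.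
  have -> : (p x)`_(j - D) = 0 by apply: nth_default; apply: leq_trans (sp x) _; lia.
  by rewrite mulr0 subrr.
by rewrite /r1 hornerD hornerN hornerM hornerM py !mulr0 subr0.
Qed.

End ModPoly.

Section CanonRoot.
Variable K : padic_field.
Variable I : Type.
Variable E : set (I -> K).
Hypothesis cE : closedE E.
Let RE : ring_set E := cE.1.
Variable d : nat.
Hypothesis d2 : (1 < d)%N.
Hypothesis Cl : ClosedD E d.

Variables (p : I -> {poly K}) (c0 : I -> K) (n : nat) (zeta : K) (N0 : nat).
Hypotheses (hp : polyF E d.+1 p) (Ec0 : E c0) (n0 : (0 < n)%N) (nd : (n <= d)%N).
Hypotheses (zeta0 : zeta != 0) (ozeta : ord zeta = 0).
Let v := ord (n%:R : K).
Hypothesis hN0 : 2 * v + 2 <= N0%:Z.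
Let v0 : 0 <= v. Proof. exact: ord_nat. Qed.
(** The relative precision at which [two_term_unique] separates roots. *)
Let m := `|(v + 1)%R|%N.
Let hm : m%:Z = v + 1. Proof. rewrite /m; lia. Qed.

Let q := shp c0 p.
Let s dl := spi zeta dl.
Let s0 dl : s dl != 0. Proof. exact: spi_neq0. Qed.
Let os dl : ord (s dl) = dl. Proof. exact: ord_spi. Qed.

(** The parameters at which Hensel's lemma isolates a root next to the sample point of order [dl]
    around [c0]. Below, [b0] selects this root and is 0 elsewhere. *)
Definition Dd x dl := (p x)`_d != 0 /\ two_term (q x) n N0%:Z (s dl).
Definition DD x := exists dl, Dd x dl.

Variable b0 : I -> K.
Hypothesis Hb1 : forall x dl, Dd x dl -> (p x).[b0 x] = 0 /\ V (dl + m%:Z) (b0 x - c0 x - s dl).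
Hypothesis Hb2 : forall x, ~ DD x -> b0 x = 0.

Lemma Huniq x dl y : Dd x dl -> (p x).[y] = 0 -> V (dl + m%:Z) (y - c0 x - s dl) -> y = b0 x.
Proof.
move=> h r hy; have [r0 h0] := Hb1 h; case: h => _ h.
suff : y - c0 x = b0 x - c0 x by move/addIr.
apply: (two_term_unique n0 _ h); rewrite ?os -/v.
- by lia.
- by apply: Vle hy; lia.
- by apply: Vle h0; lia.
- by rewrite shpE subrK.
by rewrite shpE subrK.
Qed.

Lemma Hz x dl : Dd x dl -> [/\ b0 x - c0 x != 0, ord (b0 x - c0 x) = dl &
  two_term (q x) n N0%:Z (b0 x - c0 x)].
Proof.
move=> h; have [r0 h0] := Hb1 h.
have [|z0 oz] := @ord_dom K (s dl) (b0 x - c0 x) (s0 dl).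
  by rewrite os; apply: Vle h0; lia.
rewrite os in oz; split=> //.
have [_ [_ qn _ hj]] := h.
apply: two_term_of_root => //; first by rewrite shpE subrK.
have e k : (q x)`_k != 0 -> ord ((q x)`_k * (b0 x - c0 x) ^+ k) = ord ((q x)`_k * s dl ^+ k).
  by move=> qk; rewrite !ordM ?expf_neq0 // !ordX // oz os.
move=> j j0 jn; have := hj j j0 jn; rewrite e //.
case: (eqVneq (q x)`_j 0) => [->|qj]; first by rewrite !mul0r !V0.
by rewrite !VE ?mulf_neq0 ?expf_neq0 // e.
Qed.

Let tDd : tame E (fun x e => Dd x (e 0%N)).
Proof.
apply: tame_and; first by apply: tame_neq0; apply: hp.2.
apply: tame_two_term (polyF_shp RE Ec0 hp) => //; lia.
Qed.

Definition C1 : I -> env -> Prop := fun x _ => DD x.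

Let tC1 : tame E C1. Proof. exact: (tame_ex tDd). Qed.

(** Uniqueness of the isolated root replaces the equality by two conditions on [c] alone: being a
    root, and lying near the sample point. *)
Lemma tame_b0eq c : E c -> tame E (fun x _ => DD x /\ b0 x = c x).
Proof.
move=> Ec; have Ecc : E (fun x => c x - c0 x) by apply: rs_sub.
have h1 : tame E (fun x _ => (p x).[c x] = 0) by apply: tame_zero; apply: polyF_horner hp Ec.
have m0 : (0 < m)%N by lia.
have h2 := tame_near zeta0 ozeta m0 Ecc.
apply: tame_ext (tame_ex (tame_and tDd (tame_and h1 h2))) => x e; split.
  case=> z [h [r hv]]; split; first by exists z.
  by apply/esym; apply: (Huniq h) => //; rewrite -/(s _) os in hv.
case=> [[z h]] e0; exists z; split=> //; have [r hv] := Hb1 h.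
by rewrite -e0; split=> //; rewrite -/(s _) os.
Qed.

Lemma rv_tr (N : nat) (t g : K) (a : int) (z : K) : t != 0 -> V (ord t + N.+1%:Z) (g - t) ->
  ord t = a -> V N%:Z (up t - z) -> [/\ g != 0, ord g = a & V N%:Z (up g - z)].
Proof.
move=> t0 hv o hz; have [|g0 og] := @ord_dom K t g t0; first by apply: Vle hv; clear; lia.
split=> //; first by rewrite og.
by apply: Vtrans hz; rewrite -rv_up //; apply: Vle hv; lia.
Qed.

Section AtU.
Variables (U : set_system (I * env)).
Context {UU : UltraFilter U}.
Hypothesis UD : ae U (fun w => DD w.1).
Let b (w : I * env) := b0 w.1.
Hypothesis nb : forall c, E c -> ae U (fun w => b w != c w.1).

Let z0ne : ae U (fun w => b w - c0 w.1 != 0). Proof. exact: (nb0 nb Ec0). Qed.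

Lemma shp_shp c x : shp c p x = q x \Po ('X + (c x - c0 x)%:P).
Proof.
rewrite /q /shp -comp_polyA; congr (_ \Po _).
by rewrite comp_polyD comp_polyX comp_polyC -addrA -polyCD subrK.
Qed.

(** A centre much closer to the root than [c0] sees a simple root. After [recenter] the linear
    coefficient may lag behind the others by [ord n], and the gain N0 in closeness makes up for it
    in every monomial of degree at least 2. *)
Lemma near_pattern c : E c -> ae U (fun w => ord (b w - c0 w.1) + N0%:Z <= ord (b w - c w.1)) ->
  ae U (fun w => two_term (shp c p w.1) 1 1 (b w - c w.1)).
Proof.
move=> Ec hc; apply: ae_imp (ae_and UD (ae_and hc (nb0 nb Ec))) => w [[dl hdl]].
case: (Hz hdl); rewrite -/(b w); set z0 := b w - c0 w.1; set z := b w - c w.1 => z00 oz h2t [hle zn0].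
pose wv := c w.1 - c0 w.1.
have ew : wv = z0 - z by rewrite /wv /z0 /z; ring.
have [wn0 ow] : wv != 0 /\ ord wv = ord z0.
  apply: ord_dom => //; rewrite ew addrAC subrr add0r VN V_ord //; lia.
have N00 : 0 <= N0%:Z by lia.
have h2w : two_term (q w.1) n N0%:Z wv.
  apply: two_term_rv h2t => //.
  have -> : z0 - wv = z by rewrite ew subKr.
  by rewrite V_ord // ow; lia.
have [|q21 oq hq] := recenter n0 _ h2w; first by rewrite -/v; lia.
rewrite -shp_shp in q21 oq hq.
apply: two_term_of_root => //; first by rewrite shpE subrK /b (Hb1 hdl).1.
have [_ q1n _ _] := h2w.
move=> j j0 j1; have o1 : ord ((shp c p w.1)`_1 * z ^+ 1) = ord ((q w.1)`_n * wv ^+ n) + v + (ord z - ord wv).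
  by rewrite expr1 ordM //; move: oq; rewrite ordM //; lia.
rewrite o1.
have -> : (shp c p w.1)`_j * z ^+ j = ((shp c p w.1)`_j * wv ^+ j) * (z / wv) ^+ j.
  by rewrite expr_div_n -mulrA [wv ^+ j * _]mulrCA divff ?mulr1 ?expf_neq0.
have hzw : ord ((z / wv) ^+ j) = j%:Z * (ord z - ord wv).
  by rewrite ordX ?ordM ?ordVn ?invr_eq0 ?mulf_neq0 ?invr_eq0.
have := VM (hq j) (V_self ((z / wv) ^+ j)); apply: Vle; rewrite hzw -/v.
have : 2 <= j%:Z by lia.
rewrite ow; move: hle; rewrite -/z -/z0; nia.
Qed.


Definition RVs (N : nat) (g : I -> K) z x (e : env) :=
  [/\ g x != 0, ord (g x) = e 0%N & V N%:Z (up (g x) - z)].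

Lemma tame_RVs N t z : E t -> tame E (RVs N t z).
Proof.
move=> Et; apply: tame_ext (@mr_F _ _ _ _ N _ (tame_T0 E) Et z) => x e.
by split=> [[]|[]].
Qed.

(** Some [c2] in E agrees with [b] so closely that [b - c1] and [c2 - c1] have the same class. [D]
    expresses, by the pattern of a simple root, that the isolated root lies that close to [c2]; the
    unknown order [dl'] of their difference is an integer variable. *)
Lemma lin_nomax c1 N z : E c1 ->
  (forall c, E c -> exists2 c', E c' & ae U (fun w => ord (b w - c w.1) < ord (b w - c' w.1))) ->
  ae U (fun w => RVs N (fun x => b0 x - c1 x) z w.1 w.2) ->
  exists D, [/\ tame E D, ae U (fun w => D w.1 w.2) &
    forall x e, D x e -> DD x /\ RVs N (fun x => b0 x - c1 x) z x e].
Proof.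
move=> Ec1 nm hP; have himp := @improve K I E U UU b nm.
pose M := (N0 + N + 1)%N.
have [c2 [Ec2 h20 h21]] : exists c2, [/\ E c2, ae U (fun w => ord (b w - c0 w.1) + M%:Z <= ord (b w - c2 w.1)) &
    ae U (fun w => ord (b w - c1 w.1) + M%:Z <= ord (b w - c2 w.1))].
  have [ca Eca ha] := himp M c0 Ec0; have [cb Ecb hb] := himp M c1 Ec1.
  have [le|le] : ae U (fun w => ord (b w - ca w.1) <= ord (b w - cb w.1)) \/ ae U (fun w => ord (b w - cb w.1) <= ord (b w - ca w.1)).
    by apply: ae_or; apply: ae_all => w; case: (lerP (ord (b w - ca w.1)) (ord (b w - cb w.1))) => h; [left|right; apply: ltW].
    by exists cb; split=> //; apply: ae_imp (ae_and le ha) => w [? ?]; lia.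
  by exists ca; split=> //; apply: ae_imp (ae_and le hb) => w [? ?]; lia.
have h2t : ae U (fun w => two_term (shp c2 p w.1) 1 1 (b w - c2 w.1)).
  by apply: near_pattern => //; apply: ae_imp h20 => w; rewrite /M; lia.
have [r [r0 or_ hr]] := @ae_unit _ _ U UU 1 _ (nb0 nb Ec2).
have Ew : E (fun x => c2 x - c0 x) by apply: rs_sub.
have Ew1 : E (fun x => c2 x - c1 x) by apply: rs_sub.
have m0 : (0 < m)%N by lia.
pose D x (e : env) := exists dl, exists dl', [/\ Dd x dl, V (dl + m%:Z) (c2 x - c0 x - s dl),
  two_term (shp c2 p x) 1 1 (spi r dl'), dl + N0%:Z <= dl' & ord (c2 x - c1 x) + N.+1%:Z <= dl' /\
  RVs N (fun x => c2 x - c1 x) z x e].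
exists D; split.
- have t1 := @tame_ren _ _ _ _ (fun _ => 1%N) tDd.
  have t2 := @tame_ren _ _ _ _ (fun _ => 1%N) (tame_near zeta0 ozeta m0 Ew).
  have t3 := tame_two_term r0 or_ 1 (ltn0Sn 0) (polyF_shp RE Ec2 hp).
  have t4 := tame_le (lin_add (lin_var E 1) (lin_cst E N0%:Z)) (lin_var E 0).
  have t5 := tame_le (lin_add (lin_ord Ew1) (lin_cst E N.+1%:Z)) (lin_var E 0).
  have t6 := @tame_ren _ _ _ _ (fun i => i.+2) (tame_RVs N z Ew1).
  apply: tame_ext (tame_ex (tame_ex (tame_and t1 (tame_and t2 (tame_and t3 (tame_and t4 (tame_and t5 t6))))))) => x e.
  split=> [[dl [dl' [h1 [h2 [h3 [h4 [h5 h6]]]]]]]|[dl [dl' [h1 h2 h3 h4 [h5 h6]]]]].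
    by exists dl, dl'; rewrite /= -/(s _) os in h2; split.
  by exists dl, dl'; rewrite /= -/(s _) os; split=> //; split.
- apply: ae_imp (ae_and UD (ae_and h20 (ae_and h21 (ae_and h2t (ae_and hr (ae_and hP (nb0 nb Ec2))))))) => w [[dl hdl] [h1 [h2 [h3 [h4 [h5 h6]]]]]].
  exists dl, (ord (b w - c2 w.1)).
  have [z00 oz _] := Hz hdl; rewrite -/(b w) in z00 oz.
  have [_ hs] := Hb1 hdl; rewrite -/(b w) in hs.
  have [g0 og hg] := h5; rewrite /= -/(b w) in g0 og hg.
  have [|w10 ow1 hw1] := @rv_tr N (b w - c1 w.1) (c2 w.1 - c1 w.1) (w.2 0%N) z g0 _ og hg.
    have -> : c2 w.1 - c1 w.1 - (b w - c1 w.1) = - (b w - c2 w.1) by ring.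
    by rewrite VN V_ord //; move: h2; rewrite /M; clear; lia.
  split=> //.
  - have -> : c2 w.1 - c0 w.1 - s dl = (b w - c0 w.1 - s dl) - (b w - c2 w.1) by ring.
    by apply: VB => //; apply: V_ord; move: h1 hm hN0 v0; rewrite /M -?oz; clear; lia.
  - by apply: two_term_rv h3; rewrite ?spi_neq0 // ord_spi.
  - by rewrite -oz; move: h1; rewrite /M; clear; lia.
  by split=> //; rewrite ow1 -og; move: h2; rewrite /M; clear; olia.
move=> x e [dl [dl' [h1 h2 h3 h4 [h5 h6]]]].
have [|y ry hy] := two_term_root (ltn0Sn 0) _ h3; first by rewrite ord1.
rewrite ord_spi // ord1 subr0 in hy.
have [||y0 oy] := @ord_dom K (spi r dl') y; rewrite ?spi_neq0 ?ord_spi //.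
rewrite ord_spi // in oy.
have e2 : y + c2 x = b0 x.
  apply: (Huniq h1); first by rewrite -shpE.
  have -> : y + c2 x - c0 x - s dl = (c2 x - c0 x - s dl) + y by ring.
  by apply: VD => //; apply: V_ord; lia.
split; first by exists dl.
have [g0 og hg] := h6; apply: (@rv_tr N (c2 x - c1 x)) => //.
have -> : b0 x - c1 x - (c2 x - c1 x) = y by rewrite -e2; ring.
by apply: V_ord; lia.
Qed.

(** [purity] excludes bounded relations between the order of [b - cm] and orders from E. So [c0] is
    itself a best approximation, [c0 - c1] and [b - c0] cannot be of comparable size, and the larger
    one gives the class of [b - c1]. *)
Lemma lin_max c1 N z cm : E c1 -> E cm ->
  (forall c', E c' -> ae U (fun w => ord (b w - c' w.1) <= ord (b w - cm w.1))) ->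
  ae U (fun w => RVs N (fun x => b0 x - c1 x) z w.1 w.2) ->
  exists D, [/\ tame E D, ae U (fun w => D w.1 w.2) &
    forall x e, D x e -> DD x /\ RVs N (fun x => b0 x - c1 x) z x e].
Proof.
move=> Ec1 Ecm hmax hP.
(* If [cm] were strictly better, the order of [b - cm] would be that of a quotient of Taylor
   coefficients when the gain is at least N0, and that of [cm - c0] up to a constant otherwise; both
   contradict [purity]. *)
have hcm : ~ ae U (fun w => ord (b w - c0 w.1) < ord (b w - cm w.1)).
  move=> hlt.
  have Ew : E (fun x => cm x - c0 x) by apply: rs_sub.
  have hw : ae U (fun w => cm w.1 - c0 w.1 != 0 /\ ord (cm w.1 - c0 w.1) = ord (b w - c0 w.1)).
    apply: ae_imp (ae_and hlt (ae_and (nb0 nb Ec0) (nb0 nb Ecm))) => w [h1 [h2 h3]].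
    apply: ord_dom => //.
    have -> : cm w.1 - c0 w.1 - (b w - c0 w.1) = - (b w - cm w.1) by ring.
    by rewrite VN V_ord //; lia.
  case: (pselect (ae U (fun w => ord (b w - c0 w.1) + N0%:Z <= ord (b w - cm w.1)))) => [hN|/nae hN].
    have h2t := near_pattern Ecm hN.
    have Eq := polyF_shp RE Ecm hp.
    have Et := rs_mul RE (Eq.2 0%N) (closed_inv cE (Eq.2 1%N)).
    apply: (@purity _ _ _ cE d Cl U UU b nb cm _ 1 0 Ecm hmax Et _ _); last 1 first.
    - apply: ae_imp (ae_and h2t (nb0 nb Ecm)) => w [h z0].
      have [q0 oq] := two_term_ord (lexx 1) h; have [_ q1 _ _] := h.
      rewrite expr1 in oq; rewrite ordM ?invr_eq0 // ordVn // oq ordM //; lia.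
    - apply: ae_imp h2t => w h.
      by have [q0 oq] := two_term_ord (lexx 1) h; have [_ q1 _ _] := h; rewrite mulf_neq0 ?invr_eq0.
    by [].
  have [k kN hk] : exists2 k, k \in iota 0 N0 & ae U (fun w => ord (b w - cm w.1) = ord (b w - c0 w.1) + k%:Z).
    apply: ae_const; apply: ae_imp (ae_and hlt hN) => w [h1 /negP]; rewrite -ltNge => h2.
    by exists `|(ord (b w - cm w.1) - ord (b w - c0 w.1))%R|%N; rewrite ?mem_iota; lia.
  apply: (@purity _ _ _ cE d Cl U UU b nb cm _ 1 k%:Z Ecm hmax Ew _ _).
  - by apply: ae_imp hw => w [].
  - by [].
  by apply: ae_imp (ae_and hw hk) => w [[h1 h2] h3]; rewrite mul1r h2 h3.
have hmax0 c' : E c' -> ae U (fun w => ord (b w - c' w.1) <= ord (b w - c0 w.1)).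
  move=> Ec'; apply: ae_imp (ae_and (hmax c' Ec') (nae hcm)) => w [h1 /negP]; rewrite -leNgt; lia.
have pur t l k Et tn0 hl := @purity _ _ _ cE d Cl U UU b nb c0 t l k Ec0 hmax0 Et tn0 hl.
have Ew : E (fun x => c0 x - c1 x) by apply: rs_sub.
have h2t : ae U (fun w => two_term (q w.1) n N0%:Z (b w - c0 w.1)).
  by apply: ae_imp UD => w [dl /Hz[]].
case: (pselect (ae U (fun w => c0 w.1 - c1 w.1 != 0 /\ ord (c0 w.1 - c1 w.1) + N.+1%:Z <= ord (b w - c0 w.1)))) => [h1|/nae h1].
  pose D x (e : env) := exists dl, [/\ Dd x dl, ord (c0 x - c1 x) + N.+1%:Z <= dl &
    RVs N (fun x => c0 x - c1 x) z x e].
  exists D; split.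
  - have t5 := tame_le (lin_add (lin_ord Ew) (lin_cst E N.+1%:Z)) (lin_var E 0).
    have t6 := @tame_ren _ _ _ _ (fun i => i.+1) (tame_RVs N z Ew).
    apply: tame_ext (tame_ex (tame_and tDd (tame_and t5 t6))) => x e.
    by split=> [[dl [? [? ?]]]|[dl [? ? ?]]]; exists dl.
  - apply: ae_imp (ae_and UD (ae_and h1 hP)) => w [[dl hdl] [[w0 h2] [g0 og hg]]].
    have [z00 oz _] := Hz hdl; rewrite /= -/(b w) in z00 oz g0 og hg.
    exists dl; split=> //; first by rewrite -oz.
    have [|g0' og'] := @ord_dom K (c0 w.1 - c1 w.1) (b w - c1 w.1) w0.
      have -> : b w - c1 w.1 - (c0 w.1 - c1 w.1) = b w - c0 w.1 by ring.
      by rewrite V_ord //; lia.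
    apply: (@rv_tr N (b w - c1 w.1)) => //.
    have -> : c0 w.1 - c1 w.1 - (b w - c1 w.1) = - (b w - c0 w.1) by ring.
    by rewrite VN V_ord // og'; lia.
  move=> x e [dl [hdl h2 [g0 og hg]]]; split; first by exists dl.
  have [z00 oz _] := Hz hdl.
  apply: (@rv_tr N (c0 x - c1 x)) => //.
  have -> : b0 x - c1 x - (c0 x - c1 x) = b0 x - c0 x by ring.
  by rewrite V_ord // oz.
have {}h1 : ae U (fun w => V (ord (b w - c0 w.1) + N.+1%:Z) (c0 w.1 - c1 w.1)).
  apply: contrapT => /nae hn.
  have [k kN hk] : exists2 k, k \in iota 0 (N + N).+3 & ae U (fun w => ord (b w - c0 w.1) = ord (c0 w.1 - c1 w.1) + (k%:Z - N.+1%:Z)).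
    apply: ae_const; apply: ae_imp (ae_and hn h1) => w [/negP h2 h3].
    have h4 := neq0_V h2; have h5 := ord_nV h2.
    have h6 : ord (b w - c0 w.1) < ord (c0 w.1 - c1 w.1) + N.+1%:Z.
      by rewrite ltNge; apply/negP => h7; apply: h3.
    exists `|(ord (b w - c0 w.1) - ord (c0 w.1 - c1 w.1) + N.+1%:Z)%R|%N; rewrite ?mem_iota; lia.
  apply: (pur _ 1%N (k%:Z - N.+1%:Z) Ew) => //; last by apply: ae_imp hk => w ->; rewrite mul1r.
  by apply: ae_imp hn => w /negP /neq0_V.
(* [purity] raises the precision of the two-term pattern from N0 to N', enough for the pattern at a
   sample point to determine the class of [b - c0] at precision N. *)
pose N' := (N0 + N.+1 + m)%N.
have h2t' : ae U (fun w => two_term (q w.1) n N'%:Z (b w - c0 w.1)).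
  have Eq := polyF_shp RE Ec0 hp.
  (* Index 0 is left out: its distance to n may be d, out of reach of [purity]. The constant term is
     controlled by [two_term_of_root] instead. *)
  have key j : j \in iota 1 d -> ae U (fun w => j != n -> V (ord ((q w.1)`_n * (b w - c0 w.1) ^+ n) + N'%:Z) ((q w.1)`_j * (b w - c0 w.1) ^+ j)).
    move=> jd; case: (eqVneq j n) => [->|jn]; first exact: ae_all.
    case: (pselect (ae U (fun w => V (ord ((q w.1)`_n * (b w - c0 w.1) ^+ n) + N'%:Z) ((q w.1)`_j * (b w - c0 w.1) ^+ j)))) => [|/nae hn].
      exact: ae_imp.
    have [k kN hk] : exists2 k, k \in iota 0 N' & ae U (fun w => [/\ b w - c0 w.1 != 0, (q w.1)`_j != 0, (q w.1)`_n != 0 &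
       ord (q w.1)`_j + j%:Z * ord (b w - c0 w.1) = ord (q w.1)`_n + n%:Z * ord (b w - c0 w.1) + k%:Z]).
      apply: ae_const; apply: ae_imp (ae_and h2t hn) => w [[z00 qn _ hj] /negP h3].
      have h4 := neq0_V h3; have h5 := ord_nV h3.
      have qj : (q w.1)`_j != 0 by apply: contraNneq h4 => ->; rewrite mul0r.
      have j0 : (j != 0)%N by move: jd; rewrite mem_iota; lia.
      have := hj j j0 jn; rewrite VE // => h6.
      move: h5 h6; rewrite !ordM ?expf_neq0 // !ordX // => h5 h6.
      exists `|(ord (q w.1)`_j + j%:Z * ord (b w - c0 w.1) - (ord (q w.1)`_n + n%:Z * ord (b w - c0 w.1)))%R|%N; last by split=> //; lia.
      by rewrite mem_iota; lia.
    rewrite mem_iota in jd.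
    have [lt|lt] : (n < j)%N \/ (j < n)%N by lia.
      have Et := rs_mul RE (Eq.2 n) (closed_inv cE (Eq.2 j)).
      case: (pur _ (j - n)%N k%:Z Et).
      - by apply: ae_imp hk => w [h2 h3 h4 _]; rewrite mulf_neq0 ?invr_eq0.
      - by lia.
      apply: ae_imp hk => w [h2 h3 h4 h5].
      rewrite ordM ?ordVn ?invr_eq0 //.
      have -> : (j - n)%N%:Z = j%:Z - n%:Z by lia.
      by rewrite mulrBl; olia.
    have Et := rs_mul RE (Eq.2 j) (closed_inv cE (Eq.2 n)).
    case: (pur _ (n - j)%N (- k%:Z) Et).
    - by apply: ae_imp hk => w [h2 h3 h4 _]; rewrite mulf_neq0 ?invr_eq0.
    - by lia.
    apply: ae_imp hk => w [h2 h3 h4 h5].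
    rewrite ordM ?ordVn ?invr_eq0 //.
    have -> : (n - j)%N%:Z = n%:Z - j%:Z by lia.
    by rewrite mulrBl; olia.
  apply: ae_imp (ae_and UD (ae_and h2t (ae_allin key))) => w [[dl hdl] [[z00 qn _ _] hk]].
  apply: two_term_of_root => //; first by rewrite shpE subrK /b (Hb1 hdl).1.
  move=> j j0 jn; case: (ltnP j d.+1) => jd; first by apply: hk => //; rewrite mem_iota; lia.
  have -> : (q w.1)`_j = 0 by apply: nth_default; apply: leq_trans (Eq.1 w.1) jd.
  by rewrite mul0r V0.
have [r [r0 or_ hr]] := @ae_unit _ _ U UU N' _ (nb0 nb Ec0).
(* These facts concern the constant [r] only, so a single point of a set in the ultrafilter yields
   them. *)
have hNr : V N%:Z (r - z) /\ forall dl, V (dl + m%:Z) (spi r dl - s dl).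
  have [w [[dl hdl] [[g0 og hg] [h3 h4]]]] := ae_ex (ae_and UD (ae_and hP (ae_and hr h1))).
  have [z00 oz _] := Hz hdl; rewrite /= -/(b w) in z00 oz g0 og hg.
  have [_ hs] := Hb1 hdl; rewrite -/(b w) in hs.
  rewrite oz in h3 h4.
  split.
    have [|_ _] := @rv_tr N (b w - c1 w.1) (spi r dl) (w.2 0%N) z g0 _ og hg.
      have h5 : V (dl + N.+1%:Z) (b w - c1 w.1 - spi r dl).
        have -> : b w - c1 w.1 - spi r dl = (b w - c0 w.1 - spi r dl) + (c0 w.1 - c1 w.1) by ring.
        by apply: VD => //; apply: Vle h3; rewrite /N'; lia.
      have [||_ o5] := @ord_dom K (spi r dl) (b w - c1 w.1); rewrite ?spi_neq0 ?ord_spi //.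
        by apply: Vle h5; lia.
      by rewrite VBC o5 ord_spi.
    by rewrite /spi upM up_pi mul1r up_unit.
  have h5 : V (dl + m%:Z) (spi r dl - s dl).
    apply: (Vtrans (y := b w - c0 w.1)) => //.
    by rewrite VBC; apply: Vle h3; rewrite /N'; lia.
  have h6 : V m%:Z (r - zeta).
    by move: h5; rewrite /s /spi -mulrBr -[X in V (X + _)](ord_pi K dl) V_mulc ?pin0.
  by move=> dl'; rewrite /s /spi -mulrBr -[X in V (X + _)](ord_pi K dl') V_mulc ?pin0.
have [hrz hrs] := hNr.
pose D x (e : env) := exists dl, [/\ Dd x dl, two_term (q x) n N'%:Z (spi r dl),
   V (dl + N.+1%:Z) (c0 x - c1 x) & dl = e 0%N].
exists D; split.
- have t1 := @tame_two_term _ _ _ _ r0 or_ _ _ n N' (ltac:(rewrite /N'; lia)) (polyF_shp RE Ec0 hp).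
  have t2 := mr_V (tame_T0 E) (lin_add (lin_var E 0) (lin_cst E N.+1%:Z)) (@mr_F _ _ _ _ 0 _ (tame_T0 E) Ew).
  have t3 := tame_eq (lin_var E 0) (lin_var E 1).
  apply: tame_ext (tame_ex (tame_and tDd (tame_and t1 (tame_and t2 t3)))) => x e.
  by split=> [[dl [? [? [[_ ?] ?]]]]|[dl [? ? ? ?]]]; exists dl; split=> //; split.
- apply: ae_imp (ae_and UD (ae_and h2t' (ae_and hr (ae_and h1 hP)))) => w [[dl hdl] [h3 [h4 [h5 [g0 og hg]]]]].
  have [z00 oz _] := Hz hdl; rewrite /= -/(b w) in z00 oz g0 og hg.
  exists dl; split=> //.
  - by apply: two_term_rv h3; rewrite ?spi_neq0 ?ord_spi // -oz.
  - by rewrite -oz.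
  rewrite -og -oz; have [|//] := @ord_dom K (b w - c0 w.1) (b w - c1 w.1) z00.
  have -> : b w - c1 w.1 - (b w - c0 w.1) = c0 w.1 - c1 w.1 by ring.
  by apply: Vle h5; lia.
move=> x e [dl [hdl h3 h4 e0]]; split; first by exists dl.
have [|y ry hy] := two_term_root n0 _ h3; first by rewrite -/v /N'; lia.
rewrite ord_spi // -/v in hy.
have e2 : y + c0 x = b0 x.
  apply: (Huniq hdl); first by rewrite -shpE.
  rewrite addrK; apply: (Vtrans (y := spi r dl)) => //.
  by apply: Vle hy; rewrite /N'; lia.
apply: (@rv_tr N (spi r dl)); rewrite ?spi_neq0 ?ord_spi //.
  rewrite -e2; have -> : y + c0 x - c1 x - spi r dl = (y - spi r dl) + (c0 x - c1 x) by ring.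
  by apply: VD => //; apply: Vle hy; rewrite /N'; lia.
by rewrite /spi upM up_pi mul1r up_unit.
Qed.

End AtU.

Lemma lin_meas c1 N : E c1 -> mr E C1 N (fun x _ => b0 x - c1 x).
Proof.
move=> Ec1 z; apply: tame_compact => U UU hU.
have UD : ae U (fun w => DD w.1) by apply: ae_imp hU => w [].
have hP : ae U (fun w => RVs N (fun x => b0 x - c1 x) z w.1 w.2) by apply: ae_imp hU => w [].
suff [D [h1 h2 h3]] : exists D, [/\ tame E D, ae U (fun w => D w.1 w.2) &
    forall x e, D x e -> DD x /\ RVs N (fun x => b0 x - c1 x) z x e].
  by exists D; split=> // x e /h3[? []].
case: (pselect (exists2 c, E c & ae U (fun w => b0 w.1 = c w.1))) => [[c Ec hc]|hn].
  have Ew : E (fun x => c x - c1 x) by apply: rs_sub.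
  exists (fun x e => (DD x /\ b0 x = c x) /\ RVs N (fun x => c x - c1 x) z x e); split.
  - by apply: tame_and; [exact: tame_b0eq|exact: tame_RVs].
  - by apply: ae_imp (ae_and UD (ae_and hP hc)) => w [h1 [h2 h3]]; move: h2; rewrite /RVs h3.
  by move=> x e [[h1 h2]]; rewrite /RVs h2.
have nb c : E c -> ae U (fun w => b0 w.1 != c w.1).
  move=> Ec; have : ~ ae U (fun w => b0 w.1 = c w.1) by move=> h; apply: hn; exists c.
  by move/nae; apply: ae_imp => w /eqP.
case: (max_or E (fun w => b0 w.1) (U := U)) => [[cm [Ecm hcm]]|nm].
  exact: (lin_max UD nb Ec1 Ecm hcm hP).
exact: (lin_nomax UD nb Ec1 nm hP).
Qed.

(** Modulo [p] a polynomial in [b0] has degree below d. Along an ultrafilter where [b0] is not a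
    germ of E, it is dominated by a Taylor monomial in some [b0 - c1], whose classes are tame by
    [lin_meas]. *)
Lemma simple_b0 : simple E b0.
Proof.
move=> _ [dr [r [hr ->]]] N.
pose C0 : I -> env -> Prop := fun x _ => ~ DD x.
have tC0 : tame E C0 := tame_not tC1.
apply: (@mr_cover _ _ _ _ N _ bool [:: true; false] (fun b => if b then C0 else C1)).
  move=> x e; split=> // _; case: (pselect (DD x)) => h; first by exists false.
  by exists true.
case=> _ /=.
  apply: (@mr_ext _ _ _ _ _ (fun x _ => (r x)`_0)).
    by move=> x e /Hb2 ->; rewrite horner_coef0.
  by apply: mr_F => //; apply: hr.2.
have hr2 : polyF E (d + dr) r.
  by split; [move=> x; apply: leq_trans (hr.1 x) _; rewrite leq_addl|exact: hr.2].
have [r' hr' er] := modF cE hp hr2.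
apply: (@mr_ext _ _ _ _ _ (fun x _ => (r' x).[b0 x])).
  by move=> x e [dl hdl]; rewrite -er ?(Hb1 hdl).1 //; case: hdl.
move=> z; apply: tame_compact => U UU hU.
have UD : ae U (fun w => DD w.1) by apply: ae_imp hU => w [].
have hP : ae U (fun w => RVs N (fun x => (r' x).[b0 x]) z w.1 w.2) by apply: ae_imp hU => w [].
suff [D [h1 h2 h3]] : exists D, [/\ tame E D, ae U (fun w => D w.1 w.2) &
    forall x e, D x e -> DD x /\ RVs N (fun x => (r' x).[b0 x]) z x e].
  by exists D; split=> // x e /h3[? []].
case: (pselect (exists2 c, E c & ae U (fun w => b0 w.1 = c w.1))) => [[c Ec hc]|hn].
  have Ew : E (fun x => (r' x).[c x]) by apply: polyF_horner hr' Ec.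
  exists (fun x e => (DD x /\ b0 x = c x) /\ RVs N (fun x => (r' x).[c x]) z x e); split.
  - by apply: tame_and; [exact: tame_b0eq|exact: tame_RVs].
  - by apply: ae_imp (ae_and UD (ae_and hP hc)) => w [h1 [h2 h3]]; move: h2; rewrite /RVs h3.
  by move=> x e [[h1 h2]]; rewrite /RVs h2.
have nb c : E c -> ae U (fun w => b0 w.1 != c w.1).
  move=> Ec; have : ~ ae U (fun w => b0 w.1 = c w.1) by move=> h; apply: hn; exists c.
  by move/nae; apply: ae_imp => w /eqP.
have r'0 : ae U (fun w => r' w.1 != 0).
  by apply: ae_imp hP => w [h _ _]; apply: contraNneq h => ->; rewrite horner0.
have [|c1 Ec1 hc1] := @prep _ _ _ cE d Cl U UU (fun w => b0 w.1) nb [:: r'] N.+1.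
  by move=> r1 [<-|//]; split.
have [k hk] := hc1 r' (or_introl erefl).
have [u [u0 ou hu]] := @ae_unit _ _ U UU N.+1 _ (nb0 nb Ec1).
have Er' := polyF_shp RE Ec1 hr'.
pose g x (e : env) := (shp c1 r' x)`_k * spi u (e 0%N) ^+ k.
pose D x (e : env) := exists dl,
  [/\ DD x, [/\ b0 x - c1 x != 0, ord (b0 x - c1 x) = dl & V N.+1%:Z (up (b0 x - c1 x) - u)],
    dom (shp c1 r' x) N.+1 k (spi u dl) &
    [/\ (shp c1 r' x)`_k * spi u dl ^+ k != 0, ord ((shp c1 r' x)`_k * spi u dl ^+ k) = e 0%N &
     V N%:Z (up ((shp c1 r' x)`_k * spi u dl ^+ k) - z)]].
have eqsp x : b0 x - c1 x != 0 -> V N.+1%:Z (up (b0 x - c1 x) - u) =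
    V (ord (b0 x - c1 x) + N.+1%:Z) (b0 x - c1 x - spi u (ord (b0 x - c1 x))).
  move=> z0; have o : ord (spi u (ord (b0 x - c1 x))) = ord (b0 x - c1 x) by rewrite ord_spi.
  rewrite -[X in _ = V (X + _) _]o rv_up; last by rewrite o.
  by rewrite /spi upM up_pi mul1r (up_unit u0 ou).
have valp x (N1 := N.+1) dl : b0 x - c1 x != 0 -> ord (b0 x - c1 x) = dl ->
    V (dl + N.+1%:Z) (b0 x - c1 x - spi u dl) -> dom (shp c1 r' x) N.+1 k (spi u dl) ->
    V (ord ((shp c1 r' x)`_k * spi u dl ^+ k) + N.+1%:Z) ((r' x).[b0 x] - (shp c1 r' x)`_k * spi u dl ^+ k).
  move=> z0 oz hv hd.
  have osp : ord (b0 x - c1 x) = ord (spi u dl) by rewrite oz ord_spi.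
  have hd' := dom_tr (spi_neq0 u0 dl) osp hd z0.
  have := dom_value hd'; rewrite shpE subrK => h.
  have [qk _ _] := hd.
  have eo : ord ((shp c1 r' x)`_k * (b0 x - c1 x) ^+ k) = ord ((shp c1 r' x)`_k * spi u dl ^+ k).
    by rewrite !ordM ?expf_neq0 ?spi_neq0 // !ordX ?spi_neq0 // osp.
  rewrite eo in h; apply: Vtrans h _; rewrite -mulrBr ordM ?expf_neq0 ?spi_neq0 // -addrA V_mulc //.
  by apply: rv_exp; rewrite ?spi_neq0 // ord_spi.
exists D; split.
- have t1 := @tame_ren _ _ _ _ (fun _ => 0%N) tC1.
  have t2 := lin_meas N.+1 Ec1 u.
  have t3 := tame_dom u0 ou N.+1 k Er'.
  have t4 := @mr_ren _ _ _ _ N _ (fun _ => 0%N) (mr_mono u0 ou k N Er'.2).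
  have t5 := @tame_ren _ _ _ _ (fun i => if i is 0%N then 1%N else 0%N) (t4 z).
  apply: tame_ext (tame_ex (tame_and t1 (tame_and t2 (tame_and t3 t5)))) => x e.
  split=> [[dl [h1 [[_ h2 h3 h4] [h5 [_ h6 h7 h8]]]]]|[dl [h1 [h2 h3 h4] h5 [h6 h7 h8]]]]; exists dl; split=> //.
- apply: ae_imp (ae_and UD (ae_and hk (ae_and hu (ae_and hP (nb0 nb Ec1))))) => w [h1 [h2 [h3 [[g0 og hg] h5]]]].
  exists (ord (b0 w.1 - c1 w.1)).
  have hd : dom (shp c1 r' w.1) N.+1 k (spi u (ord (b0 w.1 - c1 w.1))).
    by apply: (dom_tr h5 _ h2); rewrite ?spi_neq0 ?ord_spi.
  have hv := valp _ _ h5 erefl h3 hd.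
  have [qk _ _] := hd.
  have t0 : (shp c1 r' w.1)`_k * spi u (ord (b0 w.1 - c1 w.1)) ^+ k != 0 by rewrite mulf_neq0 ?expf_neq0 ?spi_neq0.
  split=> //; first by split=> //; rewrite eqsp.
  have [|_ og'] := @ord_dom K _ (r' w.1).[b0 w.1] t0; first by apply: Vle hv; clear; lia.
  by apply: (@rv_tr N ((r' w.1).[b0 w.1])) => //; rewrite VBC og'.
move=> x e [dl [h1 [h2 h3 h4] h5 [h6 h7 h8]]]; split=> //.
rewrite eqsp // h3 in h4.
have hv := valp _ _ h2 h3 h4 h5.
by apply: (@rv_tr N ((shp c1 r' x)`_k * spi u dl ^+ k)).
Qed.

End CanonRoot.

(** * Elimination of a polynomial field variable *)

Section Closed.
Variable K : padic_field.
Variable I : Type.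
Variable E : set (I -> K).
Hypothesis cE : closedE E.
Let RE : ring_set E := cE.1.

Lemma closedD_le d d' : (d' <= d)%N -> ClosedD E d -> ClosedD E d'.
Proof.
move=> le H U UU b p [sp hp]; apply: H; split=> // x; exact: leq_trans le.
Qed.

Lemma closedD2 : ClosedD E 2.
Proof.
move=> U UU b p [sp hp] p0 r.
have hor w : (p w.1).[b w] = (p w.1)`_0 + (p w.1)`_1 * b w.
  by rewrite (horner_coef_wide _ (sp _)) !big_ord_recl big_ord0 /= expr0 mulr1 expr1 addr0.
exists (fun x => - (p x)`_0 * ((p x)`_1)^-1).
  by apply: (rs_mul RE); [apply: rs_opp|apply: closed_inv].
apply: ae_imp (ae_and p0 r) => w [pw]; rewrite hor => e.
case: (eqVneq (p w.1)`_1 0) => [e1|n1]; last first.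
  move/eqP: e; rewrite addrC addr_eq0 => /eqP <-.
  by rewrite mulrC mulKf.
case/eqP: pw; apply/polyP => j; rewrite coef0; case: j => [|[|j]] //.
  by move: e; rewrite e1 mul0r addr0.
by apply: nth_default; apply: leq_trans (sp _) _.
Qed.

(** One Taylor monomial, of index k, dominates the derivative; hence [p] is two-term at its root,
    with the monomial of index k + 1 against the constant one. The isolated root [b0] is simple over
    E, so it belongs to E, and it equals [b] along U. *)
Lemma closedD_step d : (1 < d)%N -> ClosedD E d -> ClosedD E d.+1.
Proof.
move=> d2 Cl U UU b p hp p0 r; have [sp cp] := hp.
apply: contrapT => hn.
have nb c : E c -> ae U (fun w => b w != c w.1).
  move=> Ec; have : ~ ae U (fun w => b w = c w.1) by move=> h; apply: hn; exists c.
  by move/nae; apply: ae_imp => w /eqP.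
have lc : ae U (fun w => (p w.1)`_d != 0).
  apply: contrapT => /nae hl; apply: hn.
  pose p2 x := \poly_(j < d) (p x)`_j.
  have hp2 : polyF E d p2.
    split=> [x|j]; first exact: size_poly.
    case: (ltnP j d) => h.
      by apply: rs_ext (cp j) => x; rewrite coef_poly h.
    by apply: rs_ext (rs_cst RE 0) => x; rewrite coef_poly ltnNge h.
  have e : ae U (fun w => p2 w.1 = p w.1).
    apply: ae_imp hl => w /negP; rewrite negbK => /eqP h; apply/polyP => j; rewrite coef_poly.
    case: ltnP => // jd; case: (eqVneq j d) => [->|jn]; first by rewrite h.
    by apply/esym/nth_default; apply: leq_trans (sp _) _; lia.
  by apply: (Cl U UU b p2 hp2); [apply: ae_imp (ae_and e p0)|apply: ae_imp (ae_and e r)] => w [->].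
have s1 : ae U (fun w => (1 < size (p w.1))%N).
  apply: ae_imp lc => w h; rewrite ltnNge; apply: contra h => h.
  by rewrite nth_default //; apply: leq_trans h _; lia.
pose dp x := (p x)^`().
have hdp : polyF E d dp by apply: polyF_deriv.
have dp0 : ae U (fun w => dp w.1 != 0) by apply: ae_imp s1 => w; apply: deriv_neq0.
pose M := (\sum_(j < d.+2) `|ord (j%:R : K)|)%N.
have hM j : (j < d.+2)%N -> (`|ord (j%:R : K)| <= M)%N.
  by move=> jn; rewrite /M (bigD1 (Ordinal jn)) //= leq_addr.
(* Large enough for Hensel's condition with every n that may occur, since [M] bounds all [ord n]. *)
pose N0 := (M + M + 2)%N.
have [|c0 Ec0 hc0] := @prep _ _ _ cE d Cl U UU b nb [:: dp] (N0 + M)%N.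
  by move=> q1 [<-|//]; split.
have [k hk] := hc0 dp (or_introl erefl).
pose n := k.+1.
have [w0 [qk0 _ _]] := ae_ex hk.
have kd : (k < d)%N.
  rewrite ltnNge; apply: contra qk0 => h; rewrite nth_default // size_shp.
  by apply: leq_trans (hdp.1 _) h.
pose q := shp c0 p.
have h2t : ae U (fun w => two_term (q w.1) n N0%:Z (b w - c0 w.1)).
  apply: ae_imp (ae_and hk r) => w [[h1 z0 h3] rw].
  set z := b w - c0 w.1 in z0 h3 *.
  have e1 : (shp c0 dp w.1) = (q w.1)^`() by rewrite shp_deriv.
  have qq j : (shp c0 dp w.1)`_j = j.+1%:R * (q w.1)`_j.+1 by rewrite e1 coef_deriv mulr_natl.
  rewrite qq in h1; have qn : (q w.1)`_n != 0 by apply: contraNneq h1 => ->; rewrite mulr0.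
  have nn0 := natn0 K (ltn0Sn k).
  apply: two_term_of_root => //; first by rewrite shpE subrK.
  case=> // j _ jn; case: (ltnP j d) => jd; last first.
    have -> : (q w.1)`_j.+1 = 0 by apply: nth_default; rewrite size_shp; apply: leq_trans (sp _) _.
    by rewrite mul0r V0.
  have jk : j != k by apply: contraNneq jn => ->.
  have := h3 j jk; rewrite !qq -!mulrA.
  have jn0 := natn0 K (ltn0Sn j).
  rewrite ordM ?mulf_neq0 ?expf_neq0 //.
  have -> : ord (k.+1%:R : K) + ord ((q w.1)`_k.+1 * z ^+ k) + (N0 + M)%N%:Z =
     ord (j.+1%:R : K) + (ord ((q w.1)`_k.+1 * z ^+ k) + N0%:Z + (ord (k.+1%:R : K) + M%:Z - ord (j.+1%:R : K))) by lia.
  rewrite V_mulc // => hv; rewrite !exprSr !mulrA.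
  have := VM hv (V_self z); apply: Vle.
  have := hM j.+1 (ltac:(lia)); have := @ord_nat K k.+1 (ltn0Sn k).
  have -> : ord ((q w.1)`_k.+1 * z ^+ k * z) = ord ((q w.1)`_k.+1 * z ^+ k) + ord z.
    by rewrite ordM ?mulf_neq0 ?expf_neq0.
  by olia.
have [zeta [zeta0 oz hz]] := @ae_unit _ _ U UU N0 _ (nb0 nb Ec0).
have hv := @ord_nat K n (ltn0Sn k).
have hv2 := hM n (ltac:(rewrite /n; lia)).
have hN0 : 2 * ord (n%:R : K) + 2 <= N0%:Z by rewrite /N0; lia.
pose m := `|(ord (n%:R : K) + 1)%R|%N.
have hm : m%:Z = ord (n%:R : K) + 1 by rewrite /m; lia.
pose D := Dd d p c0 n zeta N0.
(* The order of the constant coefficient determines [dl], so the selected root depends on [x]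
   alone. *)
have Duniq x dl dl' : D x dl -> D x dl' -> dl = dl'.
  move=> [_ h] [_ h']; have N1 : 1 <= N0%:Z by lia.
  have [_ o] := two_term_ord N1 h; have [_ o'] := two_term_ord N1 h'.
  have [_ qn _ _] := h; move: o; rewrite o' !ordM ?expf_neq0 ?spi_neq0 // !ordX ?spi_neq0 // !ord_spi //.
  rewrite /n; nia.
have /choice[b0 hb0] : forall x, exists y, (forall dl, D x dl ->
    (p x).[y] = 0 /\ V (dl + m%:Z) (y - c0 x - spi zeta dl)) /\ (~ (exists dl, D x dl) -> y = 0).
  move=> x; case: (pselect (exists dl, D x dl)) => [[dl hdl]|h]; last first.
    by exists 0; split=> // dl hdl; case: h; exists dl.
  have [|y ry hy] := two_term_root (ltn0Sn k) _ hdl.2; first by rewrite -/n; lia.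
  exists (y + c0 x); split=> [dl' hdl'|[]]; last by exists dl.
  rewrite (Duniq _ _ _ hdl' hdl) addrK -shpE; split=> //.
  rewrite ord_spi // in hy; apply: Vle hy; rewrite -/n; lia.
have Hb1 x dl : D x dl -> (p x).[b0 x] = 0 /\ V (dl + m%:Z) (b0 x - c0 x - spi zeta dl) by move=> h; apply: (hb0 x).1.
have Hb2 x : ~ (exists dl, D x dl) -> b0 x = 0 by apply: (hb0 x).2.
have Eb0 : E b0.
  by apply: cE.2; apply: (@simple_b0 _ _ _ cE d d2 Cl p c0 n zeta N0 hp Ec0 (ltn0Sn k) _ zeta0 oz hN0 b0 Hb1 Hb2).
apply: (@ae_false _ U UU).
apply: ae_imp (ae_and (nb _ Eb0) (ae_and lc (ae_and h2t (ae_and hz (ae_and r (nb0 nb Ec0)))))) => w [h1 [h2 [h3 [h4 [h5 h6]]]]].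
case/eqP: h1; apply: (@Huniq _ _ d d2 p c0 n zeta N0 (ltn0Sn k) kd zeta0 oz hN0 b0 Hb1 w.1 (ord (b w - c0 w.1))) => //.
  by split=> //; apply: two_term_rv h3; rewrite ?spi_neq0 ?ord_spi.
by apply: Vle h4; rewrite lerD2l -/m lez_nat /m; lia.
Qed.

Lemma closedD_all d : ClosedD E d.
Proof.
suff h k : ClosedD E k.+2 by apply: closedD_le (h d); lia.
by elim: k => [|k IH]; [exact: closedD2|apply: closedD_step].
Qed.

End Closed.

Section FQE.
Variable K : padic_field.
Variable I : Type.

Lemma dom_rv (q : {poly K}) (N k : nat) z s : s != 0 -> z != 0 -> ord z = ord s ->
  V (ord s + N%:Z) (z - s) -> dom q N k s ->
  V (ord (q`_k * s ^+ k) + N%:Z) (q.[z] - q`_k * s ^+ k).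
Proof.
move=> s0 z0 o hv hd.
have h := dom_value (dom_tr s0 o hd z0).
have [qk _ _] := hd.
have eo : ord (q`_k * z ^+ k) = ord (q`_k * s ^+ k).
  by rewrite !ordM ?expf_neq0 // !ordX // o.
rewrite eo in h; apply: Vtrans h _; rewrite -mulrBr ordM ?expf_neq0 // -addrA V_mulc //.
exact: rv_exp.
Qed.

(** A witness [b] is followed along an ultrafilter. If it is a germ of E it is substituted.
    Otherwise it is replaced by [spi u z + c], which the formula cannot distinguish from it, and the
    field quantifier becomes a quantifier over the integer z. *)
Lemma alg_fqe (F : set (I -> K)) (G : set (I * K -> K)) P : ring_set F ->
  (forall g, G g -> exists d p, polyF F d p /\ forall x y, g (x, y) = (p x).[y]) ->
  tame G P -> tame F (fun x e => exists y, P (x, y) e).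
Proof.
move=> RF hG [B hP]; have [E [FE cE htr]] := closure RF; apply: htr.
have RE := cE.1.
have {}hG g : G g -> exists d p, polyF E d p /\ forall x y, g (x, y) = (p x).[y].
  by move=> /hG[d [p [h1 h2]]]; exists d, p; split=> //; apply: polyF_mono h1.
have [fs [fsG hfs]] := tb_fin hP.
apply: tame_compact => U UU hU.
have /choice[b hb] : forall w : I * env, exists y, (exists y, P (w.1, y) w.2) -> P (w.1, y) w.2.
  move=> w; case: (pselect (exists y, P (w.1, y) w.2)) => [[y h]|h]; first by exists y.
  by exists 0.
have {hU} hU : ae U (fun w => P (w.1, b w) w.2) by apply: ae_imp hU => w /hb.
case: (pselect (exists2 c, E c & ae U (fun w => b w = c w.1))) => [[c Ec hc]|hn].
  exists (fun x e => P (x, c x) e); split; last by move=> x e h; exists (c x).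
    have := @tame_pull _ _ _ E _ _ _ hP (@T0 I) (fun x _ => (x, c x)) id (tame_T0 E).
    move=> h; apply: tame_ext (h _) => [x e|g /hG[d [p [hp e]]]]; first by split=> [[]|].
    apply: (@mr_ext _ _ _ _ _ (fun x _ => (p x).[c x])) => [x e' _|]; first by rewrite e.
    by apply: (@mr_F _ _ _ _ _ (fun x => (p x).[c x])); [exact: tame_T0|apply: polyF_horner hp Ec].
  by apply: ae_imp (ae_and hU hc) => w [h1 <-].
have nb c : E c -> ae U (fun w => b w != c w.1).
  move=> Ec; have : ~ ae U (fun w => b w = c w.1) by move=> h; apply: hn; exists c.
  by move/nae; apply: ae_imp => w /eqP.
(* Polynomials that vanish identically along U have no dominant monomial and are kept apart. *)
have [ps [d [hps hgs]]] : exists (ps : seq (I -> {poly K})) d,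
    (forall p, List.In p ps -> polyF E d p /\ ae U (fun w => p w.1 != 0)) /\
    forall g, List.In g fs -> (exists p, List.In p ps /\ forall x y, g (x, y) = (p x).[y]) \/
      (exists p, [/\ polyF E d p, ae U (fun w => p w.1 = 0) & forall x y, g (x, y) = (p x).[y]]).
  have le d d' p : (d <= d')%N -> polyF E d p -> polyF E d' p.
    by move=> dd [h1 h2]; split=> // x; apply: leq_trans dd.
  elim: fs fsG {hfs} => [|g fs IH] fsG; first by exists [::], 0%N; split.
  have [|ps [d [h1 h2]]] := IH; first by move=> f hf; apply: fsG; right.
  have [d' [p [hp e]]] := hG g (fsG g (or_introl erefl)).
  case: (pselect (ae U (fun w => p w.1 = 0))) => h0.
    exists ps, (maxn d d'); split.
      by move=> p1 /h1[h3 h4]; split=> //; apply: le h3; rewrite leq_maxl.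
    move=> f /= [<-|/h2[h|[p1 [h3 h4 h5]]]]; [right|by left|right].
      by exists p; split=> //; apply: le hp; rewrite leq_maxr.
    by exists p1; split=> //; apply: le h3; rewrite leq_maxl.
  exists (p :: ps), (maxn d d'); split.
    move=> p1 /= [<-|/h1[h3 h4]].
      by split; [apply: le hp; rewrite leq_maxr|move/nae: h0; apply: ae_imp => w /eqP].
    by split=> //; apply: le h3; rewrite leq_maxl.
  move=> f /= [<-|/h2[[p1 [h3 h4]]|[p1 [h3 h4 h5]]]].
  - by left; exists p; split=> //; left.
  - by left; exists p1; split=> //; right.
  by right; exists p1; split=> //; apply: le h3; rewrite leq_maxl.
(* The extra digit makes closeness preserve orders even when B is 0. *)
pose N := B.+1.
have [c Ec hc] := @prep _ _ _ cE d (closedD_all cE (d := d)) U UU b nb ps N hps.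
have [u [u0 ou hu]] := @ae_unit _ _ U UU N _ (nb0 nb Ec).
pose dl w := ord (b w - c w.1).
pose th x (e : env) := (x, spi u (e 0%N) + c x).
have [C [hC UC hm hrv]] : exists C, [/\ tame E C, ae U (fun w => C w.1 (scons (dl w) w.2)),
    forall g, List.In g fs -> mr E C B (fun x e => g (th x e)) &
    forall g w, List.In g fs -> C w.1 (scons (dl w) w.2) -> b w - c w.1 != 0 ->
      V (dl w + N%:Z) (b w - c w.1 - spi u (dl w)) ->
      rveq B (g (w.1, b w)) (g (w.1, spi u (dl w) + c w.1))].
  elim: fs hgs {fsG hfs} => [|g fs IH] hgs.
    by exists (@T0 I); split=> //; [exact: tame_T0|exact: ae_all].
  have [|C [hC UC hm hrv]] := IH; first by move=> f hf; apply: hgs; right.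
  suff [C' [hC' UC' hm' hrv']] : exists C', [/\ tame E C', ae U (fun w => C' w.1 (scons (dl w) w.2)),
      mr E C' B (fun x e => g (th x e)) &
      forall w, C' w.1 (scons (dl w) w.2) -> b w - c w.1 != 0 ->
      V (dl w + N%:Z) (b w - c w.1 - spi u (dl w)) ->
      rveq B (g (w.1, b w)) (g (w.1, spi u (dl w) + c w.1))].
    have hCC := tame_and hC hC'.
    exists (fun x e => C x e /\ C' x e); split=> //; first exact: ae_and.
      by move=> f /= [<-|hf]; [apply: mr_sub hm' => // x e []|apply: mr_sub (hm f hf) => // x e []].
    by move=> f w /= [<-|hf] [h1 h2]; [apply: hrv'|apply: hrv].
  case: (hgs g (or_introl erefl)) => [[p [hp e]]|[p [hp p0 e]]].
    have [k hk] := hc p hp; have [hpF pn0] := hps p hp.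
    have Eq := polyF_shp RE Ec hpF.
    exists (fun x e => dom (shp c p x) N k (spi u (e 0%N))).
    have tD := tame_dom u0 ou N k Eq.
    split=> //.
    - apply: ae_imp (ae_and hk (ae_and hu (nb0 nb Ec))) => w /= [h1 [h2 h3]].
      by apply: (dom_tr h3 _ h1); rewrite ?spi_neq0 ?ord_spi.
    - apply: (@mr_close _ _ _ _ _ (fun x e => (shp c p x)`_k * spi u (e 0%N) ^+ k)) => //.
        by apply: mr_sub (mr_mono u0 ou k B Eq.2).
      move=> x e' /= hd; right; rewrite e -shpE.
      have [qk s0 _] := hd.
      have t0 : (shp c p x)`_k * spi u (e' 0%N) ^+ k != 0 by rewrite mulf_neq0 ?expf_neq0.
      have hv := dom_value hd.
      have [|g0 og] := ord_dom t0 (_ : V _ ((shp c p x).[spi u (e' 0%N)] - _)).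
        by apply: Vle hv; rewrite /N; lia.
      by split=> //; apply: Vle hv; rewrite lerD2l lez_nat /N.
    move=> w /= hd z0 hv; rewrite !e; right.
    have [qk s0 _] := hd.
    have osp : ord (b w - c w.1) = ord (spi u (dl w)) by rewrite ord_spi.
    have := @dom_rv (shp c p w.1) N k _ _ s0 z0 osp (ltac:(rewrite -osp; exact: hv)) hd.
    rewrite shpE subrK -shpE => hv1; have hv2 := dom_value hd.
    have t0 : (shp c p w.1)`_k * spi u (dl w) ^+ k != 0 by rewrite mulf_neq0 ?expf_neq0.
    have [|g0 og] := ord_dom t0 (_ : V _ ((shp c p w.1).[spi u (dl w)] - _)).
      by apply: Vle hv2; rewrite /N; clear; lia.
    have [|g0' og'] := ord_dom t0 (_ : V _ ((p w.1).[b w] - _)).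
      by apply: Vle hv1; rewrite /N; clear; lia.
    split=> //; first by rewrite og og'.
    rewrite og'; apply: (Vtrans (y := (shp c p w.1)`_k * spi u (dl w) ^+ k)).
      by apply: Vle hv2; rewrite /N; clear; lia.
    by rewrite VBC; apply: Vle hv1; rewrite /N; clear; lia.
  have tD : tame E (fun x (_ : env) => p x = 0).
    apply: tame_ext (tame_allin (s := iota 0 d) (fun j _ => tame_zero (hp.2 j))) => x e'.
    split=> [h|-> j _]; last by rewrite coef0.
    apply/polyP => j; rewrite coef0; case: (ltnP j d) => jd; first by apply: h; rewrite mem_iota.
    by apply: nth_default; apply: leq_trans (hp.1 x) jd.
  exists (fun x _ => p x = 0); split=> //.
    apply: (@mr_ext _ _ _ _ _ (fun _ _ => 0)) (mr_cst B 0 tD) => x e' /= p00.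
    by rewrite e p00 horner0.
  by move=> w /= h _ _; left; rewrite !e h !horner0.
have tP := tame_ex (tame_pull hfs S hC hm).
exists (fun x e => exists z, C x (scons z e) /\ P (th x (scons z e)) (fun i => (scons z e) i.+1)).
split=> //; last by move=> x e [z [_ h]]; exists (spi u z + c x).
apply: ae_imp (ae_and hU (ae_and UC (ae_and hu (nb0 nb Ec)))) => w [h1 [h2 [h3 h4]]].
exists (dl w); split=> //.
by apply/(tb_rveq hfs (x := (w.1, b w))); last exact: h1; move=> f hf; apply: hrv.
Qed.

End FQE.

(** * Restricted power series *)

Section Lim.
Variable K : padic_field.
Variable Om : Type.
Implicit Types (gs : seq (Om -> K)) (F G : Om -> K) (k l : int).

(** The integer bounds from below the orders of the coefficients of a polynomial in [gs], so that
    smallness is measured on coefficients and not on values. *)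
Inductive Poly gs : int -> (Om -> K) -> Prop :=
| Poly_cst k (c : K) of V k c : Poly gs k (fun _ => c)
| Poly_gen g of List.In g gs : Poly gs 0 g
| Poly_add k F G of Poly gs k F & Poly gs k G : Poly gs k (fun w => F w + G w)
| Poly_mul k l F G of Poly gs k F & Poly gs l G : Poly gs (k + l) (fun w => F w * G w)
| Poly_le k l F of k <= l & Poly gs l F : Poly gs k F.

Definition bdd gs := forall g, List.In g gs -> forall w, V 0 (g w).

Lemma Poly_ext gs k F G : (forall w, F w = G w) -> Poly gs k F -> Poly gs k G.
Proof. by move=> h; suff -> : F = G by []; apply/funext. Qed.

Lemma Poly_mono gs gs' k F : (forall g, List.In g gs -> List.In g gs') -> Poly gs k F -> Poly gs' k F.
Proof.
move=> h; elim=> [k' c hc|g hg|k' F' G' _ h1 _ h2|k' l F' G' _ h1 _ h2|k' l F' le _ h1].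
- exact: Poly_cst.
- by apply: Poly_gen; apply: h.
- exact: Poly_add.
- exact: Poly_mul.
exact: Poly_le h1.
Qed.

Lemma Poly_V gs k F : bdd gs -> Poly gs k F -> forall w, V k (F w).
Proof.
move=> hb; elim=> [k' c hc|g hg|k' F' G' _ h1 _ h2|k' l F' G' _ h1 _ h2|k' l F' le _ h1] w //.
- exact: hb.
- exact: VD.
- exact: VM.
exact: Vle (h1 w).
Qed.

Lemma Poly_mul0 gs k l m F G : m <= k + l -> Poly gs k F -> Poly gs l G -> Poly gs m (fun w => F w * G w).
Proof. by move=> h hF hG; apply: Poly_le h (Poly_mul hF hG). Qed.

Lemma Poly0 gs k : Poly gs k (fun _ => 0).
Proof. by apply: Poly_cst; rewrite V0. Qed.

Lemma Poly_sum gs k (T : Type) (s : seq T) (P : pred T) (f : T -> Om -> K) :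
  (forall i, P i -> Poly gs k (f i)) -> Poly gs k (fun w => \sum_(i <- s | P i) f i w).
Proof.
move=> h; elim: s => [|a s IH].
  by apply: Poly_ext (Poly0 gs k) => w; rewrite big_nil.
case: (boolP (P a)) => Pa.
  by apply: Poly_ext (Poly_add (h a Pa) IH) => w; rewrite big_cons Pa.
by apply: Poly_ext IH => w; rewrite big_cons (negbTE Pa).
Qed.

Lemma Poly_exp gs F n : Poly gs 0 F -> Poly gs 0 (fun w => F w ^+ n).
Proof.
move=> h; elim: n => [|n IH].
  by apply: Poly_ext (Poly_cst gs (V1 K)) => w; rewrite expr0.
by apply: Poly_ext (Poly_mul h IH) => w; rewrite exprS.
Qed.

(** Restricted power series in [gs], as functions. Successive approximations must be close
    coefficientwise; uniform convergence of the values alone would be a weaker condition. *)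
Definition Lim gs k F := exists P : nat -> Om -> K,
  [/\ forall j, Poly gs k (P j), forall j : nat, Poly gs j%:Z (fun w => P j.+1 w - P j w) &
      forall (j : nat) w, V j%:Z (F w - P j w)].

Lemma Lim_ext gs k F G : (forall w, F w = G w) -> Lim gs k F -> Lim gs k G.
Proof. by move=> h; suff -> : F = G by []; apply/funext. Qed.

Lemma Lim_mono gs gs' k F : (forall g, List.In g gs -> List.In g gs') -> Lim gs k F -> Lim gs' k F.
Proof.
move=> h [P [h1 h2 h3]]; exists P; split=> // j; apply: Poly_mono h _ => //.
Qed.

Lemma Lim_le gs k l F : k <= l -> Lim gs l F -> Lim gs k F.
Proof. by move=> le [P [h1 h2 h3]]; exists P; split=> // j; apply: Poly_le le (h1 j). Qed.

Lemma Lim_Poly gs k F : Poly gs k F -> Lim gs k F.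
Proof.
move=> h; exists (fun _ => F); split=> // [j|j w]; last by rewrite subrr V0.
by apply: Poly_ext (Poly0 gs j%:Z) => w; rewrite subrr.
Qed.

Lemma Poly_incr gs (P : nat -> Om -> K) :
  (forall j : nat, Poly gs j%:Z (fun w => P j.+1 w - P j w)) ->
  forall i j, (i <= j)%N -> Poly gs i%:Z (fun w => P j w - P i w).
Proof.
move=> h i j /subnKC <-; elim: (j - i)%N => [|m IH].
  by apply: Poly_ext (Poly0 gs i%:Z) => w; rewrite addn0 subrr.
have h1 : Poly gs i%:Z (fun w => P (i + m).+1 w - P (i + m)%N w).
  by apply: Poly_le (h (i + m)%N); lia.
by apply: Poly_ext (Poly_add h1 IH) => w; rewrite addnS; ring.
Qed.

Lemma Lim_shift gs k F : Lim gs k F -> exists P : nat -> Om -> K,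
  [/\ forall j, Poly gs k (P j), forall j : nat, Poly gs (Num.max k j%:Z) (fun w => P j.+1 w - P j w) &
      forall (j : nat) w, V j%:Z (F w - P j w)].
Proof.
move=> [P [h1 h2 h3]]; exists (fun j => P (`|k|%N + j)%N); split=> [j|j|j w].
- exact: h1.
- rewrite addnS; apply: Poly_le (h2 _); rewrite ge_max; lia.
by apply: Vle (h3 _ w); lia.
Qed.

Lemma Lim_V gs k F : bdd gs -> Lim gs k F -> forall w, V k (F w).
Proof.
move=> hb [P [h1 h2 h3]] w; rewrite -(subrK (P `|k|%N w) (F w)); apply: VD.
  by apply: Vle (h3 _ w); lia.
exact: Poly_V (h1 _) w.
Qed.

Lemma Lim_add gs k F G : Lim gs k F -> Lim gs k G -> Lim gs k (fun w => F w + G w).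
Proof.
move=> [P [h1 h2 h3]] [Q [h1' h2' h3']]; exists (fun j w => P j w + Q j w); split=> [j|j|j w].
- exact: Poly_add.
- by apply: Poly_ext (Poly_add (h2 j) (h2' j)) => w; ring.
by rewrite opprD addrACA VD.
Qed.

Lemma Lim_mul gs k l F G : bdd gs -> Lim gs k F -> Lim gs l G -> Lim gs (k + l) (fun w => F w * G w).
Proof.
move=> hb hF hG; have hFV := Lim_V hb hF.
have [P [h1 h2 h3]] := hF; have [Q [h1' h2' h3']] := hG.
pose s := (`|k| + `|l|)%N.
exists (fun j w => P (s + j)%N w * Q (s + j)%N w); split=> [j|j|j w].
- exact: Poly_mul.
- have a1 : Poly gs j%:Z (fun w => P (s + j)%N.+1 w * (Q (s + j)%N.+1 w - Q (s + j)%N w)).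
    apply: (@Poly_mul0 _ _ _ _ _ (fun w => Q (s + j)%N.+1 w - Q (s + j)%N w) _ (h1 _) (h2' _)).
    by rewrite /s; lia.
  have a2 : Poly gs j%:Z (fun w => (P (s + j)%N.+1 w - P (s + j)%N w) * Q (s + j)%N w).
    apply: (@Poly_mul0 _ _ _ _ (fun w => P (s + j)%N.+1 w - P (s + j)%N w) _ _ (h2 _) (h1' _)).
    by rewrite /s; lia.
  by apply: Poly_ext (Poly_add a1 a2) => w; rewrite addnS; ring.
have -> : F w * G w - P (s + j)%N w * Q (s + j)%N w =
  F w * (G w - Q (s + j)%N w) + (F w - P (s + j)%N w) * Q (s + j)%N w by ring.
apply: VD.
  by apply: Vle (VM (hFV w) (h3' _ w)); rewrite /s; lia.
by apply: Vle (VM (h3 _ w) (Poly_V hb (h1' _) w)); rewrite /s; lia.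
Qed.

Lemma Lim_mul0 gs k l m F G : bdd gs -> m <= k + l -> Lim gs k F -> Lim gs l G -> Lim gs m (fun w => F w * G w).
Proof. by move=> hb h hF hG; apply: Lim_le h (Lim_mul hb hF hG). Qed.

Lemma Lim_cst gs k c : V k c -> Lim gs k (fun _ => c).
Proof. by move=> h; apply: Lim_Poly; apply: Poly_cst. Qed.

Lemma Lim_gen gs g : List.In g gs -> Lim gs 0 g.
Proof. by move=> h; apply: Lim_Poly; apply: Poly_gen. Qed.

Lemma Lim0 gs k : Lim gs k (fun _ => 0).
Proof. by apply: Lim_cst; rewrite V0. Qed.

Lemma Lim_opp gs k F : bdd gs -> Lim gs k F -> Lim gs k (fun w => - F w).
Proof.
move=> hb h; have hN1 : V 0 (-1 : K) by rewrite VN V1.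
apply: Lim_ext (Lim_mul0 hb (_ : k <= 0 + k) (Lim_cst gs hN1) h) => [w|]; first by rewrite mulN1r.
by rewrite add0r.
Qed.

Lemma Lim_sum gs k (T : Type) (s : seq T) (P : pred T) (f : T -> Om -> K) :
  (forall i, P i -> Lim gs k (f i)) -> Lim gs k (fun w => \sum_(i <- s | P i) f i w).
Proof.
move=> h; elim: s => [|a s IH].
  by apply: Lim_ext (Lim0 gs k) => w; rewrite big_nil.
case: (boolP (P a)) => Pa.
  by apply: Lim_ext (Lim_add (h a Pa) IH) => w; rewrite big_cons Pa.
by apply: Lim_ext IH => w; rewrite big_cons (negbTE Pa).
Qed.

Lemma Lim_exp gs F n : bdd gs -> Lim gs 0 F -> Lim gs 0 (fun w => F w ^+ n).
Proof.
move=> hb h; elim: n => [|n IH].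
  by apply: Lim_ext (Lim_cst gs (V1 K)) => w; rewrite expr0.
by apply: Lim_ext (Lim_mul hb h IH) => w; rewrite exprS.
Qed.

Lemma Lim_approx gs k F (N : nat) : Lim gs k F -> exists2 P, Poly gs k P & Lim gs N%:Z (fun w => F w - P w).
Proof.
move=> [P [h1 h2 h3]]; exists (P N) => //.
exists (fun j w => P (N + j)%N w - P N w); split=> [j|j|j w].
- by apply: Poly_incr => //; rewrite leq_addr.
- by apply: Poly_le (_ : j%:Z <= (N + j)%N%:Z) _; [lia|apply: Poly_ext (h2 (N + j)%N) => w; rewrite addnS; ring].
have -> : F w - P N w - (P (N + j)%N w - P N w) = F w - P (N + j)%N w by ring.
by apply: Vle (h3 _ w); lia.
Qed.

(** Diagonal argument: the j-th approximation adds up the j-th approximations of the first j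
    increments. *)
Lemma Lim_lim gs k (FF : nat -> Om -> K) F :
  Lim gs k (FF 0%N) -> (forall i : nat, Lim gs (Num.max k i%:Z) (fun w => FF i.+1 w - FF i w)) ->
  (forall (i : nat) w, V i%:Z (F w - FF i w)) -> Lim gs k F.
Proof.
move=> h0 hd hF.
have [P0 [p1 p2 p3]] := h0.
have /choice[D hD] : forall i : nat, exists D : nat -> Om -> K,
    [/\ forall j, Poly gs (Num.max k i%:Z) (D j), forall j : nat, Poly gs j%:Z (fun w => D j.+1 w - D j w) &
      forall (j : nat) w, V j%:Z (FF i.+1 w - FF i w - D j w)] by move=> i; have := hd i.
exists (fun j w => P0 j w + \sum_(i < j) D i j w); split=> [j|j|j w].
- apply: Poly_add => //; apply: Poly_sum => i _; have [h1 _ _] := hD i.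
  by apply: Poly_le (h1 j); rewrite le_max lexx.
- have a1 : Poly gs j%:Z (fun w => \sum_(i < j) (D i j.+1 w - D i j w)).
    by apply: Poly_sum => i _; have [_ h2 _] := hD i; apply: h2.
  have a2 : Poly gs j%:Z (D j j.+1).
    by have [h1 _ _] := hD j; apply: Poly_le (h1 _); rewrite le_max lexx orbT.
  apply: Poly_ext (Poly_add (p2 j) (Poly_add a1 a2)) => w.
  by rewrite big_ord_recr /= sumrB; ring.
have e : FF j w = FF 0%N w + \sum_(i < j) (FF i.+1 w - FF i w).
  elim: (j) => [|m IH]; first by rewrite big_ord0 addr0.
  by rewrite big_ord_recr /= addrA -IH addrC subrK.
have -> : F w - (P0 j w + \sum_(i < j) D i j w) =
  (F w - FF j w) + (FF 0%N w - P0 j w) + \sum_(i < j) (FF i.+1 w - FF i w - D i j w).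
  by rewrite sumrB e; ring.
apply: VD; first by apply: VD.
by apply: V_sum => i _; have [_ _ h3] := hD i; apply: h3.
Qed.

Lemma Lim_limit gs k (FF : nat -> Om -> K) :
  Lim gs k (FF 0%N) -> (forall i : nat, Lim gs (Num.max k i%:Z) (fun w => FF i.+1 w - FF i w)) ->
  bdd gs -> exists2 F, Lim gs k F & forall (i : nat) w, V i%:Z (F w - FF i w).
Proof.
move=> h0 hd hb.
have /choice[F hF] : forall w, exists a : K, forall i : nat, V i%:Z (FF i w - a).
  move=> w; apply: conv_limit => i; apply: Vle (Lim_V hb (hd i) w).
  by rewrite le_max lexx orbT.
exists F; last by move=> i w; rewrite VBC.
by apply: Lim_lim h0 hd _ => i w; rewrite VBC.
Qed.

End Lim.

Lemma Lim_comp (K : padic_field) (Om Om' : Type) (gs : seq (Om -> K)) (gs' : seq (Om' -> K)) (s : Om' -> Om) k F :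
  bdd gs' -> (forall g, List.In g gs -> Lim gs' 0 (fun w => g (s w))) ->
  Lim gs k F -> Lim gs' k (fun w => F (s w)).
Proof.
move=> hb hg; have hP l P : Poly gs l P -> Lim gs' l (fun w => P (s w)).
  elim=> [k' c hc|g hgi|k' F' G' _ h1 _ h2|k' l' F' G' _ h1 _ h2|k' l' F' le _ h1].
  - exact: Lim_cst.
  - exact: hg.
  - exact: Lim_add.
  - exact: Lim_mul.
  exact: Lim_le h1.
move=> /Lim_shift[P [h1 h2 h3]].
by apply: (Lim_lim (hP _ _ (h1 0%N)) (fun i => hP _ _ (h2 i))) => i w.
Qed.

(** * Series with explicit coefficients *)

Section Rep.
Variable K : padic_field.
Variable Om : Type.
Variable X : eqType.
Variable mon : X -> Om -> K.
Hypothesis hmon : forall x w, V 0 (mon x w).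
Implicit Types (c : X -> K) (F G : Om -> K).

Definition nullf c := forall N : nat, exists B : seq X, forall x, x \notin B -> V N%:Z (c x).

(** The remainder is bounded for every finite set off which the coefficients are small, so no order
    of summation intervenes. The coefficients are a choice, as the functions [mon x] may satisfy
    relations. *)
Definition Rep c F := nullf c /\ forall (N : int) (B : seq X), uniq B -> (forall x, x \notin B -> V N (c x)) ->
  forall w, V N (F w - \sum_(x <- B) c x * mon x w).

Lemma sum_wide c (N : int) (B B' : seq X) w : uniq B -> uniq B' -> {subset B <= B'} ->
  (forall x, x \notin B -> V N (c x)) ->
  V N (\sum_(x <- B') c x * mon x w - \sum_(x <- B) c x * mon x w).
Proof.
move=> uB uB' s h; rewrite [X in V _ (X - _)](bigID (fun x => x \in B)) /=.
have -> : \sum_(x <- B' | x \in B) c x * mon x w = \sum_(x <- B) c x * mon x w.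
  rewrite -big_filter; apply: perm_big; apply: uniq_perm => //; first exact: filter_uniq.
  by move=> x; rewrite mem_filter; case: (boolP (x \in B)) => //= /s ->.
rewrite addrAC subrr add0r; apply: V_sum => x hx.
by apply: VMl; rewrite ?h.
Qed.

Lemma RepI c F : (forall N : nat, exists B, [/\ uniq B, forall x, x \notin B -> V N%:Z (c x) &
  forall w, V N%:Z (F w - \sum_(x <- B) c x * mon x w)]) -> Rep c F.
Proof.
move=> h; split=> [N|N B' uB' hB' w]; first by have [B [_ hB _]] := h N; exists B.
have [B [uB hB hF]] := h `|N|%N.
pose C := undup (B ++ B').
have uC : uniq C by rewrite undup_uniq.
have sB : {subset B <= C} by move=> x hx; rewrite mem_undup mem_cat hx.
have sB' : {subset B' <= C} by move=> x hx; rewrite mem_undup mem_cat hx orbT.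
have h1 : V N (\sum_(x <- C) c x * mon x w - \sum_(x <- B) c x * mon x w).
  by apply: sum_wide => // x hx; apply: Vle (hB x hx); lia.
have h2 : V N (\sum_(x <- C) c x * mon x w - \sum_(x <- B') c x * mon x w) by apply: sum_wide.
have -> : F w - \sum_(x <- B') c x * mon x w =
  (F w - \sum_(x <- B) c x * mon x w) - (\sum_(x <- C) c x * mon x w - \sum_(x <- B) c x * mon x w)
   + (\sum_(x <- C) c x * mon x w - \sum_(x <- B') c x * mon x w) by ring.
by apply: VD => //; apply: VB => //; apply: Vle (hF w); lia.
Qed.

Lemma null_sets c : nullf c -> exists C : nat -> seq X, [/\ forall j, uniq (C j),
  forall j, {subset C j <= C j.+1} & forall (j : nat) x, x \notin C j -> V j%:Z (c x)].
Proof.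
move=> /choice[B hB].
exists (fun j => undup (flatten [seq B i | i <- iota 0 j.+1])); split=> [j|j x|j x].
- exact: undup_uniq.
- rewrite !mem_undup => /flatten_mapP[i hi hx]; apply/flatten_mapP; exists i => //.
  by move: hi; rewrite !mem_iota; lia.
move=> hx; apply: hB; apply: contra hx => hx; rewrite mem_undup; apply/flatten_mapP.
by exists j => //; rewrite mem_iota; lia.
Qed.

Lemma rep_exists c : nullf c -> exists F, Rep c F.
Proof.
move=> hc; have [C [uC sC hC]] := null_sets hc.
have /choice[F hF] : forall w, exists l, forall j : nat, V j%:Z (\sum_(x <- C j) c x * mon x w - l).
  by move=> w; apply: conv_limit => j; exact: (sum_wide _ (uC j) (uC j.+1) (sC j) (@hC j)).
by exists F; apply: RepI => N; exists (C N); split=> // [x|w]; [apply: hC|rewrite VBC].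
Qed.

Lemma rep_V c F (k : int) : Rep c F -> (forall x, V k (c x)) -> forall w, V k (F w).
Proof.
by move=> [_ h] hk w; have := h k [::] isT (fun x _ => hk x) w; rewrite big_nil subr0.
Qed.

Lemma rep_add c c' F F' : Rep c F -> Rep c' F' -> Rep (fun x => c x + c' x) (fun w => F w + F' w).
Proof.
move=> [hn h] [hn' h']; apply: RepI => N; have [B hB] := hn N; have [B' hB'] := hn' N.
pose C := undup (B ++ B').
have hC x : x \notin C -> V N%:Z (c x) /\ V N%:Z (c' x).
  by rewrite mem_undup mem_cat negb_or => /andP[/hB ? /hB' ?].
exists C; split=> [|x /hC[? ?]|w]; [exact: undup_uniq|exact: VD|].
under eq_bigr => x _ do rewrite mulrDl.
rewrite big_split /= opprD addrACA VD //; [apply: h|apply: h']; rewrite ?undup_uniq // => x /hC[] //.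
Qed.

Lemma rep_scale c F a : Rep c F -> Rep (fun x => a * c x) (fun w => a * F w).
Proof.
move=> [hn h]; case: (eqVneq a 0) => [->|a0].
  apply: RepI => N; exists [::]; split=> // [x _|w]; first by rewrite mul0r V0.
  by rewrite big_nil mul0r subrr V0.
apply: RepI => N.
have [B hB] := hn `|(N%:Z - ord a)%R|%N.
have hC x : x \notin undup B -> V (N%:Z - ord a) (c x) by rewrite mem_undup => /hB; apply: Vle; lia.
exists (undup B); split=> [|x /hC hx|w]; first exact: undup_uniq.
  by have := VM (V_self a) hx; apply: Vle; lia.
under eq_bigr => x _ do rewrite -mulrA.
rewrite -mulr_sumr -mulrBr; have := VM (V_self a) (h _ _ (undup_uniq B) hC w).
by apply: Vle; lia.
Qed.

Lemma rep_Lim (gs : seq (Om -> K)) c F k : (forall x, Poly gs 0 (mon x)) -> Rep c F ->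
  (forall x, V k (c x)) -> Lim gs k F.
Proof.
move=> hm [hn hF] hk; have [C [uC sC hC]] := null_sets hn.
exists (fun j w => \sum_(x <- C j) c x * mon x w); split=> [j|j|j w].
- apply: Poly_sum => x _; apply: (Poly_mul0 (l := 0) _ (Poly_cst gs (hk x)) (hm x)); lia.
- have : Poly gs j%:Z (fun w => \sum_(x <- C j.+1 | x \notin C j) c x * mon x w).
    apply: Poly_sum => x hx; apply: (Poly_mul0 (l := 0) _ (Poly_cst gs (hC j x hx)) (hm x)); lia.
  apply: Poly_ext => w; rewrite [X in _ = X - _](bigID (fun x => x \in C j)) /=.
  have -> : \sum_(x <- C j.+1 | x \in C j) c x * mon x w = \sum_(x <- C j) c x * mon x w.
    rewrite -big_filter; apply: perm_big; apply: uniq_perm => //; first exact: filter_uniq.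
    by move=> x; rewrite mem_filter; case: (boolP (x \in C j)) => //= /sC ->.
  by rewrite addrAC subrr add0r.
by apply: hF => // x; apply: hC.
Qed.

Variable gs : seq (Om -> K).
Hypothesis mon1 : exists x, forall w, mon x w = 1.
Hypothesis monM : forall x y, exists z, forall w, mon z w = mon x w * mon y w.
Hypothesis mong : forall g, List.In g gs -> exists x, forall w, mon x w = g w.

Lemma Poly_nf k P : Poly gs k P -> exists s : seq (K * X), (forall e, e \in s -> V k e.1) /\
  forall w, P w = \sum_(e <- s) e.1 * mon e.2 w.
Proof.
elim=> {k P} [k c hc|g hg|k F G _ [s [h1 h2]] _ [s' [h1' h2']]|k l F G _ [s [h1 h2]] _ [s' [h1' h2']]|k l F le _ [s [h1 h2]]].
- have [x hx] := mon1; exists [:: (c, x)]; split=> [e|w]; first by rewrite inE => /eqP ->.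
  by rewrite big_seq1 hx mulr1.
- have [x hx] := mong hg; exists [:: (1, x)]; split=> [e|w]; first by rewrite inE => /eqP -> /=; rewrite V1.
  by rewrite big_seq1 hx mul1r.
- exists (s ++ s'); split=> [e|w]; first by rewrite mem_cat => /orP[/h1|/h1'].
  by rewrite big_cat h2 h2'.
- have /choice[z hz] : forall p : X * X, exists z, forall w, mon z w = mon p.1 w * mon p.2 w.
    by move=> p; apply: monM.
  exists [seq (e.1 * e'.1, z (e.2, e'.2)) | e <- s, e' <- s']; split=> [e|w].
    by move=> /allpairsP[[a b] /= [ha hb ->]] /=; apply: VM; [apply: h1|apply: h1'].
  rewrite h2 h2' big_allpairs_dep /= mulr_suml; apply: eq_bigr => e _.
  by rewrite mulr_sumr; apply: eq_bigr => e' _; rewrite hz /=; ring.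
by exists s; split=> // e /h1; apply: Vle.
Qed.

(** The coefficients of each monomial in the successive approximations form a Cauchy sequence; its
    limit is the coefficient of a formal series for F. *)
Lemma Lim_rep k F : Lim gs k F -> exists2 c, Rep c F & forall x, V k (c x).
Proof.
move=> /Lim_shift[P [h1 h2 h3]].
have [s0 [hs0 e0]] := Poly_nf (h1 0%N).
have /choice[s1 hs1] := fun j => Poly_nf (h2 j).
pose cf (s : seq (K * X)) x := \sum_(e <- s | e.2 == x) e.1.
pose u x j := cf s0 x + \sum_(i < j) cf (s1 i) x.
have cfV s (l : int) : (forall e, e \in s -> V l e.1) -> forall x, V l (cf s x).
  by move=> h x; rewrite /cf big_seq_cond; apply: V_sum => e /andP[/h].
have hu x j : V (Num.max k j%:Z) (u x j.+1 - u x j).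
  have -> : u x j.+1 - u x j = cf (s1 j) x by rewrite /u big_ord_recr /=; ring.
  by apply: cfV; case: (hs1 j).
have /choice[c hc] : forall x, exists l, forall j : nat, V j%:Z (u x j - l).
  by move=> x; apply: conv_limit => j; apply: Vle (hu x j); rewrite le_max lexx orbT.
have hk x j : V k (u x j).
  elim: j => [|j IH]; first by rewrite /u big_ord0 addr0; apply: cfV.
  by rewrite -(subrK (u x j) (u x j.+1)); apply: VD => //; apply: Vle (hu x j); rewrite le_max lexx.
exists c; last first.
  move=> x; rewrite -[c x](subKr (u x `|k|%N)); apply: VB => //.
  by apply: Vle (hc x _); lia.
have sumE s w (B : seq X) : uniq B -> {subset [seq e.2 | e <- s] <= B} ->
    \sum_(e <- s) e.1 * mon e.2 w = \sum_(x <- B) cf s x * mon x w.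
  move=> uB sB; rewrite /cf; under [RHS]eq_bigr => x _ do rewrite mulr_suml.
  rewrite (exchange_big_dep xpredT) //= big_seq [RHS]big_seq; apply: eq_bigr => e es.
  rewrite [RHS]big_mkcond (bigD1_seq e.2) /=; [|by apply: sB; apply: map_f|exact: uB].
  by rewrite eqxx big1 ?addr0 // => x hx; rewrite eq_sym (negbTE hx).
apply: RepI => N.
pose B := undup ([seq e.2 | e <- s0] ++ flatten [seq [seq e.2 | e <- s1 i] | i <- iota 0 N]).
have sB0 : {subset [seq e.2 | e <- s0] <= B} by move=> x hx; rewrite mem_undup mem_cat hx.
have sB1 i : (i < N)%N -> {subset [seq e.2 | e <- s1 i] <= B}.
  move=> iN x hx; rewrite mem_undup mem_cat; apply/orP; right; apply/flatten_mapP.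
  by exists i => //; rewrite mem_iota.
have cf0 s x : x \notin [seq e.2 | e <- s] -> cf s x = 0.
  move=> h; rewrite /cf big_seq_cond big1 // => e /andP[es /eqP ee].
  by case/negP: h; rewrite -ee; apply: map_f.
exists B; split=> [|x xB|w]; first exact: undup_uniq.
  have := hc x N; suff -> : u x N = 0 by rewrite sub0r VN.
  rewrite /u cf0 ?add0r; last by apply: contra xB => /sB0.
  by rewrite big1 // => i _; apply: cf0; apply: contra xB => /(sB1 i (ltn_ord i)).
have eP : P N w = \sum_(x <- B) u x N * mon x w.
  have -> : P N w = P 0%N w + \sum_(i < N) (P i.+1 w - P i w).
    elim: (N) => [|m IH]; first by rewrite big_ord0 addr0.
    by rewrite big_ord_recr /= addrA -IH addrC subrK.
  rewrite e0 (sumE _ _ _ (undup_uniq _) sB0).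
  have -> : \sum_(i < N) (P i.+1 w - P i w) = \sum_(i < N) \sum_(x <- B) cf (s1 i) x * mon x w.
    by apply: eq_bigr => i _; rewrite (hs1 i).2 (sumE _ _ _ (undup_uniq _) (sB1 i (ltn_ord i))).
  rewrite exchange_big /= -big_split; apply: eq_bigr => x _.
  by rewrite /u mulrDl; congr (_ + _); rewrite mulr_suml.
apply: (Vtrans (y := P N w)) => //; rewrite eP -sumrB; apply: V_sum => x _.
by rewrite -mulrBl; apply: VMl.
Qed.

End Rep.

(** * Strong noetherianity *)

Section Dickson.

Lemma incr_leq (ph : nat -> nat) : (forall i, (ph i < ph i.+1)%N) -> forall i j, (i < j)%N -> (ph i < ph j)%N.
Proof.
move=> h i; elim=> // j IH; rewrite ltnS leq_eqVlt => /orP[/eqP->//|/IH lt].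
exact: ltn_trans lt (h j).
Qed.

Lemma mono_subseq (f : nat -> nat) : exists ph : nat -> nat,
  (forall i, (ph i < ph i.+1)%N) /\ forall i, (f (ph i) <= f (ph i.+1))%N.
Proof.
have tailmin k : exists m, (k <= m)%N /\ forall m', (k <= m')%N -> (f m <= f m')%N.
  have ex : exists v, `[< exists2 m, (k <= m)%N & f m = v >] by exists (f k); apply/asboolP; exists k.
  have [v /asboolP[m km fm] hv] := ex_minnP ex.
  by exists m; split=> // m' hm'; rewrite fm; apply: hv; apply/asboolP; exists m'.
have /choice[g hg] := tailmin.
exists (fun i => iter i (fun n => g n.+1) (g 0%N)); split=> i; rewrite iterS.
  by have [h _] := hg (iter i (fun n => g n.+1) (g 0%N)).+1.
set x := iter i _ _; have [h1 h2] := hg x.+1.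
case: i @x h1 h2 => [|i] x h1 h2.
  by have [_ h] := hg 0%N; apply: h.
have [h3 h4] := hg (iter i (fun n => g n.+1) (g 0%N)).+1.
by apply: h4; apply: leq_trans (ltnW h1); exact: h3.
Qed.

Lemma mono_subseqs n (f : 'I_n -> nat -> nat) (s : seq 'I_n) : exists ph : nat -> nat,
  (forall i, (ph i < ph i.+1)%N) /\ forall k, k \in s -> forall i, (f k (ph i) <= f k (ph i.+1))%N.
Proof.
elim: s => [|k s [ph [h1 h2]]]; first by exists id.
have [ps [h3 h4]] := mono_subseq (f k \o ph).
exists (ph \o ps); split=> [i|k']; first exact: (incr_leq h1).
rewrite inE => /orP[/eqP->|ks] i; first exact: h4.
rewrite /=; have : (ps i < ps i.+1)%N by [].
elim: (ps i.+1) => // m IH; rewrite ltnS leq_eqVlt => /orP[/eqP->|/IH le]; first exact: h2.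
exact: leq_trans le (h2 _ ks m).
Qed.

(** Otherwise one could forever pick an element of S above none of the earlier ones, against a
    subsequence that is nondecreasing in every coordinate. *)
Lemma dickson n (S : multinom n -> Prop) : exists s : seq (multinom n),
  (forall a, a \in s -> S a) /\ forall a, S a -> exists2 b, b \in s & forall i, (b i <= a i)%N.
Proof.
apply: contrapT => hn.
have /choice[pk hpk] : forall s : seq (multinom n), exists a, (forall x, x \in s -> S x) ->
    S a /\ forall b, b \in s -> ~ forall i, (b i <= a i)%N.
  move=> s; apply: contrapT => /forallNP h; apply: hn; exists s; split.
    by apply: contrapT => h'; apply: (h (mnm0)) => h''; case: h'.
  move=> a Sa; apply: contrapT => h'; apply: (h a) => _; split=> // b bs hb.
  by apply: h'; exists b.
pose L := fix L k := if k is k'.+1 then rcons (L k') (pk (L k')) else [::].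
have hL k : forall x, x \in L k -> S x.
  elim: k => //= k IH x; rewrite mem_rcons inE => /orP[/eqP->|/IH//].
  by case: (hpk _ IH).
pose a k := pk (L k).
have ha i j : (i < j)%N -> a i \in L j.
  elim: j => // j IH; rewrite ltnS leq_eqVlt /= mem_rcons inE => /orP[/eqP->|/IH ->].
    by rewrite eqxx.
  by rewrite orbT.
have [ph [h1 h2]] := mono_subseqs (fun (i : 'I_n) k => a k i) (enum 'I_n).
have [_ h3] := hpk _ (hL (ph 1%N)).
apply: (h3 (a (ph 0%N))); first by apply: ha.
by move=> i; apply: (h2 i); rewrite mem_enum.
Qed.

Lemma seq_best (X : eqType) (R : X -> X -> Prop) (P : X -> Prop) (s : seq X) :
  (forall x y, R x y \/ R y x) -> (forall x y z, R x y -> R y z -> R x z) ->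
  (exists2 j, j \in s & P j) ->
  exists2 k, k \in s & P k /\ forall j, j \in s -> P j -> R k j.
Proof.
move=> tot tr; have rf x : R x x by case: (tot x x).
elim: s => [[j]//|a s IH] hj.
case: (pselect (exists2 j, j \in s & P j)) => [/IH[k ks [Pk hk]]|hn]; last first.
  have Pa : P a.
    by case: hj => j; rewrite inE => /orP[/eqP->//|js Pj]; case: hn; exists j.
  exists a; rewrite ?mem_head //; split=> // j; rewrite inE => /orP[/eqP->//|js Pj].
  by case: hn; exists j.
case: (pselect (P a /\ R a k)) => [[Pa le]|na].
  exists a; rewrite ?mem_head //; split=> // j; rewrite inE => /orP[/eqP->//|js Pj].
  exact: tr le (hk j js Pj).
exists k; first by rewrite inE ks orbT.
split=> // j; rewrite inE => /orP[/eqP->|] Pj; last exact: hk.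
by case: (tot k a) => // h; case: na.
Qed.

End Dickson.

(** * Finitely many coefficients generate all of them *)

Section Noether.
Variable K : padic_field.
Variable Om : Type.
Variable gs gs' : seq (Om -> K).
Hypothesis bgs' : bdd gs'.
Hypothesis sgs : forall g, List.In g gs -> List.In g gs'.
Let bgs : bdd gs. Proof. by move=> g /sgs /bgs'. Qed.
Let M := size gs.
Notation A := (multinom M).

Definition mon (al : A) (w : Om) : K := \prod_(i < M) (nth (fun _ => 0) gs i w) ^+ al i.

Lemma nth_In (T : Type) (s : seq T) x i : (i < size s)%N -> List.In (nth x s i) s.
Proof. by elim: s i => // a s IH [|i] /= h; [left|right; apply: IH]. Qed.

Lemma In_nth (T : Type) (s : seq T) x a : List.In a s -> exists2 i, (i < size s)%N & nth x s i = a.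
Proof.
elim: s => // b s IH [->|/IH[i h1 h2]]; first by exists 0%N.
by exists i.+1.
Qed.

Lemma Poly_mon al : Poly gs 0 (mon al).
Proof.
rewrite /mon; elim: (index_enum _) => [|i s IH].
  by apply: Poly_ext (Poly_cst gs (V1 K)) => w; rewrite big_nil.
have h : Poly gs 0 (fun w => nth (fun _ => 0) gs i w ^+ al i).
  by apply: Poly_exp; apply: Poly_gen; apply: nth_In.
by apply: Poly_ext (Poly_mul h IH) => w; rewrite big_cons.
Qed.

Lemma V_mon al w : V 0 (mon al w).
Proof. exact: Poly_V (Poly_mon al) w. Qed.

Lemma monD al be w : mon (mnm_add al be) w = mon al w * mon be w.
Proof. by rewrite /mon -big_split; apply: eq_bigr => i _; rewrite mnmDE exprD. Qed.

Variable Y : eqType.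
Variable ym : Y -> Om -> K.
Hypothesis hym : forall nu, Poly gs' 0 (ym nu).
Variable c : A * Y -> K.
Variable F : Om -> K.
Variable k0 : int.
Hypothesis hk0 : forall m, V k0 (c m).
Hypothesis hF : Rep (fun m w => mon m.1 w * ym m.2 w) c F.

Let Vym nu w : V 0 (ym nu w). Proof. exact: Poly_V (hym nu) w. Qed.

Lemma c_null nu : nullf (fun al => c (al, nu)).
Proof.
move=> N; have [B hB] := hF.1 N; exists [seq m.1 | m <- B] => al h; apply: hB.
by apply: contra h => h; apply/mapP; exists (al, nu).
Qed.

(** [Phi nu] is the coefficient of [ym nu] when F is expanded in the second family of monomials. *)
Lemma Phi_ex : exists Phi : Y -> Om -> K, forall nu, Rep mon (fun al => c (al, nu)) (Phi nu).
Proof.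
suff /choice[Phi h] : forall nu, exists Ph, Rep mon (fun al => c (al, nu)) Ph by exists Phi.
by move=> nu; apply: rep_exists; [exact: V_mon|exact: c_null].
Qed.

Variable Phi : Y -> Om -> K.
Hypothesis hPhi : forall nu, Rep mon (fun al => c (al, nu)) (Phi nu).

Let LPhi nu : Lim gs k0 (Phi nu).
Proof. by apply: (rep_Lim Poly_mon (hPhi nu)) => al. Qed.

Definition shft (be : A) (g : A -> K) (ga : A) : K :=
  if `[< forall i, (be i <= ga i)%N >] then g (mnm_sub ga be) else 0.

Lemma mnm_addKl (be ga : A) : mnm_sub (mnm_add be ga) be = ga.
Proof. by apply/mnmP => i; rewrite mnmBE mnmDE addKn. Qed.

Lemma mnm_subKl (be ga : A) : (forall i, (be i <= ga i)%N) -> mnm_add be (mnm_sub ga be) = ga.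
Proof. by move=> h; apply/mnmP => i; rewrite mnmDE mnmBE subnKC. Qed.

Lemma shft_add be g ga : shft be g (mnm_add be ga) = g ga.
Proof.
rewrite /shft; case: asboolP => [_|[]]; first by rewrite mnm_addKl.
by move=> i; rewrite mnmDE leq_addr.
Qed.

Lemma rep_shft be g G : Rep mon g G -> Rep mon (shft be g) (fun w => mon be w * G w).
Proof.
move=> [hn h]; apply: RepI; first exact: V_mon.
move=> N; have [B hB] := hn N; pose C := undup B.
have hC x : x \notin C -> V N%:Z (g x) by rewrite mem_undup; apply: hB.
exists [seq mnm_add be x | x <- C]; split=> [|ga hga|w].
- by rewrite map_inj_uniq ?undup_uniq // => x y e; rewrite -(mnm_addKl be x) e mnm_addKl.
- rewrite /shft; case: asboolP => [le|_]; last by rewrite V0.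
  apply: hC; apply: contra hga => hga; apply/mapP; exists (mnm_sub ga be) => //.
  by rewrite mnm_subKl.
rewrite big_map; under eq_bigr => x _ do rewrite shft_add monD mulrCA.
rewrite -mulr_sumr -mulrBr; apply: VMr; first exact: V_mon.
by apply: h; rewrite ?undup_uniq.
Qed.

(** Finite combinations of the coefficients of the [ym nu], carried both as formal families, which
    have leading terms, and as functions, which the conclusion concerns. *)
Inductive J : (A -> K) -> (Om -> K) -> Prop :=
| J_gen nu : J (fun al => c (al, nu)) (Phi nu)
| J_lin f Ps g Ga a be of J f Ps & J g Ga :
    J (fun ga => f ga + a * shft be g ga) (fun w => Ps w + a * (mon be w * Ga w)).

Lemma J_rep f Ps : J f Ps -> Rep mon f Ps.
Proof.
elim=> [nu|{}f {}Ps g Ga a be _ h1 _ h2]; first exact: hPhi.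
by apply: rep_add => //; [exact: V_mon|apply: rep_scale; [exact: V_mon|exact: rep_shft]].
Qed.

Lemma J_comb f Ps : J f Ps -> exists (sy : seq Y) (r : Y -> Om -> K) (D : int),
  [/\ uniq sy, forall mu, Poly gs D (r mu) & forall w, Ps w = \sum_(mu <- sy) Phi mu w * r mu w].
Proof.
elim=> [nu|{}f {}Ps g Ga a be _ [s1 [r1 [D1 [u1 h1 e1]]]] _ [s2 [r2 [D2 [u2 h2 e2]]]]].
  exists [:: nu], (fun _ _ => 1), 0; split=> // [mu|w]; first by apply: Poly_cst; exact: V1.
  by rewrite big_seq1 mulr1.
pose r mu w := (if mu \in s1 then r1 mu w else 0) + a * (mon be w * (if mu \in s2 then r2 mu w else 0)).
pose D := Num.min D1 (ord a + D2).
exists (undup (s1 ++ s2)), r, D; split=> [|mu|w]; first exact: undup_uniq.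
  apply: Poly_add.
    case: (mu \in s1); last exact: Poly0.
    by apply: Poly_le (h1 mu); rewrite ge_min lexx.
  apply: (Poly_mul0 (k := ord a) (l := D2) _ (Poly_cst gs (V_self a))).
    by rewrite ge_min lexx orbT.
  apply: (Poly_mul0 (k := 0) (l := D2) _ (Poly_mon be)); first by rewrite add0r.
  by case: (mu \in s2); [exact: h2|exact: Poly0].
have key (s : seq Y) (q : Y -> K) : uniq s -> {subset s <= undup (s1 ++ s2)} ->
    \sum_(mu <- s) q mu = \sum_(mu <- undup (s1 ++ s2)) (if mu \in s then q mu else 0).
  move=> us ss; rewrite -big_mkcond -big_filter; apply: perm_big; apply: uniq_perm => //.
    by rewrite filter_uniq ?undup_uniq.
  by move=> x; rewrite mem_filter; case: (boolP (x \in s)) => //= /ss ->.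
rewrite e1 e2 (key s1) //; last by move=> x hx; rewrite mem_undup mem_cat hx.
rewrite (key s2) //; last by move=> x hx; rewrite mem_undup mem_cat hx orbT.
rewrite !mulr_sumr -big_split; apply: eq_bigr => mu _ /=.
by rewrite /r; case: (mu \in s1); case: (mu \in s2); ring.
Qed.

(** Leading exponent for the Gauss norm: the largest exponent among the coefficients of least
    order. *)
Definition lead (f : A -> K) (al : A) := f al != 0 /\
  forall ga, V (ord (f al)) (f ga) /\ ((al < ga)%O -> V (ord (f al) + 1) (f ga)).

Lemma lead_exists f al0 : nullf f -> f al0 != 0 -> exists al, lead f al.
Proof.
move=> hn f0; have [B hB] := hn `|(ord (f al0) + 1)%R|%N.
have hB' x : x \notin B -> V (ord (f al0) + 1) (f x) by move=> /hB; apply: Vle; lia.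
pose R x y := ord (f x) < ord (f y) \/ (ord (f x) = ord (f y) /\ (y <= x)%O).
have [|||al alB [fal hal]] := @seq_best A R (fun x => f x != 0) B.
- move=> x y; rewrite /R; case: (ltgtP (ord (f x)) (ord (f y))) => h; [by left; left|by right; left|].
  by case: (leP x y) => h'; [right|left]; right; split=> //; apply: ltW.
- move=> x y z [h|[h h']] [h1|[h1 h1']]; rewrite /R; try (left; lia).
  by right; split; [lia|apply: le_trans h1' h'].
- exists al0 => //; apply: contraT => /hB'; rewrite VE //; lia.
have al0B : al0 \in B by apply: contraT => /hB'; rewrite VE //; lia.
have le0 : ord (f al) <= ord (f al0) by case: (hal al0 al0B f0) => [/ltW|[->]].
exists al; split=> // ga; case: (boolP (ga \in B)) => hga; last first.
  by split=> [|_]; apply: Vle (hB' _ hga); lia.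
case: (eqVneq (f ga) 0) => [->|fga]; first by rewrite !V0.
rewrite !VE //; case: (hal ga hga fga) => [h|[-> h]]; first by split=> [|_]; lia.
by split=> // h'; rewrite ltNge h in h'.
Qed.

Let Sl al := exists f Ps, J f Ps /\ lead f al.

(* Division by a standard basis: the leading monomials of the module generated
   by the [c (_, nu)] are those of finitely many elements. *)
Lemma division : exists (s : seq A) (PS : A -> Om -> K) (C : nat),
  [/\ forall al, al \in s -> exists f, [/\ J f (PS al), lead f al & (`|ord (f al)| <= C)%N] &
      forall (k : int) f Ps, J f Ps -> (forall ga, V k (f ga)) ->
      exists2 h : A -> Om -> K, (forall al, al \in s -> Lim gs (k - C%:Z) (h al)) &
        forall w, Ps w = \sum_(al <- s) h al w * PS al w].
Proof.
have [s0 [hs1 hs2]] := dickson Sl; pose s := undup s0.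
have us : uniq s by exact: undup_uniq.
have /choice[gP hgP] : forall al, exists p : (A -> K) * (Om -> K), al \in s -> J p.1 p.2 /\ lead p.1 al.
  move=> al; case: (boolP (al \in s)) => h; last by exists (fun _ => 0, fun _ => 0).
  by rewrite mem_undup in h; have [f [Ps ?]] := hs1 al h; exists (f, Ps).
pose o al := ord ((gP al).1 al).
(* Bounds the orders of the leading coefficients, hence the precision lost when dividing by them. *)
pose C := (\sum_(al <- s) `|o al|)%N.
have hC al : al \in s -> (`|o al| <= C)%N.
  by move=> h; rewrite /C (bigD1_seq al) //= leq_addr.
exists s, (fun al => (gP al).2), C; split.
  by move=> al h; have [h1 h2] := hgP al h; exists (gP al).1; split=> //; apply: hC.
pose good k f Ps := J f Ps /\ forall ga, V k (f ga).
(* One digit of the division: leading terms of order k are cancelled one after another. The leading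
   exponent decreases in a well-founded order, so after finitely many cancellations all coefficients
   have order at least k + 1. *)
have step k f Ps : good k f Ps -> exists p : ((A -> K) * (Om -> K)) * (A -> Om -> K),
    [/\ good (k + 1) p.1.1 p.1.2, forall al, al \in s -> Poly gs (k - C%:Z) (p.2 al) &
        forall w, Ps w = p.1.2 w + \sum_(al <- s) p.2 al w * (gP al).2 w].
  pose concl (f : A -> K) Ps := exists p : ((A -> K) * (Om -> K)) * (A -> Om -> K),
    [/\ good (k + 1) p.1.1 p.1.2, forall al, al \in s -> Poly gs (k - C%:Z) (p.2 al) &
        forall w, Ps w = p.1.2 w + \sum_(al <- s) p.2 al w * (gP al).2 w].
  have red f' Ps' : good k f' Ps' -> ~ (forall ga, V (k + 1) (f' ga)) -> exists al0 f1 Ps1,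
     [/\ ~ V (k + 1) (f' al0), good k f1 Ps1, forall ga, ~ (ga < al0)%O -> V (k + 1) (f1 ga) &
       concl f1 Ps1 -> concl f' Ps'].
    move=> [hJ hV] /existsNP[ga0 /negP hga0].
    have [al0 hl] := lead_exists (J_rep hJ).1 (neq0_V hga0).
    have [f0 hl'] := hl.
    have o0 : ord (f' al0) = k.
      have h1 := ord_nV hga0; have [h2 _] := hl' ga0; rewrite VE ?(neq0_V hga0) // in h2.
      by have := hV al0; rewrite VE //; lia.
    have [|al' als hle] := hs2 al0; first by exists f', Ps'.
    have {als} als : al' \in s by rewrite mem_undup.
    have [gJ [g0 gl]] := hgP al' als; have oal := hC al' als.
    set g := (gP al').1 in gJ g0 gl oal; pose be := mnm_sub al0 al'.
    have e0 : mnm_add be al' = al0 by rewrite addmC mnm_subKl.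
    pose a := f' al0 / g al'.
    have oa : ord a = k - o al' by rewrite /a ordM ?ordVn ?invr_eq0 // o0.
    have shV ga : V (o al') (shft be g ga).
      by rewrite /shft; case: asboolP => [_|_]; [case: (gl (mnm_sub ga be))|rewrite V0].
    exists al0, (fun ga => f' ga + - a * shft be g ga), (fun w => Ps' w + - a * (mon be w * (gP al').2 w)); split.
    - by rewrite VE // o0; lia.
    - split; first by apply: J_lin.
      move=> ga; apply: VD => //; have := VM (V_self (- a)) (shV ga); apply: Vle; rewrite ordN oa; lia.
    - move=> ga hga; case: (eqVneq ga al0) => [->|ne].
        by rewrite -[in shft _ _ _]e0 shft_add /a mulNr divfK // subrr V0.
      have lt : (al0 < ga)%O by move/negP: hga; rewrite -leNgt le_eqVlt eq_sym (negbTE ne).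
      apply: VD; first by case: (hl' ga) => _; rewrite o0; apply.
      rewrite /shft; case: asboolP => [le|_]; last by rewrite mulr0 V0.
      have lt2 : (mnm_add be al' < mnm_add be (mnm_sub ga be))%O by rewrite e0 mnm_subKl.
      have lt' : (al' < mnm_sub ga be)%O.
        case: (leP (mnm_sub ga be) al') => // h.
        by have := le_lt_trans (lem_add (lexx be) h) lt2; rewrite ltxx.
      by have := VM (V_self (- a)) ((gl (mnm_sub ga be)).2 lt'); apply: Vle; rewrite ordN oa; rewrite -/(o al'); clear; lia.
    case=> -[[f2 Ps2] p] [/= h1 h2 h3].
    exists ((f2, Ps2), fun al w => p al w + (if al == al' then a * mon be w else 0)); split=> //= [al hal|w].
      apply: Poly_add; first exact: h2.
      case: (al == al'); last exact: Poly0.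
      apply: (Poly_mul0 (k := ord a) (l := 0) _ (Poly_cst gs (V_self a)) (Poly_mon be)).
      by rewrite oa; lia.
    under eq_bigr => al _ do rewrite mulrDl.
    rewrite big_split /= addrA -h3; under eq_bigr => al _ do rewrite (fun_if (fun t => t * _)) mul0r.
    rewrite -big_mkcond /= -big_filter.
    have -> : [seq al <- s | al == al'] = [:: al'].
      by apply: perm_small_eq => //; apply: uniq_perm; rewrite ?filter_uniq // => x; rewrite mem_filter inE; case: eqVneq => // ->.
    by rewrite big_seq1; ring.
  have fin f' Ps' : good k f' Ps' -> (forall ga, V (k + 1) (f' ga)) -> concl f' Ps'.
    move=> [hJ _] hV; exists ((f', Ps'), fun _ _ => 0); split=> //= [al _|w]; first exact: Poly0.
    by rewrite big1 ?addr0 // => al _; rewrite mul0r.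
  have key al : forall f' Ps', good k f' Ps' -> (forall ga, ~ (ga < al)%O -> V (k + 1) (f' ga)) -> concl f' Ps'.
    elim/(ltmwf (n := M)): al => al IH f' Ps' hg hb.
    case: (pselect (forall ga, V (k + 1) (f' ga))) => h; first exact: fin.
    have [al0 [f1 [Ps1 [h1 h2 h3]]]] := red f' Ps' hg h; apply.
    have lt : (al0 < al)%O by apply: contrapT => nlt; apply: h1; apply: hb.
    exact: (IH al0 lt f1 Ps1 h2 h3).
  move=> hg; case: (pselect (forall ga, V (k + 1) (f ga))) => h; first exact: (fin f Ps hg h).
  have [al0 [f1 [Ps1 [h1 h2 h3]]]] := red f Ps hg h; apply; exact: (key al0 f1 Ps1 h2 h3).
move=> k f Ps hJ hV.
(* Iterated over all digits, the partial quotients converge and the remainders tend to 0. *)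
have /choice[nx hnx] : forall x : nat * ((A -> K) * (Om -> K)), exists p : ((A -> K) * (Om -> K)) * (A -> Om -> K),
   good (k + x.1%:Z) x.2.1 x.2.2 ->
   [/\ good (k + x.1%:Z + 1) p.1.1 p.1.2, forall al, al \in s -> Poly gs (k + x.1%:Z - C%:Z) (p.2 al) &
        forall w, x.2.2 w = p.1.2 w + \sum_(al <- s) p.2 al w * (gP al).2 w].
  move=> [j [f' Ps']] /=; case: (pselect (good (k + j%:Z) f' Ps')) => h; last by exists ((f', Ps'), fun _ _ => 0).
  by have [p hp] := step _ _ _ h; exists p.
pose x := fix x j := if j is j'.+1 then (nx (j', x j')).1 else (f, Ps).
pose p j := (nx (j, x j)).2.
have hx j : good (k + j%:Z) (x j).1 (x j).2.
  elim: j => [|j IH]; first by rewrite addr0.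
  have [h _ _] := hnx (j, x j) IH; suff -> : k + j.+1%:Z = k + j%:Z + 1 by []; lia.
have hp j : (forall al, al \in s -> Poly gs (k + j%:Z - C%:Z) (p j al)) /\
   forall w, (x j).2 w = (x j.+1).2 w + \sum_(al <- s) p j al w * (gP al).2 w.
  by have [_ h1 h2] := hnx (j, x j) (hx j).
pose N := (`|k| + C)%N.
pose FF al i w := \sum_(i' < N + i) p i' al w.
have /choice[h hh] : forall al, exists h : Om -> K, al \in s -> Lim gs (k - C%:Z) h /\
    forall (i : nat) w, V i%:Z (h w - FF al i w).
  move=> al; case: (boolP (al \in s)) => als; last by exists (fun _ => 0).
  have [|i||h h1 h2] := @Lim_limit _ _ gs (k - C%:Z) (FF al); last by exists h.
  - apply: Lim_sum => i _; apply: Lim_Poly; apply: Poly_le ((hp i).1 al als); lia.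
  - apply: Lim_ext (Lim_Poly (Poly_le _ ((hp (N + i)%N).1 al als))) => [w|].
      by rewrite /FF addnS big_ord_recr /=; ring.
    by rewrite ge_max /N; apply/andP; split; lia.
  exact: bgs.
exists h => [al als|w]; first by case: (hh al als).
apply/subr0_eq/V_all => n.
have eF i : Ps w = (x (N + i)%N).2 w + \sum_(al <- s) FF al i w * (gP al).2 w.
  rewrite /FF; elim: (N + i)%N => [|j IH].
    by rewrite big1 ?addr0 // => al _; rewrite big_ord0 mul0r.
  rewrite IH (hp j).2 -addrA -big_split; congr (_ + _); apply: eq_bigr => al _ /=.
  by rewrite big_ord_recr /= mulrDl addrC.
pose i := (n + N + N)%N.
rewrite (eF i) -addrA -sumrB; apply: VD.
  by have [hJ' hV'] := hx (N + i)%N; apply: Vle (rep_V (J_rep hJ') hV' w); rewrite /i /N; lia.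
apply: V_sum_in => al als; rewrite -mulrBl -VN -mulNr opprB.
have [_ hv] := hh al als; have [gJ [g0 gl]] := hgP al als.
have hb := rep_V (J_rep gJ) (fun ga => (gl ga).1) w.
have := VM (hv i w) hb; apply: Vle; have := hC al als; rewrite /o /i /N; lia.
Qed.

(** By [division] the coefficients [Phi nu] are combinations of finitely many, at a loss of
    precision bounded by a constant C'. Off a finite set of indices the coefficients have order
    above C', and those terms are absorbed by the multiples [G] of the uniformizer. *)
Lemma strong_noether : exists (Fs : seq Y) (G : Y -> Om -> K), [/\ uniq Fs,
  forall mu, Lim gs' 1 (G mu) &
  forall w, F w = \sum_(mu <- Fs) Phi mu w * (ym mu w + G mu w)].
Proof.
have [s [PS [C [hs1 hs2]]]] := division.
have /choice[sr hsr] : forall al, exists q : seq Y * (Y -> Om -> K) * int, al \in s ->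
  [/\ uniq q.1.1, forall mu, Poly gs q.2 (q.1.2 mu) & forall w, PS al w = \sum_(mu <- q.1.1) Phi mu w * q.1.2 mu w].
  move=> al; case: (boolP (al \in s)) => als; last by exists ([::], fun _ _ => 0, 0).
  have [f [h1 _ _]] := hs1 al als; have [sy [r [D [a1 a2 a3]]]] := J_comb h1.
  by exists (sy, r, D).
pose Fs0 := undup (flatten [seq (sr al).1.1 | al <- s]).
pose r al mu w := if mu \in (sr al).1.1 then (sr al).1.2 mu w else 0.
pose C' := (C + \sum_(al <- undup s) `|(sr al).2|)%N.
have hr al mu : al \in s -> Poly gs (C%:Z - C'%:Z) (r al mu).
  move=> als; rewrite /r; case: (mu \in _); last exact: Poly0.
  have [_ h _] := hsr al als; apply: Poly_le (h mu).
  have : (`|(sr al).2| <= \sum_(al <- undup s) `|(sr al).2|)%N.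
    by rewrite (bigD1_seq al) ?undup_uniq ?mem_undup //= leq_addr.
  by rewrite /C'; lia.
have uF0 : uniq Fs0 by exact: undup_uniq.
have ePS al w : al \in s -> PS al w = \sum_(mu <- Fs0) Phi mu w * r al mu w.
  move=> als; have [us _ ->] := hsr al als.
  have -> : \sum_(mu <- Fs0) Phi mu w * r al mu w = \sum_(mu <- Fs0 | mu \in (sr al).1.1) Phi mu w * (sr al).1.2 mu w.
    by rewrite [RHS]big_mkcond; apply: eq_bigr => mu _; rewrite /r; case: (mu \in _); rewrite ?mulr0.
  rewrite -[RHS]big_filter; apply: perm_big; apply: uniq_perm; rewrite ?filter_uniq //.
  move=> mu; rewrite mem_filter; case: (boolP (mu \in _)) => //= hm.
  by rewrite mem_undup; apply/esym/flatten_mapP; exists al.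
have H nu (k : int) : (forall al, V k (c (al, nu))) -> exists hh : Y -> Om -> K,
    (forall mu, Lim gs (k - C'%:Z) (hh mu)) /\ forall w, Phi nu w = \sum_(mu <- Fs0) Phi mu w * hh mu w.
  move=> hk; have [h h1 h2] := hs2 k _ _ (J_gen nu) hk.
  exists (fun mu w => \sum_(al <- s) (if al \in s then h al w * r al mu w else 0)); split.
    move=> mu; apply: Lim_sum => al _; case: (boolP (al \in s)) => als; last exact: Lim0.
    apply: (Lim_mul0 bgs _ (h1 al als) (Lim_Poly (hr al mu als))); lia.
  move=> w; rewrite h2; under [RHS]eq_bigr => mu _ do rewrite mulr_sumr.
  rewrite exchange_big /= big_seq [RHS]big_seq; apply: eq_bigr => al als.
  by rewrite ePS // mulr_sumr; apply: eq_bigr => mu _; rewrite als; ring.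
have [Cs [uC sC hC]] := null_sets hF.1.
pose YN n := undup [seq m.2 | m <- Cs n].
have hYN n nu : nu \notin YN n -> forall al, V n%:Z (c (al, nu)).
  rewrite mem_undup => h al; apply: hC; apply: contra h => h.
  by apply/mapP; exists (al, nu).
have sYN n : {subset YN n <= YN n.+1}.
  by move=> nu; rewrite !mem_undup => /mapP[m hm ->]; apply: map_f; apply: sC.
have approx n (Y' : seq Y) w : uniq Y' -> {subset YN n <= Y'} ->
    V n%:Z (F w - \sum_(nu <- Y') Phi nu w * ym nu w).
  move=> uY sY; pose AN := undup [seq m.1 | m <- Cs n].
  have uA : uniq AN by exact: undup_uniq.
  pose B := [seq (a, nu) | a <- AN, nu <- Y'].
  have uB : uniq B by apply: allpairs_uniq => // -[a b] [a' b'].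
  have hB m : m \notin B -> V n%:Z (c m).
    move=> h; apply: hC; apply: contra h => h; case: m h => a nu h.
    apply/allpairsP; exists (a, nu); split=> //=; first by rewrite mem_undup; apply/mapP; exists (a, nu).
    by apply: sY; rewrite mem_undup; apply/mapP; exists (a, nu).
  have h1 := hF.2 n%:Z B uB hB w.
  apply: Vtrans h1 _; rewrite /B big_allpairs_dep exchange_big -sumrB; apply: V_sum_in => nu nuY /=.
  have -> : \sum_(i <- AN) c (i, nu) * (mon i w * ym nu w) - Phi nu w * ym nu w =
     - ((Phi nu w - \sum_(i <- AN) c (i, nu) * mon i w) * ym nu w).
    by rewrite mulrBl opprB mulr_suml; congr (_ - _); apply: eq_bigr => i _; rewrite mulrA.
  rewrite VN; apply: VMl; last exact: Vym.
  apply: (hPhi nu).2 => // al hal; apply: hC; apply: contra hal => h.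
  by rewrite mem_undup; apply/mapP; exists (al, nu).
(* After the loss C', the indices outside [Yn i] contribute with order at least 1 + i. *)
pose Yn i := YN (C' + 1 + i)%N.
have sYn i : {subset Yn i <= Yn i.+1} by rewrite /Yn [(_ + i.+1)%N]addnS; apply: sYN.
have /choice[hh hhP] : forall q : nat * Y, exists hh : Y -> Om -> K, q.2 \notin Yn q.1 ->
    (forall mu, Lim gs (1 + q.1%:Z) (hh mu)) /\ forall w, Phi q.2 w = \sum_(mu <- Fs0) Phi mu w * hh mu w.
  move=> [i nu] /=; case: (boolP (nu \in Yn i)) => hnu; first by exists (fun _ _ => 0).
  have [hh [h1 h2]] := H nu _ (hYN _ _ hnu); exists hh => _; split=> // mu.
  by apply: Lim_le (h1 mu); lia.
pose new i := [seq nu <- Yn i.+1 | (nu \notin Yn i) && (nu \notin Fs0)].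
pose T mu i w := \sum_(nu <- new i) hh (i, nu) mu w * ym nu w.
have hT mu i : Lim gs' (1 + i%:Z) (T mu i).
  rewrite /T; have hn nu : nu \in new i -> nu \notin Yn i by rewrite mem_filter => /andP[/andP[]].
  elim: (new i) hn => [|nu l IH] hn; first by apply: Lim_ext (Lim0 gs' _) => w; rewrite big_nil.
  have h1 : Lim gs' (1 + i%:Z) (fun w => hh (i, nu) mu w * ym nu w).
    have [h _] := hhP (i, nu) (hn nu (mem_head _ _)).
    by apply: (Lim_mul0 bgs' (l := 0) _ (Lim_mono sgs (h mu)) (Lim_Poly (hym nu))); rewrite addr0.
  apply: Lim_ext (Lim_add h1 (IH _)) => [w|nu' hnu']; first by rewrite big_cons.
  by apply: hn; rewrite inE hnu' orbT.
have /choice[G0 hG0] : forall mu, exists G : Om -> K, Lim gs' 1 G /\ forall (i : nat) w, V i%:Z (G w - \sum_(j < i) T mu j w).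
  move=> mu; have [|i||G h1 h2] := @Lim_limit _ _ gs' 1 (fun i w => \sum_(j < i) T mu j w); last by exists G.
  - by apply: Lim_ext (Lim0 gs' 1) => w; rewrite big_ord0.
  - apply: Lim_ext (Lim_le _ (hT mu i)) => [w|]; first by rewrite big_ord_recr /=; ring.
    by rewrite ge_max; apply/andP; split; lia.
  exact: bgs'.
pose Fi i := undup (Fs0 ++ Yn i).
exists (Fi 0%N), (fun mu w => if mu \in Fs0 then G0 mu w else 0); split=> [|mu|w].
- exact: undup_uniq.
- by case: (mu \in Fs0); [case: (hG0 mu)|exact: Lim0].
apply/subr0_eq/V_all => n.
have mFi i nu : (nu \in Fi i) = (nu \in Fs0) || (nu \in Yn i) by rewrite mem_undup mem_cat.
have eFi i : \sum_(nu <- Fi i) Phi nu w * ym nu w = \sum_(nu <- Fi 0%N) Phi nu w * ym nu w +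
   \sum_(mu <- Fs0) Phi mu w * (\sum_(j < i) T mu j w).
  elim: i => [|i IH].
    by rewrite [X in _ + X]big1 ?addr0 // => mu _; rewrite big_ord0 mulr0.
  have pe : perm_eq (Fi i.+1) (Fi i ++ new i).
    apply: uniq_perm; first exact: undup_uniq.
      rewrite cat_uniq undup_uniq filter_uniq ?undup_uniq // andbT /=; apply/hasPn => nu.
      by rewrite mem_filter => /andP[/andP[h1 h2] _]; rewrite /= mFi negb_or h1 h2.
    move=> nu; rewrite mFi mem_cat mFi mem_filter.
    case: (boolP (nu \in Fs0)) => //= _; case: (boolP (nu \in Yn i)) => h /=; rewrite ?(sYn _ _ h) ?andbT ?andbF ?orbF //.
  rewrite (perm_big _ pe) big_cat /= IH -addrA; congr (_ + _).
  have -> : \sum_(nu <- new i) Phi nu w * ym nu w = \sum_(mu <- Fs0) Phi mu w * T mu i w.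
    rewrite /T; under [RHS]eq_bigr => mu _ do rewrite mulr_sumr.
    rewrite exchange_big /= big_seq [RHS]big_seq; apply: eq_bigr => nu.
    rewrite mem_filter => /andP[/andP[h _] _]; have [_ ->] := hhP (i, nu) h.
    by rewrite mulr_suml; apply: eq_bigr => mu _; rewrite mulrA.
  by rewrite -big_split; apply: eq_bigr => mu _; rewrite big_ord_recr /= mulrDr.
pose i := (n + `|k0|)%N.
have sub : {subset YN (C' + 1 + i)%N <= Fi i} by move=> nu h; rewrite mem_undup mem_cat h orbT.
have := approx _ (Fi i) w (undup_uniq _) sub; rewrite eFi => h.
apply: (Vtrans (y := \sum_(nu <- Fi 0%N) Phi nu w * ym nu w + \sum_(mu <- Fs0) Phi mu w * (\sum_(j < i) T mu j w))).
  by apply: Vle h; rewrite /i; lia.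
under [X in _ - X]eq_bigr => mu _ do rewrite mulrDr.
rewrite big_split /= opprD addrACA subrr add0r.
have -> : \sum_(mu <- Fi 0%N) Phi mu w * (if mu \in Fs0 then G0 mu w else 0) = \sum_(mu <- Fs0) Phi mu w * G0 mu w.
  have -> : \sum_(mu <- Fs0) Phi mu w * G0 mu w = \sum_(mu <- Fi 0%N | mu \in Fs0) Phi mu w * G0 mu w.
    rewrite -[RHS]big_filter; apply: perm_big; apply: uniq_perm; rewrite ?filter_uniq ?undup_uniq //.
    by move=> mu; rewrite mem_filter mFi; case: (mu \in Fs0).
  by rewrite [RHS]big_mkcond; apply: eq_bigr => mu _; case: (mu \in Fs0); rewrite ?mulr0.
rewrite -sumrB; apply: V_sum => mu _; rewrite -mulrBr -VN -mulrN opprB.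
have [_ h1] := hG0 mu; have := VM (Lim_V bgs (LPhi mu) w) (h1 i w).
by apply: Vle; rewrite /i; lia.
Qed.

End Noether.

(** * Weierstrass division *)

Section Weier.
Variable K : padic_field.
Variable I : Type.
Local Notation Om := (I * (nat -> K))%type.
Implicit Types (ts : seq (I -> K)) (n : nat) (F G H : Om -> K) (p q r : Om -> {poly K}).

(** Coordinates are retracted to R, so that series are total functions and no domain has to be
    carried along. *)
Definition clip (z : K) : K := if V 0 z then z else 0.

Lemma V_clip z : V 0 (clip z).
Proof. by rewrite /clip; case: ifP => // _; rewrite V0. Qed.

Lemma clipE z : V 0 z -> clip z = z.
Proof. by rewrite /clip => ->. Qed.

Definition yv (i : nat) (w : Om) : K := clip (w.2 i).

Definition gens ts n : seq (Om -> K) :=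
  [seq (fun w : Om => t w.1) | t <- ts] ++ [seq yv i | i <- iota 0 n].

Lemma In_map (T T' : Type) (f : T -> T') (s : seq T) b : List.In b [seq f i | i <- s] <-> exists2 a, List.In a s & f a = b.
Proof.
elim: s => [|a s IH] /=; first by split=> // -[].
split=> [[<-|/IH[a' h1 h2]]|[a' [->|h1] h2]].
- by exists a; [left|].
- by exists a'; [right|].
- by left.
by right; apply/IH; exists a'.
Qed.

Lemma In_cat (T : Type) (s s' : seq T) b : List.In b (s ++ s') <-> List.In b s \/ List.In b s'.
Proof.
elim: s => [|a s IH] /=; first by split=> [|[]] //; right.
by rewrite IH; split=> [[?|[?|?]]|[[?|?]|?]]; tauto.
Qed.

Lemma In_mem (T : eqType) (s : seq T) b : List.In b s <-> b \in s.
Proof.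
elim: s => [|a s IH] //=; rewrite inE; split=> [[->|/IH ->]|/orP[/eqP->|/IH]]; rewrite ?eqxx ?orbT //; by [left|right].
Qed.

Lemma gensP ts n g : List.In g (gens ts n) <->
  (exists2 t, List.In t ts & g = fun w => t w.1) \/ (exists2 i, (i < n)%N & g = yv i).
Proof.
rewrite /gens In_cat !In_map; split=> [[[t h <-]|[i]]|[[t h ->]|[i h ->]]].
- by left; exists t.
- by rewrite In_mem mem_iota => h <-; right; exists i.
- by left; exists t.
by right; exists i => //; rewrite In_mem mem_iota.
Qed.

Definition Rv ts := forall t, List.In t ts -> forall x, V 0 (t x).

Lemma bdd_gens ts n : Rv ts -> bdd (gens ts n).
Proof. by move=> h g /gensP[[t ht ->]|[i _ ->]] w; [apply: h|apply: V_clip]. Qed.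

Lemma gens_mono ts ts' n n' : (forall t, List.In t ts -> List.In t ts') -> (n <= n')%N ->
  forall g, List.In g (gens ts n) -> List.In g (gens ts' n').
Proof.
move=> h le g /gensP[[t ht ->]|[i hi ->]]; apply/gensP; first by left; exists t => //; apply: h.
by right; exists i => //; apply: leq_trans le.
Qed.

Variables (ts : seq (I -> K)) (n : nat).
Hypothesis hts : Rv ts.
Let gn := gens ts n.
Let gn1 := gens ts n.+1.
Let bn : bdd gn. Proof. exact: bdd_gens. Qed.
Let bn1 : bdd gn1. Proof. exact: bdd_gens. Qed.
Let sn : forall g, List.In g gn -> List.In g gn1. Proof. exact: gens_mono. Qed.
Let y : Om -> K := yv n.
Let Ly : Lim gn1 0 y. Proof. by apply: Lim_gen; apply/gensP; right; exists n. Qed.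

Definition coefL (k : int) p := forall j, Lim gn k (fun w => (p w)`_j).

Lemma coefL_add k p q : coefL k p -> coefL k q -> coefL k (fun w => p w + q w).
Proof. by move=> h h' j; apply: Lim_ext (Lim_add (h j) (h' j)) => w; rewrite coefD. Qed.

Lemma coefL_mul k l p q : coefL k p -> coefL l q -> coefL (k + l) (fun w => p w * q w).
Proof.
move=> h h' j.
apply: Lim_ext (Lim_sum (index_enum 'I_j.+1) (P := xpredT) (fun i _ => Lim_mul bn (h i) (h' (j - i)%N))) => w.
by rewrite coefM.
Qed.

Lemma coefL_C k F : Lim gn k F -> coefL k (fun w => (F w)%:P).
Proof.
move=> h [|j]; first by apply: Lim_ext h => w; rewrite coefC.
by apply: Lim_ext (Lim0 gn k) => w; rewrite coefC.
Qed.

Lemma coefL_Xn (d : nat) : coefL 0 (fun w => 'X^d).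
Proof. by move=> j; apply: Lim_cst; rewrite coefXn; case: (j == d); rewrite ?V1 ?V0. Qed.

Lemma coefL0 k : coefL k (fun w => 0).
Proof. by move=> j; apply: Lim_ext (Lim0 gn k) => w; rewrite coef0. Qed.

Lemma coefL_sum k (T : Type) (s : seq T) (P : pred T) (f : T -> Om -> {poly K}) :
  (forall i, P i -> coefL k (f i)) -> coefL k (fun w => \sum_(i <- s | P i) f i w).
Proof.
by move=> h j; apply: Lim_ext (Lim_sum s (fun i Pi => h i Pi j)) => w; rewrite coef_sum.
Qed.

Lemma coefL_horner k (d : nat) p : (forall w, (size (p w) <= d)%N) -> coefL k p -> Lim gn1 k (fun w => (p w).[y w]).
Proof.
move=> sp hp.
apply: Lim_ext (Lim_sum (index_enum 'I_d) (P := xpredT) (fun i _ => Lim_mul0 (l := 0) bn1 _ (Lim_mono sn (hp i)) (Lim_exp i bn1 Ly))) => [w|i]; last by rewrite addr0.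
by rewrite (horner_coef_wide _ (sp w)).
Qed.

Lemma Poly_y k G : Poly gn1 k G -> exists d r, [/\ forall w, (size (r w) <= d)%N,
  forall j, Poly gn k (fun w => (r w)`_j) & forall w, G w = (r w).[y w]].
Proof.
elim=> {k G} [k c hc|g /gensP[[t ht ->]|[i hi ->]]|k G1 G2 _ [d [r [h1 h2 h3]]] _ [d' [r' [h1' h2' h3']]]|k l G1 G2 _ [d [r [h1 h2 h3]]] _ [d' [r' [h1' h2' h3']]]|k l G le _ [d [r [h1 h2 h3]]]].
- exists 1%N, (fun _ => c%:P); split=> [w|j|w]; [exact: size_polyC_leq1| |by rewrite hornerC].
  by apply: Poly_cst; rewrite coefC; case: (j == 0%N); rewrite ?V0.
- exists 1%N, (fun w => (t w.1)%:P); split=> [w|[|j]|w]; [exact: size_polyC_leq1| | |by rewrite hornerC].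
    apply: Poly_ext (Poly_gen _) => [w|]; first by rewrite coefC.
    by apply/gensP; left; exists t.
  by apply: Poly_ext (Poly0 gn 0) => w; rewrite coefC.
- case: (eqVneq i n) => [->|ne].
    exists 2%N, (fun w => 'X); split=> [w|j|w]; [by rewrite size_polyX| |by rewrite hornerX].
    by apply: Poly_cst; rewrite coefX; case: (j == 1%N); rewrite ?V0 ?V1.
  exists 1%N, (fun w => (yv i w)%:P); split=> [w|[|j]|w]; [exact: size_polyC_leq1| | |by rewrite hornerC].
    apply: Poly_ext (Poly_gen (g := yv i) _) => [w|]; first by rewrite coefC.
    by apply/gensP; right; exists i => //; lia.
  by apply: Poly_ext (Poly0 gn 0) => w; rewrite coefC.
- exists (maxn d d'), (fun w => r w + r' w); split=> [w|j|w]; last by rewrite hornerD h3 h3'.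
    by apply: leq_trans (size_polyD _ _) _; move: (h1 w) (h1' w); lia.
  by apply: Poly_ext (Poly_add (h2 j) (h2' j)) => w; rewrite coefD.
- exists (d + d')%N, (fun w => r w * r' w); split=> [w|j|w]; last by rewrite hornerM h3 h3'.
    by apply: leq_trans (size_polyMleq _ _) _; move: (h1 w) (h1' w); lia.
  apply: Poly_ext (Poly_sum (index_enum 'I_j.+1) (P := xpredT) (fun i _ => Poly_mul (h2 i) (h2' (j - i)%N))) => w.
  by rewrite coefM.
by exists d, r; split=> // j; apply: Poly_le le (h2 j).
Qed.

Variables (d : nat) (p : Om -> {poly K}).
Hypotheses (mp : forall w, (p w) \is monic) (sp : forall w, size (p w) = d.+1) (cp : coefL 0 p).

Lemma divpoly k D r : (forall w, (size (r w) <= d + D)%N) -> coefL k r -> exists q r',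
  [/\ coefL k q, coefL k r', forall w, (size (q w) <= D)%N, forall w, (size (r' w) <= d)%N & forall w, r w = q w * p w + r' w].
Proof.
elim: D r => [|D IH] r sr cr.
  exists (fun _ => 0), r; split=> // [|w|w|w]; [exact: coefL0|by rewrite size_poly0|by rewrite -(addn0 d)|by rewrite mul0r add0r].
pose a w : {poly K} := ((r w)`_(d + D))%:P * 'X^D.
have ca : coefL k a by rewrite -[k]addr0; apply: coefL_mul; [apply: coefL_C|exact: coefL_Xn].
pose r1 w := \poly_(j < d + D) (r w - a w * p w)`_j.
have e1 w : r1 w = r w - a w * p w.
  apply/polyP => j; rewrite coef_poly; case: ltnP => // h.
  have lcp : (p w)`_d = 1 by have := monicP (mp w); rewrite lead_coefE sp.
  rewrite coefB /a -mulrA coefCM coefXnM.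
  have -> : (j < D)%N = false by lia.
  case: (eqVneq j (d + D)%N) => [->|jn]; first by rewrite addnK lcp mulr1 subrr.
  have -> : (r w)`_j = 0 by apply: nth_default; apply: leq_trans (sr w) _; lia.
  have -> : (p w)`_(j - D) = 0 by apply: nth_default; rewrite sp; lia.
  by rewrite mulr0 subrr.
have cr1 : coefL k r1.
  have cN1 : coefL 0 (fun _ => (-1)%:P) by apply: coefL_C; apply: Lim_cst; rewrite VN V1.
  have h1 := coefL_mul cN1 (coefL_mul ca cp); rewrite add0r addr0 in h1.
  have h2 := coefL_add cr h1.
  by move=> j; apply: Lim_ext (h2 j) => w; rewrite e1 polyCN mulNr mul1r.
have [q [r' [h1 h2 h3 h4 h5]]] := IH r1 (fun w => size_poly _ _) cr1.
exists (fun w => q w + a w), r'; split=> // [|w|w]; first exact: coefL_add.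
  apply: leq_trans (size_polyD _ _) _; rewrite geq_max (leq_trans (h3 w)) //=.
  by rewrite /a mul_polyC; apply: leq_trans (size_scale_leq _ _) _; rewrite size_polyXn.
by rewrite mulrDl addrAC -h5 e1 subrK.
Qed.

Let Pv w := (p w).[y w].

Let LPv : Lim gn1 0 Pv.
Proof. by apply: (coefL_horner (d := d.+1)) => // w; rewrite sp. Qed.

Lemma div_P k G : Poly gn1 k G -> exists (q : Om -> K) r',
  [/\ Lim gn1 k q, coefL k r', forall w, (size (r' w) <= d)%N & forall w, G w = q w * Pv w + (r' w).[y w]].
Proof.
move=> /Poly_y[D [r [h1 h2 h3]]].
have h1' w : (size (r w) <= d + D)%N by apply: leq_trans (h1 w) _; rewrite leq_addl.
have [q [r' [a1 a2 a3 a4 a5]]] := divpoly h1' (fun j => Lim_Poly (h2 j)).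
exists (fun w => (q w).[y w]), r'; split=> // [|w]; first exact: (coefL_horner a3 a1).
by rewrite h3 a5 hornerD hornerM.
Qed.

(** Division by a monic polynomial with integral coefficients loses no precision, so it passes to
    limits. *)
Lemma div_Lim k G : Lim gn1 k G -> exists (q : Om -> K) r',
  [/\ Lim gn1 k q, coefL k r', forall w, (size (r' w) <= d)%N & forall w, G w = q w * Pv w + (r' w).[y w]].
Proof.
move=> /Lim_shift[P [h1 h2 h3]].
have [q0 [r0 [a1 a2 a3 a4]]] := div_P (h1 0%N).
have /choice[qr hqr] : forall j : nat, exists x : (Om -> K) * (Om -> {poly K}),
    [/\ Lim gn1 (Num.max k j%:Z) x.1, coefL (Num.max k j%:Z) x.2, forall w, (size (x.2 w) <= d)%N &
        forall w, P j.+1 w - P j w = x.1 w * Pv w + (x.2 w).[y w]].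
  by move=> j; have [q [r' h]] := div_P (h2 j); exists (q, r').
pose FF i w := q0 w + \sum_(j < i) (qr j).1 w.
have [|i||q hq1 hq2] := @Lim_limit _ _ gn1 k FF.
- by apply: Lim_ext a1 => w; rewrite /FF big_ord0 addr0.
- have [h _ _ _] := hqr i; apply: Lim_ext h => w.
  by rewrite /FF big_ord_recr /=; ring.
- exact: bn1.
pose RR l i w := (r0 w)`_l + \sum_(j < i) ((qr j).2 w)`_l.
have /choice[R hR] : forall l : nat, exists R : Om -> K, Lim gn k R /\ forall (i : nat) w, V i%:Z (R w - RR l i w).
  move=> l; have [|i||R h h'] := @Lim_limit _ _ gn k (RR l); last by exists R.
  - by apply: Lim_ext (a2 l) => w; rewrite /RR big_ord0 addr0.
  - have [_ h _ _] := hqr i; apply: Lim_ext (h l) => w.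
    by rewrite /RR big_ord_recr /=; ring.
  - exact: bn.
pose r' w := \poly_(l < d) R l w.
exists q, r'; split=> // [l|w|w].
- case: (ltnP l d) => h.
    by apply: Lim_ext (hR l).1 => w; rewrite coef_poly h.
  by apply: Lim_ext (Lim0 gn k) => w; rewrite coef_poly ltnNge h.
- exact: size_poly.
apply/subr0_eq/V_all => N.
have eN : P N w = FF N w * Pv w + \sum_(l < d) RR l N w * y w ^+ l.
  have -> : P N w = P 0%N w + \sum_(i < N) (P i.+1 w - P i w).
    elim: (N) => [|m IH]; first by rewrite big_ord0 addr0.
    by rewrite big_ord_recr /= addrA -IH addrC subrK.
  have -> : \sum_(i < N) (P i.+1 w - P i w) = \sum_(i < N) ((qr i).1 w * Pv w + \sum_(l < d) ((qr i).2 w)`_l * y w ^+ l).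
    apply: eq_bigr => i _; have [_ _ h h'] := hqr i; rewrite h'; congr (_ + _).
    by rewrite (horner_coef_wide _ (h w)).
  rewrite a4 (horner_coef_wide _ (a3 w)) big_split /= /FF /RR mulrDl mulr_suml.
  under [X in _ = _ + X]eq_bigr => l _ do rewrite mulrDl mulr_suml.
  by rewrite big_split /= [X in _ = _ + (_ + X)]exchange_big /=; ring.
apply: (Vtrans (y := P N w)) => //; rewrite eN horner_poly opprD addrACA; apply: VD.
  by rewrite -mulrBl -opprB mulNr VN; apply: VMl; [exact: hq2|exact: Lim_V bn1 LPv w].
rewrite -sumrB; apply: V_sum => l _; rewrite -mulrBl -opprB mulNr VN; apply: VMl; first exact: (hR l).2.
by apply: VX; exact: V_clip.
Qed.

Variable H' : Om -> K.
Hypothesis LH' : Lim gn1 0 H'.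

(** Preparation: up to a unit congruent to 1, a monic polynomial perturbed by a multiple of the
    uniformizer is again a monic polynomial in the last variable. *)
Lemma weierstrass : exists (Q : Om -> K) r',
  [/\ Lim gn1 0 Q, forall w, V 1 (Q w - 1), coefL 0 r', forall w, (size (r' w) <= d)%N &
      forall w, (Pv w + unif K * H' w) * Q w = Pv w + (r' w).[y w]].
Proof.
have Vpi : V 1 (unif K) by rewrite V_ord // ord_unif.
have /choice[qr hqr] : forall x : int * (Om -> K), exists z : (Om -> K) * (Om -> {poly K}), Lim gn1 x.1 x.2 ->
    [/\ Lim gn1 x.1 z.1, coefL x.1 z.2, forall w, (size (z.2 w) <= d)%N &
        forall w, x.2 w = z.1 w * Pv w + (z.2 w).[y w]].
  move=> [k G] /=; case: (pselect (Lim gn1 k G)) => h; last by exists (fun _ => 0, fun _ => 0).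
  by have [q [r' h']] := div_Lim h; exists (q, r').
(* Successive errors. Dividing the current error by the polynomial gives a quotient q and a
   remainder; subtracting q from the unit leaves the error [- pi * q * H'], whose order is larger by
   one. *)
pose E := fix E (i : nat) : Om -> K := if i is i'.+1 then fun w => - (unif K * ((qr (i'.+1%:Z, E i')).1 w * H' w)) else fun w => unif K * H' w.
pose q (i : nat) := (qr (i.+1%:Z, E i)).1; pose rr (i : nat) := (qr (i.+1%:Z, E i)).2.
have hE (i : nat) : Lim gn1 i.+1%:Z (E i).
  elim: i => [|i IH].
    exact: (Lim_mul0 (k := 1) (l := 0) bn1 _ (Lim_cst gn1 Vpi) LH').
  have [h _ _ _] := hqr (i.+1%:Z, E i) IH.
  apply: (Lim_opp bn1); apply: (Lim_mul0 (k := 1) (l := i.+1%:Z) bn1 _ (Lim_cst gn1 Vpi)); first by lia.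
  by apply: (Lim_mul0 (l := 0) bn1 _ h LH'); rewrite addr0.
have hq (i : nat) := hqr (i.+1%:Z, E i) (hE i).
pose FF (i : nat) w := 1 - \sum_(j < i) q j w.
have [|i||Q hQ1 hQ2] := @Lim_limit _ _ gn1 0 FF.
- by apply: Lim_ext (Lim_cst gn1 (V1 K)) => w; rewrite /FF big_ord0 subr0.
- have [h _ _ _] := hq i; apply: Lim_ext (Lim_le _ (Lim_opp bn1 h)) => [w|]; last by rewrite ge_max /=; lia.
  by rewrite /FF big_ord_recr /= /q; ring.
- exact: bn1.
pose RR l (i : nat) w := \sum_(j < i) (rr j w)`_l.
have /choice[R hR] : forall l : nat, exists R : Om -> K, Lim gn 0 R /\ forall (i : nat) w, V i%:Z (R w - RR l i w).
  move=> l; have [|i||R h h'] := @Lim_limit _ _ gn 0 (RR l); last by exists R.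
  - by apply: Lim_ext (Lim0 gn 0) => w; rewrite /RR big_ord0.
  - have [_ h _ _] := hq i; apply: Lim_ext (Lim_le _ (h l)) => [w|]; last by rewrite ge_max /=; lia.
    by rewrite /RR big_ord_recr /=; ring.
  - exact: bn.
pose r' w := \poly_(l < d) R l w.
have qV (j : nat) w : V j.+1%:Z (q j w) by have [h _ _ _] := hq j; apply: Lim_V bn1 h w.
exists Q, r'; split=> // [w|l|w|w].
- have := hQ2 1%N w => h; rewrite -(subrK (FF 1%N w) (Q w)) -addrA; apply: VD => //.
  by rewrite /FF big_ord_recr big_ord0 /= add0r addrAC subrr add0r VN; exact: (qV 0%N).
- case: (ltnP l d) => h.
    by apply: Lim_ext (hR l).1 => w; rewrite coef_poly h.
  by apply: Lim_ext (Lim0 gn 0) => w; rewrite coef_poly ltnNge h.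
- exact: size_poly.
apply/subr0_eq/V_all => N; set Hw := Pv w + _.
have hHw : V 0 Hw.
  apply: VD; first exact: Lim_V bn1 LPv w.
  by have := VM Vpi (Lim_V bn1 LH' w); apply: Vle.
have eN : Hw * FF N w = Pv w + \sum_(l < d) RR l N w * y w ^+ l + E N w.
  elim: (N) => [|m IH].
    by rewrite /FF big_ord0 subr0 mulr1 [X in _ + X + _]big1 ?addr0 // => l _; rewrite /RR big_ord0 mul0r.
  have -> : FF m.+1 w = FF m w - q m w by rewrite /FF big_ord_recr /=; ring.
  rewrite mulrBr IH.
  have [_ _ h1 h2] := hq m; move: (h2 w) => /=; rewrite -/(q m w) -/(rr m w) => ->.
  under [X in _ = _ + X + _]eq_bigr => l _ do rewrite /RR big_ord_recr /= mulrDl.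
  rewrite big_split /= (horner_coef_wide _ (h1 w)) /Hw -/(q m) -/(rr m) /RR; ring.
have -> : Hw * Q w - (Pv w + (r' w).[y w]) = Hw * (Q w - FF N w) - (\sum_(l < d) (R l w - RR l N w) * y w ^+ l) + E N w.
  rewrite mulrBr eN horner_poly; under [X in _ = _ - X + _]eq_bigr => l _ do rewrite mulrBl.
  by rewrite sumrB; ring.
apply: VD; last by apply: Vle (Lim_V bn1 (hE N) w); lia.
apply: VB; first by apply: VMr.
by apply: V_sum => l _; apply: VMl; [exact: (hR l).2|apply: VX; exact: V_clip].
Qed.

End Weier.

(** * Elimination of analytic variables *)

Section Weights.

Lemma digits_inj (B : nat) (a b : nat -> nat) m : (forall i, (a i < B)%N) -> (forall i, (b i < B)%N) ->
  (\sum_(i < m) a i * B ^ i = \sum_(i < m) b i * B ^ i)%N -> forall i, (i < m)%N -> a i = b i.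
Proof.
elim: m a b => // m IH a b ha hb.
rewrite !big_ord_recl !expn0 !muln1.
have e (f : nat -> nat) : (\sum_(i < m) f (bump 0 i) * B ^ (bump 0 i) = (\sum_(i < m) f i.+1 * B ^ i) * B)%N.
  by rewrite big_distrl; apply: eq_bigr => i _; rewrite /bump /= add1n expnS; lia.
rewrite /= !e => h.
have B0 : (0 < B)%N by apply: leq_ltn_trans (ha 0%N).
have h0 : a 0%N = b 0%N.
  have hm x y : ((x + y * B) %% B = x %% B)%N by rewrite addnC modnMDl.
  by have := congr1 (fun x => x %% B)%N h; rewrite /= !hm !modn_small.
have h1 : (\sum_(i < m) a i.+1 * B ^ i = \sum_(i < m) b i.+1 * B ^ i)%N.
  apply/eqP; rewrite -(eqn_pmul2r B0); apply/eqP.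
  by move: h; rewrite h0 => /addnI.
by case=> [|i] // hi; apply: (IH (fun i => a i.+1) (fun i => b i.+1)).
Qed.

End Weights.

Section Elim.
Variable K : padic_field.
Variable I : Type.
Local Notation Om := (I * (nat -> K))%type.

(** Restricted division; the conventional value 0 off its domain keeps the class of functions
    R-valued. *)
Definition Dq (u v : I -> K) (x : I) : K := if (v x != 0) && V (ord (v x)) (u x) then u x / v x else 0.

Record closedT (T : set (I -> K)) : Prop := ClosedT {
  T_V : forall t, T t -> forall x, V 0 (t x);
  T_ser : forall ts, (forall t, List.In t ts -> T t) -> forall F, Lim ts 0 F -> T F;
  T_D : forall u v, T u -> T v -> T (Dq u v)
}.

Variable T : set (I -> K).
Hypothesis cT : closedT T.

Lemma T_cst c : V 0 c -> T (fun _ => c).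
Proof. by move=> h; apply: (T_ser cT (ts := [::])) => //; apply: Lim_cst. Qed.

Lemma T_mul s t : T s -> T t -> T (fun x => s x * t x).
Proof.
move=> hs ht; have b : bdd [:: s; t] by move=> g /= [<-|[<-|//]]; apply: (T_V cT).
apply: (T_ser cT (ts := [:: s; t])) => [g /= [<-|[<-|//]]|] //.
by apply: (Lim_mul b (k := 0) (l := 0)); apply: Lim_gen => /=; [left|right; left].
Qed.

Lemma T_add s t : T s -> T t -> T (fun x => s x + t x).
Proof.
move=> hs ht; apply: (T_ser cT (ts := [:: s; t])) => [g /= [<-|[<-|//]]|] //.
by apply: Lim_add; apply: Lim_gen => /=; [left|right; left].
Qed.

(** T consists of R-valued functions; inverting the uniformizer supplies the constants outside R
    that a [ring_set] must contain. *)
Definition TK : set (I -> K) := [set F | exists k : nat, T (fun x => unif K ^+ k * F x)].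

Lemma TK_le F (k l : nat) : (k <= l)%N -> T (fun x => unif K ^+ k * F x) -> T (fun x => unif K ^+ l * F x).
Proof.
move=> le h.
have := T_mul (T_cst (Vle (_ : 0 <= (l - k)%N%:Z) (V_pi K (l - k)))) h.
suff -> : (fun x => unif K ^+ (l - k) * (unif K ^+ k * F x)) = (fun x => unif K ^+ l * F x) by apply.
by apply/funext => x; rewrite mulrA -exprD subnK.
Qed.

Lemma TK_ring : ring_set TK.
Proof.
split=> [c|s t [k hs] [l ht]|s t [k hs] [l ht]].
- exists `|ord c|%N; apply: T_cst; case: (eqVneq c 0) => [->|c0]; first by rewrite mulr0 V0.
  by rewrite exprnP V_ord // ordM ?pin0 // ord_pi; lia.
- exists (k + l)%N; have h1 := TK_le (leq_addr l k) hs; have h2 := TK_le (leq_addl k l) ht.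
  suff -> : (fun x => unif K ^+ (k + l) * (s x + t x)) = (fun x => unif K ^+ (k + l) * s x + unif K ^+ (k + l) * t x) by apply: T_add.
  by apply/funext => x; rewrite mulrDr.
exists (k + l)%N; suff -> : (fun x => unif K ^+ (k + l) * (s x * t x)) = (fun x => unif K ^+ k * s x * (unif K ^+ l * t x)) by apply: T_mul.
by apply/funext => x; rewrite exprD; ring.
Qed.

Definition inT ts := forall t, List.In t ts -> T t.

Lemma inT_Rv ts : inT ts -> Rv ts.
Proof. by move=> h t /h ht x; apply: (T_V cT). Qed.

Definition AA n : set (Om -> K) := [set F | exists ts k, inT ts /\ Lim (gens ts n) k F].

Lemma inT_cat ts ts' : inT ts -> inT ts' -> inT (ts ++ ts').
Proof. by move=> h h' t /In_cat[/h|/h']. Qed.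

Lemma AA_ring n : ring_set (AA n).
Proof.
split=> [c|F G [ts [k [h hF]]] [ts' [k' [h' hG]]]|F G [ts [k [h hF]]] [ts' [k' [h' hG]]]].
- exists [::], (ord c); split=> //; apply: Lim_cst; exact: V_self.
- exists (ts ++ ts'), (Num.min k k'); split; first exact: inT_cat.
  have h1 : Lim (gens (ts ++ ts') n) k F by apply: Lim_mono hF; apply: gens_mono => // t; rewrite In_cat; left.
  have h2 : Lim (gens (ts ++ ts') n) k' G by apply: Lim_mono hG; apply: gens_mono => // t; rewrite In_cat; right.
  by apply: Lim_add; [apply: Lim_le h1|apply: Lim_le h2]; rewrite ge_min lexx ?orbT.
exists (ts ++ ts'), (k + k'); split; first exact: inT_cat.
have h1 : Lim (gens (ts ++ ts') n) k F by apply: Lim_mono hF; apply: gens_mono => // t; rewrite In_cat; left.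
have h2 : Lim (gens (ts ++ ts') n) k' G by apply: Lim_mono hG; apply: gens_mono => // t; rewrite In_cat; right.
by apply: Lim_mul => //; apply: bdd_gens; apply: inT_Rv; apply: inT_cat.
Qed.

Lemma AA_mono n n' : (n <= n')%N -> AA n `<=` AA n'.
Proof.
move=> le F [ts [k [h hF]]]; exists ts, k; split=> //; apply: Lim_mono hF; exact: gens_mono.
Qed.

Lemma Lim_inv (Om' : Type) (gs : seq (Om' -> K)) k F w w' : Lim gs k F -> (forall g, List.In g gs -> g w = g w') -> F w = F w'.
Proof.
move=> [P [h1 _ h3]] hg.
have hP l G : Poly gs l G -> G w = G w'.
  by elim=> {l G} // [l' G1 G2 _ e1 _ e2|l' l2 G1 G2 _ e1 _ e2]; rewrite e1 e2.
apply/subr0_eq/V_all => N; apply: (Vtrans (h3 N w)).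
by rewrite (hP _ _ (h1 N)) VBC.
Qed.

Lemma AA_inv n F x (y y' : nat -> K) : AA n F -> (forall i, (i < n)%N -> clip (y i) = clip (y' i)) -> F (x, y) = F (x, y').
Proof.
move=> [ts [k [h hF]]] hy; apply: Lim_inv hF _ => g /gensP[[t _ ->]|[i hi ->]] //; exact: hy.
Qed.

Section Step.
Variable n : nat.

(* The change of variables y_i := y_i + y_n ^ (B ^ i.+1), i < n, makes series
   regular in y_n once B exceeds the exponents of their dominant monomials. *)
Definition Dex (B i : nat) : nat := (if i < n then B ^ i.+1 else 1)%N.
Definition sig (B : nat) (w : Om) : Om :=
  (w.1, fun i => if (i < n)%N then clip (w.2 i) + clip (w.2 n) ^+ Dex B i else w.2 i).

Lemma yv_sig B w i : yv i (sig B w) = if (i < n)%N then yv i w + yv n w ^+ Dex B i else yv i w.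
Proof.
rewrite /yv /sig /=; case: ifP => // h.
by apply: clipE; apply: VD; [exact: V_clip|apply: VX; exact: V_clip].
Qed.

Local Notation Y := (multinom n.+1).
Definition ymon (nu : Y) (w : Om) : K := \prod_(i < n.+1) yv i w ^+ nu i.

Lemma ymonD nu mu w : ymon (mnm_add nu mu) w = ymon nu w * ymon mu w.
Proof. by rewrite /ymon -big_split; apply: eq_bigr => i _; rewrite mnmDE exprD. Qed.

Lemma Poly_ymon ts nu : Poly (gens ts n.+1) 0 (ymon nu).
Proof.
rewrite /ymon; elim: (index_enum _) => [|i s IH].
  by apply: Poly_ext (Poly_cst _ (V1 K)) => w; rewrite big_nil.
have h : Poly (gens ts n.+1) 0 (fun w => yv i w ^+ nu i).
  by apply: Poly_exp; apply: Poly_gen; apply/gensP; right; exists i.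
by apply: Poly_ext (Poly_mul h IH) => w; rewrite big_cons.
Qed.

(** The degree in the last variable that the monomial [nu] acquires under [sig B]. Exponents below B
    are digits of the weight in base B, so distinct monomials get distinct degrees. *)
Definition wt (B : nat) (nu : Y) : nat := (\sum_(i < n.+1) nu i * Dex B i)%N.

Lemma wt_inj B (nu mu : Y) : (forall i, (nu i < B)%N) -> (forall i, (mu i < B)%N) -> wt B nu = wt B mu -> nu = mu.
Proof.
move=> h1 h2.
pose a (nu : Y) (j : nat) : nat := if j is j'.+1 then nu (inord j') else nu ord_max.
have e (nu' : Y) : wt B nu' = (\sum_(j < n.+1) a nu' j * B ^ j)%N.
  rewrite /wt big_ord_recr /= big_ord_recl /= expn0 muln1 addnC; congr (_ + _)%N.
    by rewrite /Dex ltnn muln1.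
  apply: eq_bigr => i _; rewrite /Dex /= ltn_ord /bump /= add1n; congr (nu' _ * _)%N.
  by apply: val_inj; rewrite /= inordK //; have := ltn_ord i; lia.
rewrite !e => /digits_inj h; have {}h : forall j, (j < n.+1)%N -> a nu j = a mu j.
  by apply: h => -[|j] /=.
apply/mnmP => i; case: (ltnP i n) => hi.
  by have := h i.+1 (hi : (i.+1 < n.+1)%N); rewrite /a inord_val.
have -> : i = ord_max by apply: val_inj => /=; have := ltn_ord i; lia.
exact: (h 0%N).
Qed.

Definition pmon (B : nat) (nu : Y) (w : Om) : {poly K} :=
  \prod_(i < n.+1) ((if (i < n)%N then (yv i w)%:P + 'X^(Dex B i) else 'X) ^+ nu i).

Lemma pmonE B nu w : (pmon B nu w).[yv n w] = ymon nu (sig B w).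
Proof.
rewrite /pmon /ymon horner_prod; apply: eq_bigr => i _; rewrite horner_exp yv_sig.
case: ifP => h; first by rewrite hornerD hornerC hornerXn.
by rewrite hornerX; congr (yv _ w ^+ _); have := ltn_ord i; lia.
Qed.

Lemma pmon_base (B : nat) (i : 'I_n.+1) (w : Om) : (0 < B)%N ->
  let q := (if (i < n)%N then (yv i w)%:P + 'X^(Dex B i) else 'X) : {poly K} in q \is monic /\ size q = (Dex B i).+1.
Proof.
move=> B0; rewrite /=; case: ifP => h; last by rewrite monicX size_polyX /Dex h.
have D0 : (0 < Dex B i)%N by rewrite /Dex h expn_gt0 B0.
have sz : (size ((yv i w)%:P : {poly K}) < size ('X^(Dex B i) : {poly K}))%N.
  by rewrite size_polyXn ltnS; apply: leq_trans (size_polyC_leq1 _) _.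
split; last by rewrite addrC size_polyDl // size_polyXn.
by rewrite monicE addrC lead_coefDl // lead_coefXn.
Qed.

Lemma pmon_monic B nu w : (0 < B)%N -> pmon B nu w \is monic /\ size (pmon B nu w) = (wt B nu).+1.
Proof.
move=> B0; have hm (i : 'I_n.+1) := (pmon_base i w B0).
have hm1 : pmon B nu w \is monic.
  by apply: monic_prod => i _; apply: monic_exp; case: (hm i).
split=> //; rewrite /pmon size_prod; last first.
  by move=> i _; rewrite expf_neq0 // monic_neq0 //; case: (hm i).
rewrite -sum1_card /wt.
have e (i : 'I_n.+1) : size ((if (i < n)%N then (yv i w)%:P + 'X^(Dex B i) else 'X : {poly K}) ^+ nu i) = (nu i * Dex B i + 1)%N.
  have [m1 s1] := hm i; rewrite -[LHS]prednK; first by rewrite size_exp s1 /= mulnC addn1.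
  by rewrite lt0n size_poly_eq0 expf_neq0 // monic_neq0.
rewrite (eq_bigr _ (fun i _ => e i)) big_split /=.
rewrite [X in (_ - X)%N](_ : _ = \sum_(i < n.+1) 1)%N; last exact: eq_bigl.
by rewrite subSn ?leq_addl // addnK.
Qed.

Lemma pmon_coefL ts B nu : inT ts -> coefL ts n 0 (pmon B nu).
Proof.
move=> hts; have b := inT_Rv hts.
have one : coefL ts n 0 (fun _ : Om => 1 : {poly K}).
  by move=> j; apply: Lim_cst; rewrite coef1; case: (j == 0%N); rewrite ?V0 ?V1.
have hexp (q : Om -> {poly K}) m : coefL ts n 0 q -> coefL ts n 0 (fun w => q w ^+ m).
  move=> hq; elim: m => [|m IH] j; first by apply: Lim_ext (one j) => w; rewrite expr0.
  by have := coefL_mul b hq IH j; rewrite addr0; apply: Lim_ext => w; rewrite exprS.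
rewrite /pmon; elim: (index_enum _) => [|i s IH] j.
  by apply: Lim_ext (one j) => w; rewrite big_nil.
have h : coefL ts n 0 (fun w => (if (i < n)%N then (yv i w)%:P + 'X^(Dex B i) else 'X) ^+ nu i).
  apply: hexp; case: (boolP (i < n)%N) => h; last exact: (coefL_Xn ts n 1).
  apply: coefL_add; last exact: coefL_Xn.
  by apply: coefL_C; apply: Lim_gen; apply/gensP; right; exists i.
by have := coefL_mul b h IH j; rewrite addr0; apply: Lim_ext => w; rewrite big_cons.
Qed.

Lemma Lim_sig ts k B F : inT ts -> Lim (gens ts n.+1) k F -> Lim (gens ts n.+1) k (fun w => F (sig B w)).
Proof.
move=> hts; have b := bdd_gens (n := n.+1) (inT_Rv hts).
apply: Lim_comp => // g /gensP[[t ht ->]|[i hi ->]].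
  by apply: Lim_gen; apply/gensP; left; exists t.
have hy j : (j < n.+1)%N -> Lim (gens ts n.+1) 0 (yv j).
  by move=> hj; apply: Lim_gen; apply/gensP; right; exists j.
case: (boolP (i < n)%N) => h.
  apply: Lim_ext (Lim_add (hy i hi) (Lim_exp (Dex B i) b (hy n (ltnSn n)))) => w.
  by rewrite yv_sig h.
by apply: Lim_ext (hy i hi) => w; rewrite yv_sig (negbTE h).
Qed.

(** [strong_noether] with the functions in T as one family of variables and the coordinates as the
    other: finitely many coefficients [phi mu] govern F up to the uniformizer. *)
Lemma AA_rep F : AA n.+1 F -> exists (ts : seq (I -> K)) (Fs : seq Y) (phi : Y -> I -> K) (G : Y -> Om -> K),
  [/\ inT ts, uniq Fs, forall mu, TK (phi mu), forall mu, Lim (gens ts n.+1) 1 (G mu) &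
    forall w, F w = \sum_(mu <- Fs) phi mu w.1 * (ymon mu w + G mu w)].
Proof.
move=> [ts [k [hts hF]]].
pose gs : seq (Om -> K) := [seq (fun w : Om => t w.1) | t <- ts].
have bg := bdd_gens (n := n.+1) (inT_Rv hts).
have sgs g : List.In g gs -> List.In g (gens ts n.+1) by move=> h; apply/In_cat; left.
have bgs : bdd gs by move=> g /sgs /bg.
pose mn (m : multinom (size gs) * Y) w := mon m.1 w * ymon m.2 w.
have hmn m w : V 0 (mn m w).
  by apply: VMl; [exact: (V_mon bg sgs m.1 w)|exact: Poly_V bg (Poly_ymon ts m.2) w].
have mon0 w : mon (mnm0 : multinom (size gs)) w = 1.
  by rewrite /mon big1 // => i _; rewrite mnm0E expr0.
have ymon0 w : ymon mnm0 w = 1.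
  by rewrite /ymon big1 // => i _; rewrite mnm0E expr0.
have m1 : exists x, forall w, mn x w = 1.
  by exists (mnm0, mnm0) => w; rewrite /mn mon0 ymon0 mulr1.
have mM x y : exists z, forall w, mn z w = mn x w * mn y w.
  by exists (mnm_add x.1 y.1, mnm_add x.2 y.2) => w; rewrite /mn monD ymonD mulrACA.
have mg g : List.In g (gens ts n.+1) -> exists x, forall w, mn x w = g w.
  move=> /gensP[[t ht ->]|[i hi ->]].
    have hg : List.In (fun w : Om => t w.1) gs by apply/In_map; exists t.
    have [i hi ei] := In_nth (fun _ => 0) hg.
    exists (mnm1 (Ordinal hi), mnm0) => w; rewrite /mn ymon0 mulr1 /mon (bigD1 (Ordinal hi)) //= big1 ?mulr1.
      by rewrite mnm1E eqxx expr1 ei.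
    by move=> j /negbTE hj; rewrite mnm1E eq_sym hj expr0.
  exists (mnm0, mnm1 (Ordinal hi)) => w; rewrite /mn mon0 mul1r /ymon (bigD1 (Ordinal hi)) //= big1 ?mulr1.
    by rewrite mnm1E eqxx expr1.
  by move=> j /negbTE hj; rewrite mnm1E eq_sym hj expr0.
have [c hc hk] := Lim_rep hmn m1 mM mg hF.
have [Phi hPhi] := Phi_ex bg sgs hc.
have [Fs [G [h1 h2 h3]]] := strong_noether bg sgs (Poly_ymon ts) hk hc hPhi.
have LPhi mu : Lim gs k (Phi mu) by apply: (rep_Lim (@Poly_mon _ _ gs) (hPhi mu)).
exists ts, Fs, (fun mu x => Phi mu (x, fun _ => 0)), G; split=> // [mu|w].
  have h : Lim ts k (fun x => Phi mu (x, fun _ => 0)).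
    apply: (Lim_comp _ _ (LPhi mu)); first by move=> t ht x; apply: inT_Rv hts t ht x.
    by move=> g /In_map[t ht <-]; apply: Lim_gen.
  exists `|k|%N; apply: (T_ser cT hts).
  have bt : bdd ts by move=> t ht x; apply: inT_Rv hts t ht x.
  by apply: (Lim_mul0 bt _ (Lim_cst ts (V_pi K `|k|%N)) h); lia.
rewrite h3; apply: eq_bigr => mu _; congr (_ * _).
by apply: Lim_inv (LPhi mu) _ => g /In_map[t ht <-].
Qed.

Definition FF' : set (Om -> K) := adjoin (AA n) (yv n).

Lemma AA_FF' : AA n `<=` FF'. Proof. exact: adjoin_sub (AA_ring n). Qed.

Lemma coefL_FF' ts k d (p : Om -> {poly K}) : inT ts -> (forall w, (size (p w) <= d)%N) -> coefL ts n k p ->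
  FF' (fun w => (p w).[yv n w]).
Proof. by move=> hts sp hp; exists d, p; split=> //; split=> // j; exists ts, k. Qed.

Lemma TK_FF' f : TK f -> FF' (fun w => f w.1).
Proof.
move=> [k hk]; apply: AA_FF'; exists [:: (fun x => unif K ^+ k * f x)], (- k%:Z); split.
  by move=> t /= [<-|//].
have := Poly_mul0 (m := - k%:Z) (l := 0) _ (Poly_cst (gens [:: (fun x => unif K ^+ k * f x)] n) (V_self (unif K ^ (- k%:Z)))) (Poly_gen (g := fun w => unif K ^+ k * f w.1) _).
move=> h; apply: Lim_ext (Lim_Poly (h _ _)) => [w||].
- by rewrite mulrA exprnP -expfzDr ?unifn0 // addNr expr0z mul1r.
- by rewrite ord_pi addr0.
by apply/gensP; left; exists (fun x => unif K ^+ k * f x) => //=; left.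
Qed.

(** The space is cut according to the dominant [phi mu], ties being broken by weight. Dividing by it
    leaves, modulo the uniformizer, a polynomial in the last variable that is monic, its degree
    being the weight of the dominant monomial; preparation then applies. *)
Lemma prep_f F : AA n.+1 F -> exists B0, forall B, (B0 <= B)%N -> forall N, mr FF' (@T0 Om) N (fun w _ => F (sig B w)).
Proof.
move=> /AA_rep[ts [Fs [phi [G [hts uF hphi hG hF]]]]].
pose B0 := (\sum_(mu <- Fs) \sum_(i < n.+1) mu i).+1.
exists B0 => B hB N.
have B1 : (0 < B)%N by apply: leq_trans hB.
have hdig mu i : mu \in Fs -> (mu i < B)%N.
  move=> hm; apply: leq_trans hB; rewrite ltnS (bigD1_seq mu) //= (bigD1 i) //=; lia.
have winj mu nu : mu \in Fs -> nu \in Fs -> wt B mu = wt B nu -> mu = nu.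
  by move=> h1 h2; apply: wt_inj => i; apply: hdig.
(* [Some mu]: of least order and, among those, of largest weight. [None]: all coefficients
   vanish. *)
pose CC (o : option Y) (w : Om) (e : env) : Prop := if o is Some mu then
    phi mu w.1 != 0 /\ forall nu, nu \in Fs -> phi nu w.1 != 0 -> ord (phi mu w.1) <= ord (phi nu w.1) /\
      ((wt B mu < wt B nu)%N -> ord (phi mu w.1) < ord (phi nu w.1))
  else forall mu, mu \in Fs -> phi mu w.1 = 0.
have tz mu : tame FF' (fun w (_ : env) => phi mu w.1 = 0).
  exact: (tame_zero (TK_FF' (hphi mu))).
have tnz mu : tame FF' (fun w (_ : env) => phi mu w.1 != 0).
  by apply: tame_ext (tame_not (tz mu)) => w e; split=> /eqP.
have tC o : tame FF' (CC o).
  case: o => [mu|] /=; last exact: (tame_allin (s := Fs) (fun mu _ => tz mu)).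
  apply: tame_and; first exact: tnz.
  have l nu := lin_ord (TK_FF' (hphi nu)).
  apply: (tame_allin (s := Fs) (P := fun nu w (e : env) => phi nu w.1 != 0 -> ord (phi mu w.1) <= ord (phi nu w.1) /\
      ((wt B mu < wt B nu)%N -> ord (phi mu w.1) < ord (phi nu w.1)))) => nu _.
  apply: tame_imp; first exact: tnz.
  apply: tame_and; first exact: (tame_le (l mu) (l nu)).
  apply: tame_imp; first exact: tame_const.
  apply: tame_ext (tame_le (lin_add (l mu) (lin_cst _ 1)) (l nu)) => w e; lia.
apply: (@mr_cover _ _ _ _ N _ _ (None :: [seq Some mu | mu <- Fs]) CC).
  move=> w e; split=> // _.
  case: (pselect (exists2 mu, mu \in Fs & phi mu w.1 != 0)) => [hex|hn]; last first.
    exists None; rewrite ?mem_head //= => mu hm; apply: contrapT => /eqP h; apply: hn; by exists mu.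
  pose R (a b : Y) := ord (phi a w.1) < ord (phi b w.1) \/ (ord (phi a w.1) = ord (phi b w.1) /\ (wt B b <= wt B a)%N).
  have [|x y z [h|[h h']] [h1|[h1 h1']]|mu hm [pm hb]] := @seq_best _ R (fun mu => phi mu w.1 != 0) Fs _ _ hex.
  - move=> x y; rewrite /R; case: (ltgtP (ord (phi x w.1)) (ord (phi y w.1))) => h; [by left; left|by right; left|].
    by case: (leqP (wt B x) (wt B y)) => h'; [right|left]; right; split=> //; apply: ltnW.
  - by left; lia.
  - by left; lia.
  - by left; lia.
  - by right; split; lia.
  exists (Some mu); first by rewrite inE map_f ?orbT.
  split=> // nu hn pn; case: (hb nu hn pn) => [h|[h h']]; first by split=> [|_]; lia.
  by split=> [|h'']; lia.
move=> o; rewrite inE => /orP[/eqP->|/mapP[mu0 hm0 ->]].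
  apply: (@mr_ext _ _ _ _ _ (fun _ _ => 0)); last by apply: mr_cst.
  by move=> w e /= h; rewrite hF big_seq big1 // => mu hm; rewrite h ?mul0r.
set C := CC (Some mu0).
pose sc (mu : Y) := sval (cid (hphi mu)).
have hsc mu : T (fun x => unif K ^+ sc mu * phi mu x) := svalP (cid (hphi mu)).
pose M := (\sum_(mu <- Fs) sc mu)%N.
have hT mu : mu \in Fs -> T (fun x => unif K ^+ M * phi mu x).
  by move=> hm; apply: TK_le (hsc mu); rewrite /M (bigD1_seq mu) //= leq_addr.
have piM0 : unif K ^+ M != 0 by rewrite expf_neq0 ?unifn0.
have Vpi : V 0 (unif K) by rewrite V_ord // ord_unif.
(* Heavier monomials have coefficients of strictly larger order, so their quotients keep a factor of
   the uniformizer and go into the perturbation [H']. *)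
pose hi mu := (wt B mu0 < wt B mu)%N.
pose wq mu : I -> K := if mu \in Fs then Dq (fun x => unif K ^+ M * phi mu x)
     (fun x => (if hi mu then unif K else 1) * (unif K ^+ M * phi mu0 x)) else fun _ => 0.
have hwq mu : T (wq mu).
  rewrite /wq; case: ifP => hm; last by apply: T_cst; rewrite V0.
  apply: (T_D cT); first exact: hT.
  by apply: T_mul; [apply: T_cst; case: (hi mu); rewrite ?V1|exact: hT].
have wqE mu w e : C w e -> mu \in Fs -> phi mu w.1 = phi mu0 w.1 * ((if hi mu then unif K else 1) * wq mu w.1).
  move=> [p0 hle] hm; rewrite /wq hm /Dq.
  have c0 : (if hi mu then unif K else 1 : K) != 0 by case: (hi mu); rewrite ?unifn0 ?oner_neq0.
  rewrite !mulf_neq0 //=; case: (boolP (V _ _)) => hv; last first.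
    case: (eqVneq (phi mu w.1) 0) => [->|pm]; first by rewrite !mulr0.
    move: hv => /ord_nV; rewrite !ordM ?mulf_neq0 //; have [h1 h2] := hle mu hm pm.
    move: h2 c0; rewrite /hi; case: ifP => h h2 _; rewrite ?ord_unif ?ord1; last by lia.
    by have := h2 isT; lia.
  move: (phi mu w.1) (phi mu0 w.1) (unif K ^+ M) (if _ then _ else _) p0 piM0 c0 => a b c d b0 c0 d0.
  by field; rewrite b0 c0 d0.
pose lo := [seq mu <- Fs | (wt B mu < wt B mu0)%N].
pose ts' := ts ++ [seq wq mu | mu <- Fs].
have hts' : inT ts' by apply: inT_cat => // t /In_map[mu _ <-].
have bn1 := bdd_gens (n := n.+1) (inT_Rv hts').
have s1 g : List.In g (gens ts n.+1) -> List.In g (gens ts' n.+1).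
  by apply: gens_mono => // t ht; apply/In_cat; left.
have Lw m mu : mu \in Fs -> Lim (gens ts' m) 0 (fun w => wq mu w.1).
  move=> hm; apply: Lim_gen; apply/gensP; left; exists (wq mu) => //.
  by apply/In_cat; right; apply/In_map; exists mu => //; apply/In_mem.
pose p (w : Om) := pmon B mu0 w + \sum_(mu <- lo) (if mu \in Fs then wq mu w.1 else 0)%:P * pmon B mu w.
have szlo (w : Om) : (size (\sum_(mu <- lo) (if mu \in Fs then wq mu w.1 else 0)%:P * pmon B mu w)%R < (wt B mu0).+1)%N.
  rewrite ltnS big_seq; apply: (big_ind (fun q : {poly K} => size q <= wt B mu0)%N).
  - by rewrite size_poly0.
  - by move=> q1 q2 h1 h2; apply: leq_trans (size_polyD _ _) _; rewrite geq_max h1.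
  move=> mu; rewrite mem_filter => /andP[h _]; rewrite mul_polyC.
  by apply: leq_trans (size_scale_leq _ _) _; rewrite (pmon_monic mu w B1).2.
have sp w : size (p w) = (wt B mu0).+1 by rewrite /p size_polyDl ?(pmon_monic mu0 w B1).2.
have mp w : p w \is monic.
  by rewrite monicE /p lead_coefDl ?(pmon_monic mu0 w B1).2 // -monicE (pmon_monic mu0 w B1).1.
have cp : coefL ts' n 0 p.
  apply: coefL_add; first exact: pmon_coefL.
  apply: coefL_sum => mu _; 
  suff : coefL ts' n (0 + 0) (fun w : Om => (if mu \in Fs then wq mu w.1 else 0)%:P * pmon B mu w) by rewrite addr0.
  apply: (coefL_mul (inT_Rv hts')); last exact: pmon_coefL.
  by apply: coefL_C; case: (boolP (mu \in Fs)) => hm; [exact: Lw|exact: Lim0].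
pose H' (w : Om) := \sum_(mu <- Fs) (if mu \in Fs then
    (if hi mu then wq mu w.1 * ymon mu (sig B w) else 0) +
    (if hi mu then unif K else 1) * wq mu w.1 * ((unif K)^-1 * G mu (sig B w)) else 0).
have LG mu : Lim (gens ts' n.+1) 0 (fun w => (unif K)^-1 * G mu (sig B w)).
  have h : V (-1) ((unif K)^-1) by rewrite V_ord // ordVn ?unifn0 // ord_unif.
  by apply: (Lim_mul0 (k := -1) (l := 1) bn1 _ (Lim_cst _ h) (Lim_mono s1 (Lim_sig B hts (hG mu)))).
have LH' : Lim (gens ts' n.+1) 0 H'.
  apply: Lim_sum => mu _; case: (boolP (mu \in Fs)) => hm; last exact: Lim0.
  apply: Lim_add.
    case: (hi mu); last exact: Lim0.
    apply: (Lim_mul0 (k := 0) (l := 0) bn1 _ (Lw _ mu hm)) => //.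
    exact: (Lim_sig B hts' (Lim_Poly (Poly_ymon ts' mu))).
  apply: (Lim_mul0 (k := 0) (l := 0) bn1 _ _ (LG mu)) => //.
  apply: (Lim_mul0 (k := 0) (l := 0) bn1 _ _ (Lw _ mu hm)) => //.
  by apply: Lim_cst; case: (hi mu); rewrite ?V1.
have [Q [r' [LQ VQ cr' sr' hQ]]] := weierstrass (inT_Rv hts') mp sp cp LH'.
have Fphi : FF' (fun w => phi mu0 w.1) by exact: TK_FF'.
pose pt (w : Om) := p w + r' w.
have Fpt : FF' (fun w => (pt w).[yv n w]).
  apply: (coefL_FF' (k := 0) (d := (wt B mu0).+1) hts'); last exact: coefL_add.
  move=> w; apply: leq_trans (size_polyD _ _) _; rewrite sp geq_max leqnn /=.
  by apply: leq_trans (sr' w) _.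
have Q0 w : Q w != 0 /\ ord (Q w) = 0.
  have [|h1 h2] := @ord_dom K 1 (Q w) (oner_neq0 _); first by rewrite ord1 add0r.
  by rewrite h2 ord1.
(* The unit is a series in the last variable, but a polynomial approximation already has the same
   classes. *)
have mQ : mr FF' C N (fun w _ => Q w).
  have [P hP1 hP2] := Lim_approx N.+1 LQ.
  have FP : FF' P.
    have [d [r [a1 a2 a3]]] := Poly_y hP1.
    have -> : P = (fun w => (r w).[yv n w]) by apply/funext.
    by apply: (coefL_FF' (k := 0) hts' a1) => j; apply: Lim_Poly.
  apply: (@mr_close _ _ _ _ _ (fun w _ => P w)); [exact: tC|exact: (mr_F N (tC (Some mu0)) FP)|].
  move=> w e _; right; have hv := Lim_V bn1 hP2 w; have [q0 oq] := Q0 w.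
  have [|p0 op] := @ord_dom K (Q w) (P w) q0; first by rewrite oq VBC; apply: Vle hv; lia.
  by split; rewrite ?op ?oq ?add0r //; apply: Vle hv; lia.
have m1 := mr_F N (tC (Some mu0)) Fphi; have m2 := mr_F N (tC (Some mu0)) Fpt.
apply: mr_ext (mr_mul (mr_mul m1 m2) (mr_inv mQ)) => w e hC.
have [q0 _] := Q0 w.
have -> : (pt w).[yv n w] = ((p w).[yv n w] + unif K * H' w) * Q w by rewrite hQ /pt hornerD.
rewrite mulrA mulfK // hF.
rewrite (eq_big_seq (fun mu => phi mu0 w.1 * ((if hi mu then unif K else 1) * wq mu w.1 * (ymon mu (sig B w) + G mu (sig B w))))); last first.
  by move=> mu hm; rewrite (wqE mu w e hC hm) /sig /= !mulrA.
rewrite -mulr_sumr; congr (_ * _).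
have w01 : wq mu0 w.1 = 1.
  have [p0 _] := hC; have := wqE mu0 w e hC hm0; rewrite /hi ltnn mul1r => h.
  by apply: (mulfI p0); rewrite mulr1 -h.
rewrite /p hornerD pmonE horner_sum /H' mulr_sumr.
have -> : ymon mu0 (sig B w) + \sum_(mu <- lo) ((if mu \in Fs then wq mu w.1 else 0)%:P * pmon B mu w).[yv n w] =
   \sum_(mu <- Fs) (if hi mu then 0 else wq mu w.1 * ymon mu (sig B w)).
  rewrite [RHS](bigD1_seq mu0) //= {1}/hi ltnn w01 mul1r; congr (_ + _).
  rewrite /lo big_filter [LHS]big_mkcond [RHS]big_mkcond /=; apply: eq_big_seq => mu hm.
  rewrite hm hornerM hornerC pmonE /hi.
  case: (ltngtP (wt B mu) (wt B mu0)) => h.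
  - by case: eqVneq => [e1|//]; rewrite e1 ltnn in h.
  - by case: ifP.
  by rewrite (winj _ _ hm hm0 h) eqxx.
rewrite -big_split; apply: eq_big_seq => mu hm /=; rewrite hm.
by case: (hi mu); field; rewrite unifn0.
Qed.

Definition updn (w : Om) (z : K) : Om := (w.1, fun i => if i == n then z else w.2 i).

(** After the change of variables the classes are those of polynomials in the last variable over
    series in the others. [alg_fqe] removes that variable, all other data serving as parameters. *)
Lemma elim_step P : tame (AA n.+1) P -> exists P3, tame (AA n) P3 /\
  forall x e, (exists y, P (x, y) e) <-> (exists y, P3 (x, y) e).
Proof.
move=> [B1 hP]; have [fs [hfs hP']] := tb_fin hP.
have [B0 hB0] : exists B0, forall f, List.In f fs -> forall B, (B0 <= B)%N -> forall N, mr FF' (@T0 Om) N (fun w _ => f (sig B w)).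
  elim: fs hfs {hP'} => [|f fs IH] hfs; first by exists 0%N.
  have [|b hb] := IH; first by move=> g hg; apply: hfs; right.
  have [b' hb'] := prep_f (hfs f (or_introl erefl)).
  by exists (maxn b b') => g /= [<-|hg] B hB; [apply: hb'|apply: (hb g hg)]; lia.
have t1 : tame FF' (fun w e => P (sig B0 w) e).
  have := @tame_pull _ _ _ FF' _ _ _ hP' (@T0 Om) (fun w _ => sig B0 w) id (tame_T0 _) (fun g hg => hB0 g hg B0 (leqnn _) B1).
  by apply: tame_ext => w e; split=> [[]|].
pose G : set (Om * K -> K) := [set g | exists d p, polyF (AA n) d p /\ forall w z, g (w, z) = (p w).[z]].
have RA := AA_ring n.
have Gz : G (fun wz => wz.2).
  exists 2%N, (fun _ => 'X); split=> [|w z]; last by rewrite hornerX.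
  by split=> [w|]; [rewrite size_polyX|exact: coefF_cst].
have tR : tame G (fun wz _ => V 0 wz.2).
  apply: tame_ext (tame_or (tame_zero Gz) (tame_ge (lin_ord Gz))) => wz e.
  by rewrite /V /vge; split=> [[/eqP ->|->]|/orP[/eqP|]] //; rewrite ?orbT //; by [left|right].
have t2 : tame G (fun wz e => V 0 wz.2 /\ P (sig B0 (updn wz.1 wz.2)) e).
  have [B2 t1'] := t1.
  apply: (@tame_pull _ _ _ G _ _ _ t1' (fun wz _ => V 0 wz.2) (fun wz _ => updn wz.1 wz.2) id tR).
  move=> g [d [p [hp ->]]].
  apply: (@mr_ext _ _ _ _ _ (fun wz _ => (p wz.1).[wz.2])); last first.
    by apply: (@mr_F _ _ _ _ _ (fun wz => (p wz.1).[wz.2])) => //; exists d, p.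
  move=> [w z] e /= hz; rewrite /yv /updn /= eqxx clipE //; congr (_.[z]).
  apply/polyP => j; case: w => x y; apply: (AA_inv x (hp.2 j)) => i hi /=.
  by rewrite (ltn_eqF hi).
exists (fun w e => exists z, V 0 z /\ P (sig B0 (updn w z)) e); split.
  by apply: (alg_fqe (P := fun wz e => V 0 wz.2 /\ P (sig B0 (updn wz.1 wz.2)) e) RA _ t2).
move=> x e; split=> [[y hy]|[y [z [hz hy]]]]; last first.
  by exists (sig B0 (updn (x, y) z)).2.
pose z := clip (y n).
(* The inverse of the change of variables, so that no witness is lost. *)
pose y' i := clip (y i) - z ^+ Dex B0 i.
have hy' i : V 0 (y' i) by apply: VB; [exact: V_clip|apply: VX; exact: V_clip].
exists y', z; split; first exact: V_clip.
apply/(tb_rveq hP (x := (x, y))); last exact: hy.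
move=> f hf; have -> : f (sig B0 (updn (x, y') z)) = f (x, y).
  apply: (AA_inv x hf) => i hi /=; case: ifP => h.
    rewrite (ltn_eqF h) eqxx (clipE (hy' i)) (clipE (V_clip _)) /y' subrK.
    by rewrite clipE // V_clip.
  have -> : i = n by lia.
  by rewrite eqxx clipE // V_clip.
case: (eqVneq (f (x, y)) 0) => h; [by left|right]; split=> //; by rewrite subrr V0.
Qed.

End Step.

Theorem elim_analytic n P : tame (AA n) P -> tame TK (fun x e => exists y, P (x, y) e).
Proof.
elim: n P => [|n IH] P hP.
  have h : tame TK (fun x e => P (x, fun _ => 0) e).
    have [B hP'] := hP.
    have := @tame_pull _ _ _ TK _ _ _ hP' (@T0 I) (fun x _ => (x, fun _ => 0)) id (tame_T0 _).
    move=> h; apply: tame_ext (h _) => [x e|f [ts [k [hts hf]]]]; first by split=> [[]|].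
    apply: (@mr_F _ _ _ _ _ (fun x => f (x, fun _ => 0))); first exact: tame_T0.
    have bt : bdd ts by move=> t ht x; apply: inT_Rv hts t ht x.
    have hl : Lim ts k (fun x => f (x, fun _ => 0)).
      apply: (Lim_comp bt _ hf) => g /gensP[[t ht ->]|[i hi _]] //.
      exact: Lim_gen.
    exists `|k|%N; apply: (T_ser cT hts).
    by apply: (Lim_mul0 bt _ (Lim_cst ts (V_pi K `|k|%N)) hl); lia.
  apply: tame_ext h => x e; split=> [hp|[y hy]]; first by exists (fun _ => 0).
  have [B hP'] := hP; apply/(tb_rveq hP' (x := (x, y))); last exact: hy.
  move=> f hf; rewrite (AA_inv x (y' := y) hf) //.
  case: (eqVneq (f (x, y)) 0) => h'; [by left|right]; split=> //; by rewrite subrr V0.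
have [P3 [h1 h2]] := elim_step hP.
by apply: tame_ext (IH P3 h1) => x e; rewrite h2.
Qed.

End Elim.

(** * Term functions *)

Section Transfer.
Variables (K : padic_field) (Om Om' Om2 : Type) (s : Om2 -> Om) (s' : Om2 -> Om').
Variables (gs : seq (Om -> K)) (gs' : seq (Om' -> K)).
Hypothesis bgs' : bdd gs'.
Hypothesis hg : forall g, List.In g gs -> exists2 h, Lim gs' 0 h & forall x, g (s x) = h (s' x).

Lemma Poly_transfer k P : Poly gs k P -> exists2 h, Lim gs' k h & forall x, P (s x) = h (s' x).
Proof.
elim=> {k P} [k c hc|g /hg //|k F G _ [h1 l1 e1] _ [h2 l2 e2]|k l F G _ [h1 l1 e1] _ [h2 l2 e2]|k l F le _ [h1 l1 e1]].
- by exists (fun _ => c) => //; apply: Lim_cst.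
- by exists (fun w => h1 w + h2 w) => [|x]; [apply: Lim_add|rewrite e1 e2].
- by exists (fun w => h1 w * h2 w) => [|x]; [apply: Lim_mul|rewrite e1 e2].
by exists h1 => //; apply: Lim_le l1.
Qed.

(** The maps [s] and [s'] send one parameter space to the old arguments and to the new variables;
    along this correspondence a series in old functions is rewritten as a series in new ones. *)
Lemma Lim_transfer k F : Lim gs k F -> exists2 h, Lim gs' k h & forall x, F (s x) = h (s' x).
Proof.
move=> /Lim_shift[P [h1 h2 h3]].
have [H0 l0 e0] := Poly_transfer (h1 0%N).
have /choice[D hD] : forall j : nat, exists h, Lim gs' (Num.max k j%:Z) h /\ forall x, P j.+1 (s x) - P j (s x) = h (s' x).
  by move=> j; have [h l e] := Poly_transfer (h2 j); exists h.
pose FF (i : nat) w := H0 w + \sum_(j < i) D j w.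
have eFF i x : FF i (s' x) = P i (s x).
  elim: i => [|i IH]; first by rewrite /FF big_ord0 addr0 e0.
  by rewrite -[RHS](subrK (P i (s x))) (hD i).2 -IH /FF big_ord_recr /=; ring.
have [|||H lH eH] := @Lim_limit _ _ gs' k FF.
- by apply: Lim_ext l0 => w; rewrite /FF big_ord0 addr0.
- by move=> i; apply: Lim_ext (hD i).1 => w; rewrite /FF big_ord_recr /=; ring.
- exact: bgs'.
exists H => // x; apply/subr0_eq/V_all => N.
by apply: Vtrans (h3 N (s x)) _; rewrite -eFF VBC.
Qed.

End Transfer.

(** * Convergent series of the language as restricted series *)

Section SeriesRep.
Variable K : padic_field.
Variable I : Type.
Variables (m : nat) (f : conv_series K m) (q : 'I_m -> I -> K).
Hypothesis hq : forall j x, V 0 (q j x).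

Definition smon (i : {ffun 'I_m -> nat}) (x : I) : K := \prod_(j < m) q j x ^+ i j.

Lemma V_smon i x : V 0 (smon i x).
Proof. by rewrite /smon; apply: (big_ind (fun z : K => V 0 z)); [exact: V1|move=> *; exact: VMl|move=> j _; exact: VX]. Qed.

(** Convergence at the point with all coordinates 1 already forces the coefficients to tend to 0. *)
Lemma coefs_null : nullf (coefs f).
Proof.
move=> N; have [s hs] := @coefs_conv _ _ f (fun _ => 1) (fun _ => V1 K).
have [B hB] := hs N%:Z; exists (enum_fset B) => i hi.
have h1 := hB B (fsubset_refl B); have h2 := hB (i |` B)%fset (fsubsetU1 i B).
have e A : \sum_(j <- A) coefs f j * (\prod_(l < m) 1 ^+ j l) = \sum_(j <- A) coefs f j :> K.
  by apply: eq_bigr => j _; rewrite big1 ?mulr1 // => l _; rewrite expr1n.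
have := VB h2 (hB B (fsubset_refl B)).
by rewrite /= !e opprB addrA subrK big_fsetU1 //= addrK.
Qed.

Lemma coefs_bounded : exists k : nat, forall i, V (- k%:Z) (coefs f i).
Proof.
have [B hB] := coefs_null 0%N.
exists (\sum_(i <- B) `|ord (coefs f i)|)%N => i.
case: (boolP (i \in B)) => hi; last by apply: Vle (hB i hi); lia.
rewrite (big_rem i hi) /=; apply: V_ord; lia.
Qed.

Lemma series_Rep : Rep smon (coefs f) (fun x => series_fun f (fun j => q j x)).
Proof.
split=> [|N B uB hB x]; first exact: coefs_null.
rewrite /series_fun; have -> : [forall j, inR (q j x)] by apply/forallP => j; exact: hq.
set s := xget _ _; have hs : has_sum (coefs f) (fun j => q j x) s.
  rewrite /s; case: xgetP => [s' _ //|hs].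
  by have [s' hs'] := @coefs_conv _ _ f (fun j => q j x) (fun j => hq j x); case: (hs s').
have [B1 hB1] := hs N.
pose A := ([fset i in B] `|` B1)%fset.
have hA := hB1 A (fsubsetUr _ _).
have sub : {subset B <= enum_fset A}.
  by move=> i hi; have : i \in A by rewrite in_fsetU in_fset /= hi.
have hw := @sum_wide _ _ _ smon V_smon (coefs f) N B (enum_fset A) x uB (fset_uniq A) sub hB.
by have : V N (s - \sum_(i <- A) coefs f i * smon i x) := (eq_ind _ is_true hA _ (VBC _ _ _)); move=> {}hA; apply: Vtrans hA hw.
Qed.

Lemma series_Lim ts : (forall j, List.In (q j) ts) -> exists k : nat, Lim ts (- k%:Z) (fun x => series_fun f (fun j => q j x)).
Proof.
move=> hts; have [k hk] := coefs_bounded; exists k.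
apply: (rep_Lim _ series_Rep) => // i.
rewrite /smon; elim: (index_enum _) => [|j s IH].
  by apply: Poly_ext (Poly_cst _ (V1 K)) => w; rewrite big_nil.
have h : Poly ts 0 (fun w => q j w ^+ i j) by apply: Poly_exp; apply: Poly_gen.
by apply: Poly_ext (Poly_mul h IH) => w; rewrite big_cons.
Qed.

End SeriesRep.

Section TermFunctions.
Variable K : padic_field.
Local Notation I := (nat -> K).
Implicit Types (a : I) (t u v w : I -> K).

(** A point of K is coded by a pair in R: z over 1 if z is integral, 1 over the inverse of z
    otherwise. Series in R-valued variables thus reach all of K. *)
Definition kin (z : K) : K := if inR z then z else 1.
Definition kout (z : K) : K := if inR z then 1 else z^-1.

Lemma V_kin z : V 0 (kin z).
Proof. by rewrite /kin; case: ifP => // _; exact: V1. Qed.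

Lemma nR_inv (z : K) : ~~ inR z -> z != 0 /\ 0 < ord z^-1.
Proof. by move=> h; have z0 := neq0_V h; have := ord_nV h; rewrite ordVn //; split=> //; lia. Qed.

Lemma V_kout z : V 0 (kout z).
Proof.
rewrite /kout; case: (boolP (inR z)) => [_|/nR_inv[_ h]]; first exact: V1.
by apply: V_ord; lia.
Qed.

Lemma kout_neq0 z : kout z != 0.
Proof. by rewrite /kout; case: (boolP (inR z)) => [_|/nR_inv[h _]]; rewrite ?oner_neq0 ?invr_neq0. Qed.

Lemma kinout z : z = kin z / kout z.
Proof. by rewrite /kin /kout; case: ifP => _; rewrite ?divr1 // mul1r invrK. Qed.

(* The R-valued functions obtained from the coordinates by restricted power
   series and restricted division. *)
Inductive TT : set (I -> K) :=
| TT_in i : TT (fun a => kin (a i))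
| TT_out i : TT (fun a => kout (a i))
| TT_lim ts F of (forall t, List.In t ts -> TT t) & Lim ts 0 F : TT F
| TT_Dq u v of TT u & TT v : TT (Dq u v).

Lemma V_Dq (J : Type) (u v : J -> K) x : V 0 (Dq u v x).
Proof.
rewrite /Dq; case: ifP => [/andP[v0 h]|_]; last by rewrite V0.
by rewrite V_divc // add0r.
Qed.

Lemma TT_closed : closedT TT.
Proof.
split=> [t||].
- elim=> {t} [i|i|ts F _ IH hF|u v _ _ _ _] a; [exact: V_kin|exact: V_kout| |exact: V_Dq].
  by apply: (Lim_V _ hF) => g hg; apply: IH.
- by move=> ts h F hF; apply: TT_lim h hF.
exact: TT_Dq.
Qed.

Lemma TT_one : TT (fun _ => 1). Proof. exact: (T_cst TT_closed (V1 K)). Qed.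

Lemma TT_opp t : TT t -> TT (fun a => - t a).
Proof.
move=> h; have hN1 : V 0 (-1 : K) by rewrite VN V1.
have := T_mul TT_closed (T_cst TT_closed hN1) h; congr (TT _).
by apply/funext => a; rewrite mulN1r.
Qed.

Definition nz t a : K := Dq t t a.

Lemma nzE t a : nz t a = (t a != 0)%:R.
Proof.
rewrite /nz /Dq; case: (eqVneq (t a) 0) => [->|t0] /=; first by [].
by rewrite V_self divff.
Qed.

Lemma TT_nz t : TT t -> TT (nz t). Proof. by move=> h; apply: TT_Dq. Qed.

(** Terms take values in K; fractions with a nowhere vanishing denominator reduce them to R-valued
    functions without exceptional points. *)
Definition Fr F := exists u w, [/\ TT u, TT w, forall a, w a != 0 & forall a, F a = u a / w a].

Lemma Fr_cst c : Fr (fun _ => c).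
Proof.
case: (boolP (V 0 c)) => h.
  by exists (fun _ => c), (fun _ => 1); split; [exact: (T_cst TT_closed h)|exact: TT_one|rewrite oner_neq0|move=> a; rewrite divr1].
have [c0 hc] := nR_inv h.
exists (fun _ => 1), (fun _ => c^-1); split; first exact: TT_one.
- by apply: (T_cst TT_closed); apply: V_ord; lia.
- by rewrite invr_neq0.
by rewrite invrK mul1r.
Qed.

Lemma Fr_mul F G : Fr F -> Fr G -> Fr (fun a => F a * G a).
Proof.
move=> [u [w [hu hw w0 hF]]] [u' [w' [hu' hw' w0' hG]]].
exists (fun a => u a * u' a), (fun a => w a * w' a); split; try exact: (T_mul TT_closed).
  by move=> a; rewrite mulf_neq0.
by move=> a; rewrite hF hG invfM; ring.
Qed.

Lemma Fr_add F G : Fr F -> Fr G -> Fr (fun a => F a + G a).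
Proof.
move=> [u [w [hu hw w0 hF]]] [u' [w' [hu' hw' w0' hG]]].
exists (fun a => u a * w' a + u' a * w a), (fun a => w a * w' a); split.
- by apply: (T_add TT_closed); exact: (T_mul TT_closed).
- exact: (T_mul TT_closed).
- by move=> a; rewrite mulf_neq0.
by move=> a; rewrite hF hG; field; rewrite w0 w0'.
Qed.

Lemma Fr_ext F G : (forall a, F a = G a) -> Fr F -> Fr G.
Proof. by move=> h; suff -> : F = G by []; apply/funext. Qed.

Lemma Fr_sub F G : Fr F -> Fr G -> Fr (fun a => F a - G a).
Proof.
move=> h h'; apply: Fr_ext (Fr_add h (Fr_mul (Fr_cst (-1)) h')) => a.
by rewrite mulN1r.
Qed.

Lemma Fr_inv F : Fr F -> Fr (fun a => (F a)^-1).
Proof.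
move=> [u [w [hu hw w0 hF]]].
(* Where [u] vanishes the numerator is 0 and the denominator 1, in accordance with the convention
   for the inverse of 0. *)
exists (fun a => w a * nz u a), (fun a => u a + (1 + - nz u a)); split.
- by apply: (T_mul TT_closed) => //; apply: TT_nz.
- apply: (T_add TT_closed) => //; apply: (T_add TT_closed); first exact: TT_one.
  by apply: TT_opp; apply: TT_nz.
- by move=> a; rewrite nzE; case: (eqVneq (u a) 0) => [->|h] /=; rewrite ?add0r ?subr0 ?oner_neq0 // subrr addr0.
move=> a; rewrite hF invf_div nzE; case: (eqVneq (u a) 0) => [->|h] /=.
  by rewrite invr0 !mulr0 mul0r.
by rewrite mulr1 subrr addr0.
Qed.

Lemma TT_Fr t : TT t -> Fr t.
Proof. by move=> h; exists t, (fun _ => 1); split=> //; [exact: TT_one|rewrite oner_neq0|move=> a; rewrite divr1]. Qed.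

Lemma Fr_prod m (f : 'I_m -> I -> K) : (forall j, Fr (f j)) -> Fr (fun a => \prod_(j < m) f j a).
Proof.
move=> h; elim: (index_enum _) => [|j s IH].
  by apply: Fr_ext (Fr_cst 1) => a; rewrite big_nil.
by apply: Fr_ext (Fr_mul (h j) IH) => a; rewrite big_cons.
Qed.

Lemma Fr_series m (f : conv_series K m) (F : 'I_m -> I -> K) : (forall j, Fr (F j)) ->
  Fr (fun a => series_fun f (fun j => F j a)).
Proof.
move=> /choice[u /choice[w h]].
(* [q j] equals [F j] where that is integral and 0 elsewhere, and [ind j] detects the first case;
   the product of these indicators restores the value 0 of the series off R^m. *)
pose q j := Dq (u j) (w j).
pose ind j a : K := 1 + - nz (fun a => u j a + - (q j a * w j a)) a.
have hu j : TT (u j) by case: (h j).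
have hw j : TT (w j) by case: (h j).
have w0 j a : w j a != 0 by case: (h j) => _ _.
have hF j a : F j a = u j a / w j a by case: (h j) => _ _ _.
have hq j : TT (q j) by apply: TT_Dq.
have hind j : TT (ind j).
  apply: (T_add TT_closed TT_one); apply: TT_opp; apply: TT_nz.
  by apply: (T_add TT_closed) => //; apply: TT_opp; apply: (T_mul TT_closed).
have inRE j a : inR (F j a) = V (ord (w j a)) (u j a) by change (V 0 (F j a) = V (ord (w j a)) (u j a)); rewrite hF (V_divc 0 (u j a) (w0 j a)) add0r.
have qE j a : q j a = if inR (F j a) then F j a else 0 by rewrite inRE /q /Dq w0 hF.
have indE j a : ind j a = (inR (F j a))%:R.
  rewrite /ind nzE qE; case: (boolP (inR (F j a))) => hR.
    by rewrite hF divfK // subrr eqxx subr0.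
  have u0 : u j a != 0 by apply: contra hR => /eqP e; rewrite inRE e V0.
  by rewrite mul0r subr0 u0 subrr.
have hin j : List.In (q j) [seq q j | j <- enum 'I_m].
  by apply/In_map; exists j => //; apply/In_mem; rewrite mem_enum.
have [k hk] := @series_Lim K I m f q (fun j x => V_Dq _ _ _) _ hin.
have hS : Fr (fun a => series_fun f (fun j => q j a)).
  exists (fun a => unif K ^+ k * series_fun f (fun j => q j a)), (fun _ => unif K ^+ k); split.
  - apply: (@TT_lim [seq q j | j <- enum 'I_m]) => [t /In_map[j _ <-] //|].
    have b : bdd [seq q j | j <- enum 'I_m] by move=> g /In_map[j _ <-] x; exact: V_Dq.
    by apply: (Lim_mul0 b _ (Lim_cst _ (V_pi K k)) hk); lia.
  - by apply: (T_cst TT_closed); apply: Vle (V_pi K k); lia.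
  - by rewrite expf_neq0 // unifn0.
  by move=> a; rewrite mulrC mulKf // expf_neq0 // unifn0.
apply: Fr_ext (Fr_mul (Fr_prod (fun j => TT_Fr (hind j))) hS) => a.
rewrite (eq_bigr _ (fun j _ => indE j a)).
case: (boolP [forall j, inR (F j a)]) => hR.
  rewrite big1 ?mul1r => [|j _]; last by rewrite (forallP hR).
  by congr series_fun; apply/funext => j; rewrite qE (forallP hR).
have /forallPn[j hj] := hR.
by rewrite (bigD1 j) //= (negbTE hj) !mul0r /series_fun (negbTE hR).
Qed.

Variable L : language.

Lemma Fr_keval r e (t : kterm K L) : Fr (fun a => keval (Assignment a r e) t).
Proof.
elim: t => [i|c|t1 h1 t2 h2|t1 h1 t2 h2|t1 h1 t2 h2|eL t1 h1|m eL m0 f ts IH] /=.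
- exists (fun a => kin (a i)), (fun a => kout (a i)); split=> [||a|a]; [exact: TT_in|exact: TT_out|exact: kout_neq0|exact: kinout].
- exact: Fr_cst.
- exact: Fr_add.
- exact: Fr_sub.
- exact: Fr_mul.
- exact: Fr_inv.
exact: Fr_series.
Qed.

Lemma TT_TK t : TT t -> TK TT t.
Proof. by move=> h; exists 0%N; congr (TT _): h; apply/funext => a; rewrite expr0 mul1r. Qed.

Definition RTK := TK_ring TT_closed.

Lemma Fr_mr F N : Fr F -> mr (TK TT) (@T0 I) N (fun a _ => F a).
Proof.
move=> [u [w [hu hw w0 hF]]].
apply: (@mr_ext _ _ _ _ _ (fun a _ => u a * (w a)^-1)) => [a e _|]; first by rewrite hF.
apply: mr_mul; first by apply: (@mr_F _ _ _ _ _ u); [exact: tame_T0|exact: TT_TK].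
apply: (@mr_inv _ _ _ _ _ (fun a _ => w a)); by apply: (@mr_F _ _ _ _ _ w); [exact: tame_T0|exact: TT_TK].
Qed.

Lemma Fr_zero F : Fr F -> tame (TK TT) (fun a _ => F a = 0).
Proof.
move=> [u [w [hu hw w0 hF]]]; apply: tame_ext (tame_zero (TT_TK hu)) => a e.
rewrite hF; split=> [->|/eqP]; first by rewrite mul0r.
by rewrite mulf_eq0 invr_eq0 (negbTE (w0 a)) orbF => /eqP.
Qed.

End TermFunctions.

(** * Elimination of a field quantifier *)

Section Resolve.
Variable K : padic_field.
Local Notation I := (nat -> K).
Local Notation Om := (I * (nat -> K))%type.
Variable i : nat.
Local Notation T := (@TT K).
Let cT : closedT T := @TT_closed K.

(* [C] describes the graph of the auxiliary variables [Y a z], the first two of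
   which encode [z]; it lives over the algebra of series in these variables. *)
Record state n (C : Om -> env -> Prop) (Y : I -> K -> nat -> K) : Prop := State {
  st_n : (1 < n)%N;
  st_V : forall a z j, V 0 (Y a z j);
  st_0 : forall a z, Y a z 0%N = kin z;
  st_1 : forall a z, Y a z 1%N = kout z;
  st_C : tame (AA T n) C;
  st_Y : forall a z e, C (a, Y a z) e;
  st_U : forall a y e, C (a, y) e -> forall j, (j < n)%N ->
    clip (y j) = Y a (clip (y 0%N) / clip (y 1%N)) j
}.

Definition st_ext n (Y : I -> K -> nat -> K) n' (Y' : I -> K -> nat -> K) :=
  (n <= n')%N /\ forall a z j, (j < n)%N -> Y' a z j = Y a z j.

Lemma st_ext_trans n Y n1 Y1 n2 Y2 : st_ext n Y n1 Y1 -> st_ext n1 Y1 n2 Y2 -> st_ext n Y n2 Y2.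
Proof.
move=> [l1 h1] [l2 h2]; split=> [|a z j hj]; first exact: leq_trans l1 l2.
by rewrite h2 ?h1 //; apply: leq_trans hj l1.
Qed.

Definition solved n (Y : I -> K -> nat -> K) (t : I -> K) := exists ts G,
  [/\ inT T ts, Lim (gens ts n) 0 G & forall a z, t (upd a i z) = G (a, Y a z)].

Lemma Lim_agree (ts : seq (I -> K)) n k G a (y y' : nat -> K) : Lim (gens ts n) k G -> (forall j, (j < n)%N -> clip (y j) = clip (y' j)) ->
  G (a, y) = G (a, y').
Proof. by move=> h hy; apply: (Lim_inv h) => g /gensP[[t _ ->]|[j hj ->]] //; exact: hy. Qed.

Lemma solved_ext n Y n' Y' t : st_ext n Y n' Y' -> solved n Y t -> solved n' Y' t.
Proof.
move=> [le h] [ts [G [h1 h2 h3]]]; exists ts, G; split=> //.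
  by apply: Lim_mono h2; apply: gens_mono.
by move=> a z; rewrite h3; apply: (Lim_agree a h2) => j hj; rewrite h.
Qed.

Definition solvable (t : I -> K) := forall n C Y, state n C Y ->
  exists n' C' Y', [/\ state n' C' Y', st_ext n Y n' Y' & solved n' Y' t].

Lemma solve_seq (ts : seq (I -> K)) : (forall t, List.In t ts -> solvable t) -> forall n C Y, state n C Y ->
  exists n' C' Y', [/\ state n' C' Y', st_ext n Y n' Y' & forall t, List.In t ts -> solved n' Y' t].
Proof.
elim: ts => [|t ts IH] h n C Y hs; first by exists n, C, Y.
have [n1 [C1 [Y1 [s1 e1 h1]]]] := IH (fun t ht => h t (or_intror ht)) n C Y hs.
have [n2 [C2 [Y2 [s2 e2 h2]]]] := h t (or_introl erefl) _ _ _ s1.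
exists n2, C2, Y2; split=> // [|t' [<-//|ht']]; first exact: st_ext_trans e1 e2.
by apply: solved_ext e2 _; apply: h1.
Qed.

Lemma solved_seq n Y (ts : seq (I -> K)) : (forall t, List.In t ts -> solved n Y t) -> exists ts', inT T ts' /\
  forall t, List.In t ts -> exists2 h, Lim (gens ts' n) 0 h & forall x : I * K, t (upd x.1 i x.2) = h (x.1, Y x.1 x.2).
Proof.
elim: ts => [|t ts IH] h; first by exists [::]; split=> // t [].
have [ts1 [h1 h2]] := IH (fun t ht => h t (or_intror ht)).
have [ts2 [G [h3 h4 h5]]] := h t (or_introl erefl).
exists (ts1 ++ ts2); split=> [|t' [<-|/h2[G' h6 h7]]]; first exact: inT_cat.
  by exists G => [|x]; [apply: Lim_mono h4; apply: gens_mono => // t0 ht0; apply/In_cat; right|rewrite h5].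
by exists G' => //; apply: Lim_mono h6; apply: gens_mono => // t0 ht0; apply/In_cat; left.
Qed.

Lemma Lim_AA (ts : seq (I -> K)) n G : inT T ts -> Lim (gens ts n) 0 G -> AA T n G.
Proof. by move=> h h'; exists ts, 0. Qed.

(** The quotient becomes a new variable [y_n]. It is determined by [y_n * v = u] on the domain of
    the division and by [y_n = 0] elsewhere, both conditions on series in the variables. *)
Lemma solve_D u v n C Y : state n C Y -> solved n Y u -> solved n Y v ->
  exists C' Y', [/\ state n.+1 C' Y', st_ext n Y n.+1 Y' & solved n.+1 Y' (Dq u v)].
Proof.
move=> hs [tu [Gu [iu lu eu]]] [tv [Gv [iv lv ev]]].
pose Y' a z j := if j == n then Dq u v (upd a i z) else Y a z j.
pose cond (w : Om) (e : env) := Gv w != 0 /\ V (ord (Gv w)) (Gu w).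
pose C' w e := C w e /\ ((cond w e -> yv n w * Gv w - Gu w = 0) /\ (~ cond w e -> yv n w = 0)).
have en a z j : (j < n)%N -> Y' a z j = Y a z j by move=> hj; rewrite /Y' (ltn_eqF hj).
have n1 := st_n hs.
have sle : forall f, AA T n f -> AA T n.+1 f by apply: AA_mono.
have Au := sle _ (Lim_AA iu lu); have Av := sle _ (Lim_AA iv lv).
have R := AA_ring cT n.+1.
have Ay : AA T n.+1 (yv n).
  by exists [::], 0; split=> //; apply: Lim_gen; apply/gensP; right; exists n.
have tc : tame (AA T n.+1) cond.
  apply: tame_and; first by apply: tame_ext (tame_not (tame_zero Av)) => w e; split=> /eqP.
  apply: tame_ext (tame_or (tame_zero Au) (tame_le (lin_ord Av) (lin_ord Au))) => w e.
  by rewrite /V /vge; split=> [[->|->]|/orP[/eqP|]]; rewrite ?eqxx ?orbT //; [left|right].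
have Aa f a (y y' : nat -> K) : AA T n f -> (forall j, (j < n)%N -> clip (y j) = clip (y' j)) -> f (a, y) = f (a, y').
  exact: AA_inv.
exists C', Y'; split.
- split.
  + by lia.
  + by move=> a z j; rewrite /Y'; case: ifP => _; [exact: V_Dq|exact: st_V hs _ _ _].
  + by move=> a z; rewrite en ?(st_0 hs) //; lia.
  + by move=> a z; rewrite en ?(st_1 hs) //; lia.
  + apply: tame_and; first exact: tame_mono (st_C hs).
    apply: tame_and; first exact: (tame_imp tc (tame_zero (rs_sub R (rs_mul R Ay Av) Au))).
    exact: (tame_imp (tame_not tc) (tame_zero Ay)).
  + move=> a z e; have hY j : (j < n)%N -> clip (Y' a z j) = clip (Y a z j) by move=> hj; rewrite en.
    split.
      have [B hB] := st_C hs; apply/(tb_rveq hB (y := (a, Y a z))); last exact: st_Y hs _ _ _.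
      move=> f hf; rewrite (Aa f a _ _ hf hY); case: (eqVneq (f (a, Y a z)) 0) => h; [by left|right].
      by split=> //; rewrite subrr V0.
    have -> : yv n (a, Y' a z) = Dq u v (upd a i z) by rewrite /yv /= /Y' eqxx clipE // V_Dq.
    rewrite /cond (Lim_agree a lu hY) (Lim_agree a lv hY) -eu -ev /Dq; split=> [[h1 h2]|hn].
      by rewrite h1 h2 divfK // subrr.
    by case: ifP => // /andP[h1 h2]; case: hn.
  move=> a y e [hC [h1 h2]] j; rewrite ltnS leq_eqVlt => /orP[/eqP->|hj]; last first.
    by rewrite en // (st_U hs hC).
  rewrite /Y' eqxx.
  have hy : forall j, (j < n)%N -> clip (y j) = clip (Y a (clip (y 0%N) / clip (y 1%N)) j).
    by move=> j' hj'; rewrite (st_U hs hC) // [RHS]clipE //; exact: (st_V hs).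
  rewrite /Dq eu ev -(Lim_agree a lu hy) -(Lim_agree a lv hy).
  case: ifP => [/andP[g1 g2]|hn].
    by have /subr0_eq <- := h1 (conj g1 g2); rewrite mulfK.
  by apply: h2 => -[g1 g2]; rewrite g1 g2 in hn.
- by split=> // a z j hj; rewrite en.
exists [::], (yv n); split=> // [|a z]; first by apply: Lim_gen; apply/gensP; right; exists n.
by rewrite /yv /= /Y' eqxx clipE // V_Dq.
Qed.

Lemma solve t : TT t -> solvable t.
Proof.
elim=> {t} [j|j|ts F _ IH hF|u v _ IHu _ IHv] n C Y hs.
- exists n, C, Y; split=> //; case: (eqVneq j i) => [->|ji].
    exists [::], (yv 0); split=> // [|a z]; first by apply: Lim_gen; apply/gensP; right; exists 0%N => //; have := st_n hs; lia.
    by rewrite /upd eqxx /yv /= (st_0 hs) clipE // V_kin.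
  exists [:: (fun a : I => kin (a j))], (fun w => kin (w.1 j)); split=> [t /= [<-|//]||a z]; first exact: TT_in.
    by apply: Lim_gen; apply/gensP; left; exists (fun a : I => kin (a j)) => //; left.
  by rewrite /upd (negbTE ji).
- exists n, C, Y; split=> //; case: (eqVneq j i) => [->|ji].
    exists [::], (yv 1); split=> // [|a z]; first by apply: Lim_gen; apply/gensP; right; exists 1%N => //; exact: st_n hs.
    by rewrite /upd eqxx /yv /= (st_1 hs) clipE // V_kout.
  exists [:: (fun a : I => kout (a j))], (fun w => kout (w.1 j)); split=> [t /= [<-|//]||a z]; first exact: TT_out.
    by apply: Lim_gen; apply/gensP; left; exists (fun a : I => kout (a j)) => //; left.
  by rewrite /upd (negbTE ji).
- have [n1 [C1 [Y1 [s1 e1 h1]]]] := solve_seq IH hs.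
  exists n1, C1, Y1; split=> //.
  have [ts' [h2 h3]] := solved_seq h1.
  have b := bdd_gens (n := n1) (inT_Rv cT h2).
  have [h l e] := @Lim_transfer K I Om (I * K)%type (fun x => upd x.1 i x.2) (fun x => (x.1, Y1 x.1 x.2)) ts (gens ts' n1) b h3 _ _ hF.
  by exists ts', h; split=> // a z; exact: (e (a, z)).
have [n1 [C1 [Y1 [s1 e1 h1]]]] := IHu _ _ _ hs.
have [n2 [C2 [Y2 [s2 e2 h2]]]] := IHv _ _ _ s1.
have [C3 [Y3 [s3 e3 h3]]] := solve_D s2 (solved_ext e2 h1) h2.
exists n2.+1, C3, Y3; split=> //.
by apply: st_ext_trans e3; apply: st_ext_trans e2.
Qed.

Lemma state0 : exists C Y, state 2 C Y.
Proof.
pose Y (a : I) z j : K := if j == 0%N then kin z else if j == 1%N then kout z else 0.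
(* Exactly the pairs coding a point of K; without this condition the quotient would not determine
   the pair. *)
pose C (w : Om) (e : env) := yv 1 w - 1 = 0 \/ (yv 0 w - 1 = 0 /\ (~ yv 1 w = 0 /\ 1 <= ord (yv 1 w))).
have R := AA_ring cT 2.
have A0 : AA T 2 (yv 0) by exists [::], 0; split=> //; apply: Lim_gen; apply/gensP; right; exists 0%N.
have A1 : AA T 2 (yv 1) by exists [::], 0; split=> //; apply: Lim_gen; apply/gensP; right; exists 1%N.
exists C, Y; split=> //.
- move=> a z j; rewrite /Y; case: ifP => _; first exact: V_kin.
  by case: ifP => _; [exact: V_kout|rewrite V0].
- apply: tame_or; first exact: (tame_zero (rs_sub R A1 (rs_cst R 1))).
  apply: tame_and; first exact: (tame_zero (rs_sub R A0 (rs_cst R 1))).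
  apply: tame_and; first exact: (tame_not (tame_zero A1)).
  exact: (tame_le (lin_cst _ 1) (lin_ord A1)).
- move=> a z e; rewrite /C /yv /Y /= !clipE ?V_kin ?V_kout // /kin /kout.
  case: (boolP (inR z)) => [_|/nR_inv[h1 h2]]; [left|right]; rewrite subrr //; split=> //; split; last by lia.
  by apply/eqP; rewrite invr_eq0.
move=> a y e; rewrite /C /yv /= => h j hj.
have v0 := V_clip (y 0%N); have v1 := V_clip (y 1%N).
have [e0 e1] : clip (y 0%N) = kin (clip (y 0%N) / clip (y 1%N)) /\ clip (y 1%N) = kout (clip (y 0%N) / clip (y 1%N)).
  case: h => [/subr0_eq ->|[/subr0_eq -> [/eqP h1 h2]]].
    by rewrite divr1 /kin /kout; change (inR (clip (y 0%N))) with (V 0 (clip (y 0%N))); rewrite v0.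
  have hn : inR (1 / clip (y 1%N)) = false.
    apply/negbTE; apply: nV_ord; first by rewrite mul1r invr_neq0.
    by rewrite mul1r ordVn //; lia.
  by rewrite /kin /kout hn mul1r invrK.
by case: j hj => [|[|j]] //=; rewrite /Y /=.
Qed.

(** On the graph [C] every function of the formula is a series in finitely many R-valued variables,
    so the quantifier over K becomes one over these variables and [elim_analytic] applies. *)
Theorem tame_exK P : tame (TK T) P -> tame (TK T) (fun a e => exists z, P (upd a i z) e).
Proof.
move=> [B hP]; have [fs [hfs hP']] := tb_fin hP.
have [C0 [Y0 s0]] := state0.
have hk f : exists k : nat, List.In f fs -> T (fun x => unif K ^+ k * f x).
  case: (pselect (List.In f fs)) => h; last by exists 0%N.
  by have [k hk] := hfs f h; exists k.
have /choice[kk hkk] := hk.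
have [n [C [Y [s1 _ h1]]]] := solve_seq (ts := [seq (fun x => unif K ^+ kk f * f x) | f <- fs])
  (fun t ht => match (iffLR (In_map _ _ _) ht) with ex_intro2 f hf e => solve (eq_ind _ _ (hkk f hf) _ e) end) s0.
have R := AA_ring cT n.
have h2 f : List.In f fs -> exists2 h, AA T n h & forall a z, f (upd a i z) = h (a, Y a z).
  move=> hf; have [|ts [G [g1 g2 g3]]] := h1 (fun x => unif K ^+ kk f * f x); first by apply/In_map; exists f.
  exists (fun w => (unif K ^+ kk f)^-1 * G w) => [|a z].
    by apply: (rs_mul R); [exact: (rs_cst R)|exact: Lim_AA g2].
  by rewrite -g3 mulKf // expf_neq0 // unifn0.
pose th (w : Om) := upd w.1 i (yv 0 w / yv 1 w).
have tP := @tame_pull _ _ _ (AA T n) _ _ _ hP' C (fun w _ => th w) id (st_C s1).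
apply: tame_ext (elim_analytic cT (tP _)) => [a e|f hf]; last first.
  have [h h3 h4] := h2 f hf.
  apply: (@mr_ext _ _ _ _ _ (fun w _ => h w)); last by apply: mr_F => //; exact: st_C s1.
  move=> [a y] e /= hC; rewrite /th h4; apply: (AA_inv a h3) => j hj.
  by rewrite (st_U s1 hC) // [RHS]clipE //; exact: (st_V s1).
split=> [[y [hC hy]]|[z hz]]; first by exists (yv 0 (a, y) / yv 1 (a, y)).
exists (Y a z); split; first exact: st_Y s1 _ _ _.
rewrite /th /yv /= (st_0 s1) (st_1 s1) !clipE ?V_kin ?V_kout // -kinout.
exact: hz.
Qed.

End Resolve.

(** * Formulas define tame sets *)

Section Formulas.
Variable K : padic_field.
Local Notation I := (nat -> K).
Local Notation tame := (tame (TK (@TT K))).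
Local Notation T := (@TT K).

(** Functions are tracked by their graphs: the order of a quotient is given by cases and need not be
    [lin]. *)
Definition tfun (f : I -> env -> int) := tame (fun a e => f a (tl e) = e 0%N).

Lemma tame_app2 (f g : I -> env -> int) (Q : int -> int -> Prop) :
  tame (fun _ e => Q (e 0%N) (e 1%N)) -> tfun f -> tfun g -> tame (fun a e => Q (f a e) (g a e)).
Proof.
move=> hQ hf hg.
pose sf (j : nat) := if j is j'.+1 then j'.+2 else 0%N.
pose sg (j : nat) := if j is j'.+1 then j'.+2 else 1%N.
have := tame_ex (tame_ex (tame_and hQ (tame_and (tame_ren sf hf) (tame_ren sg hg)))).
apply: tame_ext => a e; split=> [[z [z' [h [h1 h2]]]]|h].
  by move: h1 h2 h => /= <- <-.
by exists (g a e), (f a e).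
Qed.

Lemma tfun_app (f g : I -> env -> int) (op : int -> int -> int) :
  lin (TK T) (fun _ e => op (e 0%N) (e 1%N)) -> tfun f -> tfun g -> tfun (fun a e => op (f a e) (g a e)).
Proof.
move=> hop hf hg.
pose sf (j : nat) := if j is j'.+1 then j'.+3 else 0%N.
pose sg (j : nat) := if j is j'.+1 then j'.+3 else 1%N.
have hQ : tame (fun _ e => op (e 0%N) (e 1%N) = e 2%N) by apply: tame_eq => //; exact: lin_var.
have := tame_ex (tame_ex (tame_and hQ (tame_and (tame_ren sf hf) (tame_ren sg hg)))).
apply: tame_ext => a e; split=> [[z [z' [h [h1 h2]]]]|h].
  by move: h1 h2 h => /= <- <-.
by exists (g a (tl e)), (f a (tl e)).
Qed.

Variable L : language.

Lemma tfun_zeval r (t : zterm K L) : tfun (fun a e => zeval (Assignment a r e) t).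
Proof.
elim: t => [j|||t1 h1 t2 h2|t1 h1 t2 h2|t] /=.
- by apply: tame_eq; [exact: (lin_var _ j.+1)|exact: (lin_var _ 0)].
- by apply: tame_eq; [exact: lin_cst|exact: lin_var].
- by apply: tame_eq; [exact: lin_cst|exact: lin_var].
- by apply: tfun_app => //; apply: lin_add; exact: lin_var.
- exact: (tfun_app (op := fun x y => x - y) (lin_sub (lin_var _ 0) (lin_var _ 1)) h1 h2).
have [u [w [hu hw w0 hF]]] := Fr_keval r (fun _ => 0) t.
have hF' a e : keval (Assignment a r e) t = u a / w a.
  rewrite -hF; elim: t {hu hw w0 hF} => //= [t1 -> t2 ->|t1 -> t2 ->|t1 -> t2 ->|_ t1 ->|m _ _ f ts IH] //.
  by congr series_fun; apply/funext => j.
have Au := TT_TK hu; have Aw := TT_TK hw.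
have t1 : tame (fun a (_ : env) => u a = 0) := tame_zero Au.
have := tame_or (tame_and t1 (tame_eq (lin_cst (TK T) (ord (0 : K))) (lin_var _ 0)))
  (tame_and (tame_not t1) (tame_eq (lin_sub (lin_ord Au) (lin_ord Aw)) (lin_var _ 0))).
apply: tame_ext => a e; rewrite hF'; case: (eqVneq (u a) 0) => [->|u0].
  by rewrite mul0r; split=> [[[_]|[]]|] //; left.
rewrite ordM ?invr_neq0 // ordVn //; split=> [[[/eqP]|[]]|h] //; first by rewrite (negbTE u0).
by right; split=> //; apply/eqP.
Qed.

(** On nonzero arguments [ac] is the residue of [up], hence a condition of precision 1. *)
Lemma tame_ac (F : I -> K) (c : resfield K) : Fr F -> tame (fun a _ => ac (F a) = c).
Proof.
move=> hF; have [hr1 hrD hrM hker hsurj] := res_residue K.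
have [z hz ez] := hsurj c.
have h1 := tame_and (Fr_zero hF) (tame_const _ (0 = c)).
have h2 := tame_ex (Fr_mr 1 hF z).
apply: tame_ext (tame_or h1 h2) => a e; rewrite /ac.
have resB (x y : K) : V 0 x -> V 0 y -> (res x = res y) <-> V 1 (x - y).
  move=> hx hy; have hxy : V 0 (x - y) by apply: VB.
  rewrite -(hker _ hxy) -[x in res x = _](subrK y) (hrD _ _ hxy hy).
  by split=> [h|->]; [apply: (addIr (res y)); rewrite h add0r|rewrite add0r].
case: (eqVneq (F a) 0) => [e0|F0].
  split=> [[[_ ->]//|[k [_ h]]]|h]; first by [].
  by left.
have hu : unif K ^ (- ord (F a)) * F a = up (F a) by rewrite /up mulrC.
rewrite hu -ez (resB _ _ (V_up _) hz); split=> [[[h _]|[k [_ _ _ h]]]|h] //.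
  by rewrite h ?eqxx in F0.
by right; exists (ord (F a)).
Qed.

Lemma keval_rz r r' e e' a (t : kterm K L) : keval (Assignment a r e) t = keval (Assignment a r' e') t.
Proof.
elim: t => //= [t1 -> t2 ->|t1 -> t2 ->|t1 -> t2 ->|_ t1 ->|m _ _ f ts IH] //.
by congr series_fun; apply/funext => j.
Qed.

Lemma tame_reval r (t : rterm K L) c : tame (fun a e => reval (Assignment a r e) t = c).
Proof.
have h2 (op : resfield K -> resfield K -> resfield K) (f g : I -> env -> resfield K) :
    (forall c, tame (fun a e => f a e = c)) -> (forall c, tame (fun a e => g a e = c)) ->
    forall c, tame (fun a e => op (f a e) (g a e) = c).
  move=> hf hg c'.
  have := tame_has (s := enum {: resfield K * resfield K})
    (P := fun p a e => op p.1 p.2 = c' /\ (f a e = p.1 /\ g a e = p.2))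
    (fun p _ => tame_and (tame_const _ _) (tame_and (hf p.1) (hg p.2))).
  apply: tame_ext => a e; split=> [[[x y] _ /= [<- [-> ->]]]|h] //.
  by exists (f a e, g a e); rewrite ?mem_enum.
elim: t c => [j|||t1 h t2 h'|t1 h t2 h'|t1 h t2 h'|t] c /=; try exact: tame_const.
- exact: h2.
- exact: (h2 (fun x y => x - y)).
- exact: h2.
apply: tame_ext (tame_ac c (Fr_keval r (fun _ => 0) t)) => a e.
by rewrite (keval_rz r r e (fun _ => 0)).
Qed.

(** The root is a field variable on which everything depends polynomially, so [alg_fqe] suffices. *)
Lemma tame_pow (F : I -> K) n : (0 < n)%N -> Fr F -> tame (fun a _ => exists2 y : K, y != 0 & F a = y ^+ n).
Proof.
move=> n0 [u [w [hu hw w0 hF]]].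
pose G : set (I * K -> K) := [set g | exists d p, polyF (TK T) d p /\ forall x z, g (x, z) = (p x).[z]].
have R := RTK K.
have G1 : G (fun xz => xz.2).
  exists 2%N, (fun _ => 'X); split=> [|x z]; last by rewrite hornerX.
  by split=> [x|]; [rewrite size_polyX|exact: coefF_cst].
have G2 : G (fun xz => u xz.1 - w xz.1 * xz.2 ^+ n).
  exists n.+1, (fun x => (u x)%:P - w x *: 'X^n); split=> [|x z]; last by rewrite !hornerE.
  split=> [x|j].
    apply: leq_trans (size_polyD _ _) _; rewrite size_polyN geq_max size_polyC.
    by rewrite (leq_trans (size_scale_leq _ _)) ?size_polyXn // andbT; case: (u x != 0).
  apply: rs_ext (rs_sub R (rs_mul R (TT_TK hu) (rs_cst R (j == 0%N)%:R)) (rs_mul R (TT_TK hw) (rs_cst R (j == n)%:R))) => x.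
  by rewrite coefB coefC coefZ coefXn; case: (j == 0%N); rewrite ?mulr1 ?mulr0.
have := alg_fqe R (fun g hg => hg) (tame_and (tame_not (tame_zero G1)) (tame_zero G2)).
apply: tame_ext => a e; split=> [[y [h1 h2]]|[y h1 h2]].
  exists y; first by apply/eqP.
  by rewrite hF -(subrK (w a * y ^+ n) (u a)) h2 add0r mulrC mulKf.
exists y; split; first by apply/eqP.
by rewrite /= -h2 hF mulrC divfK // subrr.
Qed.

(** The residue field is finite: its assignment [r] stays fixed and its quantifiers are finite
    disjunctions. *)
Theorem tame_holds (A : formula K L) r : tame (fun a e => holds (Assignment a r e) A).
Proof.
elim: A r => [t1 t2|n n0 t|t1 t2|t1 t2|t1 t2|n n0 t1 t2|A h|A h1 B h2|i A h|i A h|i A h] r /=.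
- have hs := Fr_sub (Fr_keval r (fun _ => 0) t1) (Fr_keval r (fun _ => 0) t2).
  apply: tame_ext (Fr_zero hs) => a e.
  rewrite -!(keval_rz r r e (fun _ => 0)); split=> [/subr0_eq|->] //; exact: subrr.
- apply: tame_ext (tame_pow n0 (Fr_keval r (fun _ => 0) t)) => a e.
  by rewrite (keval_rz r r e (fun _ => 0)).
- have := tame_has (s := enum (resfield K))
    (P := fun c a e => reval (Assignment a r e) t1 = c /\ reval (Assignment a r e) t2 = c)
    (fun c _ => tame_and (tame_reval r t1 c) (tame_reval r t2 c)).
  apply: tame_ext => a e; split=> [[c _ [-> ->]]|h] //.
  by exists (reval (Assignment a r e) t2); rewrite ?mem_enum.
- by apply: (tame_app2 (Q := eq) _ (tfun_zeval r t1) (tfun_zeval r t2)); apply: tame_eq; exact: lin_var.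
- by apply: (tame_app2 (Q := fun x y => x <= y) _ (tfun_zeval r t1) (tfun_zeval r t2)); apply: tame_le; exact: lin_var.
- apply: (tame_app2 (Q := fun x y => (x = y %[mod n%:Z])%Z) _ (tfun_zeval r t1) (tfun_zeval r t2)).
  apply: tame_ext (tame_mod n0 (lin_sub (lin_var _ 0) (lin_var _ 1))) => a e.
  by rewrite -eqz_mod_dvd; split=> [/eqP|->].
- exact: tame_not (h r).
- exact: tame_and (h1 r) (h2 r).
- exact: (tame_exK i (h r)).
- have := tame_has (s := enum (resfield K)) (P := fun c a e => holds (Assignment a (upd r i c) e) A) (fun c _ => h _).
  apply: tame_ext => a e; split=> [[c _ hc]|[c hc]]; first by exists c.
  by exists c; rewrite ?mem_enum.
have := tame_ex (tame_ren (fun j => if j == i then 0%N else j.+1) (h r)).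
have E z e : (fun j => scons z e (if j == i then 0%N else j.+1)) = upd e i z.
  by apply/funext => j; rewrite /upd; case: ifP.
by apply: tame_ext => a e; split=> -[z hz]; exists z; move: hz; rewrite E.
Qed.

End Formulas.

(** * Presburger arithmetic with parameters *)

Section Presburger.
Variable I : Type.
Implicit Types (a : I) (e : env) (P Q : I -> env -> Prop).

(* Presburger arithmetic with parameters from I entering only through
   constants, so that the coefficients and moduli are uniform. *)
Inductive pl : (I -> env -> int) -> Prop :=
| pl_var i : pl (fun _ e => e i)
| pl_cst (k : I -> int) : pl (fun a _ => k a)
| pl_add l l' of pl l & pl l' : pl (fun a e => l a e + l' a e)
| pl_opp l of pl l : pl (fun a e => - l a e).

Inductive qf : (I -> env -> Prop) -> Prop :=
| qf_ge l of pl l : qf (fun a e => 0 <= l a e)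
| qf_mod (m : nat) l of (0 < m)%N & pl l : qf (fun a e => (m%:Z %| l a e)%Z)
| qf_par (Q : I -> Prop) : qf (fun a _ => Q a)
| qf_not P of qf P : qf (fun a e => ~ P a e)
| qf_and P Q of qf P & qf Q : qf (fun a e => P a e /\ Q a e).

Lemma pl_ext l l' : (forall a e, l a e = l' a e) -> pl l -> pl l'.
Proof. by move=> h; suff -> : l = l' by []; apply/funext => a; apply/funext => e. Qed.

Lemma qf_ext P Q : (forall a e, P a e <-> Q a e) -> qf P -> qf Q.
Proof. by move=> h; suff -> : P = Q by []; apply/funext => a; apply/funext => e; apply/propext. Qed.

Lemma pl_mul (n : int) l : pl l -> pl (fun a e => n * l a e).
Proof.
move=> hl; have hn (k : nat) : pl (fun a e => k%:Z * l a e).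
  elim: k => [|k IH]; first by apply: pl_ext (pl_cst (fun _ => 0)) => a e; rewrite mul0r.
  by apply: pl_ext (pl_add hl IH) => a e; rewrite -addn1 PoszD mulrDl mul1r addrC.
case: n => k; first exact: hn.
by apply: pl_ext (pl_opp (hn k.+1)) => a e; rewrite NegzE mulNr.
Qed.

Lemma pl_split l : pl l -> exists c l', pl l' /\ forall a z e, l a (scons z e) = c * z + l' a e.
Proof.
elim=> {l} [[|i]|k|l1 l2 _ [c1 [m1 [h1 e1]]] _ [c2 [m2 [h2 e2]]]|l1 _ [c1 [m1 [h1 e1]]]].
- by exists 1, (fun _ _ => 0); split=> [|a z e]; [exact: (pl_cst (fun _ => 0))|rewrite mul1r addr0].
- by exists 0, (fun _ e => e i); split=> [|a z e]; [exact: pl_var|rewrite mul0r add0r].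
- by exists 0, (fun a _ => k a); split=> [|a z e]; [exact: pl_cst|rewrite mul0r add0r].
- by exists (c1 + c2), (fun a e => m1 a e + m2 a e); split=> [|a z e]; [exact: pl_add|rewrite e1 e2; ring].
by exists (- c1), (fun a e => - m1 a e); split=> [|a z e]; [exact: pl_opp|rewrite e1; ring].
Qed.

Lemma qf_or P Q : qf P -> qf Q -> qf (fun a e => P a e \/ Q a e).
Proof.
move=> hP hQ; apply: qf_ext (qf_not (qf_and (qf_not hP) (qf_not hQ))) => a e.
split=> [h|[h|h] []//]; case: (pselect (P a e)) => p; [by left|right].
by apply: contrapT => q; apply: h.
Qed.

Lemma qf_has (T : Type) (s : seq T) (P : T -> I -> env -> Prop) : (forall t, List.In t s -> qf (P t)) ->
  qf (fun a e => exists2 t, List.In t s & P t a e).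
Proof.
elim: s => [|t s IH] h; first by apply: qf_ext (qf_par (fun _ => False)) => a e; split=> [//|[]].
apply: qf_ext (qf_or (h t (or_introl erefl)) (IH (fun t' ht => h t' (or_intror ht)))) => a e.
split=> [[h1|[t' h1 h2]]|[t' [<-|h1] h2]]; [by exists t; [left|]|by exists t'; [right|]|by left|].
by right; exists t'.
Qed.

(** Multiplying each atom, and the modulus of a congruence, by d clears the denominator of the
    substituted point. *)
Lemma qf_subst P (d : nat) b : qf P -> (0 < d)%N -> pl b ->
  qf (fun a e => (d%:Z %| b a e)%Z /\ P a (scons (b a e %/ d%:Z)%Z e)).
Proof.
move=> hP d0 hb; have hd := qf_mod d0 hb; have dz : d%:Z != 0 by lia.
elim: hP => {P} [l hl|m l m0 hl|Q|P _ IH|P Q _ IH1 _ IH2].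
- have [c [l' [h e1]]] := pl_split hl.
  apply: qf_ext (qf_and hd (qf_ge (pl_add (pl_mul c hb) (pl_mul d%:Z h)))) => a e.
  rewrite e1; split=> -[h1 h2]; split=> //; move: h2; have [q ->] := dvdzP h1; rewrite mulzK //.
    by rewrite (_ : c * (q * d%:Z) + d%:Z * l' a e = d%:Z * (c * q + l' a e)) ?pmulr_rge0 //; ring.
  by move=> h2; rewrite (_ : c * (q * d%:Z) + d%:Z * l' a e = d%:Z * (c * q + l' a e)) ?pmulr_rge0 //; ring.
- have [c [l' [h e1]]] := pl_split hl.
  have md : (0 < d * m)%N by rewrite muln_gt0 d0.
  apply: qf_ext (qf_and hd (qf_mod md (pl_add (pl_mul c hb) (pl_mul d%:Z h)))) => a e.
  rewrite e1 PoszM; split=> -[h1 h2]; split=> //; move: h2; have [q ->] := dvdzP h1; rewrite mulzK //;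
  rewrite (_ : c * (q * d%:Z) + d%:Z * l' a e = d%:Z * (c * q + l' a e)) ?dvdz_mul2l //; ring.
- exact: qf_and hd (qf_par Q).
- by apply: qf_ext (qf_and hd (qf_not IH)) => a e; tauto.
by apply: qf_ext (qf_and IH1 IH2) => a e; tauto.
Qed.

(* With [d] clearing the coefficients of the first variable z, the truth of P
   depends on the class of z modulo M and on its position among the cuts. *)
Definition cuts P (d : nat) (Bd : seq (I -> env -> int)) (M : nat) :=
  [/\ forall b, List.In b Bd -> pl b, (0 < M)%N & forall a e (z z' : int), (M%:Z %| z - z')%Z ->
    (forall b, List.In b Bd -> (b a e <= d%:Z * z) = (b a e <= d%:Z * z')) ->
    P a (scons z e) <-> P a (scons z' e)].

(** All multiples d of [d0] are allowed so that subformulas can share one d; each inequality then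
    compares [d * z] with a bound free of z. *)
Lemma qf_cuts P : qf P -> exists2 d0 : nat, (0 < d0)%N & forall d : nat, (0 < d)%N -> (d0 %| d)%N ->
  exists Bd M, cuts P d Bd M.
Proof.
elim=> {P} [l hl|m l m0 hl|Q|P _ [d0 d00 IH]|P Q _ [d1 d10 IH1] _ [d2 d20 IH2]].
- have [c [l' [h e1]]] := pl_split hl.
  case: (ltgtP c 0) => c0; last first.
  + exists 1%N => // d d0 _; exists [::], 1%N; split=> // a e z z' _ _.
    by rewrite !e1 c0 !mul0r.
  + exists `|c|%N; first by lia.
    move=> d d0 /dvdnP[k ek]; have k0 : (0 < k)%N by move: d0; rewrite ek muln_gt0 => /andP[].
    exists [:: (fun a e => - (k%:Z * l' a e))], 1%N; split=> // [b /= [<-|//]|a e z z' _ hb].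
      by apply: pl_opp; apply: pl_mul.
    have E x : (0 <= c * x + l' a e) = (- (k%:Z * l' a e) <= d%:Z * x).
      rewrite -(pmulr_rge0 (c * x + l' a e) (_ : 0 < k%:Z)); last by lia.
      rewrite -[RHS]subr_ge0; congr (_ <= _); rewrite ek PoszM gez0_abs; last by lia.
      by ring.
    by rewrite !e1 !E (hb (fun a e => - (k%:Z * l' a e))) //=; left.
  exists `|c|%N; first by lia.
  move=> d d0 /dvdnP[k ek]; have k0 : (0 < k)%N by move: d0; rewrite ek muln_gt0 => /andP[].
  exists [:: (fun a e => k%:Z * l' a e + 1)], 1%N; split=> // [b /= [<-|//]|a e z z' _ hb].
    by apply: pl_add; [apply: pl_mul|exact: (pl_cst (fun _ => 1))].
  have E x : (0 <= c * x + l' a e) = ~~ (k%:Z * l' a e + 1 <= d%:Z * x).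
    rewrite -(pmulr_rge0 (c * x + l' a e) (_ : 0 < k%:Z)); last by lia.
    rewrite -ltNge ltzD1 -[RHS]subr_ge0; congr (_ <= _); rewrite ek PoszM ltz0_abs; last by lia.
    by ring.
  by rewrite !e1 !E (hb (fun a e => k%:Z * l' a e + 1)) //=; left.
- have [c [l' [h e1]]] := pl_split hl.
  exists 1%N => // d d0 _; exists [::], m; split=> // a e z z' hz _.
  rewrite !e1 (_ : c * z + l' a e = c * (z - z') + (c * z' + l' a e)); last by ring.
  by rewrite rpredDl // dvdz_mull.
- by exists 1%N => // d d0 _; exists [::], 1%N; split.
- exists d0 => // d dp dd; have [Bd [M [h1 h2 h3]]] := IH d dp dd.
  by exists Bd, M; split=> // a e z z' hz hb; rewrite (h3 a e z z').
exists (d1 * d2)%N; first by rewrite muln_gt0 d10.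
move=> d dp dd.
have [Bd1 [M1 [h1 m1 h2]]] := IH1 d dp (dvdn_trans (dvdn_mulr _ (dvdnn _)) dd).
have [Bd2 [M2 [h3 m2 h4]]] := IH2 d dp (dvdn_trans (dvdn_mull _ (dvdnn _)) dd).
exists (Bd1 ++ Bd2), (M1 * M2)%N; split=> [b /In_cat[]||a e z z' hz hb]; [exact: h1|exact: h3|by rewrite muln_gt0 m1|].
rewrite (h2 a e z z') ?(h4 a e z z') //.
- by apply: dvdz_trans hz; rewrite PoszM dvdz_mull.
- by move=> b hb'; apply: hb; apply/In_cat; right.
- by apply: dvdz_trans hz; rewrite PoszM dvdz_mulr.
by move=> b hb'; apply: hb; apply/In_cat; left.
Qed.

Lemma seq_maxP (s : seq int) (Q : int -> bool) : has Q s ->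
  exists b, [/\ b \in s, Q b & forall b', b' \in s -> Q b' -> b' <= b].
Proof.
elim: s => // b s IH /=; case: (boolP (has Q s)) => [/IH[b1 [h1 h2 h3]] _|hn].
  case: (boolP (Q b && (b1 < b))) => [/andP[q lt]|hq].
    exists b; split=> // [|b' ]; first by rewrite mem_head.
    by rewrite inE => /orP[/eqP->//|h] q'; apply: le_trans (h3 _ h q') (ltW lt).
  exists b1; split=> // [|b']; first by rewrite inE h1 orbT.
  rewrite inE => /orP[/eqP->|h] q'; last exact: h3.
  by move: hq; rewrite q' /= -leNgt.
rewrite orbF => q; exists b; split=> // [|b']; first by rewrite mem_head.
rewrite inE => /orP[/eqP->//|h] q'; case/negP: hn; apply/hasP; by exists b'.
Qed.

(** Moving by steps of M, one descends close to the largest cut below [d * z]; if there is none, one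
    ascends to just below the smallest cut. The extra cut 0 covers an empty list. *)
Lemma cut_point (s : seq int) (d M : nat) (z : int) : (0 < d)%N -> (0 < M)%N ->
  exists b j z', [/\ b \in 0 :: s, (`|j| <= d * M)%N, b + j = d%:Z * z', (M%:Z %| z - z')%Z &
    forall b', b' \in s -> (b' <= d%:Z * z) = (b' <= d%:Z * z')].
Proof.
move=> d0 M0; pose w := d%:Z * z; pose D := (d * M)%N%:Z.
have D0 : 0 < D by rewrite /D; lia.
suff [b [j [h1 h2 h3 h4]]] : exists b j, [/\ b \in 0 :: s, (`|j| <= d * M)%N, (D %| w - (b + j))%Z &
    forall b', b' \in s -> (b' <= w) = (b' <= b + j)].
  have /dvdzP[q eq] := h3.
  exists b, j, (z - q * M%:Z); split=> //.
  - by move: eq; rewrite /w /D PoszM mulrBr => e; rewrite -(subKr (d%:Z * z) (b + j)) e; ring.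
  - by rewrite opprB addrC subrK dvdz_mull.
  by move=> b' hb'; rewrite h4 //; congr (_ <= _); move: eq; rewrite /w /D PoszM mulrBr => e; rewrite -(subKr (d%:Z * z) (b + j)) e; ring.
case: (boolP (has (fun b => b <= w) (0 :: s))) => [/seq_maxP[b [h1 h2 h3]]|hn].
  exists b, ((w - b) %% D)%Z.
  have m0 := modz_ge0 (w - b) (lt0r_neq0 D0); have m1 := ltz_pmod (w - b) D0.
  have m2 := divz_eq (w - b) D; have m3 : 0 <= ((w - b) %/ D)%Z by rewrite divz_ge0 // subr_ge0.
  have m4 : 0 <= ((w - b) %/ D)%Z * D by rewrite mulr_ge0 // ltW.
  split=> //; first by move: m1; rewrite /D; lia.
    by apply/dvdzP; exists ((w - b) %/ D)%Z; lia.
  move=> b' hb'; apply/idP/idP => h; last by lia.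
  by have := h3 b' (mem_behead (s := 0 :: s) hb') h; lia.
have /seq_maxP[b [h1 _ h3]] : has (fun _ => true) [seq - b | b <- 0 :: s] by [].
exists (- b), (- (1 + ((- b - 1 - w) %% D)%Z)).
have hb : - b \in 0 :: s by move: h1 => /mapP[b' h ->]; rewrite opprK.
have hw : w < - b by move/hasPn: hn => /(_ _ hb); rewrite -ltNge.
have hmin b' : b' \in 0 :: s -> - b <= b' by move=> h; have := h3 (- b') (map_f _ h) isT; lia.
have m0 := modz_ge0 (- b - 1 - w) (lt0r_neq0 D0); have m1 := ltz_pmod (- b - 1 - w) D0.
have m2 := divz_eq (- b - 1 - w) D.
split=> //; first by move: m1; rewrite /D; lia.
  by apply/dvdzP; exists (- ((- b - 1 - w) %/ D)%Z); rewrite mulNr; lia.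
move=> b' hb'; have := hmin b' (mem_behead (s := 0 :: s) hb').
by move=> h; apply/idP/idP; lia.
Qed.

Definition jrange (N : nat) : seq int := [seq (i%:Z - N%:Z) | i <- iota 0 (2 * N).+1].

Lemma jrangeP N (j : int) : (`|j| <= N)%N -> List.In j (jrange N).
Proof.
move=> h; apply/In_map; exists (absz (j + N%:Z)); last by lia.
by apply/In_mem; rewrite mem_iota; lia.
Qed.

Lemma cuts_points P d Bd M : (0 < d)%N -> cuts P d Bd M -> forall a e z, P a (scons z e) ->
  exists2 b, List.In b ((fun _ _ => 0) :: Bd) & exists2 j, List.In j (jrange (d * M)) &
    (d%:Z %| b a e + j)%Z /\ P a (scons ((b a e + j) %/ d%:Z)%Z e).
Proof.
move=> d0 [_ M0 h] a e z hz.
have [b [j [z' [h1 h2 h3 h4 h5]]]] := cut_point [seq b a e | b <- Bd] z d0 M0.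
have [f hf ef] : exists2 f, List.In f ((fun _ _ => 0) :: Bd) & f a e = b.
  move: h1; rewrite inE => /orP[/eqP->|/In_mem /In_map[f hf ef]]; first by exists (fun _ _ => 0) => //; left.
  by exists f => //; right.
exists f => //; exists j; first exact: jrangeP.
rewrite ef h3 dvdz_mulr //; split=> //; rewrite mulKz; last by lia.
apply/(h a e z z') => // f' hf'; apply: h5; apply/In_mem/In_map; by exists f'.
Qed.

(** Cooper's argument: it suffices to test points at bounded distance from the cuts, finitely many
    for each parameter and of uniform shape. *)
Theorem qf_ex P : qf P -> qf (fun a e => exists z, P a (scons z e)).
Proof.
move=> hP; have [d d0 hd] := qf_cuts hP; have [Bd [M hc]] := hd d d0 (dvdnn d).
have hB b : List.In b ((fun _ _ => 0) :: Bd) -> pl b.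
  by case: hc => h _ _ [<-|/h//]; exact: (pl_cst (fun _ => 0)).
have := qf_has (s := (fun _ _ => 0) :: Bd) (P := fun b a e => exists2 j, List.In j (jrange (d * M)) &
    (d%:Z %| b a e + j)%Z /\ P a (scons ((b a e + j) %/ d%:Z)%Z e))
  (fun b hb => qf_has (fun j _ => qf_subst hP d0 (pl_add (hB b hb) (pl_cst (fun _ => j))))).
apply: qf_ext => a e; split=> [[b _ [j _ [_ h]]]|[z hz]]; last exact: cuts_points hc _ _ _ hz.
by eexists; exact: h.
Qed.

Definition econst : env := fun _ => 0.

(** The value lies among candidates [(b + j) / d] whose coefficients in n are fixed. For large n the
    inequalities deciding whether a candidate is valid are settled, so validity depends only on n
    modulo an E independent of the parameters. *)
Theorem qf_slopes P (D : I -> Prop) (al : I -> nat -> int) : qf P ->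
  (forall a, D a -> forall n z, P a (scons z (scons n%:Z econst)) <-> z = al a n) ->
  exists (E : nat) (S : seq int), (0 < E)%N /\ forall a, D a -> forall c, exists2 s, s \in S &
    exists l0, forall l, (l0 <= l)%N -> al a (E * l.+1 + c)%N - al a (E * l + c)%N = s.
Proof.
move=> hP hal; have [d d0 hd] := qf_cuts hP; have [Bd [M hc]] := hd d d0 (dvdnn d).
have hB b : List.In b ((fun _ _ => 0) :: Bd) -> pl b.
  by case: hc => h _ _ [<-|/h//]; exact: (pl_cst (fun _ => 0)).
pose chi (p : (I -> env -> int) * int) a e :=
  (d%:Z %| p.1 a e + p.2)%Z /\ P a (scons ((p.1 a e + p.2) %/ d%:Z)%Z e).
have qchi p : pl p.1 -> qf (chi p).
  by move=> hp; apply: (qf_subst hP d0 (pl_add hp (pl_cst (fun _ => p.2)))).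
have /choice[MM hM] : forall p, exists m : nat, (0 < m)%N /\ (pl p.1 -> forall a, exists n0 : nat, forall n n' : nat,
    (n0 <= n)%N -> (n0 <= n')%N -> (m%:Z %| n%:Z - n'%:Z)%Z -> chi p a (scons n%:Z econst) -> chi p a (scons n'%:Z econst)).
  move=> p; case: (pselect (pl p.1)) => [/qchi hq|hn]; last by exists 1%N.
  have [d1 d10 hd1] := qf_cuts hq; have [Bd1 [M1 [h1 h2 h3]]] := hd1 d1 d10 (dvdnn d1).
  exists M1; split=> // _ a.
  have [n0 hn0] : exists n0 : nat, forall b, List.In b Bd1 -> b a econst <= n0%:Z.
    elim: Bd1 {h1 h3} => [|b s [n0 IH]]; first by exists 0%N.
    by exists (maxn `|b a econst| n0)%N => b' [<-|/IH]; lia.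
  exists n0 => n n' hn hn' hm; rewrite -(h3 a econst n%:Z n'%:Z) // => b hb.
  have b1 := hn0 b hb.
  have b2 (k : nat) : (n0 <= k)%N -> b a econst <= d1%:Z * k%:Z.
    by move=> hk; have : k%:Z <= d1%:Z * k%:Z; [rewrite ler_peMl //; lia|lia].
  by rewrite !b2.
have /choice[cf hcf] : forall b, exists c, pl b -> exists k : I -> int, forall a (n : int), b a (scons n econst) = c * n + k a.
  move=> b; case: (pselect (pl b)) => [/pl_split[c [l' [_ h]]]|hn]; last by exists 0.
  by exists c => _; exists (fun a => l' a econst) => a n; rewrite h.
pose cands := [seq (b, j) | b <- (fun _ _ => 0) :: Bd, j <- jrange (d * M)].
have candP b j : List.In b ((fun _ _ => 0) :: Bd) -> List.In j (jrange (d * M)) -> List.In (b, j) cands.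
  move=> hb hj; rewrite /cands; elim: (_ :: Bd) hb => // b' s IH [->|hb]; apply/In_cat.
    by left; apply/In_map; exists j.
  by right; apply: IH.
have candV p : List.In p cands -> pl p.1.
  rewrite /cands; elim: (_ :: Bd) hB => // b' s IH hb /In_cat[/In_map[j _ <-]|]; first by apply: hb; left.
  by apply: IH => b h; apply: hb; right.
pose E := foldr (fun p m => MM p * m)%N 1%N cands.
have E0 : (0 < E)%N.
  by rewrite /E; elim: cands {E candP candV} => //= p s IH; rewrite muln_gt0 (hM p).1.
have hE p : List.In p cands -> (MM p %| E)%N.
  rewrite /E; elim: cands {E E0 candP candV} => //= p' s IH [->|/IH h]; first exact: dvdn_mulr.
  exact: dvdn_mull.
exists E, [seq ((cf p.1 * E%:Z) %/ d%:Z)%Z | p <- cands]; split=> // a Da c.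
have [l0 hl0] : exists l0 : nat, forall p, List.In p cands -> forall n n' : nat, (l0 <= n)%N -> (l0 <= n')%N ->
    ((MM p)%:Z %| n%:Z - n'%:Z)%Z -> chi p a (scons n%:Z econst) -> chi p a (scons n'%:Z econst).
  elim: cands candV {candP hE E E0} => [|p s IH] hv; first by exists 0%N.
  have [l1 h1] := IH (fun p' hp => hv p' (or_intror hp)).
  have [l2 h2] := (hM p).2 (hv p (or_introl erefl)) a.
  exists (maxn l1 l2) => p' [<-|hp'] n n' hn hn'; first by apply: h2; lia.
  by apply: (h1 p' hp'); lia.
have hz := (hal a Da (E * l0 + c)%N _).2 erefl.
have [b hb [j hj hchi]] := cuts_points d0 hc hz.
have hp := candP b j hb hj.
have hall l : (l0 <= l)%N -> chi (b, j) a (scons (E * l + c)%N%:Z econst).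
  move=> hl; have h0 : (l0 <= E * l0 + c)%N by apply: leq_trans (leq_addr _ _); apply: leq_pmull.
  have h1 : (l0 <= E * l + c)%N.
    by apply: leq_trans (leq_addr _ _); apply: leq_trans hl _; apply: leq_pmull.
  apply: (hl0 _ hp _ _ h0 h1 _ hchi); apply: (@dvdz_trans E%:Z); first exact: hE hp.
  by apply/dvdzP; exists (l0%:Z - l%:Z); rewrite !PoszD !PoszM; ring.
have [k hk] := hcf b (hB b hb).
have dz : d%:Z != 0 by lia.
have key l : (l0 <= l)%N -> d%:Z * al a (E * l + c)%N = cf b * (E * l + c)%N%:Z + k a + j.
  move=> hl; have [h1 h2] := hall l hl; have := (hal a Da _ _).1 h2; rewrite /= => <-.
  by rewrite mulrC divzK // hk.
exists ((cf b * E%:Z) %/ d%:Z)%Z; first by apply/In_mem/In_map; exists (b, j).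
exists l0 => l hl; have h1 := key l hl; have h2 := key l.+1 (leqW hl).
have -> : cf b * E%:Z = d%:Z * (al a (E * l.+1 + c)%N - al a (E * l + c)%N).
  have el : l.+1%:Z = l%:Z + 1 by lia.
  by rewrite mulrBr h1 h2 !PoszD !PoszM el; ring.
by rewrite mulKz.
Qed.

End Presburger.

(** Orders become integer constants attached to the parameter, and zero and angular conditions
    become propositions about it. *)
Lemma tame_qf (K : padic_field) (I : Type) (F : set (I -> K)) P : tame F P -> qf P.
Proof.
have hl l : lin F l -> pl l.
  by elim=> *; [exact: pl_var|exact: (pl_cst (fun _ => _))|exact: (pl_cst (fun a => _))|exact: pl_add|exact: pl_opp].
move=> [B]; elim=> {P} *.
- by apply: qf_ge; apply: hl.
- by apply: qf_mod => //; apply: hl.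
- exact: (qf_par (fun a => _)).
- exact: (qf_par (fun a => _)).
- exact: qf_not.
- exact: qf_and.
exact: qf_ex.
Qed.

(** * Definable sets and functions *)

Section Renaming.
Variables (K : padic_field) (L : language).
Local Notation asg := (@Assignment K).

Lemma reval_z a r e e' (t : rterm K L) : reval (asg a r e) t = reval (asg a r e') t.
Proof.
elim: t => //= [t1 -> t2 ->|t1 -> t2 ->|t1 -> t2 ->|t] //.
by rewrite (keval_rz r r e e').
Qed.

Lemma zeval_bound (t : zterm K L) : exists N : nat, forall a r e e', (forall i, (i < N)%N -> e i = e' i) ->
  zeval (asg a r e) t = zeval (asg a r e') t.
Proof.
elim: t => [i|||t1 [N1 h1] t2 [N2 h2]|t1 [N1 h1] t2 [N2 h2]|t]; try by exists 0%N.
- by exists i.+1 => a r e e' h /=; apply: h.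
- by exists (maxn N1 N2) => a r e e' h /=; rewrite (h1 a r e e') ?(h2 a r e e') // => i hi; apply: h; lia.
- by exists (maxn N1 N2) => a r e e' h /=; rewrite (h1 a r e e') ?(h2 a r e e') // => i hi; apply: h; lia.
by exists 0%N => a r e e' _ /=; rewrite (keval_rz r r e e').
Qed.

(** Only finitely many integer variables matter, which leaves fresh names for quantifiers. *)
Lemma holds_bound (A : formula K L) : exists N : nat, forall a r e e', (forall i, (i < N)%N -> e i = e' i) ->
  holds (asg a r e) A <-> holds (asg a r e') A.
Proof.
have h2 t1 t2 : exists N : nat, forall a r e e', (forall i, (i < N)%N -> e i = e' i) ->
    zeval (asg a r e) (t1 : zterm K L) = zeval (asg a r e') t1 /\ zeval (asg a r e) (t2 : zterm K L) = zeval (asg a r e') t2.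
  have [N1 h1] := zeval_bound t1; have [N2 h2] := zeval_bound t2; exists (maxn N1 N2) => a r e e' h.
  by rewrite (h1 a r e e') ?(h2 a r e e') // => i hi; apply: h; lia.
elim: A => [t1 t2|n n0 t|t1 t2|t1 t2|t1 t2|n n0 t1 t2|A [N h]|A [N1 h1] B [N2 h3]|i A [N h]|i A [N h]|i A [N h]] /=.
- by exists 0%N => a r e e' _; rewrite (keval_rz r r e e') (keval_rz r r e e' a t2).
- by exists 0%N => a r e e' _; rewrite (keval_rz r r e e').
- by exists 0%N => a r e e' _; rewrite (reval_z a r e e') (reval_z a r e e' t2).
- by have [N h] := h2 t1 t2; exists N => a r e e' he; have [-> ->] := h a r e e' he.
- by have [N h] := h2 t1 t2; exists N => a r e e' he; have [-> ->] := h a r e e' he.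
- by have [N h] := h2 t1 t2; exists N => a r e e' he; have [-> ->] := h a r e e' he.
- by exists N => a r e e' he; rewrite (h a r e e' he).
- by exists (maxn N1 N2) => a r e e' he; rewrite (h1 a r e e') ?(h3 a r e e') // => i hi; apply: he; lia.
- by exists N => a r e e' he; split=> -[z hz]; exists z; move: hz; rewrite /updK /= (h _ _ e e').
- by exists N => a r e e' he; split=> -[z hz]; exists z; move: hz; rewrite /updR /= (h _ _ e e').
exists N => a r e e' he; split=> -[z hz]; exists z; move: hz; rewrite /updZ /= (h _ _ (upd e i z) (upd e' i z)) // => j hj;
  by rewrite /upd; case: ifP => // _; apply: he.
Qed.

Lemma zeval_ren (t : zterm K L) (s : nat -> nat) : exists t' : zterm K L, forall a r e,
  zeval (asg a r e) t' = zeval (asg a r (fun i => e (s i))) t.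
Proof.
elim: t => [i|||t1 [t1' h1] t2 [t2' h2]|t1 [t1' h1] t2 [t2' h2]|t].
- by exists (ZVar K L (s i)).
- by exists (ZZero K L).
- by exists (ZOne K L).
- by exists (ZAdd t1' t2') => a r e /=; rewrite h1 h2.
- by exists (ZSub t1' t2') => a r e /=; rewrite h1 h2.
by exists (ZOrd t) => a r e /=; rewrite (keval_rz r r e (fun i => e (s i))).
Qed.

(* A quantified variable is renamed to a fresh one, above the image under [s]
   of the variables that matter in its scope. *)
Lemma holds_ren (A : formula K L) (s : nat -> nat) : exists A' : formula K L, forall a r e,
  holds (asg a r e) A' <-> holds (asg a r (fun i => e (s i))) A.
Proof.
elim: A s => [t1 t2|n n0 t|t1 t2|t1 t2|t1 t2|n n0 t1 t2|A h|A h1 B h2|i A h|i A h|i A h] s.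
- by exists (FKEq t1 t2) => a r e /=; rewrite (keval_rz r r e (fun i => e (s i))) (keval_rz r r e (fun i => e (s i)) a t2).
- by exists (FKPow n0 t) => a r e /=; rewrite (keval_rz r r e (fun i => e (s i))).
- by exists (FREq t1 t2) => a r e /=; rewrite (reval_z a r e (fun i => e (s i))) (reval_z a r e (fun i => e (s i)) t2).
- by have [t1' h1] := zeval_ren t1 s; have [t2' h2] := zeval_ren t2 s; exists (FZEq t1' t2') => a r e /=; rewrite h1 h2.
- by have [t1' h1] := zeval_ren t1 s; have [t2' h2] := zeval_ren t2 s; exists (FZLe t1' t2') => a r e /=; rewrite h1 h2.
- by have [t1' h1] := zeval_ren t1 s; have [t2' h2] := zeval_ren t2 s; exists (FZMod n0 t1' t2') => a r e /=; rewrite h1 h2.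
- by have [A' h'] := h s; exists (FNot A') => a r e /=; rewrite h'.
- by have [A' h'] := h1 s; have [B' h''] := h2 s; exists (FAnd A' B') => a r e /=; rewrite h' h''.
- by have [A' h'] := h s; exists (FExK i A') => a r e /=; split=> -[z hz]; exists z; move: hz; rewrite /updK /= h'.
- by have [A' h'] := h s; exists (FExR i A') => a r e /=; split=> -[z hz]; exists z; move: hz; rewrite /updR /= h'.
have [N hN] := holds_bound A.
pose k := (\max_(j < N) s j).+1.
have hk j : (j < N)%N -> s j != k.
  by move=> hj; rewrite neq_ltn ltnS (leq_bigmax (Ordinal hj)).
have [A' h'] := h (upd s i k); exists (FExZ k A') => a r e /=.
have E z : holds (asg a r (upd e k z)) A' <-> holds (asg a r (upd (fun i => e (s i)) i z)) A.
  rewrite h'; apply: hN => j hj; rewrite /upd; case: (eqVneq j i) => _; first by rewrite eqxx.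
  by rewrite (negbTE (hk j hj)).
by split=> -[z hz]; exists z; apply/E.
Qed.

End Renaming.

(** * Definable families with integer variables *)

Section Dp.
Variables (K : padic_field) (L : language) (m : nat).
Local Notation asg := (@Assignment K).
Implicit Types (x : m.-tuple K) (e : env) (P Q : m.-tuple K -> env -> Prop).

(** With an infinite list of integer variables, definable subsets of the product of K^m and Z^r are
    handled for all r at once, and quantification uses [scons] as for tame sets. *)
Definition dp P := exists A : formula K L, forall x e,
  holds (asg (nth 0 x) (fun _ => 0) e) A <-> P x e.

Lemma dp_ext P Q : (forall x e, P x e <-> Q x e) -> dp P -> dp Q.
Proof. by move=> h [A hA]; exists A => x e; rewrite hA. Qed.

Lemma dp_not P : dp P -> dp (fun x e => ~ P x e).
Proof. by case=> A hA; exists (FNot A) => x e /=; rewrite hA. Qed.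

Lemma dp_and P Q : dp P -> dp Q -> dp (fun x e => P x e /\ Q x e).
Proof. by case=> A hA [B hB]; exists (FAnd A B) => x e /=; rewrite hA hB. Qed.

Lemma dp_or P Q : dp P -> dp Q -> dp (fun x e => P x e \/ Q x e).
Proof.
move=> hP hQ; apply: dp_ext (dp_not (dp_and (dp_not hP) (dp_not hQ))) => x e.
split=> [h|[h|h] []//]; case: (pselect (P x e)) => p; [by left|right].
by apply: contrapT => q; apply: h.
Qed.

Lemma dp_imp P Q : dp P -> dp Q -> dp (fun x e => P x e -> Q x e).
Proof.
move=> hP hQ; apply: dp_ext (dp_or (dp_not hP) hQ) => x e.
split=> [[h|h] //|h]; case: (pselect (P x e)) => p; [by right; apply: h|by left].
Qed.

Lemma dp_ren P (s : nat -> nat) : dp P -> dp (fun x e => P x (fun i => e (s i))).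
Proof. by case=> A hA; have [A' h] := holds_ren A s; exists A' => x e; rewrite h hA. Qed.

Lemma dp_tl P : dp P -> dp (fun x e => P x (tl e)).
Proof. exact: (@dp_ren P S). Qed.

Lemma dp_ex P : dp P -> dp (fun x e => exists z, P x (scons z e)).
Proof.
case=> A hA; have [N hN] := holds_bound A.
have [A' h'] := holds_ren A (fun i => if i is i'.+1 then i' else N); exists (FExZ N A') => x e /=.
have E z : holds (asg (nth 0 x) (fun _ => 0) (upd e N z)) A' <-> P x (scons z e).
  rewrite h' -hA; apply: hN => -[|j] hj /=; rewrite /upd ?eqxx //.
  by rewrite (ltn_eqF (ltnW hj)).
by split=> -[z hz]; exists z; apply/E.
Qed.

Lemma dp_all P : dp P -> dp (fun x e => forall z, P x (scons z e)).
Proof.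
move=> hP; apply: dp_ext (dp_not (dp_ex (dp_not hP))) => x e.
by split=> [h z|h [z]]; [apply: contrapT => h'; apply: h; exists z|apply].
Qed.

Definition zlin (f : env -> int) := exists t : zterm K L, forall a r e, zeval (asg a r e) t = f e.

Lemma zlin_var i : zlin (fun e => e i). Proof. by exists (ZVar K L i). Qed.

Lemma zlin_add f g : zlin f -> zlin g -> zlin (fun e => f e + g e).
Proof. by case=> t ht [t' ht']; exists (ZAdd t t') => a r e /=; rewrite ht ht'. Qed.

Lemma zlin_sub f g : zlin f -> zlin g -> zlin (fun e => f e - g e).
Proof. by case=> t ht [t' ht']; exists (ZSub t t') => a r e /=; rewrite ht ht'. Qed.

Lemma zlin_ext f g : (forall e, f e = g e) -> zlin f -> zlin g.
Proof. by move=> h [t ht]; exists t => a r e; rewrite ht. Qed.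

Lemma zlin_cst (k : int) : zlin (fun _ => k).
Proof.
have hn (n : nat) : zlin (fun _ => n%:Z).
  elim: n => [|n [t ht]]; first by exists (ZZero K L).
  by exists (ZAdd t (ZOne K L)) => a r e /=; rewrite ht; lia.
case: k => n; first exact: hn.
by apply: zlin_ext (zlin_sub (hn 0%N) (hn n.+1)) => e; rewrite sub0r NegzE.
Qed.

Lemma zlin_mul (k : nat) f : zlin f -> zlin (fun e => k%:Z * f e).
Proof.
move=> hf; elim: k => [|k IH]; first by apply: zlin_ext (zlin_cst 0) => e; rewrite mul0r.
by apply: zlin_ext (zlin_add hf IH) => e; rewrite -addn1 PoszD mulrDl mul1r addrC.
Qed.

Lemma dp_eq f g : zlin f -> zlin g -> dp (fun _ e => f e = g e).
Proof. by case=> t ht [t' ht']; exists (FZEq t t') => x e /=; rewrite ht ht'. Qed.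

Lemma dp_le f g : zlin f -> zlin g -> dp (fun _ e => f e <= g e).
Proof. by case=> t ht [t' ht']; exists (FZLe t t') => x e /=; rewrite ht ht'. Qed.

Lemma dp_lt f g : zlin f -> zlin g -> dp (fun _ e => f e < g e).
Proof.
move=> hf hg; apply: dp_ext (dp_le (zlin_add hf (zlin_cst 1)) hg) => x e.
by rewrite lezD1.
Qed.

Lemma dp_const (Q : Prop) : dp (fun _ _ => Q).
Proof.
case: (pselect Q) => h.
  by apply: dp_ext (dp_eq (zlin_cst 0) (zlin_cst 0)) => x e; split.
by apply: dp_ext (dp_eq (zlin_cst 0) (zlin_cst 1)) => x e; split.
Qed.

Lemma dp_has (T : eqType) (s : seq T) (P : T -> m.-tuple K -> env -> Prop) :
  (forall t, t \in s -> dp (P t)) -> dp (fun x e => exists2 t, t \in s & P t x e).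
Proof.
elim: s => [|t s IH] h; first by apply: dp_ext (dp_const False) => x e; split=> // -[].
have h1 := h t (mem_head _ _); have h2 := IH (fun t' ht => h t' (mem_behead (s := t :: s) ht)).
apply: dp_ext (dp_or h1 h2) => x e; split=> [[h3|[t' h3 h4]]|[t']].
- by exists t; rewrite ?mem_head.
- by exists t'; rewrite // inE h3 orbT.
by rewrite inE => /orP[/eqP->|h3] h4; [left|right; exists t'].
Qed.

Lemma dp_allin (T : eqType) (s : seq T) (P : T -> m.-tuple K -> env -> Prop) :
  (forall t, t \in s -> dp (P t)) -> dp (fun x e => forall t, t \in s -> P t x e).
Proof.
move=> h; have hn t : t \in s -> dp (fun x e => ~ P t x e) by move=> ht; apply: dp_not; apply: h.
apply: dp_ext (dp_not (dp_has hn)) => x e.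
split=> [h' t ht|h' [t ht]]; last by apply; apply: h'.
by apply: contrapT => h''; apply: h'; exists t.
Qed.

Lemma dp_allIn (T : Type) (s : seq T) (P : T -> m.-tuple K -> env -> Prop) :
  (forall t, List.In t s -> dp (P t)) -> dp (fun x e => forall t, List.In t s -> P t x e).
Proof.
elim: s => [|t s IH] h; first by apply: dp_ext (dp_const True) => x e; split.
have h1 := h t (or_introl erefl); have h2 := IH (fun t' ht => h t' (or_intror ht)).
apply: dp_ext (dp_and h1 h2) => x e; split=> [[h3 h4] t' [<-|]//|h3]; first exact: h4.
by split=> [|t' ht]; apply: h3; [left|right].
Qed.

Lemma dp_bind P f : dp P -> zlin f -> dp (fun x e => P x (scons (f e) e)).
Proof.
move=> hP [t ht]; have [t' ht'] := zeval_ren t S.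
have h : zlin (fun e => f (tl e)) by exists t' => a r e; rewrite ht' ht.
apply: dp_ext (dp_ex (dp_and (dp_eq (zlin_var 0) h) hP)) => x e.
by split=> [[z [/= -> ]]//|hz]; exists (f e).
Qed.

Lemma dp_trunc P (n : nat) : dp P -> dp (fun x e => P x (fun i => if (i < n)%N then e i else 0)).
Proof.
move=> hP; have h1 := dp_ren (fun i => if (i < n)%N then i.+1 else 0%N) hP.
apply: dp_ext (dp_bind h1 (zlin_cst 0)) => x e.
suff -> : (fun i => scons 0 e (if (i < n)%N then i.+1 else 0%N)) = (fun i => if (i < n)%N then e i else 0) by [].
by apply/funext => i; case: ifP.
Qed.

Definition dpf (D : m.-tuple K -> env -> Prop) (f : m.-tuple K -> env -> int) :=
  dp (fun x e => D x (tl e) /\ e 0%N = f x (tl e)).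

Lemma dpf_ext D f g : (forall x e, D x e -> f x e = g x e) -> dpf D f -> dpf D g.
Proof. by move=> h; apply: dp_ext => x e; split=> -[h1 ->]; rewrite h. Qed.

Lemma dpf_ren D f (s : nat -> nat) : dpf D f -> dpf (fun x e => D x (fun i => e (s i))) (fun x e => f x (fun i => e (s i))).
Proof. exact: (@dp_ren _ (lift s)). Qed.

Lemma dpf_tl D f : dpf D f -> dpf (fun x e => D x (tl e)) (fun x e => f x (tl e)).
Proof. exact: (@dpf_ren _ _ S). Qed.

Lemma dp_rel1 D f Q : dpf D f -> dp Q -> dp (fun x e => D x e /\ Q x (scons (f x e) e)).
Proof.
move=> hf hQ; apply: dp_ext (dp_ex (dp_and hf hQ)) => x e.
by split=> [[z [[h1 /= ->] h2]]//|[h1 h2]]; exists (f x e).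
Qed.

Lemma dp_rel2 D f g Q : dpf D f -> dpf D g -> dp Q ->
  dp (fun x e => D x e /\ Q x (scons (f x e) (scons (g x e) e))).
Proof.
move=> hf hg hQ; apply: dp_ext (dp_rel1 hg (dp_rel1 (dpf_tl hf) hQ)) => x e /=.
by split=> [[h1 [h2 h3]]|[h1 h2]].
Qed.

Lemma dpf_lin D f : dp D -> zlin f -> dpf D (fun _ e => f e).
Proof.
move=> hD [t ht]; have [t' ht'] := zeval_ren t S.
have h : zlin (fun e => f (tl e)) by exists t' => a r e; rewrite ht' ht.
exact: (dp_and (dp_tl hD) (dp_eq (zlin_var 0) h)).
Qed.

Lemma dpf_sub_dom D D' f : dp D' -> (forall x e, D' x e -> D x e) -> dpf D f -> dpf D' f.
Proof.
move=> hD' h hf; apply: dp_ext (dp_and (dp_tl hD') hf) => x e.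
by split=> [[h1 [h2 h3]]|[h1 h2]]; do ?split=> //; apply: h.
Qed.

Lemma dpf_case D Q f g : dp Q -> dpf D f -> dpf D g -> dpf D (fun x e => if pselect (Q x e) then f x e else g x e).
Proof.
move=> hQ hf hg; have hQ' := dp_tl hQ.
apply: dp_ext (dp_or (dp_and hQ' hf) (dp_and (dp_not hQ') hg)) => x e /=.
case: pselect => q; split=> [[[]|[]]|] //; by [left|right].
Qed.

End Dp.

Section DefinableFunctions.
Variables (K : padic_field) (L : language) (m : nat) (X : set (m.-tuple K)).
Local Notation asg := (@Assignment K).
Local Notation dp := (@dp K L m).
Local Notation dpf := (@dpf K L m).

Definition XK (x : m.-tuple K) (e : env) := X x.
Definition XN (x : m.-tuple K) (e : env) := X x /\ 0 <= e 0%N.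

Lemma dp_XK : definableK L X -> dp XK.
Proof.
move=> [A _ hA].
have h : dp (fun x e => holds (asg (nth 0 x) (fun _ => 0) e) A) by exists A.
apply: dp_ext (dp_trunc 0 h) => x e; rewrite /XK hA /env_of /=.
suff -> : (fun i => nth 0 ([tuple] : 0.-tuple int) i) = (fun i => if (i < 0)%N then e i else 0) by [].
by apply/funext => i; rewrite nth_nil.
Qed.

Lemma dp_XN : dp XK -> dp XN.
Proof. by move=> h; exact: (dp_and h (dp_le m (zlin_cst K L 0) (zlin_var K L 0))). Qed.

Lemma tuple1E (t : 1.-tuple int) : t = [tuple thead t].
Proof. by apply/val_inj; case: t => [[|a [|b t]] ht] //. Qed.

Lemma dpf_definableK (b : m.-tuple K -> int) : dpf XK (fun x _ => b x) ->
  definable_fun L [set y : Defs.space K m 0 | X y.1] (fun y => b y.1).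
Proof.
move=> [A hA]; exists A => w; rewrite /env_of hA /XK /graph_on /=; split.
  by move=> [y hy <-] /=; rewrite (tuple0 y.2).
move=> [h1 h2]; exists (w.1, [tuple]) => //=; case: w h1 h2 => x t /= h1 h2.
by congr (_, _); apply/val_inj => /=; rewrite -h2; case: t h2 => [[|a [|b' t]] ht].
Qed.

Lemma dpf_definableN (al : m.-tuple K -> nat -> int) : dpf XN (fun x e => al x `|e 0%N|%N) ->
  definable_fun L [set y : Defs.space K m 1 | X y.1 /\ 0 <= thead y.2] (fun y => al y.1 `|thead y.2|%N).
Proof.
(* [graph_on] puts the value last, whereas [dpf] has it as variable 0; the renaming exchanges the
   two. *)
move=> h; have [A hA] := dp_ren (fun i => if i == 0%N then 1%N else if i == 1%N then 0%N else i) h.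
exists A => w; rewrite /env_of hA /XN /tl /graph_on /=; split.
  by move=> [[x t] [h1 h2] <-] /=; move: h2; rewrite (tuple1E t) /= !theadE.
move=> [[h1 h2] h3]; case: w h1 h2 h3 => x t /= h1 h2 h3.
exists (x, [tuple nth 0 t 0]); first by rewrite /= theadE.
congr (_, _); apply/val_inj => /=; rewrite theadE.
by case: t h2 h3 => [[|a [|b' [|c t]]] ht] //= _ ->.
Qed.

Lemma definable_dpfN (al : Defs.space K m 1 -> int) : dp XK ->
  definable_fun L [set y : Defs.space K m 1 | X y.1 /\ 0 <= thead y.2] al ->
  dpf XN (fun x e => al (x, [tuple e 0%N])).
Proof.
move=> hX [A hA].
have h : dp (fun x e => holds (asg (nth 0 x) (fun _ => 0) e) A) by exists A.
have h1 := dp_ren (fun i => if i == 0%N then 1%N else if i == 1%N then 0%N else i) (dp_trunc 2 h).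
apply: dp_ext h1 => x e.
have := hA (x, [tuple e 1%N; e 0%N]); rewrite /env_of /=.
have -> : (fun i => nth 0 [:: e 1%N; e 0%N] i) = (fun i => if (i < 2)%N then e (if i == 0%N then 1%N else if i == 1%N then 0%N else i) else 0).
  by apply/funext => -[|[|[|i]]].
move=> <-; rewrite /graph_on /XN /tl /=; split=> [[[x' t] /= [h2 h3] eq]|[[h2 h3] h4]].
  have := congr1 fst eq; have := congr1 (fun w => val w.2) eq; rewrite /=.
  by move: h3; rewrite (tuple1E t) /= !theadE => h3 [<- <-] <-.
exists (x, [tuple e 1%N]); first by rewrite /= theadE.
by congr (_, _); apply/val_inj; rewrite /= h4.
Qed.

Lemma definable_slopes (al : m.-tuple K -> nat -> int) : dpf XN (fun x e => al x `|e 0%N|%N) ->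
  exists (E : nat) (S : seq int), (0 < E)%N /\ forall x, X x -> forall c, exists2 s, s \in S &
    exists l0, forall l, (l0 <= l)%N -> al x (E * l.+1 + c)%N - al x (E * l + c)%N = s.
Proof.
move=> [A hA]; have hq := tame_qf (tame_holds A (fun _ => 0)).
have [|E [S [E0 hS]]] := @qf_slopes _ _ (fun a => exists2 x, X x & a = nth 0 x) (fun a n => al [tuple a i | i < m] n) hq.
  move=> a [x hx ->] n z; rewrite hA /XN /= (_ : [tuple nth 0 x i | i < m] = x); first by split=> [[]|].
  by apply: eq_from_tnth => i; rewrite tnth_mktuple (tnth_nth 0).
exists E, S; split=> // x hx c.
have [|s hs [l0 h]] := hS (nth 0 x) _ c; first by exists x.
exists s => //; exists l0 => l hl; rewrite -(h l hl).
suff -> : [tuple nth 0 x i | i < m] = x by [].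
by apply: eq_from_tnth => i; rewrite tnth_mktuple (tnth_nth 0).
Qed.

End DefinableFunctions.

(** * Normal form of constructible functions *)

Lemma In_allpairs (S T U : Type) (f : S -> T -> U) (s : seq S) (t : seq T) u :
  List.In u [seq f a b | a <- s, b <- t] -> exists2 a, List.In a s & exists2 b, List.In b t & u = f a b.
Proof.
elim: s => //= a s IH /In_cat[/In_map[b hb <-]|/IH[a' h1 h2]].
  by exists a; [left|exists b].
by exists a'; [right|].
Qed.

Lemma sum_allpairs (R : nmodType) (S T U : Type) (f : S -> T -> U) (s : seq S) (t : seq T) (F : U -> R) :
  \sum_(u <- [seq f a b | a <- s, b <- t]) F u = \sum_(a <- s) \sum_(b <- t) F (f a b).
Proof. by elim: s => [|a s IH] /=; rewrite ?big_nil // big_cons big_cat big_map IH. Qed.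

Section NormalForm.
Variables (K : padic_field) (L : language) (m : nat) (X : set (m.-tuple K)).
Hypothesis hX : definableK L X.
Local Notation dp := (@dp K L m).
Local Notation dpf := (@dpf K L m).
Local Notation XK := (XK X).
Local Notation XN := (XN X).
Local Notation cK := (constructibleK L X).
Local Notation cN := (constructibleN L X).
Let q : rat := (qK K)%:R.
Implicit Types (x : m.-tuple K) (al : m.-tuple K -> nat -> int).

Let dXK : dp XK := dp_XK hX.
Let dXN : dp XN := dp_XN dXK.
Definition dfN al := dpf XN (fun x e => al x `|e 0%N|%N).
Definition dfK (b : m.-tuple K -> int) := dpf XK (fun x _ => b x).

Lemma cK_fun b : dfK b -> cK (fun x => (b x)%:~R).
Proof. by move=> /dpf_definableK h; exact: (cst_fun h). Qed.

Lemma cK_pow b : dfK b -> cK (fun x => q ^ (- b x)).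
Proof. by move=> /dpf_definableK h; exact: (cst_qpow h). Qed.

Lemma cK_cst c : cK (fun _ => c). Proof. exact: cst_scalar. Qed.
Lemma cK_add f g : cK f -> cK g -> cK (fun x => f x + g x). Proof. exact: cst_add. Qed.
Lemma cK_mul f g : cK f -> cK g -> cK (fun x => f x * g x). Proof. exact: cst_mul. Qed.

Lemma cK_sum (T : Type) (s : seq T) (P : pred T) (f : T -> m.-tuple K -> rat) :
  (forall t, cK (f t)) -> cK (fun x => \sum_(t <- s | P t) f t x).
Proof.
move=> h; elim: s => [|t s IH].
  by suff -> : (fun x => \sum_(t <- [::] | P t) f t x) = fun _ => 0 by [exact: cK_cst|]; apply/funext => x; rewrite big_nil.
have -> : (fun x => \sum_(t0 <- t :: s | P t0) f t0 x) = (fun x => (P t)%:R * f t x + \sum_(t <- s | P t) f t x).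
  by apply/funext => x; rewrite big_cons; case: (P t); rewrite ?mul1r // mul0r add0r.
by apply: cK_add => //; apply: cK_mul => //; apply: cK_cst.
Qed.

Lemma cK_sumIn (T : Type) (s : seq T) (P : pred T) (f : T -> m.-tuple K -> rat) :
  (forall t, List.In t s -> cK (f t)) -> cK (fun x => \sum_(t <- s | P t) f t x).
Proof.
elim: s => [|t s IH] h.
  by suff -> : (fun x => \sum_(t <- [::] | P t) f t x) = fun _ => 0 by [exact: cK_cst|]; apply/funext => x; rewrite big_nil.
have -> : (fun x => \sum_(t0 <- t :: s | P t0) f t0 x) = (fun x => (P t)%:R * f t x + \sum_(t <- s | P t) f t x).
  by apply/funext => x; rewrite big_cons; case: (P t); rewrite ?mul1r // mul0r add0r.
apply: cK_add; last by apply: IH => t' ht; apply: h; right.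
by apply: cK_mul; [exact: cK_cst|apply: h; left].
Qed.

(** Isolates the finitely many definable functions behind a constructible one, so that a common
    modulus and a common threshold exist for them. *)
Inductive Alg (As : seq (m.-tuple K -> nat -> int)) : (m.-tuple K -> nat -> rat) -> Prop :=
| Alg_fun al of List.In al As : Alg As (fun x n => (al x n)%:~R)
| Alg_pow al of List.In al As : Alg As (fun x n => q ^ (- al x n))
| Alg_cst c : Alg As (fun _ _ => c)
| Alg_add f g of Alg As f & Alg As g : Alg As (fun x n => f x n + g x n)
| Alg_mul f g of Alg As f & Alg As g : Alg As (fun x n => f x n * g x n)
| Alg_eq f g of Alg As f & (forall x n, X x -> f x n = g x n) : Alg As g.

Lemma Alg_mono As As' f : (forall al, List.In al As -> List.In al As') -> Alg As f -> Alg As' f.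
Proof.
move=> h; elim=> {f} [al /h|al /h|c|f g _ h1 _ h2|f g _ h1 _ h2|f g _ h1 h2].
- exact: Alg_fun.
- exact: Alg_pow.
- exact: Alg_cst.
- exact: Alg_add.
- exact: Alg_mul.
exact: Alg_eq h1 h2.
Qed.

Lemma cN_Alg phi : cN phi -> exists As, (forall al, List.In al As -> dfN al) /\ Alg As phi.
Proof.
have gen f : constructible L [set y : Defs.space K m 1 | X y.1 /\ 0 <= thead y.2] f -> exists As,
    (forall al, List.In al As -> dfN al) /\ Alg As (fun x n => f (x, [tuple n%:Z])).
  have hd (al : Defs.space K m 1 -> int) : definable_fun L [set y : Defs.space K m 1 | X y.1 /\ 0 <= thead y.2] al ->
      dfN (fun x n => al (x, [tuple n%:Z])).
    move=> /(definable_dpfN dXK); apply: dpf_ext => x e [_ h].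
    by rewrite gez0_abs.
  elim=> {f} [al /hd h|al /hd h|c|f g _ [A1 [h1 h2]] _ [A2 [h3 h4]]|f g _ [A1 [h1 h2]] _ [A2 [h3 h4]]|f g _ [A1 [h1 h2]] h3].
  - by exists [:: (fun x n => al (x, [tuple n%:Z]))]; split=> [al' /= [<-|//] //|]; apply: (Alg_fun (al := fun x n => al (x, [tuple n%:Z]))); left.
  - by exists [:: (fun x n => al (x, [tuple n%:Z]))]; split=> [al' /= [<-|//] //|]; apply: (Alg_pow (al := fun x n => al (x, [tuple n%:Z]))); left.
  - by exists [::]; split=> //; exact: Alg_cst.
  - exists (A1 ++ A2); split=> [al /In_cat[]|]; [exact: h1|exact: h3|].
    by apply: Alg_add; [apply: Alg_mono h2|apply: Alg_mono h4] => al ?; apply/In_cat; [left|right].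
  - exists (A1 ++ A2); split=> [al /In_cat[]|]; [exact: h1|exact: h3|].
    by apply: Alg_mul; [apply: Alg_mono h2|apply: Alg_mono h4] => al ?; apply/In_cat; [left|right].
  by exists A1; split=> //; apply: Alg_eq h2 _ => x n hx; apply: h3; rewrite /= theadE.
by move=> /gen[As [h1 h2]]; exists As; split=> //; apply: Alg_eq h2 _ => x n _ /=.
Qed.

Definition slope_from al x (E c t : nat) (s : int) :=
  forall l, (t <= l)%N -> al x (E * l.+1 + c)%N - al x (E * l + c)%N = s.

Lemma slope_affine al x E c t s : slope_from al x E c t s ->
  forall l j, (t <= l)%N -> al x (E * (l + j) + c)%N = al x (E * l + c)%N + s * j%:Z.
Proof.
move=> h l; elim=> [|j IH] hl; first by rewrite addn0 mulr0 addr0.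
have := h (l + j)%N (leq_trans hl (leq_addr _ _)); rewrite addnS => e.
rewrite -[LHS](subrK (al x (E * (l + j) + c)%N)) e IH //.
by rewrite (_ : j.+1%:Z = j%:Z + 1); [ring|lia].
Qed.

Lemma slope_scale al x E c t s k : (0 < k)%N -> slope_from al x E c t s -> slope_from al x (E * k) c t (s * k%:Z).
Proof.
move=> k0 h l hl.
rewrite (_ : E * k * l.+1 + c = E * (k * l + k) + c)%N; last by rewrite -mulnA mulnSr.
rewrite (_ : E * k * l + c = E * (k * l) + c)%N; last by rewrite mulnA.
rewrite (slope_affine h); first by rewrite addrC addKr.
by apply: leq_trans hl _; apply: leq_pmull.
Qed.

Lemma common_slopes As : (forall al, List.In al As -> dfN al) -> exists (E : nat) (S : seq int), (0 < E)%N /\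
  forall al, List.In al As -> forall x, X x -> forall c, exists2 s, s \in S & exists t, slope_from al x E c t s.
Proof.
elim: As => [|al As IH] h; first by exists 1%N, [::].
have [E1 [S1 [E10 h1]]] := IH (fun al' ha => h al' (or_intror ha)).
have [E2 [S2 [E20 h2]]] := definable_slopes (h al (or_introl erefl)).
exists (E1 * E2)%N, ([seq s * E2%:Z | s <- S1] ++ [seq s * E1%:Z | s <- S2]); split; first by rewrite muln_gt0 E10.
move=> al' [<-|ha] x hx c.
  have [s hs [t ht]] := h2 x hx c; exists (s * E1%:Z); first by rewrite mem_cat (map_f (fun s => s * E1%:Z)) ?orbT.
  by exists t; rewrite mulnC; apply: slope_scale.
have [s hs [t ht]] := h1 al' ha x hx c; exists (s * E2%:Z); first by rewrite mem_cat (map_f (fun s => s * E2%:Z)).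
by exists t; apply: slope_scale.
Qed.

Lemma dpf_at al (E c : nat) : dfN al ->
  dpf (fun x e => X x /\ 0 <= e 0%N) (fun x e => al x (E * `|e 0%N| + c)%N).
Proof.
move=> h.
have hz : zlin K L (fun e => E%:Z * e 1%N + c%:Z) by apply: zlin_add (zlin_mul E (zlin_var _ _ 1)) (zlin_cst _ _ _).
have h1 := dp_bind (dp_ren (fun i => if i == 0%N then 1%N else if i == 1%N then 0%N else i) h) hz.
have h2 := dp_tl (dp_le m (zlin_cst K L 0) (zlin_var K L 0)).
apply: dp_ext (dp_and h2 h1) => x e; rewrite /XN /tl /=.
have E1 : 0 <= e 1%N -> absz (E%:Z * e 1%N + c%:Z) = (E * `|e 1%N| + c)%N.
  by move=> h0; apply/eqP; rewrite -eqz_nat PoszD PoszM gez0_abs // ?gez0_abs // addr_ge0 ?mulr_ge0.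
split=> [[h3 [[h4 h5] h6]]|[[h3 h4] h5]]; first by rewrite -E1.
by rewrite E1 // addr_ge0 ?mulr_ge0.
Qed.

Section Fixed.
Variables (As : seq (m.-tuple K -> nat -> int)) (E : nat) (S : seq int).
Hypothesis hAs : forall al, List.In al As -> dfN al.
Hypothesis E0 : (0 < E)%N.
Hypothesis hS : forall al, List.In al As -> forall x, X x -> forall c, exists2 s, s \in S & exists t, slope_from al x E c t s.

Definition good x (t : nat) := forall al, List.In al As -> forall c, c \in iota 0 E ->
  exists2 s, s \in S & slope_from al x E c t s.

Lemma slope_from_le al x c t t' s : (t <= t')%N -> slope_from al x E c t s -> slope_from al x E c t' s.
Proof. by move=> le h l hl; apply: h; apply: leq_trans hl. Qed.

Lemma good_ex x : X x -> exists t, good x t.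
Proof.
move=> hx; rewrite /good; elim: As hS => [|al As' IH] h; first by exists 0%N.
have [t1 h1] := IH (fun al' ha => h al' (or_intror ha)).
have [t2 h2] : exists t2, forall c, c \in iota 0 E -> exists2 s, s \in S & slope_from al x E c t2 s.
  elim: (iota 0 E) => [|c r [t2 h2]]; first by exists 0%N.
  have [s hs [t3 h3]] := h al (or_introl erefl) x hx c.
  exists (maxn t2 t3) => c'; rewrite inE => /orP[/eqP->|/h2[s' hs' h4]].
    by exists s => //; apply: slope_from_le h3; rewrite leq_maxr.
  by exists s' => //; apply: slope_from_le h4; rewrite leq_maxl.
exists (maxn t1 t2) => al' [<-|ha] c hc.
  by have [s hs h3] := h2 c hc; exists s => //; apply: slope_from_le h3; rewrite leq_maxr.
by have [s hs h3] := h1 al' ha c hc; exists s => //; apply: slope_from_le h3; rewrite leq_maxl.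
Qed.

Lemma least_ex x : exists t, X x -> good x t /\ forall t', (t' < t)%N -> ~ good x t'.
Proof.
case: (pselect (X x)) => [hx|hn]; last by exists 0%N.
have hg : exists t, `[< good x t >] by have [t ht] := good_ex hx; exists t; apply/asboolP.
case: (ex_minnP hg) => t /asboolP h1 h2; exists t => _; split=> // t' ht' /asboolP /h2.
by rewrite leqNgt ht'.
Qed.

(** Being the least threshold, it is a definable function of [x]; an arbitrary choice would not
    be. *)
Definition l0 x : nat := sval (cid (least_ex x)).

Lemma l0_good x : X x -> good x (l0 x). Proof. by move=> hx; case: (svalP (cid (least_ex x)) hx). Qed.
Lemma l0_least x t : X x -> (t < l0 x)%N -> ~ good x t.
Proof. by move=> hx; case: (svalP (cid (least_ex x)) hx) => _; apply. Qed.

Lemma dp_good : dp (fun x e => (X x /\ 0 <= e 0%N) /\ good x `|e 0%N|).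
Proof.
(* The next point of the class is written [E * l + (E + c)], so that [dpf_at] covers both values at
   the same l. *)
have h1 al c s : List.In al As -> dp (fun x e => XN x e /\ al x (E * `|e 0%N| + (E + c))%N - al x (E * `|e 0%N| + c)%N = s).
  move=> /hAs ha.
  by apply: (dp_rel2 (dpf_at E (E + c) ha) (dpf_at E c ha) (dp_eq m (zlin_sub (zlin_var K L 0) (zlin_var K L 1)) (zlin_cst K L s))).
have h2 al c s : List.In al As -> dp (fun x e => forall z, e 0%N <= z -> XN x (scons z e) /\
    al x (E * `|z| + (E + c))%N - al x (E * `|z| + c)%N = s).
  by move=> ha; apply: (dp_all (dp_imp (dp_le m (zlin_var K L 1) (zlin_var K L 0)) (h1 al c s ha))).
have h3 := dp_allIn (fun al ha => dp_allin (s := iota 0 E) (fun c _ => dp_has (s := S) (fun s _ => h2 al c s ha))).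
apply: dp_ext (dp_and dXN h3) => x e; rewrite /XN /=; split=> -[[hx h0] h]; split=> // al ha c hc.
  have [s hs h4] := h al ha c hc; exists s => // l hl.
  have [|_ <-] := h4 l%:Z; first by lia.
  by rewrite mulnSr addnA.
have [s hs h4] := h al ha c hc; exists s => // z hz; split; first by split=> //; lia.
by rewrite -(h4 `|z|%N) ?mulnSr ?addnA //; lia.
Qed.

Lemma dfK_l0 : dfK (fun x => (l0 x)%:Z).
Proof.
have h1 := dp_imp (dp_le m (zlin_cst K L 0) (zlin_var K L 0)) (dp_imp (dp_lt m (zlin_var K L 0) (zlin_var K L 1))
  (dp_not (dp_ren (fun i => if i == 0%N then 0%N else i) dp_good))).
apply: dp_ext (dp_and dp_good (dp_all h1)) => x e; rewrite /XK /=; split.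
  move=> [[[hx e0] hg] hmin]; split=> //; apply/eqP; rewrite eq_le.
  apply/andP; split; last first.
    by rewrite leNgt; apply/negP => lt; apply: (@l0_least x `|e 0%N| hx) => //; lia.
  rewrite leNgt; apply/negP => lt; have := l0_good hx.
  by have := hmin (l0 x)%:Z isT lt => hn g; apply: hn.
move=> [hx ->]; split; first by split=> //; exact: l0_good.
by move=> z z0 lt [_ hg]; apply: (@l0_least x `|z| hx) hg; lia.
Qed.

Definition be al c x : int := al x (E * l0 x + c)%N.

Lemma dfK_be al c : List.In al As -> dfK (be al c).
Proof.
move=> /hAs ha.
have h := dp_ren (fun i => if i == 0%N then 1%N else if i == 1%N then 0%N else i) (dpf_at E c ha).
apply: dp_ext (dp_rel1 (D := XK) dfK_l0 h) => x e; rewrite /XK /be /tl /=.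
by split=> [[h1 [_ h2]]|[h1 h2]].
Qed.

(** The slope can be read off the first difference after the threshold, so its indicator is
    definable and the unknown slope is summed over the finite set S. *)
Definition ind al c s x : int := if pselect (X x /\ be al (E + c) x - be al c x = s) then 1 else 0.

Lemma dfK_ind al c s : List.In al As -> dfK (ind al c s).
Proof.
move=> ha.
have h : dp (fun x e => X x /\ be al (E + c) x - be al c x = s).
  exact: (dp_rel2 (dfK_be (E + c) ha) (dfK_be c ha) (dp_eq m (zlin_sub (zlin_var K L 0) (zlin_var K L 1)) (zlin_cst K L s))).
exact: (dpf_case h (dpf_lin dXK (zlin_cst K L 1)) (dpf_lin dXK (zlin_cst K L 0))).
Qed.

Lemma al_affine al c x : List.In al As -> (c < E)%N -> X x -> exists2 s, s \in S &
  (forall l, al x (E * (l0 x + l) + c)%N = be al c x + s * l%:Z) /\ forall s', ind al c s' x = (s == s')%:R.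
Proof.
move=> ha hc hx; have [|s hs h] := l0_good hx ha (c := c); first by rewrite mem_iota.
exists s => //; split=> [l|s']; first by rewrite (slope_affine h).
have e : be al (E + c) x - be al c x = s by rewrite -(h (l0 x)) // /be mulnSr addnA.
rewrite /ind e; case: pselect => [[hx' h']|hn] /=; first by rewrite h' eqxx.
by case: eqVneq => // e'; case: hn.
Qed.

Definition term := ((nat * int) * (m.-tuple K -> rat))%type.
Definition wgt (g : nat * int) (l : nat) : rat := l%:R ^+ g.1 * (q ^ g.2) ^+ l.

Definition isNF c (psi : m.-tuple K -> nat -> rat) := exists ts : seq term,
  (forall t, List.In t ts -> cK t.2) /\
  forall x, X x -> forall l, psi x (E * (l0 x + l) + c)%N = \sum_(t <- ts) t.2 x * wgt t.1 l.

Let q0 : q != 0.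
Proof. by rewrite pnatr_eq0 -lt0n /qK; apply/card_gt0P; exists 0. Qed.

Lemma wgtD g g' l : wgt (g.1 + g'.1, g.2 + g'.2)%R l = wgt g l * wgt g' l.
Proof. by rewrite /wgt /= exprD expfzDr // exprMn; ring. Qed.

Lemma sum_ind (f : int -> rat) al c x s : (forall s', ind al c s' x = (s == s')%:R) -> s \in S ->
  \sum_(s' <- undup S) (ind al c s' x)%:~R * f s' = f s.
Proof.
move=> h hs; rewrite (bigD1_seq s) ?mem_undup ?undup_uniq //= h eqxx mul1r big1 ?addr0 // => s' ne.
by rewrite h eq_sym (negbTE ne) mul0r.
Qed.

Lemma Alg_NF psi c : Alg As psi -> (c < E)%N -> isNF c psi.
Proof.
move=> h hc; elim: h => {psi} [al ha|al ha|k|f g _ [t1 [h1 e1]] _ [t2 [h2 e2]]|f g _ [t1 [h1 e1]] _ [t2 [h2 e2]]|f g _ [t1 [h1 e1]] h2].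
- exists (((0%N, 0), fun x => (be al c x)%:~R) :: [seq ((1%N, 0), fun x => s%:~R * (ind al c s x)%:~R) | s <- undup S]); split.
    move=> t /= [<-|/In_map[s _ <-]] /=; first by apply: cK_fun; apply: dfK_be.
    by apply: cK_mul; [exact: cK_cst|apply: cK_fun; apply: dfK_ind].
  move=> x hx l; have [s hs [-> hi]] := al_affine ha hc hx.
  rewrite big_cons big_map /wgt /= ?expr0 expr0z expr1n !mulr1 rmorphD rmorphM /=; congr (_ + _).
  rewrite -(sum_ind (fun s => s%:~R * l%:R) hi hs); apply: eq_bigr => s' _.
  by rewrite ?expr1n ?mulr1 ?expr1 /=; ring.
- exists [seq ((0%N, - s), fun x => q ^ (- be al c x) * (ind al c s x)%:~R) | s <- undup S]; split.
    move=> t /In_map[s _ <-] /=.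
    by apply: cK_mul; [apply: cK_pow; apply: dfK_be|apply: cK_fun; apply: dfK_ind].
  move=> x hx l; have [s hs [-> hi]] := al_affine ha hc hx.
  rewrite big_map /= -(sum_ind (fun s => q ^ (- (be al c x + s * l%:Z))) hi hs); apply: eq_bigr => s' _.
  by rewrite /wgt /= expr0 mul1r opprD expfzDr // -mulNr -exprz_exp -exprnP; ring.
- exists [:: ((0%N, 0), fun _ => k)]; split=> [t /= [<-|//]|x hx l]; first exact: cK_cst.
  by rewrite big_seq1 /wgt /= expr0z expr1n expr0 !mulr1.
- exists (t1 ++ t2); split=> [t /In_cat[]|x hx l]; [exact: h1|exact: h2|].
  by rewrite e1 // e2 // big_cat.
- exists [seq ((a.1.1 + b.1.1, a.1.2 + b.1.2)%R, fun x => a.2 x * b.2 x) | a <- t1, b <- t2]; split=> [t|x hx l].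
    by move=> ht; have [a ha [b hb ->]] := In_allpairs ht; exact: (cK_mul (h1 a ha) (h2 b hb)).
  rewrite e1 // e2 // big_distrlr /= sum_allpairs; apply: eq_bigr => a _; apply: eq_bigr => b _.
  by rewrite /= wgtD; ring.
by exists t1; split=> // x hx l; rewrite -h2 // e1.
Qed.

(** Terms of equal growth are merged; only with distinct weights can a growth comparison isolate a
    coefficient. *)
Lemma isNF_keys c psi : isNF c psi -> exists (G : seq (nat * int)) (k : nat * int -> m.-tuple K -> rat),
  [/\ uniq G, forall g, cK (k g) &
    forall x, X x -> forall l, psi x (E * (l0 x + l) + c)%N = \sum_(g <- G) k g x * wgt g l].
Proof.
move=> [ts [h1 h2]]; exists (undup [seq t.1 | t <- ts]), (fun g x => \sum_(t <- ts | t.1 == g) t.2 x).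
split=> [|g|x hx l]; [exact: undup_uniq|exact: cK_sumIn|].
rewrite h2 //; set G := undup _.
have hG : forall t, List.In t ts -> t.1 \in G.
  by move=> t ht; rewrite mem_undup; apply/In_mem/In_map; exists t.
have uG : uniq G by exact: undup_uniq.
move: hG; move: {1 2 3}ts => ts' ; elim: ts' => [|t ts' IH] hG.
  by rewrite big_nil big1 // => g _; rewrite big_nil mul0r.
rewrite big_cons IH; last by move=> t' ht; apply: hG; right.
rewrite [in RHS](bigD1_seq t.1) ?hG //=; last by left.
rewrite [in LHS](bigD1_seq t.1) ?hG //=; last by left.
rewrite big_cons eqxx addrA -mulrDl; congr (_ + _).
by apply: eq_bigr => g ne; rewrite big_cons eq_sym (negbTE ne).
Qed.

End Fixed.

Lemma normal_form phi : cN phi -> exists (E : nat) (l0 : m.-tuple K -> nat), [/\ (0 < E)%N, dfK (fun x => (l0 x)%:Z) &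
  forall c, (c < E)%N -> exists (G : seq (nat * int)) (k : nat * int -> m.-tuple K -> rat),
  [/\ uniq G, forall g, cK (k g) &
    forall x, X x -> forall l, phi x (E * (l0 x + l) + c)%N = \sum_(g <- G) k g x * wgt g l]].
Proof.
move=> /cN_Alg[As [hAs hA]]; have [E [S [E0 hS]]] := common_slopes hAs.
exists E, (l0 hS); split=> // [|c hc]; first exact: dfK_l0.
exact: (isNF_keys (Alg_NF hAs E0 hS hA hc)).
Qed.

End NormalForm.

(** * Null sequences and mean values *)

Section NullSequences.
Implicit Types u v : nat -> rat.

Definition nul u := forall eps : rat, 0 < eps -> exists N : nat, forall l, (N <= l)%N -> `|u l| < eps.

Lemma nul_ext u v : (forall l, u l = v l) -> nul u -> nul v.
Proof. by move=> h; suff -> : u = v by []; apply/funext. Qed.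

Lemma nul_le u v (N0 : nat) : (forall l, (N0 <= l)%N -> `|u l| <= `|v l|) -> nul v -> nul u.
Proof.
move=> h hv eps e0; have [N hN] := hv eps e0; exists (maxn N0 N) => l hl.
by apply: le_lt_trans (h l _) (hN l _); lia.
Qed.

Lemma nul_add u v : nul u -> nul v -> nul (fun l => u l + v l).
Proof.
move=> hu hv eps e0; have e2 : 0 < eps / 2 by rewrite divr_gt0.
have [N1 h1] := hu _ e2; have [N2 h2] := hv _ e2; exists (maxn N1 N2) => l hl.
apply: le_lt_trans (ler_normD _ _) _; rewrite [ltRHS](_ : _ = eps / 2 + eps / 2); last by rewrite -splitr.
by apply: ltrD; [apply: h1|apply: h2]; lia.
Qed.

Lemma nul_mulc c u : nul u -> nul (fun l => c * u l).
Proof.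
move=> hu eps e0; have c1 : 0 < `|c| + 1 by rewrite ltr_wpDl.
have [N h] := hu (eps / (`|c| + 1)) (divr_gt0 e0 c1); exists N => l /h; rewrite normrM ltr_pdivlMr // mulrC.
by apply: le_lt_trans; rewrite ler_wpM2r // lerDl.
Qed.

Lemma nul_sum (T : Type) (s : seq T) (P : pred T) (f : T -> nat -> rat) : (forall t, P t -> nul (f t)) ->
  nul (fun l => \sum_(t <- s | P t) f t l).
Proof.
move=> h; elim: s => [|t s IH]; first by move=> eps e0; exists 0%N => l _; rewrite big_nil normr0.
have [hP|hP] := boolP (P t); last by apply: nul_ext IH => l; rewrite big_cons (negbTE hP).
by apply: nul_ext (nul_add (h t hP) IH) => l; rewrite big_cons hP.
Qed.

Lemma nul_sum_mem (T : eqType) (s : seq T) (P : pred T) (f : T -> nat -> rat) : (forall t, t \in s -> P t -> nul (f t)) ->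
  nul (fun l => \sum_(t <- s | P t) f t l).
Proof.
move=> h; apply: nul_ext (nul_sum s (P := fun t => (t \in s) && P t) (f := f) _) => [l|t /andP[]]; last exact: h.
by rewrite [RHS]big_seq_cond.
Qed.

Lemma nul_const c : nul (fun _ => c) -> c = 0.
Proof.
move=> h; apply/eqP; apply: contrapT => /negP c0.
have c1 : 0 < `|c| by rewrite normr_gt0.
have [N hN] := h _ c1.
by have := hN N (leqnn N); rewrite ltxx.
Qed.

Lemma nul_inv C : nul (fun l => C / l%:R).
Proof.
move=> eps e0; have h0 : 0 <= `|C| / eps by rewrite divr_ge0 // ltW.
exists (Num.bound (`|C| / eps)) => l hl; have := archi_boundP h0; rewrite ltr_pdivrMr // => h.
have l0 : (0 : rat) < l%:R.
  by rewrite ltr0n; apply: leq_trans hl; rewrite lt0n; apply/eqP => e; move: h; rewrite e mul0r ltNge normr_ge0.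
rewrite normrM normfV (gtr0_norm l0) ltr_pdivrMr //; apply: lt_le_trans h _.
by rewrite mulrC ler_wpM2l ?ler_nat // ltW.
Qed.

(** From [l <= k * 2 ^ (l %/ k)], raised to the power k. *)
Lemma pow_bound (k l : nat) : (0 < k)%N -> (l ^ k <= k ^ k * 2 ^ l)%N.
Proof.
move=> k0; have h : (l <= k * 2 ^ (l %/ k))%N.
  apply: leq_trans (ltnW (ltn_ceil l k0)) _; rewrite mulnC leq_mul2l.
  by rewrite ltn_expl ?orbT.
apply: (@leq_trans ((k * 2 ^ (l %/ k)) ^ k)); first by rewrite leq_exp2r.
by rewrite expnMn -expnM leq_mul2l leq_exp2l // leq_divM orbT.
Qed.

Variable K : padic_field.
Let q : rat := (qK K)%:R.

Let q2 : 2 <= q.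
Proof. by rewrite ler_nat /qK card_finNzRing_gt1. Qed.

Let q0 : 0 < q. Proof. exact: lt_le_trans q2. Qed.

Let w_gt0 g l : (0 < l)%N -> 0 < wgt K g l.
Proof. by move=> l0; rewrite /wgt mulr_gt0 ?exprn_gt0 ?exprz_gt0 // ltr0n. Qed.

(** Growth is ordered lexicographically, by exponential rate and then by degree. A gap of one in the
    rate gives at least a factor 2 at each step, as q is at least 2. *)
Lemma wgt_ratio (g g' : nat * int) : g.2 < g'.2 \/ (g.2 = g'.2 /\ (g.1 < g'.1)%N) ->
  nul (fun l => wgt K g l / wgt K g' l).
Proof.
case=> [h|[h1 h2]]; last first.
  apply: (@nul_le _ _ 1%N) (nul_inv 1) => l l0.
  have lp : (0 : rat) < l%:R by rewrite ltr0n.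
  rewrite /wgt h1 -mulf_div divff ?expf_neq0 ?expfz_neq0 ?(gt_eqF q0) // mulr1.
  rewrite !ger0_norm ?divr_ge0 ?exprn_ge0 ?(ltW lp) // ler_pdivrMr ?exprn_gt0 //.
  rewrite mul1r -(subnKC h2) exprD exprS mulrA mulrA mulVf ?(gt_eqF lp) // mul1r.
  by rewrite -[leLHS]mulr1 ler_wpM2l ?exprn_ge0 ?(ltW lp) // exprn_ege1 // ler1n.
pose C : rat := (g.1.+1 ^ g.1.+1)%N%:R; have C0 : 0 <= C by exact: ler0n.
apply: (@nul_le _ _ 1%N) (nul_inv C) => l l0.
have lp : (0 : rat) < l%:R by rewrite ltr0n.
have w0 := w_gt0 g l0; have w0' := w_gt0 g' l0.
rewrite !ger0_norm ?divr_ge0 ?(ltW w0) ?(ltW w0') ?(ltW lp) ?C0 //.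
have e1 : wgt K g l / wgt K g' l = l%:R ^+ g.1 / l%:R ^+ g'.1 * (q ^ (g.2 - g'.2)) ^+ l.
  by rewrite /wgt -mulf_div -expr_div_n expfzDr ?(gt_eqF q0) // -invr_expz.
have e2 : (q ^ (g.2 - g'.2)) ^+ l <= (2 ^+ l)^-1.
  rewrite -exprVn; apply: lerXn2r; rewrite ?nnegrE ?invr_ge0 ?exprz_ge0 ?(ltW q0) //.
  apply: (@le_trans _ _ (q ^ (-1))); first by apply: ler_weXz2l; [exact: le_trans q2|lia].
  by rewrite -exprN1 lef_pV2 ?posrE.
have e3 : l%:R ^+ g.1 / l%:R ^+ g'.1 <= l%:R ^+ g.1 :> rat.
  by rewrite ler_pdivrMr ?exprn_gt0 // -[leLHS]mulr1 ler_wpM2l ?exprn_ge0 ?(ltW lp) // exprn_ege1 // ler1n.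
rewrite e1; apply: le_trans (ler_pM _ _ e3 e2) _; rewrite ?divr_ge0 ?exprn_ge0 ?exprz_ge0 ?(ltW q0) ?(ltW lp) //.
rewrite ler_pdivrMr ?exprn_gt0 // mulrAC ler_pdivlMr // -exprSr -!natrX -natrM ler_nat.
exact: pow_bound.
Qed.

Lemma wgt0 l : wgt K (0%N, 0) l = 1.
Proof. by rewrite /wgt /= expr0z expr1n mulr1. Qed.

Lemma wgt_decay g : g.2 < 0 -> nul (wgt K g).
Proof.
move=> h; apply: nul_ext (wgt_ratio (g := g) (g' := (0%N, 0)) (or_introl h)) => l.
by rewrite wgt0 divr1.
Qed.

Lemma wgt_grow g : 0 < g.2 \/ (g.2 = 0 /\ (0 < g.1)%N) -> nul (fun l => (wgt K g l)^-1).
Proof.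
move=> h; apply: nul_ext (wgt_ratio (g := (0%N, 0)) (g' := g) _) => [l|]; first by rewrite wgt0 mul1r.
by case: h => [h|[h1 h2]]; [left|right].
Qed.

(** Dividing by the fastest growing weight with nonzero coefficient sends the bounded sum and all
    other terms to 0, so that coefficient would be a constant null sequence. *)
Lemma bounded_coefs (G : seq (nat * int)) (a : nat * int -> rat) (C : rat) : uniq G ->
  (forall l, `|\sum_(g <- G) a g * wgt K g l| <= C) ->
  forall g, g \in G -> 0 < g.2 \/ (g.2 = 0 /\ (0 < g.1)%N) -> a g = 0.
Proof.
move=> uG hC g hg grow; apply: contrapT => /eqP ag.
pose R (x y : nat * int) := y.2 < x.2 \/ (y.2 = x.2 /\ (y.1 <= x.1)%N).
have tot (x y : nat * int) : R x y \/ R y x.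
  rewrite /R; case: (ltgtP x.2 y.2) => e; [by right; left|by left; left|].
  by case: (leqP y.1 x.1) => e'; [left|right]; right; rewrite e; split=> //; exact: ltnW.
have tr (x y z : nat * int) : R x y -> R y z -> R x z.
  rewrite /R => -[h|[h1 h2]] [h'|[h1' h2']].
  - by left; exact: lt_trans h' h.
  - by left; rewrite h1'.
  - by left; rewrite -h1.
  by right; rewrite h1' h1; split=> //; exact: leq_trans h2' h2.
have [h hh [ah hmax]] := seq_best tot tr (ex_intro2 _ (fun g => a g != 0) g hg ag).
have growh : 0 < h.2 \/ (h.2 = 0 /\ (0 < h.1)%N).
  case: (hmax g hg ag) => [h1|[h1 h2]]; case: grow => [g1|[g1 g2]].
  - by left; exact: lt_trans g1 h1.
  - by left; rewrite -g1.
  - by left; rewrite -h1.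
  by right; rewrite -h1; split=> //; exact: leq_trans g2 h2.
case/eqP: ah; apply: nul_const.
have n1 : nul (fun l => C * (wgt K h l)^-1) := nul_mulc C (wgt_grow growh).
have n2 : nul (fun l => \sum_(g <- G | g != h) - a g * (wgt K g l / wgt K h l)).
  apply: nul_sum_mem => g' hg' ne; case: (eqVneq (a g') 0) => [->|ag'].
    by move=> eps e0; exists 0%N => l _; rewrite oppr0 mul0r normr0.
  apply: nul_mulc; apply: wgt_ratio; have := hmax g' hg' ag'; rewrite /R.
  move=> [|[e1 e2]]; [by left|right; split=> //].
  rewrite ltn_neqAle e2 andbT; apply: contra ne => /eqP e3.
  by apply/eqP; case: g' h e1 e3 {hg' ag' e2 hh hmax growh n1} => [a1 a2] [b1 b2] /= -> ->.
have n3 : nul (fun l => (\sum_(g <- G) a g * wgt K g l) / wgt K h l).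
  apply: (@nul_le _ _ 1%N) n1 => l l0; have w0 := w_gt0 h l0.
  rewrite !normrM ler_wpM2r //; apply: le_trans (hC l) _; exact: ler_norm.
apply: (@nul_le _ _ 1%N) (nul_add n3 n2) => l l0; have w0 := w_gt0 h l0.
rewrite (bigD1_seq h) //= mulrDl mulfK ?(gt_eqF w0) // -addrA [X in _ + (X + _)]mulr_suml -big_split /=.
by rewrite big1 ?addr0 // => g' _; rewrite -mulrA -mulrDl subrr mul0r.
Qed.

End NullSequences.

Section MeanValues.
Variable R : realType.
Implicit Types (h : nat -> R).

Lemma oo_mod_proper e c : (0 < e)%N -> ProperFilter (oo_mod e c).
Proof.
move=> e0; have FF : Filter (oo_mod e c) by exact: (@within_filter _ _ _ eventually_filter).
apply: Build_ProperFilter_ex.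
move=> A [N _ hN]; exists (c + e * N)%N; apply: hN => /=; last by rewrite addnC mulnC modnMDl.
by apply: leq_trans (leq_addl _ _); apply: leq_pmull.
Qed.

Lemma cvg_oo_mod h e c (l : R) : (forall eps, 0 < eps -> exists N : nat, forall n, (N <= n)%N -> n = c %[mod e] -> `|l - h n| < eps) ->
  h @ oo_mod e c --> l.
Proof.
move=> H; apply/cvgrPdist_lt => eps e0; have [N hN] := H eps e0.
by exists N => // n hn /= hc; apply: hN.
Qed.

Lemma oo_mod_cvg h e c (l : R) : h @ oo_mod e c --> l ->
  forall eps, 0 < eps -> exists N : nat, forall n, (N <= n)%N -> n = c %[mod e] -> `|l - h n| < eps.
Proof.
move=> /cvgrPdist_lt H eps e0; have [N _ hN] := H eps e0.
by exists N => n hn hc; apply: hN.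
Qed.

Lemma sum_mod (f : nat -> R) E e : \sum_(k < e * E) f (k %% E)%N = e%:R * \sum_(c < E) f c.
Proof.
elim: e => [|e IH]; first by rewrite mul0n big_ord0 mul0r.
rewrite mulSn addnC big_split_ord /= IH -[e.+1]addn1 natrD mulrDl mul1r; congr (_ + _).
by apply: eq_bigr => c _; rewrite modnMDl modn_small.
Qed.

(** [mean_value] refers to an unknown modulus e. Every class modulo e meets a class modulo E through
    arbitrarily large members of one sequence k + e E t, so the limits agree along k and both
    averages equal the one over e E consecutive k. *)
Lemma mean_valueE h E (lam : nat -> R) : (0 < E)%N ->
  (forall c, (c < E)%N -> forall eps, 0 < eps -> exists N : nat, forall n, (N <= n)%N -> (n %% E)%N = c -> `|lam c - h n| < eps) ->
  has_mean_value h /\ mean_value h = E%:R^-1 * \sum_(c < E) lam c.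
Proof.
move=> E0 H; have hE : has_mean_value_mod h E.
  split=> // c; apply: cvgP; apply: (@cvg_oo_mod _ _ _ (lam c)) => eps e0.
  have [N hN] := H c (ltn_ord c) eps e0; exists N => n hn hc; apply: hN => //.
  by rewrite hc modn_small.
split; first by exists E.
rewrite /mean_value /=; set e := xget _ _.
have [e0 he] : has_mean_value_mod h e by rewrite /e; case: xgetP => [e' _ //|/(_ E)].
pose mu (d : nat) : R := lim (h @ oo_mod e d).
have hmu d : (d < e)%N -> h @ oo_mod e d --> mu d by move=> hd; exact: (he (Ordinal hd)).
have key k : mu (k %% e)%N = lam (k %% E)%N.
  apply/eqP; rewrite -subr_eq0 -normr_eq0; apply/eqP/le_anti; rewrite normr_ge0 andbT.
  apply/ler_addgt0Pr => eps ep; rewrite add0r; have ep2 : 0 < eps / 2 by rewrite divr_gt0.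
  have [N1 h1] := oo_mod_cvg (hmu (k %% e)%N (ltn_pmod k e0)) ep2.
  have [N2 h2] := H (k %% E)%N (ltn_pmod k E0) _ ep2.
  pose n := (e * E * maxn N1 N2 + k)%N.
  have nN : (maxn N1 N2 <= n)%N by apply: leq_trans (leq_addr _ _); apply: leq_pmull; rewrite muln_gt0 e0.
  have g1 := h1 n (leq_trans (leq_maxl _ _) nN) _; have g2 := h2 n (leq_trans (leq_maxr _ _) nN) _.
  apply: le_trans (ler_distD (h n) _ _) _; rewrite [leRHS]splitr; apply: ltW; apply: ltrD.
    by apply: g1; rewrite modn_mod /n -mulnA mulnC modnMDl.
  by rewrite distrC; apply: g2; rewrite /n [(e * E)%N]mulnC -mulnA mulnC modnMDl.
have s1 := sum_mod mu e E; have s2 := sum_mod lam E e.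
have : E%:R * \sum_(c < e) mu c = e%:R * \sum_(c < E) lam c.
  rewrite -s1 -s2 mulnC; apply: eq_bigr => k _; exact: key.
have en : (e%:R : R) != 0 by rewrite pnatr_eq0 -lt0n.
have En : (E%:R : R) != 0 by rewrite pnatr_eq0 -lt0n.
move=> e1; apply: (mulfI En); apply: (mulfI en).
by rewrite (mulVKf En) mulrCA (mulVKf en) e1.
Qed.

Lemma mean_value_ge0 h : has_mean_value h -> (forall n, 0 <= h n) -> 0 <= mean_value h.
Proof.
move=> [E hE] h0; rewrite /mean_value /=; set e := xget _ _.
have [e0 he] : has_mean_value_mod h e by rewrite /e; case: xgetP => [e' _ //|/(_ E)].
rewrite mulr_ge0 ?invr_ge0 // sumr_ge0 // => c _.
have pf := oo_mod_proper c e0.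
by apply: limr_ge; [exact: he|exact: nearW].
Qed.

End MeanValues.

(** * Decomposition of bounded constructible functions *)

Section Final.
Variables (K : padic_field) (L : language) (m : nat) (X : set (m.-tuple K)).
Hypothesis hX : definableK L X.
Local Notation dp := (@dp K L m).
Local Notation dpf := (@dpf K L m).
Local Notation XK := (XK X).
Local Notation XN := (XN X).
Local Notation cK := (constructibleK L X).
Local Notation cN := (constructibleN L X).
Local Notation dfK := (dfK L X).
Local Notation dfN := (dfN L X).
Let q : rat := (qK K)%:R.
Let dXK : dp XK := dp_XK hX.
Let dXN : dp XN := dp_XN dXK.

Lemma cN_fun al : dfN al -> cN (fun x n => (al x n)%:~R).
Proof. by move=> /dpf_definableN h; exact: (cst_fun h). Qed.
Lemma cN_pow al : dfN al -> cN (fun x n => q ^ (- al x n)).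
Proof. by move=> /dpf_definableN h; exact: (cst_qpow h). Qed.
Lemma cN_cst c : cN (fun _ _ => c). Proof. exact: cst_scalar. Qed.
Lemma cN_add f g : cN f -> cN g -> cN (fun x n => f x n + g x n). Proof. exact: cst_add. Qed.
Lemma cN_mul f g : cN f -> cN g -> cN (fun x n => f x n * g x n). Proof. exact: cst_mul. Qed.
Lemma cN_eq f g : (forall x n, X x -> f x n = g x n) -> cN f -> cN g.
Proof. by move=> h hf; apply: cst_eq_on hf _ => y [hy _]; exact: h. Qed.

Lemma cN_sub f g : cN f -> cN g -> cN (fun x n => f x n - g x n).
Proof.
by move=> hf hg; apply: cN_eq (cN_add hf (cN_mul (cN_cst (-1)) hg)) => x n _; rewrite mulN1r.
Qed.

Lemma cN_sum (T : Type) (s : seq T) (P : pred T) (f : T -> m.-tuple K -> nat -> rat) :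
  (forall t, P t -> cN (f t)) -> cN (fun x n => \sum_(t <- s | P t) f t x n).
Proof.
move=> h; elim: s => [|t s IH].
  by apply: cN_eq (cN_cst 0) => x n _; rewrite big_nil.
case: (boolP (P t)) => ht; last by apply: cN_eq IH => x n _; rewrite big_cons (negbTE ht).
by apply: cN_eq (cN_add (h t ht) IH) => x n _; rewrite big_cons ht.
Qed.

Lemma cN_exp f i : cN f -> cN (fun x n => f x n ^+ i).
Proof.
move=> h; elim: i => [|i IH]; first by apply: cN_eq (cN_cst 1) => x n _; rewrite expr0.
by apply: cN_eq (cN_mul h IH) => x n _; rewrite exprS.
Qed.

Lemma dpf_liftN b : dfK b -> dpf XN (fun x _ => b x).
Proof.
by move=> h; apply: (dpf_sub_dom dXN _ h) => x e [].
Qed.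

Lemma cN_lift k : cK k -> cN (fun x _ => k x).
Proof.
have gen f : constructible L [set y : Defs.space K m 0 | X y.1] f -> cN (fun x _ => f (x, [tuple])).
  have hd (al : Defs.space K m 0 -> int) : definable_fun L [set y : Defs.space K m 0 | X y.1] al ->
      dfN (fun x _ => al (x, [tuple])).
    move=> [A hA]; apply: dpf_liftN.
    have h : dp (fun x e => holds (Assignment (nth 0 x) (fun _ => 0) e) A) by exists A.
    apply: dp_ext (dp_trunc 1 h) => x e.
    have := hA (x, [tuple e 0%N]); rewrite /env_of /=.
    have -> : (fun i => nth 0 [:: e 0%N] i) = (fun i => if (i < 1)%N then e i else 0) by apply/funext => -[|[|i]].
    move=> <-; rewrite /graph_on /=; split=> [[[x' t] /= h1 eq]|[h1 h2]].
      have := congr1 fst eq; have := congr1 (fun w => val w.2) eq; rewrite /= (tuple0 t) /= => -[<-] <-.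
      by split.
    exists (x, [tuple]) => //; congr (_, _); by apply/val_inj; rewrite /= h2.
  elim=> {f} [al /hd h|al /hd h|c|f g _ h1 _ h2|f g _ h1 _ h2|f g _ h1 h2].
  - exact: cN_fun h.
  - exact: cN_pow h.
  - exact: cN_cst.
  - exact: cN_add.
  - exact: cN_mul.
  by apply: cN_eq h1 => x n hx; apply: h2.
by move=> /gen.
Qed.

Section Decomposition.
Variables (E : nat) (l0 : m.-tuple K -> nat).
Hypothesis E0 : (0 < E)%N.
Hypothesis dl0 : dfK (fun x => (l0 x)%:Z).

Definition lN x (n : nat) : nat := (n %/ E - l0 x)%N.
Definition indN c x (n : nat) : bool := (E * l0 x <= n)%N && (n %% E == c)%N.

Let hz := @zlin_var K L.
Let hc := @zlin_cst K L.

Lemma div_unique (t n : int) : 0 <= n -> E%:Z * t <= n -> n < E%:Z * t + E%:Z -> t = (`|n|%N %/ E)%N%:Z.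
Proof.
move=> n0 h1 h2; have t0 : 0 <= t.
  by rewrite leNgt; apply/negP => t0; have : E%:Z * t + E%:Z <= 0; [rewrite (_ : _ + _ = E%:Z * (t + 1)); [apply: mulr_ge0_le0; lia|ring]|lia].
have -> : `|n|%N = (`|t| * E + (`|n| - `|t| * E))%N.
  by rewrite subnKC //; have : (`|t| * E)%N%:Z <= `|n|%:Z; [rewrite PoszM !gez0_abs // mulrC|].
have h3 : (`|n| - `|t| * E < E)%N.
  rewrite ltn_subLR; last by have : (`|t| * E)%N%:Z <= `|n|%:Z; [rewrite PoszM !gez0_abs // mulrC|].
  have : `|n|%:Z < (`|t| * E + E)%N%:Z; last by [].
  by rewrite PoszD PoszM !gez0_abs // mulrC.
by rewrite divnMDl // divn_small // addn0 gez0_abs.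
Qed.

Lemma dfN_lN : dfN (fun x n => (lN x n)%:Z).
Proof.
(* variables: 0 = n / E, 1 = l0, 2 = value, 3 = n *)
have h1 := dp_and (dp_le m (zlin_mul E (hz 0)) (hz 3)) (dp_lt m (hz 3) (zlin_add (zlin_mul E (hz 0)) (hc E%:Z))).
have h2 := dp_or (dp_and (dp_le m (hz 1) (hz 0)) (dp_eq m (hz 2) (zlin_sub (hz 0) (hz 1))))
  (dp_and (dp_lt m (hz 0) (hz 1)) (dp_eq m (hz 2) (hc 0))).
have hQ := dp_ex (dp_and h1 h2).
apply: dp_ext (dp_rel1 (dpf_tl (dpf_liftN dl0)) hQ) => x e; rewrite /XN /tl /lN /=.
split=> [[[hx n0] [t [[h3 h4] h5]]]|[[hx n0] h]]; split=> //.
  have et := div_unique n0 h3 h4; rewrite et in h5; lia.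
exists (`|e 1%N|%N %/ E)%N%:Z.
have h3 : (`|e 1%N| %/ E * E <= `|e 1%N|)%N by apply: leq_divM.
have h4 : (`|e 1%N| < (`|e 1%N| %/ E).+1 * E)%N by apply: ltn_ceil.
split; last by rewrite h; lia.
split; first by have : ((`|e 1%N| %/ E * E)%N%:Z <= `|e 1%N|%N%:Z) by []; rewrite PoszM gez0_abs // mulrC.
have : (`|e 1%N|%N%:Z < ((`|e 1%N| %/ E).+1 * E)%N%:Z) by []; rewrite mulSn PoszD PoszM gez0_abs // => h5.
by rewrite mulrC addrC.
Qed.

Lemma dfN_indN c : (c < E)%N -> dfN (fun x n => (indN c x n)%:Z).
Proof.
move=> cE.
(* variables: 0 = l0, 1 = n, and below a quantifier 0 = n / E *)
have h1 := dp_and (dp_le m (zlin_mul E (hz 0)) (hz 1)) (dp_ex (dp_eq m (hz 2) (zlin_add (zlin_mul E (hz 0)) (hc c%:Z)))).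
have h2 := dp_rel1 (dpf_liftN dl0) h1.
apply: dpf_ext (dpf_case h2 (dpf_lin dXN (hc 1)) (dpf_lin dXN (hc 0))) => x e [hx n0].
have key : (XN x e /\ (E%:Z * (l0 x)%:Z <= e 0%N /\ exists z, e 0%N = E%:Z * z + c%:Z)) <-> indN c x `|e 0%N|%N.
  rewrite /indN; split=> [[_ [h3 [z h4]]]|/andP[h3 /eqP h4]].
    have -> : (E * l0 x <= `|e 0%N|)%N by rewrite -lez_nat PoszM gez0_abs.
    have ez : z = (`|e 0%N| %/ E)%N%:Z by apply: div_unique => //; rewrite h4; lia.
    have : `|e 0%N|%N%:Z = (E * (`|e 0%N| %/ E) + c)%N%:Z by rewrite gez0_abs // {1}h4 {1}ez PoszD PoszM.
    move=> /eqP; rewrite eqz_nat => /eqP he.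
    by rewrite he mulnC modnMDl modn_small // eqxx.
  split; first by [].
  split; first by move: h3; rewrite -lez_nat PoszM gez0_abs.
  exists (`|e 0%N| %/ E)%N%:Z; rewrite -{1}(gez0_abs n0) {1}(divn_eq `|e 0%N| E) h4 PoszD PoszM mulrC.
  by [].
case: pselect => [/key ->//|hn]; by case: (boolP (indN c x `|e 0%N|)) => // /key.
Qed.

Lemma dfN_mul al (k : nat) : dfN al -> dfN (fun x n => k%:Z * al x n).
Proof.
move=> h; apply: dp_ext (dp_rel1 (dpf_tl h) (dp_eq m (hz 1) (zlin_mul k (hz 0)))) => x e.
by rewrite /tl /=.
Qed.

Lemma cN_ind c (k : m.-tuple K -> rat) (g : nat * int) : (c < E)%N -> g.2 < 0 -> cK k ->
  cN (fun x n => (indN c x n)%:R * (k x * wgt K g (lN x n))).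
Proof.
move=> cE g0 hk; have h1 := cN_fun (dfN_indN cE).
have h2 := cN_exp g.1 (cN_fun dfN_lN).
have h3 := cN_pow (dfN_mul `|g.2| dfN_lN).
apply: cN_eq (cN_mul h1 (cN_mul (cN_lift hk) (cN_mul h2 h3))) => x n _.
congr (_ * (_ * (_ * _))).
by rewrite ltz0_abs // mulNr opprK -exprz_exp.
Qed.

Variables (G : nat -> seq (nat * int)) (k : nat -> nat * int -> m.-tuple K -> rat).
Hypothesis ck : forall c g, (c < E)%N -> cK (k c g).

(** The decaying part of the normal form. Below the threshold it is 0, which affects finitely many n
    for each [x]. *)
Definition dec x (n : nat) : rat := if (E * l0 x <= n)%N then
  \sum_(g <- G (n %% E)%N | g.2 < 0) k (n %% E)%N g x * wgt K g (lN x n) else 0.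

Lemma cN_dec : cN dec.
Proof.
have h := cN_sum (index_enum 'I_E) (P := xpredT)
  (f := fun c x n => \sum_(g <- G c | g.2 < 0) (indN c x n)%:R * (k c g x * wgt K g (lN x n)))
  (fun c _ => cN_sum (G c) (fun g hg => cN_ind (ltn_ord c) hg (ck g (ltn_ord c)))).
apply: cN_eq h => x n _; rewrite /dec.
rewrite (bigD1 (Ordinal (ltn_pmod n E0))) //= [X in _ + X]big1 ?addr0 => [|c ne].
  rewrite /indN eqxx andbT; case: ifP => h; last by rewrite big1 // => g _; rewrite mul0r.
  by apply: eq_bigr => g _; rewrite mul1r.
rewrite big1 // => g _; rewrite /indN; case: eqP => [e|_]; last by rewrite andbF mul0r.
by case/eqP: ne; apply/val_inj.
Qed.

Lemma lN_shift x n : (E * l0 x <= n)%N -> n = (E * (l0 x + lN x n) + n %% E)%N.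
Proof.
move=> h; rewrite /lN subnKC; first by rewrite mulnC -divn_eq.
by rewrite leq_divRL // mulnC.
Qed.

Lemma lN_large x N n : (E * (l0 x + N) <= n)%N -> (N <= lN x n)%N.
Proof.
move=> h; have : (l0 x + N <= n %/ E)%N by rewrite leq_divRL // mulnC.
by rewrite /lN; lia.
Qed.

Lemma nul_dec x : nul (dec x).
Proof.
move=> eps e0.
have hn c : exists N : nat, forall l, (N <= l)%N -> `|\sum_(g <- G c | g.2 < 0) k c g x * wgt K g l| < eps.
  by apply: nul_sum e0 => g hg; apply: nul_mulc; apply: wgt_decay.
have /choice[N hN] := hn.
exists (E * (l0 x + \sum_(c < E) N c))%N => n le; rewrite /dec.
rewrite (leq_trans _ le); last by rewrite leq_mul2l leq_addr orbT.
apply: hN; apply: leq_trans (lN_large le).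
by rewrite (bigD1 (Ordinal (ltn_pmod n E0))) //= leq_addr.
Qed.

End Decomposition.

Lemma bounded_rat (R : realType) (u : nat -> rat) (A : set R) : compact A -> range (fun n => ratr (u n) : R) `<=` A ->
  exists C : rat, forall n, `|u n| <= C.
Proof.
move=> /compact_bounded[M [_ hM]] hA.
have hb n : `|ratr (u n) : R| <= `|M| + 1.
  apply: (hM (`|M| + 1)); first by rewrite (le_lt_trans (ler_norm M)) // ltrDl.
  by apply: hA; exists n.
exists (Num.bound (`|M| + 1))%:R => n.
have := le_lt_trans (hb n) (archi_boundP (_ : 0 <= `|M| + 1)).
rewrite -ratr_norm -(ratr_nat R) ltr_rat => h; apply: ltW; apply: h.
by rewrite addr_ge0.
Qed.

Lemma nul_ratr (R : realType) (u : nat -> rat) : nul u -> forall eps : R, 0 < eps ->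
  exists N : nat, forall n, (N <= n)%N -> `|ratr (u n) : R| < eps.
Proof.
move=> hu eps e0.
pose d : rat := (Num.bound eps^-1).+1%:R^-1.
have d0 : 0 < d by rewrite invr_gt0 ltr0n.
have [N hN] := hu d d0; exists N => n /hN; rewrite -(ltr_rat R) ratr_norm => h.
apply: lt_le_trans h _; rewrite /d fmorphV rmorph_nat invf_ple ?posrE ?ltr0n //.
have := archi_boundP (_ : 0 <= eps^-1); rewrite invr_ge0 ltW // => /(_ isT) h.
by apply: ltW; apply: lt_le_trans h _; rewrite ler_nat.
Qed.

Variable R : realType.
Variable phi : m.-tuple K -> nat -> rat.
Hypothesis hphi : cN phi.
Hypothesis hbd : bounded_over X (fun x n => ratr (phi x n) : R).

Lemma decomposition : exists (E : nat) (l0 : m.-tuple K -> nat) (phi' : m.-tuple K -> nat -> rat) (kz : nat -> m.-tuple K -> rat),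
  [/\ (0 < E)%N, cN phi', forall x, nul (phi' x), forall c, (c < E)%N -> cK (kz c) &
    forall x n, X x -> (E * l0 x <= n)%N -> phi x n - phi' x n = kz (n %% E)%N x].
Proof.
have [E [l0 [E0 dl0 hNF]]] := normal_form hX hphi.
have /choice[Gk hGk] : forall c, exists Gk : seq (nat * int) * (nat * int -> m.-tuple K -> rat), (c < E)%N ->
    [/\ uniq Gk.1, forall g, cK (Gk.2 g) &
      forall x, X x -> forall l, phi x (E * (l0 x + l) + c)%N = \sum_(g <- Gk.1) Gk.2 g x * wgt K g l].
  move=> c; case: (ltnP c E) => hc; last by exists ([::], fun _ _ => 0).
  by have [G [k h]] := hNF c hc; exists (G, k).
pose G c := (Gk c).1; pose k c := (Gk c).2.
have ck c g : (c < E)%N -> cK (k c g) by move=> cE; have [_ h _] := hGk c cE; exact: h.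
(* The sum picks out the constant coefficient, and is 0 when the weight (0, 0) does not occur in
   [G c]. *)
exists E, l0, (dec E l0 G k), (fun c x => \sum_(g <- G c | g == (0%N, 0)) k c g x); split=> //.
- exact: cN_dec.
- by move=> x; exact: nul_dec.
- by move=> c hc; apply: cK_sum => g; exact: ck.
move=> x n hx hn; rewrite /dec hn; set c := (n %% E)%N.
have cE : (c < E)%N by exact: ltn_pmod.
have [uG _ hG0] := hGk c cE.
have hG l : phi x (E * (l0 x + l) + c)%N = \sum_(g <- G c) k c g x * wgt K g l by exact: hG0.
have [A cA sA] := hbd hx; have [C hC] := bounded_rat cA sA.
have hz := @bounded_coefs K (G c) (fun g => k c g x) C uG _.
have {}hz : forall g, g \in G c -> 0 < g.2 \/ (g.2 = 0 /\ (0 < g.1)%N) -> k c g x = 0.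
  by apply: hz => l; rewrite -hG.
rewrite {1}(lN_shift E0 hn) -/c hG.
rewrite [X in X - _](bigID (fun g : nat * int => g.2 < 0)) /= [X in X - _]addrC addrK.
rewrite big_mkcond [RHS]big_mkcond; apply: eq_big_seq => g hg /=.
case: (eqVneq g (0%N, 0)) => [->|ne] /=; first by rewrite wgt0 mulr1.
rewrite -leNgt; case: ifP => // g0; rewrite hz ?mul0r //.
case: g ne g0 {hg} => i s /= ne; rewrite le_eqVlt => /orP[/eqP e|]; last by left.
by right; split=> //; rewrite lt0n; apply: contra ne => /eqP ->; rewrite -e.
Qed.

End Final.

Unset Implicit Arguments.

Theorem proposition2p2p3 (K : padic_field) (L : language) (R : realType)
    (m : nat) (X : set (m.-tuple K)) (phi : m.-tuple K -> nat -> rat)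
    (hX : definableK L X) (hphi : constructibleN L X phi)
    (hbd : bounded_over X (fun x n => ratr (phi x n) : R)) :
  [/\ exists phi' : m.-tuple K -> nat -> rat,
        let g := fun x n => phi x n - phi' x n in
        [/\ constructibleN L X phi',
            forall x, X x -> (ratr (phi' x n) : R) @[n --> \oo] --> (0 : R),
            forall x, X x -> finite_set (range (g x)),
            constructibleN L X g
          & forall x, X x ->
              [/\ has_mean_value (fun n => ratr (g x n) : R),
                  has_mean_value (fun n => ratr (phi x n) : R)
                & mean_value (fun n => ratr (g x n) : R)
                  = mean_value (fun n => ratr (phi x n) : R)]],
      exists2 M : m.-tuple K -> rat, constructibleK L X M &
        forall x, X x ->
          ratr (M x) = mean_value (fun n => ratr (phi x n) : R)
    & (forall x n, X x -> 0 <= phi x n) ->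
      forall x, X x -> 0 <= mean_value (fun n => ratr (phi x n) : R)].
Proof.
have [E [l0 [phi' [kz [E0 c' n' ckz hg]]]]] := decomposition hX hphi hbd.
have mphi x : X x -> has_mean_value (fun n => ratr (phi x n) : R) /\
    mean_value (fun n => ratr (phi x n) : R) = E%:R^-1 * \sum_(c < E) (ratr (kz c x) : R).
  move=> hx; apply: (mean_valueE (lam := fun c => ratr (kz c x)) E0) => c cE eps e0.
  have [N hN] := nul_ratr (n' x) e0.
  exists (maxn N (E * l0 x)) => n hn hc.
  rewrite -hc -hg //; last by lia.
  by rewrite rmorphB addrAC subrr add0r normrN; apply: hN; lia.
have mg x : X x -> has_mean_value (fun n => ratr (phi x n - phi' x n) : R) /\
    mean_value (fun n => ratr (phi x n - phi' x n) : R) = E%:R^-1 * \sum_(c < E) (ratr (kz c x) : R).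
  move=> hx; apply: (mean_valueE (lam := fun c => ratr (kz c x)) E0) => c cE eps e0.
  by exists (E * l0 x)%N => n hn hc; rewrite -hc hg // subrr normr0.
split.
- exists phi'; split=> [//|x hx|x hx||x hx].
  + apply/cvgrPdist_lt => eps e0; have [N hN] := nul_ratr (n' x) e0.
    by exists N => // n hn; rewrite sub0r normrN; exact: hN.
  (* Finitely many n lie below the threshold; from there on the value depends only on n modulo E. *)
  + pose s := [seq phi x n - phi' x n | n <- iota 0 (E * l0 x)] ++ [seq kz c x | c <- iota 0 E].
    apply: (@sub_finite_set _ _ [set` s]) => [y [n _ <-]|]; last by apply/finite_seqP; exists s.
    rewrite /= mem_cat; case: (ltnP n (E * l0 x)) => hn; apply/orP; [left|right].
      by apply/mapP; exists n => //; rewrite mem_iota.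
    by rewrite hg //; apply/mapP; exists (n %% E)%N => //; rewrite mem_iota ltn_pmod.
  + exact: cN_sub hphi c'.
  by have [h1 h2] := mphi x hx; have [h3 h4] := mg x hx; split; [exact: h3|exact: h1|rewrite h4 h2].
- exists (fun x => E%:R^-1 * \sum_(c < E) kz c x).
    by apply: cK_mul; [exact: cK_cst|apply: cK_sum => c; exact: ckz].
  by move=> x hx; rewrite (mphi x hx).2 rmorphM rmorph_sum fmorphV rmorph_nat.
move=> h0 x hx; apply: mean_value_ge0; first exact: (mphi x hx).1.
by move=> n; rewrite ler0q; exact: h0.
Qed.
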